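(* Let $\Delta(\cdot)$ denote either exterior algebraic shifting $\Delta^e(\cdot)$ or symmetric algebraic shifting $\Delta^s(\cdot)$. Let $\Sigma$ be a $(d-1)$-dimensional pure shifted simplicial complex on $[n]$ satisfying $h_i(\Sigma)=h_{d-i}(\Sigma)$ for $i=0,1,\dots,d$ and $\Sigma\subset\Delta^s(C(n,d))$, where $C(n,d)$ is the boundary complex of a cyclic $d$-polytope with $n$ vertices. Then there exists a squeezed sphere $\Gamma$ such that $\Delta(\Gamma)=\Sigma$.
   Context: A simplicial complex on a finite set $V$ is a collection $\Gamma$ of subsets of $V$ with $\{v\}\in\Gamma$ for all $v\in V$ and closed under taking subsets; facets are maximal faces, pure means all facets have equal cardinality. $\Gamma$ on $[n]$ is shifted if $F\in\Gamma$, $i\in F$, $i<j\le n$ imply $(F\setminus\{i\})\cup\{j\}\in\Gamma$. With $f_k$ the number of faces of size $k+1$, $f_{-1}=1$, $d=\dim\Gamma+1$: $h_i(\Gamma)=\sum_{j=0}^i(-1)^{i-j}\binom{d-j}{d-i}f_{j-1}(\Gamma)$. Exterior algebraic shifting (over an infinite field $K$): $E=\bigwedge\langle e_1,\dots,e_n\rangle$, $J_\Gamma$ generated by $e_F$ ($F\notin\Gamma$), $\mathrm{Gin}(J)=\mathrm{in}(\varphi(J))$ for generic $\varphi\in GL_n(K)$ w.r.t. reverse lexicographic order induced by $1>\dots>n$; $\Delta^e(\Gamma)$ is the complex with exterior face ideal $\mathrm{Gin}(J_\Gamma)$. Symmetric algebraic shifting (char $0$): $I_\Gamma\subset K[x_1,\dots,x_n]$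 the Stanley–Reisner ideal, $\mathrm{Gin}(I_\Gamma)$ w.r.t. degree revlex with $x_1>\dots>x_n$, $\Phi(x_{i_1}\cdots x_{i_k})=x_{i_1}x_{i_2+1}\cdots x_{i_k+k-1}$ ($i_1\le\dots\le i_k$); $\Delta^s(\Gamma)$ has Stanley–Reisner ideal generated by $\Phi(u)$ for $u$ the minimal generators of $\mathrm{Gin}(I_\Gamma)$. Squeezed spheres: fix $n>d>0$, $m=n-d-1$; $\mathcal M_{[m]}$ is the set of monomials of $K[x_1,\dots,x_m]$ ($\mathcal M_{[0]}=\{1\}$). An order ideal of monomials on $[m]$ is $U\subset\mathcal M_{[m]}$ with $\{1,x_1,\dots,x_m\}\subset U$ and closed under divisors; it is shifted if $ux_i\in U$ and $i<j\le m$ imply $ux_j\in U$. For $u=x_{i_1}\cdots x_{i_k}$ ($i_1\le\dots\le i_k$, $k\le\frac{d+1}2$) put $F_d(u)=\{i_1,i_1+1\}\cup\{i_2+2,i_2+3\}\cup\dots\cup\{i_k+2(k-1),i_k+2k-1\}\cup\{n+2k-d,\dots,n\}$, $F_d(1)=\{n-d,\dots,n\}$. For a shifted order ideal $U$ of monomials of degree at most $\frac{d+1}2$ on $[m]$, $B_d(U)$ is the complex generated by $\{F_d(u):u\in U\}$ (a $d$-ball), and the squeezed $(d-1)$-sphere $S_d(U)$ is its boundary, i.e. the complex generated by the $d$-element faces of $B_d(U)$ contained in exactly one facet of $B_d(U)$. *)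

(* Defs.v *)
(* Vertices and variables are indexed by 'I_n, i.e. from 0: the vertex j of [n] is the
   ordinal with value j - 1.  A family of subsets of [n] is a
   {set {set 'I_n}}; subsets of a ring are predicates R -> Prop. *)
From HB Require Import structures.
From mathcomp Require Import all_boot all_order all_algebra.
From mathcomp Require Import boolp.
From mathcomp Require Import mpoly.
From mathcomp Require Import ring.

Set Implicit Arguments.
Unset Strict Implicit.
Unset Printing Implicit Defensive.

Import Order.TTheory GRing.Theory Num.Theory.
Local Open Scope ring_scope.

Section Complexes.
Variable n : nat.
Implicit Types (C : {set {set 'I_n}}) (F G : {set 'I_n}).

Definition simplicial_complex C : Prop :=
  (forall v : 'I_n, [set v] \in C) /\
  (forall F G, F \in C -> G \subset F -> G \in C).

Definition facets C : {set {set 'I_n}} := [set F | maxset (mem C) F].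

Definition pure C : Prop :=
  forall F G, F \in facets C -> G \in facets C -> #|F| = #|G|.

(* dim C + 1 *)
Definition dim1 C : nat := \max_(F in C) #|F|.

Definition shifted C : Prop :=
  forall F (i j : 'I_n), F \in C -> i \in F -> (i < j)%N ->
    j |: (F :\ i) \in C.

(* fnum C k is f_{k-1}(C). *)
Definition fnum C (k : nat) : nat := #|[set F in C | #|F| == k]|.

Definition hnum C (i : nat) : int :=
  let d := dim1 C in
  \sum_(j < i.+1) (-1) ^+ (i - j) * ('C(d - j, d - i))%:Z * (fnum C j)%:Z.

Definition generated_complex (P : {set 'I_n} -> Prop) : {set {set 'I_n}} :=
  [set G : {set 'I_n} | `[< exists2 F, P F & G \subset F >]].

End Complexes.

Section CyclicPolytope.
Variables (R : realFieldType) (n d : nat).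

(* F is a face iff the points indexed by F are exactly the p i lying in a proper
   face of the convex hull of all the p i, i.e. on the hyperplane a.x = b for
   some inequality a.x <= b valid on all the p i. *)
Definition boundary_complex (p : 'I_n -> 'rV[R]_d) : {set {set 'I_n}} :=
  [set F : {set 'I_n} | (F != setT) &&
    `[< exists a : 'cV[R]_d, exists b : R, forall i : 'I_n,
          if i \in F then (p i *m a) 0 0 = b else (p i *m a) 0 0 < b >]].

Definition moment_curve (t : R) : 'rV[R]_d := \row_(j < d) t ^+ j.+1.

Definition cyclic_complex (t : 'I_n -> R) : {set {set 'I_n}} :=
  boundary_complex (fun i => moment_curve (t i)).

End CyclicPolytope.

Definition ideal_gen (R : pzRingType) (S : R -> Prop) (f : R) : Prop :=
  exists2 s : seq (R * R * R),
    forall t, t \in s -> S t.1.2 & f = \sum_(t <- s) t.1.1 * t.1.2 * t.2.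

Definition image_of (A B : Type) (h : A -> B) (S : A -> Prop) (y : B) : Prop :=
  exists2 x, S x & y = h x.

Definition same_set (A : Type) (S T : A -> Prop) : Prop :=
  forall x, S x <-> T x.

Definition infinite_type (T : eqType) : Prop :=
  forall s : seq T, exists x, x \notin s.

(* P holds on a nonempty Zariski open subset of GL_n(K).  The field K is meant
   to be infinite: then p != 0 implies that p does not vanish on all of
   GL_n(K), and any nonempty open subset contains one of this form. *)
Definition generically (K : fieldType) (n : nat) (P : 'M[K]_n -> Prop) : Prop :=
  exists2 p : {mpoly K[(n * n)%N]}, p != 0 &
    forall A : 'M[K]_n, A \in unitmx ->
      p.@[fun k => mxvec A 0 k] != 0 -> P A.

(* The degree reverse lexicographic order with x_0 > ... > x_{n-1}.  (The order
   on 'X_{1..n} in mpoly, which defines mlead, is degree lexicographic.) *)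
Definition revlex_lt (n : nat) (u v : 'X_{1..n}) : bool :=
  (mdeg u < mdeg v)%N ||
  (mdeg u == mdeg v) &&
  [exists i : 'I_n, (v i < u i)%N &&
     [forall j : 'I_n, (i < j)%N ==> (u j == v j)]].

(* The nondecreasing list i_1 <= ... <= i_k of the indices of the monomial
   x_{i_1} ... x_{i_k}. *)
Definition mindices (n : nat) (u : 'X_{1..n}) : seq nat :=
  flatten [seq nseq (u i) (val i) | i <- enum 'I_n].

Section SymmetricShifting.
Variables (K : fieldType) (n : nat).
Implicit Types (C D : {set {set 'I_n}}) (I G : {mpoly K[n]} -> Prop).

(* mesym1 F is the exponent of the squarefree monomial x_F. *)
Definition sr_ideal C : {mpoly K[n]} -> Prop :=
  ideal_gen (fun f => exists2 F, F \notin C & f = 'X_[mesym1 F]).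

Definition sym_map (A : 'M[K]_n) (f : {mpoly K[n]}) : {mpoly K[n]} :=
  f \mPo [tuple \sum_(i < n) A i j *: 'X_i | j < n].

Definition sym_lead (f : {mpoly K[n]}) (u : 'X_{1..n}) : Prop :=
  u \in msupp f /\ (forall v, v \in msupp f -> v != u -> revlex_lt v u).

Definition sym_initial I : {mpoly K[n]} -> Prop :=
  ideal_gen (fun g => exists f u, [/\ I f, sym_lead f u & g = 'X_[u]]).

Definition is_sym_gin I G : Prop :=
  generically (fun A => same_set (sym_initial (image_of (sym_map A) I)) G).

(* u is a minimal monomial generator of the monomial ideal G. *)
Definition min_generator G (u : 'X_{1..n}) : Prop :=
  G 'X_[u] /\ (forall v : 'X_{1..n}, (v <= u)%MM -> G 'X_[v] -> v = u).

(* The index list of Phi(u). *)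
Definition Phi_indices (u : 'X_{1..n}) : seq nat :=
  mkseq (fun k => (nth 0 (mindices u) k + k)%N) (mdeg u).

(* Phi(u) = x_F; for u a minimal generator of Gin(I_C) such an F exists, i.e.
   the indices of Phi(u) do not exceed n. *)
Definition Phi_is (u : 'X_{1..n}) (F : {set 'I_n}) : Prop :=
  [seq val i | i <- enum F] = Phi_indices u.

(* D is the symmetric algebraic shifting of C. *)
Definition sym_shifting C D : Prop :=
  simplicial_complex D /\
  exists2 G, is_sym_gin (sr_ideal C) G &
    same_set (sr_ideal D)
      (ideal_gen (fun f => exists u F,
         [/\ min_generator G u, Phi_is u F & f = 'X_[mesym1 F]])).

End SymmetricShifting.

(* The exterior algebra of K^n: f F is the coefficient of e_F in f. *)
Definition exterior (K : fieldType) (n : nat) : Type :=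
  {ffun {set 'I_n} -> K}.

Section ExteriorAlgebra.
Variables (K : fieldType) (n : nat).
Implicit Types (f g h : exterior K n) (A B C F G : {set 'I_n}).

HB.instance Definition _ := GRing.Lmodule.copy (exterior K n)
  {ffun {set 'I_n} -> K^o}.

Definition inversions A B : nat :=
  (\sum_(i in A) \sum_(j in B) (j < i)%N)%N.

(* e_A * e_B = wedge_sign A B *: e_(A :|: B) *)
Definition wedge_sign A B : K :=
  if [disjoint A & B] then (-1) ^+ inversions A B else 0.

Definition ext_basis F : exterior K n := [ffun G => (G == F)%:R].

Definition ext_mul f g : exterior K n :=
  [ffun F => \sum_A \sum_B
     (A :|: B == F)%:R * (wedge_sign A B * (f A * g B))].

Definition ext_one : exterior K n := ext_basis set0.

Lemma wedge_signA A B C :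
  wedge_sign A B * wedge_sign (A :|: B) C =
  wedge_sign B C * wedge_sign A (B :|: C).
Proof.
rewrite /wedge_sign.
have -> : [disjoint A :|: B & C] = [disjoint A & C] && [disjoint B & C].
  by rewrite -!setI_eq0 setIUl setU_eq0.
have -> : [disjoint A & B :|: C] = [disjoint A & B] && [disjoint A & C].
  by rewrite -!setI_eq0 setIUr setU_eq0.
have [dAB|_] := boolP [disjoint A & B]; last by rewrite mul0r !mulr0.
have [dBC|_] := boolP [disjoint B & C]; last by rewrite andbF mulr0 mul0r.
have [dAC|_] := boolP [disjoint A & C]; last by rewrite /= !mulr0.
rewrite /= -!exprD; congr (_ ^+ _); rewrite /inversions.
have sumU (X Y : {set 'I_n}) (w : 'I_n -> nat) : [disjoint X & Y] ->
    (\sum_(i in X :|: Y) w i = \sum_(i in X) w i + \sum_(i in Y) w i)%N.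
  by move=> dXY; rewrite -bigU //=; apply: eq_bigl => i; rewrite inE.
rewrite sumU // addnA addnC; congr addn.
by rewrite -big_split; apply: eq_bigr => i _; rewrite sumU.
Qed.

Lemma wedge_sign0l A : wedge_sign set0 A = 1.
Proof.
by rewrite /wedge_sign -setI_eq0 set0I eqxx /inversions big_set0 expr0.
Qed.

Lemma wedge_sign0r A : wedge_sign A set0 = 1.
Proof.
rewrite /wedge_sign -setI_eq0 setI0 eqxx /inversions big1 ?expr0 // => i _.
by rewrite big_set0.
Qed.

Lemma sum_setU (w : {set 'I_n} -> {set 'I_n} -> K) (phi : {set 'I_n} -> K) :
  \sum_X phi X * (\sum_B \sum_C (B :|: C == X)%:R * w B C) =
  \sum_B \sum_C phi (B :|: C) * w B C.
Proof.
under eq_bigr => X _ do rewrite mulr_sumr.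
rewrite exchange_big /=; apply: eq_bigr => B _.
under eq_bigr => X _ do rewrite mulr_sumr.
rewrite exchange_big /=; apply: eq_bigr => C _.
rewrite (bigD1 (B :|: C)) //= eqxx mul1r big1 ?addr0 // => X neX.
by rewrite eq_sym (negPf neX) mul0r mulr0.
Qed.

Lemma ext_mulA : associative ext_mul.
Proof.
move=> f g h; apply/ffunP => F; rewrite !ffunE.
transitivity (\sum_A \sum_B \sum_C (A :|: (B :|: C) == F)%:R *
    (wedge_sign A (B :|: C) * wedge_sign B C) * (f A * g B * h C)).
  apply: eq_bigr => A _.
  under eq_bigr => X _ do rewrite ffunE mulrA mulrA.
  rewrite sum_setU; apply: eq_bigr => B _; apply: eq_bigr => C _.
  ring.
rewrite exchange_big /= (eq_bigr _ (fun B _ => exchange_big _ _ _ _ _ _)) /=.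
rewrite exchange_big /= [RHS]exchange_big /=; apply: eq_bigr => C _.
transitivity (\sum_X ((X :|: C == F)%:R * wedge_sign X C * h C) *
    \sum_A \sum_B (A :|: B == X)%:R * (wedge_sign A B * (f A * g B))).
  rewrite sum_setU exchange_big /=.
  apply: eq_bigr => A _; apply: eq_bigr => B _; rewrite setUA.
  rewrite [wedge_sign A _ * _]mulrC -wedge_signA.
  ring.
by apply: eq_bigr => X _; rewrite ffunE; ring.
Qed.

Lemma ext_mul1l : left_id ext_one ext_mul.
Proof.
move=> f; apply/ffunP => F; rewrite ffunE (bigD1 set0) //=.
rewrite [X in _ + X]big1 => [|A neA]; last first.
  by apply: big1 => B _; rewrite ffunE (negPf neA) mul0r !mulr0.
rewrite addr0 (bigD1 F) //= big1 => [|B neB].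
  by rewrite set0U wedge_sign0l ffunE !eqxx !mul1r addr0.
by rewrite set0U (negPf neB) mul0r.
Qed.

Lemma ext_mul1r : right_id ext_one ext_mul.
Proof.
move=> f; apply/ffunP => F; rewrite ffunE exchange_big (bigD1 set0) //=.
rewrite [X in _ + X]big1 => [|A neA]; last first.
  by apply: big1 => B _; rewrite ffunE (negPf neA) !mulr0.
rewrite addr0 (bigD1 F) //= big1 => [|B neB].
  by rewrite setU0 wedge_sign0r ffunE !eqxx !mul1r mulr1 addr0.
by rewrite setU0 (negPf neB) mul0r.
Qed.

Lemma ext_mulDl : left_distributive ext_mul +%R.
Proof.
move=> f g h; apply/ffunP => F; rewrite !ffunE -big_split.
apply: eq_bigr => A _; rewrite -big_split; apply: eq_bigr => B _ /=.
by rewrite ffunE /=; ring.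
Qed.

Lemma ext_mulDr : right_distributive ext_mul +%R.
Proof.
move=> f g h; apply/ffunP => F; rewrite !ffunE -big_split.
apply: eq_bigr => A _; rewrite -big_split; apply: eq_bigr => B _ /=.
by rewrite ffunE /=; ring.
Qed.

Lemma ext_one_neq0 : ext_one != 0.
Proof.
by apply/eqP => /ffunP/(_ set0); rewrite !ffunE eqxx; apply/eqP/oner_neq0.
Qed.

HB.instance Definition _ := GRing.Zmodule_isNzRing.Build (exterior K n)
  ext_mulA ext_mul1l ext_mul1r ext_mulDl ext_mulDr ext_one_neq0.

End ExteriorAlgebra.

Section ExteriorShifting.
Variables (K : fieldType) (n : nat).
Implicit Types (C D : {set {set 'I_n}}) (I J : exterior K n -> Prop).

Definition ext_face_ideal C : exterior K n -> Prop :=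
  ideal_gen (fun f => exists2 F, F \notin C & f = ext_basis K F).

(* The algebra endomorphism of the exterior algebra induced by A; a product
   over j in F is taken in increasing order of j. *)
Definition ext_map (A : 'M[K]_n) (f : exterior K n) : exterior K n :=
  \sum_(F : {set 'I_n}) f F *:
    \prod_(j in F) \sum_(i < n) A i j *: ext_basis K [set i].

(* Exterior monomials are ordered as the squarefree monomials x_F. *)
Definition ext_lead (f : exterior K n) (F : {set 'I_n}) : Prop :=
  f F != 0 /\
  (forall G, f G != 0 -> G != F -> revlex_lt (mesym1 G) (mesym1 F)).

Definition ext_initial J : exterior K n -> Prop :=
  ideal_gen (fun g => exists f F,
    [/\ J f, ext_lead f F & g = ext_basis K F]).

Definition is_ext_gin J I : Prop :=
  generically (fun A => same_set (ext_initial (image_of (ext_map A) J)) I).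

(* D is the exterior algebraic shifting of C. *)
Definition ext_shifting C D : Prop :=
  simplicial_complex D /\ is_ext_gin (ext_face_ideal C) (ext_face_ideal D).

End ExteriorShifting.

Section SqueezedSpheres.
Variables (n d m : nat).
Implicit Types (U : {pred 'X_{1..m}}) (u v : 'X_{1..m}).

Definition shifted_order_ideal U : Prop :=
  [/\ 0%MM \in U,
      forall i : 'I_m, U_(i)%MM \in U,
      forall u v, u \in U -> (v <= u)%MM -> v \in U
    & forall u (i j : 'I_m), (u + U_(i))%MM \in U -> (i < j)%N ->
        (u + U_(j))%MM \in U].

(* The facet F_d(u) of B_d(U).  In terms of 0-based indices i_0 <= ... <= i_{k-1}
   and vertices, its pairs are {i_j + 2j, i_j + 2j + 1}. *)
Definition squeezed_facet u : {set 'I_n} :=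
  let k := mdeg u in
  let i j := nth 0%N (mindices u) j in
  [set v : 'I_n |
     [exists j : 'I_k, (val v == i j + j.*2)%N || (val v == (i j + j.*2).+1)]
     || (n + k.*2 <= v.+1 + d)%N].

Definition squeezed_ball U : {set {set 'I_n}} :=
  generated_complex (fun F => exists2 u, u \in U & F = squeezed_facet u).

Definition ball_boundary (B : {set {set 'I_n}}) : {set {set 'I_n}} :=
  generated_complex (fun F =>
    [/\ F \in B, #|F| = d & #|[set G in facets B | F \subset G]| = 1%N]).

End SqueezedSpheres.

(* C is the squeezed (d-1)-sphere S_d(U) on [n] for some U; the degree bound
   reads k <= (d+1)/2. *)
Definition squeezed_sphere (n d : nat) (C : {set {set 'I_n}}) : Prop :=
  exists U : {pred 'X_{1..n - d.+1}},
    [/\ shifted_order_ideal U,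
        forall u, u \in U -> ((mdeg u).*2 <= d.+1)%N
      & C = ball_boundary d (squeezed_ball n d U)].

(* Main.v *)
(* A monomial u is recorded by its partial sums psum u, which turn shifted order
   ideals into down-sets for the pointwise order; similarly a set F of vertices is
   recorded by the function cnt F, equal to psum u when x_F = Phi(u).  Let n = m + d + 1.
   The sphere is S_d(U), where U consists of the u with 2 deg u <= d and Phi(u) in
   Sigma.  Since Sigma lies in Delta^s(C(n, d)), its faces satisfy
   cnt F m + cnt F (m + 1) <= d, and by the symmetry of the h-vector Sigma consists of
   all F with this property for which cnt F is below some psum u, u in U.  One has to
   show that the leading monomials of the generic ideal of S_d(U) are exactly those
   that violate one of these two conditions on partial sums.

   Violators of the second condition are leading monomials by a Lefschetz property.
   It is proved for ideals of monomials in vectors h_0, h_1, ... by the degeneration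
   h_{p+1} -> h_p + t h_{p+1}, whose limit is governed by the contraction of the edge
   {p, p + 1} and by its link; it also holds for the cyclic polytope, which gives the
   inequality above.  Violators of the first condition are leading monomials of
   combinations of generators x_(R(u)), where R(u) consists of the lower elements of the
   pairs of F_d(u), because vanishing on the linear subspaces of
   enough facets restricts the leading monomial.  There are no other leading
   monomials, because the facets of S_d(U) are at least as many as the monomials that
   violate neither condition. *)
Require Import Defs.
From HB Require Import structures.
From mathcomp Require Import all_boot all_order all_algebra.
From mathcomp Require Import boolp mpoly ring zify.

Set Implicit Arguments.
Unset Strict Implicit.
Unset Printing Implicit Defensive.

Import Order.TTheory GRing.Theory Num.Theory.

(** * Polynomials over infinite fields *)

Local Open Scope ring_scope.

(** Exterior shifting is taken over any infinite field, so the Lefschetz property is needed free of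
    the characteristic. Only its surjective half is needed, and this is a spanning statement, which
    passes from a degenerate family to generic ones. Both algebras enter only through a multilinear
    product of lists of vectors that is commutative up to a sign, so one induction serves both. Its
    state (a, c) is a position on the lattice path that reads the vertices from left to right: a
    gaps and c pairs have been passed, and p = a + 2 c is the next vertex. Contracting {p, p + 1} is
    a gap step and keeps the degree e; passing to the link is a pair step, which lowers e by 1 and d
    by 2, so that the Lefschetz exponent 2 e - d never changes. No complex is followed through the
    induction, only the explicit nonfaces given by [lower] and [reach], which reproduce themselves
    up to inclusion under both steps. They are also nonfaces of the cyclic polytope if the condition
    on S is taken to be 2 S(m) <= d + 1, which is why it is covered by the same argument. *)

Section InfiniteField.
Variable K : fieldType.
Hypothesis Kinf : infinite_type K.

Lemma infinite_uniq k : exists s : seq K, uniq s /\ size s = k.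
Proof.
elim: k => [|k [s [us ss]]]; first by exists [::].
by have [x xs] := Kinf s; exists (x :: s); rewrite /= xs us ss.
Qed.

Lemma poly_nonroot (p : {poly K}) : p != 0 -> exists x, p.[x] != 0.
Proof.
move=> p0; have [s [us ss]] := infinite_uniq (size p).
apply: contrapT => noroot; have: all (root p) s.
  apply/allP => x _; apply/negPn/negP => /negP npx.
  by apply: noroot; exists x; apply/negP.
by move=> /max_poly_roots-/(_ p0 us); rewrite ss ltnn.
Qed.

Lemma poly_eq0_infinite (p : {poly K}) :
  (forall x, x != 0 -> p.[x] = 0) -> p = 0.
Proof.
move=> px; apply/eqP/negPn/negP => p0.
have /poly_nonroot[x] : p * 'X != 0 by rewrite mulf_neq0 // polyX_eq0.
rewrite hornerM hornerX; have [->|x0] := eqVneq x 0; first by rewrite mulr0 eqxx.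
by rewrite px // mul0r eqxx.
Qed.

Lemma digits_inj B n (f g : 'I_n -> nat) :
  (forall i, f i < B)%N -> (forall i, g i < B)%N ->
  (\sum_i f i * B ^ i = \sum_i g i * B ^ i)%N -> f =1 g.
Proof.
elim: n f g => [|n IHn] f g fB gB; first by move=> _ [].
rewrite !big_ord_recl !expn0 !muln1.
have shift (h : 'I_n.+1 -> nat) : (\sum_(i < n) h (lift ord0 i) * B ^ lift ord0 i
     = (\sum_(i < n) h (lift ord0 i) * B ^ i) * B)%N.
  by rewrite big_distrl /=; apply: eq_bigr => i _; rewrite /bump /= add1n expnSr mulnA.
rewrite !shift => eqs.
have e0 : f ord0 = g ord0.
  by have := congr1 (modn^~ B) eqs; rewrite ![(f ord0 + _)%N]addnC ![(g ord0 + _)%N]addnC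
    !modnMDl !modn_small.
have B0 : (0 < B)%N by apply: leq_ltn_trans (fB ord0).
move: eqs; rewrite e0 => /addnI/eqP; rewrite eqn_pmul2r // => /eqP/IHn e1 i.
by case: (unliftP ord0 i) => [j|] -> //; apply: e1.
Qed.

(** Kronecker substitution: x_i = t ^ (B ^ i), with B above all exponents, keeps the monomials of p
    apart by uniqueness of base-B digits, and so reduces the claim to one variable. *)
Lemma mpoly_nonroot N (p : {mpoly K[N]}) :
  p != 0 -> exists x, p.@[x] != 0.
Proof.
move=> p0; pose B := msize p; pose k (u : 'X_{1..N}) := (\sum_i u i * B ^ i)%N.
have uB u i : u \in msupp p -> (u i < B)%N.
  move=> /msize_mdeg_lt; apply: leq_ltn_trans.
  by rewrite mdegE (bigD1 i) //= leq_addr.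
pose q : {poly K} := \sum_(u <- msupp p) p@_u *: 'X^(k u).
have [u up] : exists u, u \in msupp p.
  case E: (msupp p) => [|u s]; first by move: p0; rewrite -msupp_eq0 E.
  by exists u; rewrite inE eqxx.
have : q != 0.
  apply/eqP => /(congr1 (fun r : {poly K} => r`_(k u))).
  rewrite coef0 coef_sum (bigD1_seq u) //= big1_seq ?addr0.
    rewrite coefZ coefXn eqxx mulr1 => /eqP; apply/negP.
    by rewrite -mcoeff_msupp.
  move=> v /andP[vu vp]; rewrite coefZ coefXn.
  case: eqP => [e|]; last by rewrite mulr0.
  case/eqP: vu; apply/mnmP => i; symmetry; move: i.
  by apply: (digits_inj (B := B)) e => i; apply: uB.
move=> /poly_nonroot[t qt]; exists (fun i => t ^+ (B ^ i)).
suff -> : p.@[fun i => t ^+ (B ^ i)] = q.[t] by [].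
rewrite mevalE horner_sum; apply: eq_bigr => v _; rewrite hornerZ hornerXn.
congr (_ * _); rewrite /k expr_sum; apply: eq_bigr => i _.
by rewrite mulnC exprM.
Qed.

End InfiniteField.

Local Close Scope ring_scope.

(** * Spans of products of vectors and openness *)

Local Open Scope ring_scope.

Section LinearSpan.
Variables (K : fieldType) (V : lmodType K).
Implicit Types (D : V -> Prop).

(** The span is inductive because D is an arbitrary predicate and V need not be
    finite-dimensional. *)
Inductive lspan D : V -> Prop :=
| lspan_nil : lspan D 0
| lspan_cons a x y : D x -> lspan D y -> lspan D (a *: x + y).

Lemma lspan_gen D x : D x -> lspan D x.
Proof. by move=> Dx; rewrite -[x]scale1r -[_ *: _]addr0; apply/lspan_cons/lspan_nil. Qed.

Lemma lspanD D x y : lspan D x -> lspan D y -> lspan D (x + y).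
Proof.
move=> Dx Dy; elim: Dx => [|a x' y' Dx' _ IH]; first by rewrite add0r.
by rewrite -addrA; apply: lspan_cons.
Qed.

Lemma lspanZ D a x : lspan D x -> lspan D (a *: x).
Proof.
elim=> [|b x' y' Dx' _ IH]; first by rewrite scaler0; apply: lspan_nil.
by rewrite scalerDr scalerA; apply: lspan_cons.
Qed.

Lemma lspanB D x y : lspan D x -> lspan D y -> lspan D (x - y).
Proof. by move=> Dx Dy; rewrite -scaleN1r; apply/lspanD/lspanZ. Qed.

Lemma lspan_sum D (I : Type) (r : seq I) (P : pred I) F :
  (forall i, P i -> lspan D (F i)) -> lspan D (\sum_(i <- r | P i) F i).
Proof.
by move=> DF; elim/big_ind: _ => //; [apply: lspan_nil | apply: lspanD].
Qed.

Lemma lspan_trans D D' x :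
  (forall y, D y -> lspan D' y) -> lspan D x -> lspan D' x.
Proof.
move=> DD'; elim=> [|a x' y' Dx' _ IH]; first exact: lspan_nil.
by apply: lspanD => //; apply: lspanZ; apply: DD'.
Qed.

End LinearSpan.

Lemma lspan_map (K : fieldType) (V W : lmodType K) (f : {linear V -> W}) (D : V -> Prop) (E : W -> Prop) x :
  (forall y, D y -> lspan E (f y)) -> lspan D x -> lspan E (f x).
Proof.
move=> DD'; elim=> [|a x' y' Dx' _ IH]; first by rewrite linear0; apply: lspan_nil.
by rewrite linearP; apply: lspanD => //; apply: lspanZ; apply: DD'.
Qed.

Section Multilinear.
Variables (K : fieldType) (n : nat) (V : lmodType K) (pr : seq 'rV[K]_n -> V).
Hypothesis prP : forall s1 s2 a u v,
  pr (s1 ++ (a *: u + v) :: s2) = a *: pr (s1 ++ u :: s2) + pr (s1 ++ v :: s2).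

Local Notation dl := (fun i : 'I_n => delta_mx 0 i : 'rV[K]_n).

Lemma prD s1 s2 u v : pr (s1 ++ (u + v) :: s2) = pr (s1 ++ u :: s2) + pr (s1 ++ v :: s2).
Proof. by have := prP s1 s2 1 u v; rewrite !scale1r. Qed.

Lemma pr0 s1 s2 : pr (s1 ++ 0 :: s2) = 0.
Proof.
by have /eqP := prD s1 s2 0 0; rewrite addr0 -[X in X == _]addr0 (inj_eq (addrI _)) eq_sym => /eqP.
Qed.

Lemma prZ s1 s2 a u : pr (s1 ++ (a *: u) :: s2) = a *: pr (s1 ++ u :: s2).
Proof. by have := prP s1 s2 a u 0; rewrite pr0 !addr0. Qed.

Lemma prB s1 s2 u v : pr (s1 ++ (u - v) :: s2) = pr (s1 ++ u :: s2) - pr (s1 ++ v :: s2).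
Proof. by have := prP s1 s2 (-1) v u; rewrite !scaleN1r addrC => ->; rewrite addrC. Qed.

Lemma pr_sum s1 s2 (I : Type) (r : seq I) (c : I -> K) (F : I -> 'rV[K]_n) :
  pr (s1 ++ (\sum_(i <- r) c i *: F i) :: s2) =
  \sum_(i <- r) c i *: pr (s1 ++ F i :: s2).
Proof.
elim: r => [|i r IHr]; first by rewrite !big_nil pr0.
by rewrite !big_cons prP IHr.
Qed.

Fixpoint words e : seq (seq 'I_n) :=
  if e is e'.+1 then [seq i :: w | i <- enum 'I_n, w <- words e'] else [:: [::]].

Lemma words_size e w : w \in words e -> size w = e.
Proof.
elim: e w => [|e IHe] w; first by rewrite inE => /eqP ->.
by case/allpairsP=> -[i w'] /= [_ /IHe <- ->].
Qed.

Lemma rowE_enum (v : 'rV[K]_n) : v = \sum_(i <- enum 'I_n) v 0 i *: dl i.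
Proof. by rewrite big_enum /= {1}[v]row_sum_delta. Qed.

Lemma pr_words_ind (P : V -> Prop) e s0 :
  P 0 -> (forall a x y, P x -> P y -> P (a *: x + y)) ->
  (forall w, size w = e -> P (pr (s0 ++ map dl w))) ->
  forall s, size s = e -> P (pr (s0 ++ s)).
Proof.
move=> P0 PD; elim: e s0 => [|e IHe] s0 Pw [|v s] //= => [_|[ss]].
  exact: (Pw [::]).
rewrite {1}(rowE_enum v) pr_sum; elim: (enum _) => [|i r IHr].
  by rewrite big_nil.
rewrite big_cons; apply: PD => //; rewrite -cat_rcons; apply: IHe => // w sw.
by rewrite cat_rcons; apply: (Pw (i :: w)); rewrite /= sw.
Qed.

Section PolynomialFamilies.
Variable N : nat.
Local Notation param := ('I_N -> K).

Definition pvec (g : param -> 'rV[K]_n) :=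
  forall i, exists p : {mpoly K[N]}, forall x, g x 0 i = p.@[x].

Fixpoint pvecs (gs : seq (param -> 'rV[K]_n)) :=
  if gs is g :: gs' then pvec g /\ pvecs gs' else True.

Lemma pr_expand gs : pvecs gs ->
  exists P : seq 'I_n -> {mpoly K[N]}, forall s0 x,
    pr (s0 ++ [seq g x | g <- gs]) =
    \sum_(w <- words (size gs)) (P w).@[x] *: pr (s0 ++ map dl w).
Proof.
elim: gs => [_|g gs IHg [/choice[p pE] /IHg[P PE]]] /=.
  by exists (fun=> 1) => s0 x; rewrite big_seq1 meval1 scale1r.
exists (fun w => if w is i :: w' then p i * P w' else 0) => s0 x.
rewrite big_allpairs_dep {1}(rowE_enum (g x)) pr_sum; apply: eq_bigr => i _.
rewrite -cat_rcons PE scaler_sumr; apply: eq_bigr => w _.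
by rewrite scalerA mevalM -pE cat_rcons.
Qed.

(* If the products attached to D0 span in degree e at the parameter x0 and each
   of them extends polynomially into the span of D x, then det p below, which is
   1 at x0, certifies spanning at x. *)
Lemma span_open e (x0 : param) (D0 : seq 'rV[K]_n -> Prop) (Xg : param -> Prop)
    (D : param -> V -> Prop) :
  (forall w, size w = e -> lspan (fun v => exists2 s, D0 s & v = pr s) (pr (map dl w))) ->
  (forall s, D0 s -> exists gs, [/\ size gs = e, pvecs gs, [seq g x0 | g <- gs] = s
     & forall x, Xg x -> lspan (D x) (pr [seq g x | g <- gs])]) ->
  exists2 p : {mpoly K[N]}, p.@[x0] != 0 &
    forall x, Xg x -> p.@[x] != 0 -> forall s, size s = e -> lspan (D x) (pr s).
Proof.
move=> D0span D0ext; pose M := size (words e).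
pose b (k : 'I_M) := pr (map dl (nth [::] (words e) k)).
have sumW (F : seq 'I_n -> V) :
    \sum_(w <- words e) F w = \sum_(k < M) F (nth [::] (words e) k).
  by rewrite (big_nth [::]) big_mkord.
(* A representation of v by the words at x0 that deforms with x inside the span of [D x]. The words
   may be linearly dependent, so the coefficients are chosen, not determined. *)
pose Rep v := exists P : 'I_M -> {mpoly K[N]},
  v = \sum_k (P k).@[x0] *: b k /\
  forall x, Xg x -> lspan (D x) (\sum_k (P k).@[x] *: b k).
have RepS v : lspan (fun v => exists2 s, D0 s & v = pr s) v -> Rep v.
  elim=> [|a x y [s Ds ->] _ [Q [yE Qx]]].
    exists (fun=> 0); split=> [|x _]; first by rewrite big1 // => k _; rewrite meval0 scale0r.
    by rewrite big1 => [|k _]; [apply: lspan_nil | rewrite meval0 scale0r].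
  have [gs [sgs pgs gx0 gsx]] := D0ext _ Ds.
  have [P PE] := pr_expand pgs.
  have {}PE z : pr [seq g z | g <- gs] = \sum_(k < M) (P (nth [::] (words e) k)).@[z] *: b k.
    by rewrite (PE [::]) sgs sumW.
  exists (fun k : 'I_M => a *: P (nth [::] (words e) k) + Q k).
  have E z : \sum_(k < M) (a *: P (nth [::] (words e) k) + Q k).@[z] *: b k =
      a *: pr [seq g z | g <- gs] + \sum_(k < M) (Q k).@[z] *: b k.
    rewrite PE scaler_sumr -big_split; apply: eq_bigr => k _.
    by rewrite mevalD mevalZ scalerDl scalerA.
  split=> [|z Xz]; first by rewrite E gx0 yE.
  by rewrite E; apply: lspanD; [apply/lspanZ/gsx | apply: Qx].
have /choice[P PE] : forall k : 'I_M, Rep (b k).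
  move=> k; apply/RepS/D0span/words_size; exact: mem_nth.
(* At x0 the combination of row k is b k, so subtracting P(x0) and adding the identity changes none
   of the combinations of the b l, and makes the matrix the identity at x0. *)
pose Q : 'M[{mpoly K[N]}]_M := \matrix_(k, l) (P k l - ((P k l).@[x0])%:MP + (k == l)%:R%:MP).
pose Qx (x : param) : 'M[K]_M := map_mx (meval x) Q.
have QxE x k l : Qx x k l = (P k l).@[x] - (P k l).@[x0] + (k == l)%:R.
  by rewrite !mxE mevalD mevalB !mevalC.
have detQ x : (\det Q).@[x] = \det (Qx x) by rewrite -det_map_mx.
have Qb x k : \sum_l Qx x k l *: b l = \sum_l (P k l).@[x] *: b l.
  under eq_bigr => l _ do rewrite QxE scalerDl scalerBl.
  rewrite !big_split /= sumrN -(PE k).1 [X in _ + X](bigD1 k) //= eqxx scale1r.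
  rewrite [X in b k + X]big1 ?addr0 ?subrK // => l.
  by rewrite eq_sym => /negPf ->; rewrite scale0r.
exists (\det Q).
  rewrite detQ (_ : Qx x0 = 1%:M) ?det1 ?oner_neq0 //.
  by apply/matrixP => k l; rewrite QxE subrr add0r mxE.
move=> x Xx; rewrite detQ -unitfE => Qu.
have bx k : lspan (D x) (b k).
  have -> : b k = \sum_l (invmx (Qx x)) k l *: (\sum_j Qx x l j *: b j).
    under eq_bigr => l _ do rewrite scaler_sumr.
    rewrite exchange_big /= [LHS](_ : _ = \sum_j (invmx (Qx x) *m Qx x) k j *: b j).
      apply: eq_bigr => j _; rewrite mxE scaler_suml.
      by apply: eq_bigr => l _; rewrite scalerA.
    rewrite mulVmx ?unitmxE // (bigD1 k) //= mxE eqxx scale1r big1 ?addr0 // => j.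
    by rewrite mxE eq_sym => /negPf ->; rewrite scale0r.
  apply: lspan_sum => l _; apply: lspanZ; rewrite Qb; exact: (PE l).2.
apply: (pr_words_ind (s0 := [::])); first exact: lspan_nil.
  by move=> a y z Dy Dz; apply: lspanD => //; apply: lspanZ.
move=> w sw; have ww : w \in words e.
  elim: e w sw {D0span D0ext M b sumW Rep RepS P PE Q Qx QxE detQ Qb Qu bx} => [|e IHe] [|i w] //= [sw].
  by apply/allpairsP; exists (i, w); rewrite mem_enum /= IHe.
have := bx (Ordinal (etrans (index_mem w (words e)) ww)).
by rewrite /b /= nth_index.
Qed.

End PolynomialFamilies.
End Multilinear.

Local Close Scope ring_scope.

Local Open Scope ring_scope.

(** * Ideals generated by products of linear forms, in a fixed degree *)

Section ProductSpan.
Variables (K : fieldType) (n : nat) (V : lmodType K) (pr : seq 'rV[K]_n -> V).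
Variable eps : K.
Hypothesis prP : forall s1 s2 a u v,
  pr (s1 ++ (a *: u + v) :: s2) = a *: pr (s1 ++ u :: s2) + pr (s1 ++ v :: s2).
Hypothesis pr_swap : forall s1 s2 u v,
  pr (s1 ++ u :: v :: s2) = eps *: pr (s1 ++ v :: u :: s2).

Local Notation dl := (fun i : 'I_n => delta_mx 0 i : 'rV[K]_n).

Lemma pr_perm_cat s0 s1 s2 : perm_eq s1 s2 ->
  exists k, pr (s0 ++ s1) = eps ^+ k *: pr (s0 ++ s2).
Proof.
elim: s1 s0 s2 => [|v s1 IHs] s0 s2.
  by move=> /perm_size/esym/size0nil ->; exists 0%N; rewrite scale1r.
move=> ps; have vs2 : v \in s2 by rewrite -(perm_mem ps) mem_head.
case/splitPr: vs2 ps => t1 t2 ps.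
have {}ps : perm_eq s1 (t1 ++ t2) by rewrite -(perm_cons v) (perm_trans ps) // (perm_catCA t1 [:: v] t2).
have [k ek] := IHs (rcons s0 v) _ ps; rewrite !cat_rcons in ek.
have [l el] : exists l, eps ^+ l *: pr (s0 ++ t1 ++ v :: t2) = pr (s0 ++ v :: t1 ++ t2).
  elim: t1 s0 {IHs ps ek} => [|u t1 IHt] s0 /=; first by exists 0%N; rewrite scale1r.
  have [l el] := IHt (rcons s0 u); rewrite !cat_rcons in el.
  by exists l.+1; rewrite exprS -scalerA el -pr_swap.
by exists (k + l)%N; rewrite ek -el scalerA exprD.
Qed.

Lemma pr_perm s1 s2 : perm_eq s1 s2 -> exists k, pr s1 = eps ^+ k *: pr s2.
Proof. exact: (@pr_perm_cat [::]). Qed.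

(** The span of [prgen I h e] is the degree-e part of the ideal generated by the products of the
    vectors h k, k in i, for i in I; [spanning] says that the quotient by this ideal vanishes in
    degree e. *)
Definition prgen (I : seq nat -> Prop) (h : nat -> 'rV[K]_n) e (x : V) :=
  exists i r, [/\ I i, (size i + size r)%N = e & x = pr (map h i ++ r)].

Definition spanning I e h := forall s, size s = e -> lspan (prgen I h e) (pr s).

Lemma prgen_perm I h e i r s : I i -> perm_eq s (map h i ++ r) -> size s = e ->
  lspan (prgen I h e) (pr s).
Proof.
move=> Ii ps ss; have [k ->] := pr_perm ps; apply/lspanZ/lspan_gen.
by exists i, r; split; rewrite // -ss (perm_size ps) size_cat size_map.
Qed.

Lemma spanning_words I e h :
  (forall w, size w = e -> lspan (prgen I h e) (pr (map dl w))) -> spanning I e h.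
Proof.
apply: (pr_words_ind prP (s0 := [::])); first exact: lspan_nil.
by move=> a x y; move=> Dx Dy; apply: lspanD => //; apply: lspanZ.
Qed.

Lemma spanning_eq I e h h' : (forall i, I i -> map h i = map h' i) ->
  spanning I e h -> spanning I e h'.
Proof.
move=> hh' sp s /sp; apply: lspan_trans => _ [i [r [Ii se ->]]].
by apply: lspan_gen; exists i, r; rewrite -hh'.
Qed.

Lemma spanning_nil (I : seq nat -> Prop) e h : I [::] -> spanning I e h.
Proof. by move=> I0 s ss; apply: lspan_gen; exists [::], s. Qed.

Lemma pvec_const N (v : 'rV[K]_n) : pvec (fun _ : 'I_N -> K => v).
Proof. by move=> i; exists (v 0 i)%:MP => x; rewrite mevalC. Qed.

Lemma pvecs_map N (h : ('I_N -> K) -> nat -> 'rV[K]_n) i r :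
  (forall k, pvec (h^~ k)) -> pvecs ([seq (fun x => h x k) | k <- i] ++ [seq (fun=> v) | v <- r]).
Proof.
move=> ph; elim: i => [|k i IHi] /=; last by split.
by elim: r => [|v r IHr] //=; split=> //; apply: pvec_const.
Qed.

Lemma spanning_open N (h : ('I_N -> K) -> nat -> 'rV[K]_n) I e x0 :
  (forall k, pvec (h^~ k)) -> spanning I e (h x0) ->
  exists2 p : {mpoly K[N]}, p.@[x0] != 0 &
    forall x, p.@[x] != 0 -> spanning I e (h x).
Proof.
move=> ph sp.
pose D0 s := exists i r, [/\ I i, (size i + size r)%N = e & s = map (h x0) i ++ r].
have [|s [i [r [Ii se ->]]]|p p0 px] := @span_open _ _ _ _ prP N e x0 D0 (fun=> True) (fun x => prgen I (h x) e).
- move=> w sw; have := sp [seq ('e_i : 'rV_n) | i <- w]; rewrite size_map => /(_ sw).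
  apply: lspan_trans => _ [i [r [Ii se ->]]]; apply: lspan_gen.
  by exists (map (h x0) i ++ r) => //; exists i, r.
- exists ([seq (fun x => h x k) | k <- i] ++ [seq (fun=> v) | v <- r]).
  have E x : [seq g x | g <- [seq (fun x => h x k) | k <- i] ++ [seq (fun=> v) | v <- r]]
      = map (h x) i ++ r by rewrite map_cat -!map_comp map_id.
  split; [by rewrite size_cat !size_map | exact: pvecs_map | exact: E |].
  by move=> x _; rewrite E; apply: lspan_gen; exists i, r.
by exists p => // x; apply: px.
Qed.

Definition rows_of R (x : 'I_(R * n) -> K) (k : nat) : 'rV[K]_n :=
  if insub k is Some i then \row_j x (mxvec_index (i : 'I_R) j) else 0.

Definition coord_of R (h : nat -> 'rV[K]_n) (k : 'I_(R * n)) : K :=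
  mxvec (\matrix_(i < R) h i) 0 k.

Lemma rows_of_coord R h k : (k < R)%N -> @rows_of R (@coord_of R h) k = h k.
Proof.
move=> kR; rewrite /rows_of (insubT (fun k => k < R)%N kR) /=.
by apply/rowP => j; rewrite mxE /coord_of mxvecE mxE.
Qed.

Lemma pvec_rows R k : pvec (@rows_of R ^~ k).
Proof.
rewrite /rows_of; case: insubP => [i _ _|_]; last exact: pvec_const.
by move=> j; exists 'X_(mxvec_index i j) => x; rewrite mxE mevalXU.
Qed.

Hypothesis Kinf : infinite_type K.

(** Both conditions are open and nonempty in the R * n coordinates of h_0, ..., h_(R-1), and over an
    infinite field two such conditions meet. *)
Lemma spanning_common R I1 e1 h1 I2 e2 h2 :
  (forall i, I1 i -> all (ltn^~ R) i) -> (forall i, I2 i -> all (ltn^~ R) i) ->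
  spanning I1 e1 h1 -> spanning I2 e2 h2 ->
  exists h, spanning I1 e1 h /\ spanning I2 e2 h.
Proof.
move=> b1 b2 s1 s2.
have op I e h : (forall i, I i -> all (ltn^~ R) i) -> spanning I e h ->
    exists2 p : {mpoly K[R * n]}, p != 0 & forall x, p.@[x] != 0 -> spanning I e (@rows_of R x).
  move=> b s; have [|p p0 px] := @spanning_open _ (@rows_of R) I e (@coord_of R h) (@pvec_rows R).
    apply: spanning_eq s => i /b /allP iR.
    by apply/eq_in_map => k /iR kR; rewrite rows_of_coord.
  by exists p => //; apply: contraNneq p0 => ->; rewrite meval0.
have [p1 p10 p1x] := op _ _ _ b1 s1; have [p2 p20 p2x] := op _ _ _ b2 s2.
have [x] : exists x, (p1 * p2).@[x] != 0 by apply: mpoly_nonroot; rewrite ?mulf_neq0.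
by rewrite mevalM mulf_eq0 negb_or => /andP[/p1x s1x /p2x s2x]; exists (@rows_of R x).
Qed.

(* The first n forms are the images f_j = \sum_i A i j e_i of the variables; the
   forms of index n, n+1, ... are the coordinate forms. *)
Definition frame (A : 'M[K]_n) (k : nat) : 'rV[K]_n :=
  if insub k is Some j then row j A^T
  else if insub (k - n)%N is Some j then delta_mx 0 (j : 'I_n) else 0.

Lemma frame_lt A (j : 'I_n) : frame A j = row j A^T.
Proof. by rewrite /frame valK. Qed.

Lemma frame_ge A (j : 'I_n) : frame A (n + j) = delta_mx 0 j.
Proof. by rewrite /frame insubF ?addKn ?valK // ltnNge leq_addr. Qed.

(** Among the families that span, a generic one has linearly independent last n forms. A change of
    coordinates turns these into the coordinate forms, and the first n forms into the columns of
    some matrix A0. Openness at A0 then gives the polynomial. *)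
Lemma spanning_generic I e h (Phi : 'M[K]_n -> {linear V -> V}) :
  (forall g s, pr (map (mulmxr g) s) = Phi g (pr s)) ->
  (forall i, I i -> all (ltn^~ (n + n)%N) i) -> spanning I e h ->
  exists2 p : {mpoly K[n * n]}, p != 0 &
    forall A : 'M_n, p.@[fun k => mxvec A 0 k] != 0 -> spanning I e (frame A).
Proof.
move=> PhiE b sp; pose R := (n + n)%N.
have [|p p0 px] := @spanning_open _ (@rows_of R) I e (@coord_of R h) (@pvec_rows R).
  apply: spanning_eq sp => i /b /allP iR.
  by apply/eq_in_map => k /iR kR; rewrite rows_of_coord.
pose W : 'M[{mpoly K[R * n]}]_n := \matrix_(i, j) 'X_(mxvec_index (rshift n i) j).
pose Wx x : 'M[K]_n := \matrix_(i, j) x (mxvec_index (rshift n i) j).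
have detW x : (\det W).@[x] = \det (Wx x).
  rewrite -det_map_mx; congr (\det _); apply/matrixP => i j.
  by rewrite !mxE; apply: mevalXU.
have W0 : \det W != 0.
  apply/eqP => /(congr1 (meval (coord_of (R := R) (fun k => if insub (k - n)%N is Some j then
      delta_mx 0 (j : 'I_n) else 0)))).
  rewrite detW meval0 (_ : Wx _ = 1%:M) ?det1; first exact/eqP/oner_neq0.
  apply/matrixP => i j; rewrite mxE /coord_of mxvecE mxE /= addKn valK !mxE eqxx /=.
  by rewrite eq_sym.
have {}p0 : p != 0 by apply: contraNneq p0 => ->; rewrite meval0.
have [x] : exists x, (p * \det W).@[x] != 0 by apply: mpoly_nonroot; rewrite ?mulf_neq0.
rewrite mevalM mulf_eq0 negb_or detW => /andP[/px {}sp Wu].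
pose g := invmx (Wx x); have {}Wu : Wx x \in unitmx by rewrite unitmxE unitfE.
pose h' k := @rows_of R x k *m g.
have {}sp : spanning I e h'.
  move=> s ss; have -> : s = map (mulmxr g) (map (mulmxr (Wx x)) s).
    rewrite -map_comp -[LHS]map_id; apply: eq_map => v /=.
    by rewrite -mulmxA mulmxV // mulmx1.
  rewrite PhiE; have /sp : size (map (mulmxr (Wx x)) s) = e by rewrite size_map.
  apply: lspan_map => _ [i [r [Ii se ->]]]; apply: lspan_gen; exists i, (map (mulmxr g) r).
  by split=> //; rewrite ?size_map // -PhiE map_cat -map_comp.
pose A0 : 'M[K]_n := (\matrix_(i < n) h' i)^T.
have ph k : pvec (fun y : 'I_(n * n) -> K => frame (vec_mx (\row_l y l)) k).
  rewrite /frame; case: insubP => [j _ _|_]; last by case: insubP => *; apply: pvec_const.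
  by move=> i; exists 'X_(mxvec_index i j) => y; rewrite mevalXU !mxE.
have frE A : frame (vec_mx (\row_l (fun k => mxvec A 0 k) l)) = frame A.
  by congr frame; rewrite -[RHS]mxvecK; congr vec_mx; apply/rowP => l; rewrite mxE.
have [|q q0 qx] := @spanning_open _ (fun y => frame (vec_mx (\row_l y l))) I e (fun k => mxvec A0 0 k) ph.
  rewrite frE; apply: spanning_eq sp => i /b /allP iR.
  apply/eq_in_map => k /iR kR; case: (ltnP k n) => kn.
    by rewrite -[k]/(val (Ordinal kn)) frame_lt /A0 trmxK rowK.
  have kn' : (k - n < n)%N by rewrite ltn_subLR.
  rewrite -(subnKC kn) -[(k - n)%N]/(val (Ordinal kn')) frame_ge /h'.
  have -> : @rows_of R x (n + Ordinal kn') = row (Ordinal kn') (Wx x).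
    rewrite /rows_of -[(n + _)%N]/(val (rshift n (Ordinal kn'))) valK.
    by apply/rowP => j; rewrite !mxE.
  by rewrite -row_mul mulmxV // row1.
exists q; first by apply: contraNneq q0 => ->; rewrite meval0.
by move=> A /qx; rewrite frE.
Qed.

End ProductSpan.

Local Close Scope ring_scope.

(** * Combinatorics of the generating nonfaces *)

Definition mono (S : nat -> nat) := forall i, S i <= S i.+1.

Lemma mono_le S i j : mono S -> i <= j -> S i <= S j.
Proof.
move=> mS; elim: j => [|j IHj]; first by rewrite leqn0 => /eqP ->.
by rewrite leq_eqVlt => /predU1P[-> //|/IHj Sij]; apply: leq_trans (mS j).
Qed.

Lemma card_ltn_ord n k : k <= n -> #|[set v : 'I_n | v < k]| = k.
Proof.
move=> kn; have wi : injective (widen_ord kn) by move=> i j /(congr1 val)/= /val_inj.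
rewrite -[RHS]card_ord -(card_imset predT wi).
apply: eq_card => v; rewrite inE; apply/idP/imsetP => [vk|[i _ ->]]; last exact: (ltn_ord i).
by exists (Ordinal vk) => //; apply: val_inj.
Qed.

Section Blocks.
Variables (n m : nat).
Implicit Types (S : nat -> nat) (X : {set 'I_n}).

(* For S the partial sums of a monomial u, [lower 2 S] consists of the lower
   elements of the pairs of F_d(u), [lower 1 S] is the set F with x_F = Phi(u),
   and [reach S] consists of the lower elements and of the vertices outside
   F_d(u). *)
Definition lower q S : {set 'I_n} :=
  [set v : 'I_n | `[< exists i t, [/\ i < m, S i <= t, t < S i.+1 & v = i + q * t :> nat] >]].

Definition reach S : {set 'I_n} :=
  [set v : 'I_n | `[< exists i t, [/\ i < m, S i <= t, t <= S i.+1 & v = i + 2 * t :> nat] >]].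

Lemma lowerP q S (v : 'I_n) :
  reflect (exists i t, [/\ i < m, S i <= t, t < S i.+1 & v = i + q * t :> nat]) (v \in lower q S).
Proof. by rewrite inE; apply: asboolP. Qed.

Lemma reachP S (v : 'I_n) :
  reflect (exists i t, [/\ i < m, S i <= t, t <= S i.+1 & v = i + 2 * t :> nat]) (v \in reach S).
Proof. by rewrite inE; apply: asboolP. Qed.

Variables (d : nat) (US : (nat -> nat) -> Prop).
Hypothesis nE : n = m + d.+1.
Hypothesis US_le : forall S S', (forall i, i <= m -> S' i <= S i) -> US S -> US S'.
Hypothesis US_deg : forall S, US S -> 2 * S m <= d.+1.

(** The state after a gap steps and c pair steps: s records for each gap the number of pairs before
    it, the sequences S compatible with this history give the nonfaces, and only their vertices from
    a + 2 c on matter. *)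
Definition gen a c (s : nat -> nat) X := exists S,
  [/\ mono S, forall j, j <= a -> S j = s j, forall j, a < j -> c <= S j &
   ~ US S /\ X = [set v in lower 2 S | a + 2 * c <= v] \/
   US S /\ X = [set v in ~: reach S | a + 2 * c <= v]].

Definition upd a c (s : nat -> nat) j := if j <= a then s j else c.

Lemma mono_upd a c s : mono s -> s a <= c -> mono (upd a c s).
Proof.
move=> ms sc j; rewrite /upd; case: (leqP j.+1 a) => h1; first by rewrite (ltnW h1).
by case: (leqP j a) => // h2; apply: leq_trans sc; apply: mono_le.
Qed.

Lemma gen_ge a c s X v : gen a c s X -> v \in X -> a + 2 * c <= v.
Proof. by case=> S [_ _ _ [[_ ->]|[_ ->]]]; rewrite inE => /andP[]. Qed.

Lemma gen_exists a c s : mono s -> s a <= c -> exists X, gen a c s X.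
Proof.
move=> ms sc; have mu := mono_upd ms sc; pose S := upd a c s.
have S1 j : j <= a -> S j = s j by rewrite /S /upd => ->.
have S2 j : a < j -> c <= S j by rewrite /S /upd [j <= a]leqNgt => ->.
case: (pselect (US S)) => h; eexists; exists S; split=> //; [right|left]; by split.
Qed.

(** Continue s by the constant c. From a + 2 c on, [lower] then has no vertex, while [reach]
    contains i + 2 c for a <= i < m, hence every vertex, because n <= m + 2 c. *)
Lemma gen_set0 a c s : mono s -> s a <= c -> d < 2 * c -> gen a c s set0.
Proof.
move=> ms sc dc; pose S := upd a c s; exists S; split=> //.
- exact: mono_upd.
- by move=> j; rewrite /S /upd => ->.
- by move=> j; rewrite /S /upd [j <= a]leqNgt => ->.
have Sle j : a <= j -> S j.+1 = c by rewrite /S /upd ltnNge => ->.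
have Slt j : j < a -> S j.+1 <= c.
  by move=> ja; rewrite /S /upd ja; apply: leq_trans sc; apply: mono_le.
case: (pselect (US S)) => h; [right|left]; split=> //; apply/esym/setP => v; rewrite [RHS]inE.
  rewrite inE in_setC; apply/negbTE; rewrite negb_and negbK -ltnNge.
  case: (ltnP v (a + 2 * c)) => [//|pv]; first by rewrite orbT.
  rewrite orbF; apply/reachP; have := ltn_ord v => vn.
  have vm : v - 2 * c < m by lia.
  have av : a <= v - 2 * c by lia.
  exists (v - 2 * c), c; split; rewrite // ?Sle //; last by lia.
  rewrite /S /upd; case: ifP => // h'; have -> : v - 2 * c = a by lia.
  exact: sc.
apply/negbTE; rewrite inE negb_and -ltnNge; apply/orP.
case: (boolP (v \in lower 2 S)) => [/lowerP[i [t [im ti it ->]]]|]; last by left.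
right; case: (ltnP i a) => ia; first by have := Slt _ ia; lia.
move: it; rewrite Sle // => tc; case: (ltngtP i a) ia => // [ai _|-> _]; last by lia.
by move: ti; rewrite /S /upd ifN -?ltnNge //; lia.
Qed.

(** The vertex p = a + 2 c lies in no generator obtained after a gap step, so cutting at p or at p +
    1 is the same. The exchange of p + 1 for p is what the substitution h_(p+1) = (h'_(p+1) - h'_p)
    / t produces in the deformation. *)
Lemma gen_gap a c s X : a < m -> mono s -> s a <= c -> 2 * c <= d ->
  gen a.+1 c (upd a c s) X ->
  gen a c s X /\ (forall p1 : 'I_n, p1 = (a + 2 * c).+1 :> nat -> p1 \in X ->
    forall p : 'I_n, p = a + 2 * c :> nat ->
    exists2 Y, gen a c s Y & Y \subset p |: (X :\ p1)).
Proof.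
move=> am ms sc dc [S [mS Ss Sc SX]].
have Sa j : j <= a -> S j = s j by move=> ja; rewrite Ss ?leqW // /upd ja.
have Sa1 : S a.+1 = c by rewrite Ss // /upd ltnn.
have Sca j : a < j -> c <= S j.
  by rewrite leq_eqVlt => /predU1P[<-|/Sc //]; rewrite Sa1.
have Sle j : j <= a -> S j.+1 <= c.
  by move=> ja; rewrite -Sa1; apply: mono_le.
have Sge j : a < j -> c <= S j by apply: Sca.
have pR (v : 'I_n) : v = a + 2 * c :> nat -> v \notin lower 2 S.
  move=> vE; apply/negP => /lowerP[i [t [im ti it]]]; rewrite vE => e.
  case: (ltngtP i a) => ia.
  - by have := Sle _ (ltnW ia); lia.
  - by have := Sge _ ia; lia.
  by move: it; rewrite ia Sa1; lia.
have pM (v : 'I_n) : v = a + 2 * c :> nat -> v \in reach S.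
  by move=> vE; apply/reachP; exists a, c; split=> //; rewrite ?Sa1 ?Sa.
have shrink (Z : {set 'I_n}) : (forall v : 'I_n, v = a + 2 * c :> nat -> v \notin Z) ->
    [set v in Z | a.+1 + 2 * c <= v] = [set v in Z | a + 2 * c <= v].
  move=> pZ; apply/setP => v; rewrite !inE; case vZ: (v \in Z) => //=.
  rewrite addSn ltn_neqAle; case: eqP => // e.
  by have := pZ v (esym e); rewrite vZ.
case: SX => -[h XE].
  have XE' : X = [set v in lower 2 S | a + 2 * c <= v] by rewrite XE shrink.
  split; first by exists S; split=> //; left.
  (* Raising S(a + 1) from c to c + 1 moves the first element of block a + 1, which is p + 1, to the
     end of block a, where it becomes p. *)
  move=> p1 p1E p1X p pE; pose S' j := if j == a.+1 then c.+1 else S j.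
  have Sa2 : c < S a.+2.
    move: p1X; rewrite XE' inE => /andP[/lowerP[i [t [im ti it]]]]; rewrite p1E => e _.
    case: (ltngtP i a.+1) => ia.
    - by have := Sle _ ia; lia.
    - by have := Sge i (ltnW ia); lia.
    by move: it; rewrite ia; lia.
  have mS' : mono S'.
    move=> j; rewrite /S' eqSS; case: (eqVneq j a.+1) => [->|_]; first by rewrite gtn_eqF.
    by case: (eqVneq j a) => [->|_]; [rewrite Sa //; lia | apply: mS].
  have S'S j : S j <= S' j by rewrite /S'; case: eqP => [->|//]; rewrite Sa1.
  exists [set v in lower 2 S' | a + 2 * c <= v].
    exists S'; split=> //.
    - by move=> j ja; rewrite /S' ltn_eqF ?Sa.
    - by move=> j ja; apply: leq_trans (S'S j); apply: Sca.
    by left; split=> // /(US_le (fun i _ => S'S i)).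
  apply/subsetP => v; rewrite inE => /andP[/lowerP[i [t [im ti it vE]]] pv].
  rewrite XE' !inE; case: (ltngtP i a) => ia.
  - move: it; rewrite /S' ltn_eqF //; have := Sle _ (ltnW ia); lia.
  - move: it ti; rewrite /S' [i.+1 == _]gtn_eqF //.
    case: eqP => [ie it tc|ie it ti]; last first.
      have va : v != p1.
        apply/eqP => e; move: vE; rewrite e p1E; have := Sge i ia; lia.
      rewrite va pv andbT; apply/orP; right; apply/asboolP; by exists i, t.
    have va : v != p1.
      by apply/eqP => e; move: vE; rewrite e p1E; lia.
    rewrite va pv andbT; apply/orP; right; apply/asboolP; exists i, t; split=> //.
    by rewrite ie Sa1; lia.
  - move: it; rewrite ia /S' eqxx => it; apply/orP; left; apply/eqP/val_inj => /=; lia.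
have XE' : X = [set v in ~: reach S | a + 2 * c <= v].
  by rewrite XE shrink // => v /pM vM; rewrite inE vM.
split; first by exists S; split=> //; right.
move=> p1 p1E p1X p pE.
(* For a + 1 < m, [reach S] would contain p + 1 = (a + 1) + 2 c; hence a is the last index. *)
have am1 : m = a.+1.
  case: (ltngtP m a.+1) => //; first by lia.
  move=> am1; move: p1X; rewrite XE' !inE => /andP[/asboolP[]].
  by exists a.+1, c; split; rewrite // ?Sa1 // Sge.
(* A last partial sum of d + 1 exceeds the degree bound, so S' gives a generator of [lower] type;
   from p on it consists of p, p + 2, p + 4, ... *)
pose S' := upd a d.+1 s; exists [set v in lower 2 S' | a + 2 * c <= v].
  exists S'; split=> //.
  - by apply: mono_upd => //; lia.
  - by move=> j ja; rewrite /S' /upd ja.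
  - by move=> j ja; rewrite /S' /upd [j <= a]leqNgt ja /=; lia.
  by left; split=> // /US_deg; rewrite am1 /S' /upd ltnn; lia.
apply/subsetP => v; rewrite inE => /andP[/lowerP[i [t [im ti it vE]]] pv].
rewrite XE' !inE; have ia : i = a.
  case: (ltngtP i a) => // ia; last by lia.
  by move: it; rewrite /S' /upd ia -Sa // => it; have := Sle i (ltnW ia); lia.
case: (eqVneq t c) => [tc|tc].
  by apply/orP; left; apply/eqP/val_inj => /=; rewrite vE ia tc pE.
have va : v != p1 by apply/eqP => e; move: vE; rewrite e p1E; lia.
rewrite va pv andbT; apply/orP; right; apply/asboolP => -[j [r [jm rj jr]]] vE'.
have ja : j <= a by lia.
have := Sle j ja; lia.
Qed.

(** Since S(a) <= c < S(a + 1), the vertex p is a lower element and p + 1 is not in [reach S].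
    Undoing the pair step therefore restores p to a generator of [lower] type and p + 1 to one of
    [reach] type. *)
Lemma gen_link a c s X : a < m -> mono s -> s a <= c -> 2 * c <= d ->
  gen a c.+1 s X ->
  forall p p1 : 'I_n, p = a + 2 * c :> nat -> p1 = (a + 2 * c).+1 :> nat ->
  gen a c s (p |: X) \/ gen a c s (p1 |: X).
Proof.
move=> am ms sc dc [S [mS Ss Sc SX]] p p1 pE p1E.
have Sca j : a < j -> c.+1 <= S j by apply: Sc.
have Sle j : j <= a -> S j <= c.
  by move=> ja; rewrite Ss //; apply: leq_trans sc; apply: mono_le.
have pR : p \in lower 2 S.
  by apply/lowerP; exists a, c; split=> //; [apply: Sle | apply: Sca].
have blk i t (v : 'I_n) : v = p1 :> nat -> S i <= t -> t <= S i.+1 -> v = i + 2 * t :> nat -> False.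
  rewrite p1E => -> ti it e; case: (ltngtP i a) => ia.
  - by have := Sle _ ia; lia.
  - by have := Sca _ ia; lia.
  by lia.
have p1R : p1 \notin lower 2 S.
  by apply/negP => /lowerP[i [t [im ti it e]]]; apply: (blk i t p1) => //; apply: ltnW.
have p1M : p1 \notin reach S.
  by apply/negP => /reachP[i [t [im ti it e]]]; apply: (blk i t p1).
have pM : p \in reach S.
  by apply/reachP; exists a, c; split; rewrite ?Sle // ltnW ?Sca.
have cut (v : 'I_n) : a + 2 * c <= v -> [\/ v = p, v = p1 | a + 2 * c.+1 <= v].
  move=> h; case: (ltngtP v (a + 2 * c).+1) => h'; last by constructor 2; apply/val_inj; rewrite /= p1E.
    by constructor 1; apply/val_inj; rewrite /= pE; lia.
  by constructor 3; lia.
have in_set_ k (Z : {set 'I_n}) v : (v \in [set w in Z | k <= w]) = (v \in Z) && (k <= v).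
  by rewrite inE.
have ge v : a + 2 * c.+1 <= v -> a + 2 * c <= v by lia.
have S' : forall j, a < j -> c <= S j by move=> j /Sca/ltnW.
case: SX => -[h ->]; [left|right]; exists S; split=> //; [left|right]; split=> //.
  apply/setP => v; rewrite in_setU1 !in_set_.
  apply/idP/idP => [/predU1P[->|/andP[-> /ge]] // | /andP[vR /cut[->|vp|->]]].
  - by rewrite pR pE leqnn.
  - by rewrite eqxx.
  - by move: p1R; rewrite -vp vR.
  by rewrite vR orbT.
apply/setP => v; rewrite in_setU1 !in_set_.
apply/idP/idP => [/predU1P[->|/andP[-> /ge]] // | /andP[vR /cut[vp|->|->]]].
- by rewrite inE p1M p1E leqnSn.
- by move: vR; rewrite vp inE pM.
- by rewrite eqxx.
by rewrite vR orbT.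
Qed.

(** A dimension bound, obtained by reading T along the path: if p is missing, take a gap step; if p
    and p + 1 are present, a pair step. If only p is present, it is replaced by p + 1 for a gap
    step, and the exchange in [gen_gap] undoes this. *)
Lemma gen_cover a c s (T : {set 'I_n}) : a <= m -> mono s -> s a <= c ->
  (forall v, v \in T -> a + 2 * c <= v) -> d < #|T| + 2 * c ->
  exists2 X, gen a c s X & X \subset T.
Proof.
have [N] := ubnP (m - a + (d.+1 - c)); elim: N a c s T => // N IHN a c s T.
rewrite ltnS => NE am ms sc Tp Tc.
have [dc|dc] := ltnP d (2 * c); first by exists set0; [exact: gen_set0 | exact: sub0set].
have [aE|anm] := eqVneq a m.
  have [X gX] := gen_exists ms sc; exists X => //.
  suff -> : T = [set v : 'I_n | a + 2 * c <= v].
    by apply/subsetP => v /(gen_ge gX); rewrite inE.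
  apply/eqP; rewrite eqEcard; apply/andP; split.
    by apply/subsetP => v /Tp; rewrite inE.
  have -> : [set v : 'I_n | a + 2 * c <= v] = ~: [set v : 'I_n | v < a + 2 * c].
    by apply/setP => v; rewrite !inE leqNgt.
  rewrite cardsCs setCK card_ord card_ltn_ord; lia.
have {}am : a < m by rewrite ltn_neqAle anm.
have pn : a + 2 * c < n by lia.
have p1n : (a + 2 * c).+1 < n by lia.
pose p := Ordinal pn; pose p1 := Ordinal p1n.
have mu := mono_upd ms sc.
have gap (T' : {set 'I_n}) : (forall v, v \in T' -> a + 2 * c < v) -> d < #|T'| + 2 * c ->
    exists2 X, gen a.+1 c (upd a c s) X & X \subset T'.
  move=> T'p T'c; apply: IHN => //; rewrite ?addSn //; first lia.
  by rewrite /upd ltnn.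
have [pT|pT] := boolP (p \in T); last first.
  have [v vT|//|X gX XT] := gap T.
    rewrite ltn_neqAle Tp // andbT; apply: contraNneq pT => e.
    by rewrite (_ : p = v) //; apply: val_inj.
  by exists X => //; have [] := gen_gap am ms sc dc gX.
have [p1T|p1T] := boolP (p1 \in T).
  have [||||v||X gX XT] := IHN a c.+1 s (T :\ p :\ p1).
  - lia.
  - exact: ltnW.
  - by [].
  - exact: leqW.
  - rewrite !inE => /and3P[v1 v0 /Tp vp].
    have {}v1 : v != p1 :> nat by []; have {}v0 : v != p :> nat by [].
    by move: v0 v1 => /=; lia.
  - have p1p : p1 != p by rewrite -val_eqE /= gtn_eqF.
    move: Tc; rewrite (cardsD1 p T) pT (cardsD1 p1 (T :\ p)) !inE p1T p1p /=.
    by move: #|T :\ p :\ p1| => x; lia.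
  have [] := gen_link am ms sc dc gX (erefl (val p)) (erefl (val p1)) => gY; eexists; try exact: gY.
    by rewrite subUset sub1set pT (subset_trans XT) // !subDset; apply/subsetP => v; rewrite !inE => ->; rewrite !orbT.
  by rewrite subUset sub1set p1T (subset_trans XT) // !subDset; apply/subsetP => v; rewrite !inE => ->; rewrite !orbT.
have [v||X gX XT] := gap (p1 |: T :\ p).
- rewrite !inE => /predU1P[->|/andP[v0 /Tp vp]] //.
  have {}v0 : v != p :> nat by [].
  by move: v0 => /=; lia.
- by move: Tc; rewrite (cardsD1 p T) pT cardsU1 !inE (negPf p1T) andbF /=; move: #|T :\ p| => x; lia.
have [gX' p1X] := gen_gap am ms sc dc gX.
have [/p1X|p1nX] := boolP (p1 \in X).
  move=> /(_ erefl p erefl)[Y gY YX]; exists Y => //; apply: subset_trans YX _.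
  rewrite subUset sub1set pT; apply/subsetP => v; rewrite inE in_set1 => /andP[v1 /(subsetP XT)].
  by rewrite !inE (negPf v1) => /andP[].
exists X => //; apply/subsetP => v vX; have := subsetP XT v vX; rewrite !inE.
by case/predU1P => [vp|/andP[]] //; move: p1nX; rewrite -vp vX.
Qed.
End Blocks.

(** * The Lefschetz property by degeneration *)

Definition vals n (X : {set 'I_n}) : seq nat := [seq val i | i <- enum X].

Lemma mem_vals n (X : {set 'I_n}) (v : 'I_n) : (val v \in vals X) = (v \in X).
Proof. by rewrite mem_map ?mem_enum //; apply: val_inj. Qed.

Lemma valsP n (X : {set 'I_n}) (k : nat) :
  reflect (exists2 v : 'I_n, v \in X & k = v) (k \in vals X).
Proof.
by apply: (iffP mapP) => -[v vX ->]; exists v => //; move: vX; rewrite mem_enum.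
Qed.

Lemma uniq_vals n (X : {set 'I_n}) : uniq (vals X).
Proof. by rewrite map_inj_uniq ?enum_uniq //; apply: val_inj. Qed.

Lemma sorted_vals n (X : {set 'I_n}) : sorted ltn (vals X).
Proof.
rewrite /vals sorted_map /enum_mem; apply: sorted_filter; first by move=> ? ? ?; apply: ltn_trans.
by have := iota_ltn_sorted 0 n; rewrite -val_enum_ord sorted_map enumT.
Qed.

Lemma size_vals n (X : {set 'I_n}) : size (vals X) = #|X|.
Proof. by rewrite size_map -cardE. Qed.

Lemma vals0 n : vals (set0 : {set 'I_n}) = [::].
Proof. by apply/size0nil; rewrite size_vals cards0. Qed.

Lemma vals_setU1 n (X : {set 'I_n}) v : v \notin X -> perm_eq (vals (v |: X)) (val v :: vals X).
Proof.
move=> vX; apply: uniq_perm; rewrite /= ?mem_vals ?vX ?uniq_vals // => k.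
rewrite inE; apply/valsP/predU1P => [[w]|[->|/valsP[w wX ->]]].
- by rewrite in_setU1 => /predU1P[->|wX ->]; [left | right; rewrite mem_vals].
- by exists v; rewrite ?setU11.
by exists w; rewrite ?in_setU1 ?wX ?orbT.
Qed.

Lemma vals_sub n (X Y : {set 'I_n}) : X \subset Y -> perm_eq (vals Y) (vals X ++ vals (Y :\: X)).
Proof.
move=> XY; apply: uniq_perm; rewrite ?cat_uniq ?uniq_vals ?andbT //=.
  by apply/hasPn => k /valsP[w]; rewrite inE => /andP[wX _] ->; rewrite mem_vals.
move=> k; rewrite mem_cat; apply/valsP/orP => [[w wY ->]|[] /valsP[w]].
- by rewrite !mem_vals in_setD wY andbT; apply/orP; case: (w \in X).
- by move=> /(subsetP XY) wY ->; exists w.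
by rewrite inE => /andP[_ wY] ->; exists w.
Qed.

Local Open Scope ring_scope.

Section Lefschetz.
Variables (K : fieldType) (n : nat) (V : lmodType K) (pr : seq 'rV[K]_n -> V).
Variables (eps : K) (lm : 'rV[K]_n -> {linear V -> V}).
Hypothesis Kinf : infinite_type K.
Hypothesis prP : forall s1 s2 a u v,
  pr (s1 ++ (a *: u + v) :: s2) = a *: pr (s1 ++ u :: s2) + pr (s1 ++ v :: s2).
Hypothesis pr_swap : forall s1 s2 u v,
  pr (s1 ++ u :: v :: s2) = eps *: pr (s1 ++ v :: u :: s2).
Hypothesis pr_cons : forall u s, pr (u :: s) = lm u (pr s).
(* [alt] tells the exterior algebra from the polynomial ring. *)
Variable alt : bool.
Hypothesis pr_alt : alt -> forall s1 s2 u, pr (s1 ++ u :: u :: s2) = 0.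

Variables (m d : nat) (US : (nat -> nat) -> Prop).
Hypothesis nE : n = (m + d.+1)%N.
Hypothesis US_le : forall S S', (forall i, i <= m -> S' i <= S i)%N -> US S -> US S'.
Hypothesis US_deg : forall S, US S -> (2 * S m <= d.+1)%N.

(* E0 is the degree, k0 the number of linear forms divided out in the exterior
   case, zl the list of the forms whose product is the Lefschetz operator. *)
Variables (E0 k0 : nat).
Hypothesis E0d : (d <= 2 * E0)%N.
Hypothesis k0E : alt -> (k0 + E0)%N = d.+1.
Let z := (2 * E0 - d)%N.
Let zl := if alt then [seq (n + (n.-1 - (k0 + l)))%N | l <- iota 0 z] else nseq z (n + m)%N.

(** The number of linear forms to be divided out. In the link, h_p and h_(p+1) must both vanish. In
    the polynomial ring each takes the place of one such form; in the exterior algebra h_p is killed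
    by h_p * h_p = 0, and only h_(p+1) does. Hence the drop by 2 or by 1 at a pair step. *)
Definition killed c := if alt then (k0 - c)%N else (d - 2 * c)%N.

(** The ideal generated by the vertices passed, the remaining nonfaces, the forms divided out and
    the product [zl] of 2 E0 - d = 2 (E0 - c) - (d - 2 c) forms. That it is everything in degree E0
    - c means that multiplication by this product is onto that degree of the quotient by the other
    generators. The form of index n + j becomes the coordinate of index j in [frame]. *)
Definition lef_lists a c s (i : seq nat) :=
  [\/ exists2 v, (v < a + 2 * c)%N & i = [:: v],
      exists2 X, gen m US a c s X & i = vals (X : {set 'I_n}),
      exists2 k, (k < killed c)%N & i = [:: (n + (n.-1 - k))%N]
    | i = zl].

Local Notation dl := (fun i : 'I_n => delta_mx 0 i : 'rV[K]_n).
Local Notation spn := (spanning pr).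

Definition coord k : 'rV[K]_n := if insub k is Some j then delta_mx 0 (j : 'I_n) else 0.

Lemma coordE (i : 'I_n) : coord i = dl i.
Proof. by rewrite /coord valK. Qed.

Lemma spanning_coord I e h :
  (forall w, size w = e -> all (ltn^~ n) w -> lspan (prgen pr I h e) (pr (map coord w))) ->
  spn I e h.
Proof.
move=> sp; apply: (spanning_words prP) => w sw.
have -> : [seq 'e_i : 'rV[K]_n | i <- w] = map coord (map val w).
  by rewrite -map_comp; apply: eq_map => i; rewrite /= coordE.
by apply: sp; rewrite ?size_map // all_map; apply/allP => i _; apply: (ltn_ord i).
Qed.

Lemma pr_dup s : alt -> ~~ uniq s -> pr s = 0.
Proof.
move=> ha; elim: s => //= v s IHs; rewrite negb_and negbK => /orP[vs|/IHs]; last first.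
  by rewrite pr_cons => ->; rewrite linear0.
have ps : perm_eq (v :: s) [:: v, v & rem v s] by rewrite perm_cons perm_to_rem.
have [k ->] := pr_perm pr_swap ps.
by rewrite (pr_alt ha [::]) scaler0.
Qed.

Lemma prgen_mem I e h k s : I [:: k] -> h k \in s -> size s = e -> lspan (prgen pr I h e) (pr s).
Proof. by move=> Ik ks; apply: (prgen_perm pr_swap (i := [:: k]) Ik (perm_to_rem ks)). Qed.

Lemma zl_lt k : k \in zl -> (n <= k < n + n)%N.
Proof.
rewrite /zl; case: alt => [/mapP[l _ ->]|/nseqP[-> _]]; rewrite leq_addr ltn_add2l; lia.
Qed.

Lemma size_zl : size zl = z.
Proof. by rewrite /zl; case: alt; rewrite ?size_map ?size_iota ?size_nseq. Qed.

(** No form remains to be divided out and E0 - c = d + 1 - 2 c, so a squarefree product of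
    coordinates involves a passed vertex or contains a generator by [gen_cover]; products with a
    repetition vanish. *)
Lemma lefschetz_cover c a s : alt -> c = k0 -> (a <= m)%N -> mono s -> (s a <= c)%N ->
  (2 * c <= d)%N -> spn (lef_lists a c s) (E0 - c) coord.
Proof.
move=> ha ck am ms sc dc; apply: spanning_coord => w sw wn.
have [uw|/pr_dup-> //] := boolP (uniq (map coord w)); last exact: lspan_nil.
have {}uw := map_uniq uw.
have [/hasP[v vw vp]|/hasPn wp] := boolP (has (fun v => v < a + 2 * c)%N w).
  apply: (prgen_mem (k := v)); rewrite ?size_map //; last by rewrite map_f.
  by constructor 1; exists v.
pose T := [set v : 'I_n | val v \in w].
have wT : perm_eq w (vals T).
  apply: uniq_perm => //; first exact: uniq_vals.
  move=> k; apply/idP/valsP => [kw|[v]]; last by rewrite inE => vw ->.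
  by exists (Ordinal (allP wn k kw)) => //; rewrite inE.
have [X gX XT] : exists2 X : {set 'I_n}, gen m US a c s X & X \subset T.
  apply: (gen_cover nE US_le US_deg) => // [v|]; first by rewrite inE => /wp; rewrite -leqNgt.
  by rewrite -size_vals -(perm_size wT) sw; have := k0E ha; lia.
apply: (prgen_perm pr_swap (i := vals X) (r := map coord (vals (T :\: X)))).
- by constructor 2; exists X.
- by rewrite -map_cat; apply: perm_map; apply: (perm_trans wT); apply: vals_sub.
by rewrite size_map.
Qed.

(** Past the last index, d + 1 - 2 c vertices remain. Dividing out the first k0 - c of them leaves
    E0 - c, so the only product to consider is that of all of these, and it is a multiple of the
    Lefschetz product. *)
Lemma lefschetz_base_alt c s : alt -> (c < k0)%N -> mono s -> (s m <= c)%N ->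
  (2 * c <= d)%N -> exists h, spn (lef_lists m c s) (E0 - c) h.
Proof.
move=> ha ck ms sc dc; have k0e := k0E ha.
pose h k := if (k < n)%N then coord k else let l := (n.-1 - (k - n))%N in
  if (l < k0 - c)%N then coord (m + 2 * c + l) else coord (m + c + l).
have hz l : (l < z)%N -> h (n + (n.-1 - (k0 + l)))%N = coord (m + c + (k0 + l)).
  move=> lz; have kl : (k0 + l <= n.-1)%N by rewrite nE; lia.
  rewrite /h ltnNge leq_addr /= addKn subKn //.
  by case: ifP => //; lia.
exists h; apply: spanning_coord => w sw wn.
have [uw|/pr_dup-> //] := boolP (uniq (map coord w)); last exact: lspan_nil.
have {}uw := map_uniq uw.
have [/hasP[v vw vp]|/hasPn wp] := boolP (has (fun v => v < m + 2 * c)%N w).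
  apply: (prgen_mem (k := v)); rewrite ?size_map //; first by constructor 1; exists v.
  by have vn : (v < n)%N := allP wn v vw; rewrite /h vn map_f.
have [/hasP[v vw vp]|/hasPn wq] := boolP (has (fun v => v < m + c + k0)%N w).
  have := wp v vw; rewrite -leqNgt => pv; have vn : (v < n)%N := allP wn v vw.
  apply: (prgen_mem (k := (n + (n.-1 - (v - (m + 2 * c))))%N)); rewrite ?size_map //.
    by constructor 3; exists (v - (m + 2 * c))%N; rewrite // /killed ha; lia.
  rewrite /h ltnNge leq_addr /= addKn subKn; last by lia.
  by rewrite ifT; [rewrite subnKC // map_f | lia].
pose zs := iota (m + c + k0) z; pose w' := iota (m + c + k0) (E0 - c).
have ww' : perm_eq w w'.
  have sub : {subset w <= w'}.
    move=> v vw; rewrite mem_iota; have := wq v vw; rewrite -leqNgt => -> /=.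
    by have := allP wn v vw; rewrite /= nE; lia.
  have sz : (size w' <= size w)%N by rewrite size_iota sw.
  by have [_ eqw] := uniq_min_size uw sub sz; apply: uniq_perm; rewrite ?iota_uniq.
apply: (prgen_perm pr_swap (i := zl) (r := map coord (iota (m + c + k0 + z) (E0 - c - z)))).
- by constructor 4.
- have -> : map h zl = map coord zs.
    rewrite /zl ha -map_comp /zs -[(m + c + k0)%N]addn0 iotaDl -map_comp; apply/eq_in_map => l.
    by rewrite mem_iota add0n => /hz /= ->; rewrite addnA.
  rewrite -map_cat -iotaD; apply/perm_map; apply: perm_trans ww' _.
  by rewrite (_ : z + (E0 - c - z) = E0 - c)%N //; rewrite /z; lia.
by rewrite size_map.
Qed.


(** Dividing out the differences with the last vertex leaves the powers of one variable L. Either z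
    <= e and L ^ z divides L ^ e, or z > e, and then e >= d + 1 - 2 c is at least the size of any
    generator. *)
Lemma lefschetz_base_sym c s : ~~ alt -> mono s -> (s m <= c)%N ->
  (2 * c <= d)%N -> exists h, spn (lef_lists m c s) (E0 - c) h.
Proof.
move=> /negPf ha ms sc dc; pose L := coord n.-1.
pose h k := if (k < n)%N then coord k else let l := (n.-1 - (k - n))%N in
  if (l < d - 2 * c)%N then coord (m + 2 * c + l) - L else L.
have hY l : (l < d - 2 * c)%N -> h (n + (n.-1 - l))%N = coord (m + 2 * c + l) - L.
  move=> ld; rewrite /h ltnNge leq_addr /= addKn subKn ?ld //.
  by rewrite nE; lia.
exists h; set e := (E0 - c)%N; pose W := lspan (prgen pr (lef_lists m c s) h e).
have red w q : (q + size w)%N = e -> all (fun v => m + 2 * c <= v < n)%N w ->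
    W (pr (nseq q L ++ map coord w) - pr (nseq (q + size w) L)).
  elim: w q => [|v w IHw] q /=.
    by move=> *; rewrite addn0 cats0 subrr; apply: lspan_nil.
  move=> sw /andP[/andP[pv vn] wp].
  have E : pr (nseq q L ++ L :: map coord w) = pr (nseq q.+1 L ++ map coord w).
    rewrite -cat_rcons; congr (pr (_ ++ _)).
    by elim: (q) => //= r ->.
  have {IHw wp}: W (pr (nseq q.+1 L ++ map coord w) - pr (nseq (q.+1 + size w) L)).
    by apply: IHw => //; rewrite addSnnS.
  rewrite -addSnnS -E => IHw.
  have [->|vL] := eqVneq v n.-1; first by [].
  have lv : (v - (m + 2 * c) < d - 2 * c)%N by rewrite nE in vn vL; lia.
  rewrite -[coord v](subrK L) (prD prP) -addrA; apply: lspanD => //.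
  apply: (prgen_mem (k := (n + (n.-1 - (v - (m + 2 * c))))%N)).
  - by constructor 3; exists (v - (m + 2 * c))%N; rewrite // /killed ha.
  - by rewrite mem_cat (hY _ lv) subnKC // mem_head orbT.
  by rewrite size_cat /= size_map size_nseq.
have WL : W (pr (nseq e L)).
  case: (leqP z e) => ze.
    apply: (prgen_perm pr_swap (i := zl) (r := nseq (e - z) L)).
    - by constructor 4.
    - rewrite /zl ha map_nseq (_ : h _ = L) -?nseqD ?subnKC //.
      rewrite /h ltnNge leq_addr /= addKn ifN // -leqNgt nE; lia.
    by rewrite size_nseq.
  have [X gX] : exists X : {set 'I_n}, gen m US m c s X by apply: gen_exists.
  have Xp v : v \in vals X -> (m + 2 * c <= v < n)%N.
    by move=> /valsP[u uX ->]; rewrite ltn_ord (gen_ge gX).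
  have sX : (#|X| <= d.+1 - 2 * c)%N.
    have -> : (d.+1 - 2 * c)%N = size (iota (m + 2 * c) (d.+1 - 2 * c)) by rewrite size_iota.
    rewrite -size_vals; apply: uniq_leq_size (uniq_vals X) _ => v /Xp.
    by rewrite mem_iota nE; lia.
  have {}sX : (#|X| <= e)%N by apply: leq_trans sX _; rewrite /e /z in ze *; lia.
  pose w := vals X ++ nseq (e - #|X|) n.-1.
  have sw : size w = e by rewrite size_cat size_vals size_nseq subnKC.
  have wW : W (pr (map coord w)).
    apply: (prgen_perm pr_swap (i := vals X) (r := map coord (nseq (e - #|X|) n.-1))).
    - by constructor 2; exists X.
    - rewrite map_cat (_ : map h _ = map coord (vals X)) //.
      by apply/eq_in_map => v /Xp/andP[_ vn]; rewrite /h vn.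
    by rewrite size_map.
  have := lspanB wW (red w 0%N _ _); rewrite sw add0n /= subKr; apply=> //.
  rewrite all_cat; apply/andP; split; first exact/allP.
  by apply/allP => v /nseqP[-> _]; rewrite nE; lia.
apply: spanning_coord => w sw wn.
have [/hasP[v vw vp]|/hasPn wp] := boolP (has (fun v => v < m + 2 * c)%N w).
  apply: (prgen_mem (k := v)); rewrite ?size_map //; first by constructor 1; exists v.
  by have vn : (v < n)%N := allP wn v vw; rewrite /h vn map_f.
rewrite -[pr _](subrK (pr (nseq e L))); apply: lspanD => //.
have := red w 0%N sw; rewrite add0n sw /=; apply.
apply/allP => v vw; rewrite (allP wn v vw : (v < n)%N) andbT leqNgt; exact: wp.
Qed.

Section Step.
Variables (a c : nat) (s : nat -> nat).
Hypotheses (am : (a < m)%N) (ms : mono s) (sc : (s a <= c)%N) (dc : (2 * c <= d)%N).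
Let p := (a + 2 * c)%N.

Lemma p1_lt : (p.+1 < n)%N.
Proof. by rewrite /p nE; lia. Qed.
Let o1 : 'I_n := Ordinal p1_lt.
Let o0 : 'I_n := Ordinal (ltnW p1_lt).

(* The initial forms of the face ideal under h_{p+1} -> h_p + t h_{p+1}, t -> 0:
   the contraction of the edge {p, p+1} and its link. *)
Definition limit_lists (i : seq nat) :=
  [\/ exists2 v, (v < p)%N & i = [:: v],
      exists2 X, gen m US a.+1 c (upd a c s) X & i = vals (X : {set 'I_n}),
      exists2 X, gen m US a c.+1 s X & i = p :: vals (X : {set 'I_n})
    | (exists2 k, (k < killed c)%N & i = [:: (n + (n.-1 - k))%N]) \/ i = zl].

(** Each generator of the limit must extend to t != 0 as a combination of generators of the deformed
    family. For the contraction this is the exchange in [gen_gap]. For the link it is [gen_link]: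
    the factor h_p is continued either by h_p itself or by h_p + t h_(p+1). *)
Lemma lefschetz_deform h e : spn limit_lists e h -> exists h', spn (lef_lists a c s) e h'.
Proof.
move=> sp; pose x0 : 'I_1 -> K := fun=> 0.
pose ht (x : 'I_1 -> K) k := if k == p.+1 then h p + x ord0 *: h p.+1 else h k.
have htE x k : k != p.+1 -> ht x k = h k by rewrite /ht => /negPf ->.
pose Xg (x : 'I_1 -> K) := x ord0 != 0.
pose D x := prgen pr (lef_lists a c s) (ht x) e.
pose D0 l := exists i r, [/\ limit_lists i, (size i + size r)%N = e & l = map h i ++ r].
have cst l : size l = e -> (forall x, Xg x -> lspan (D x) (pr l)) ->
    exists gs, [/\ size gs = e, pvecs gs, [seq g x0 | g <- gs] = l
     & forall x, Xg x -> lspan (D x) (pr [seq g x | g <- gs])].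
  move=> sl Dl; exists [seq (fun=> v) | v <- l].
  have E x : [seq g x | g <- [seq (fun _ : 'I_1 -> K => v) | v <- l]] = l.
    by rewrite -map_comp map_id.
  split=> [|||x]; rewrite ?size_map ?E //; last exact: Dl.
  have := @pvecs_map K n 1 (fun _ _ => 0) [::] l; apply=> k; exact: pvec_const.
have key i r x : limit_lists i -> (size i + size r)%N = e -> p.+1 \notin i -> lef_lists a c s i ->
    lspan (D x) (pr (map h i ++ r)).
  move=> li se pi lef; apply: lspan_gen; exists i, r; split=> //; congr (pr (_ ++ _)).
  by apply/eq_in_map => k ki; rewrite htE //; apply: contraNneq pi => <-.
have big k : (n <= k)%N -> k != p.+1.
  by apply: contraTneq => ->; rewrite -ltnNge p1_lt.
have [|l [i [r [li se lE]]]|q q0 qx] := @span_open _ _ _ _ prP 1 e x0 D0 Xg D.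
- move=> w sw; have := sp [seq ('e_i : 'rV[K]_n) | i <- w]; rewrite size_map => /(_ sw).
  apply: lspan_trans => _ [i [r [Ii se ->]]]; apply: lspan_gen.
  by exists (map h i ++ r) => //; exists i, r.
- have sl : size l = e by rewrite lE size_cat size_map.
  case: (li) => [[v vp iE]|[X gX iE]|[X gX iE]|[[k kk iE]|iE]].
  + apply: cst => // x _; rewrite lE; apply: key => //; last by constructor 1; exists v.
    by rewrite iE inE gtn_eqF // ltnS ltnW.
  + have [gX' pX] := gen_gap nE US_le US_deg am ms sc dc gX.
    apply: cst => // x x0'; rewrite lE.
    have [o1X|o1X] := boolP (o1 \in X); last first.
      apply: key => //; last by constructor 2; exists X.
      by rewrite iE -[p.+1]/(val o1) mem_vals.
    pose Y := X :\ o1.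
    have XY : X = o1 |: Y by rewrite setD1K.
    have o1Y : o1 \notin Y by rewrite !inE eqxx.
    have o0Y : o0 \notin Y.
      rewrite !inE; apply/negP => /andP[_ /(gen_ge gX)]; rewrite addSn /= ltnn //.
    have YX : map (ht x) (vals Y) = map h (vals Y).
      apply/eq_in_map => k kY; rewrite htE //; apply: contraNneq o1Y => kp.
      by rewrite -mem_vals /= -kp.
    have pX' : perm_eq (map h i) (h p.+1 :: map h (vals Y)).
      rewrite iE {1}XY; have := perm_map h (vals_setU1 o1Y); exact.
    have [k ->] : exists k, pr (map h i ++ r) = eps ^+ k *: pr (h p.+1 :: map h (vals Y) ++ r).
      by apply: (pr_perm pr_swap); rewrite -cat_cons perm_cat2r.
    have sY : ((size (vals Y)).+1 + size r)%N = e.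
      by rewrite -se; move: (perm_size pX'); rewrite /= !size_map => ->.
    apply: lspanZ.
    have -> : h p.+1 = (x ord0)^-1 *: (ht x p.+1 - ht x p).
      rewrite /ht eqxx ltn_eqF // addrC addKr scalerA mulVf ?scale1r //.
    have := prZ prP [::] (map h (vals Y) ++ r) (x ord0)^-1 (ht x p.+1 - ht x p).
    rewrite /= => ->; apply: lspanZ.
    have := prB prP [::] (map h (vals Y) ++ r) (ht x p.+1) (ht x p).
    rewrite /= => ->; apply: lspanB.
      apply: (prgen_perm pr_swap (i := vals X) (r := r)).
      * by constructor 2; exists X.
      * rewrite -cat_cons perm_cat2r perm_sym XY -YX.
        have := perm_map (ht x) (vals_setU1 o1Y); exact.
      by rewrite /= size_cat size_map -sY.
    have [Z gZ ZY] := pX o1 (erefl _) o1X o0 (erefl _).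
    apply: (prgen_perm pr_swap (i := vals Z) (r := map (ht x) (vals ((o0 |: Y) :\: Z)) ++ r)).
    * by constructor 2; exists Z.
    * rewrite catA -map_cat -cat_cons perm_cat2r -YX -[_ :: _]/(map (ht x) (val o0 :: vals Y)).
      apply: perm_map; apply: perm_trans (vals_sub ZY); rewrite perm_sym; exact: vals_setU1.
    by rewrite /= size_cat size_map -sY.
  + have XpE v : v \in X -> (p + 2 <= v)%N by move=> /(gen_ge gX); rewrite /p; lia.
    have o0X : o0 \notin X by apply/negP => /XpE /=; lia.
    have o1X : o1 \notin X by apply/negP => /XpE /=; lia.
    have Xh x : map (ht x) (vals X) = map h (vals X).
      apply/eq_in_map => k /valsP[v vX ->]; rewrite htE //; apply: contraNneq o1X => vp.
      by rewrite (_ : o1 = v) //; apply: val_inj.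
    have sr : ((size (vals X)).+1 + size r)%N = e by rewrite -se iE.
    have [g0|g1] := gen_link nE am ms sc dc gX (erefl (val o0)) (erefl (val o1)).
      apply: cst => // x _; rewrite lE iE /=.
      apply: (prgen_perm pr_swap (i := vals (o0 |: X)) (r := r)).
      * by constructor 2; exists (o0 |: X).
      * rewrite -cat_cons perm_cat2r perm_sym -(Xh x) -[h p](htE x) ?ltn_eqF //.
        have := perm_map (ht x) (vals_setU1 o0X); exact.
      by rewrite /= size_cat size_map.
    exists ((fun x => ht x p.+1) :: [seq (fun=> v) | v <- map h (vals X) ++ r]).
    have E x : [seq g x | g <- [seq (fun _ : 'I_1 -> K => v) | v <- map h (vals X) ++ r]] = map h (vals X) ++ r.
      by rewrite -map_comp map_id.
    split=> [||/=|x _].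
    * by rewrite /= size_map size_cat size_map.
    * split; last by have := @pvecs_map K n 1 (fun _ _ => 0) [::] (map h (vals X) ++ r);
        apply=> k; exact: pvec_const.
      move=> j; exists ((h p 0 j)%:MP + (h p.+1 0 j)%:MP * 'X_ord0) => x.
      by rewrite /ht eqxx !mxE mevalD mevalM !mevalC mevalXU mulrC.
    * by rewrite E lE iE /= /ht eqxx scale0r addr0.
    rewrite /= E; apply: (prgen_perm pr_swap (i := vals (o1 |: X)) (r := r)).
    * by constructor 2; exists (o1 |: X).
    * rewrite -cat_cons perm_cat2r perm_sym -(Xh x).
      have := perm_map (ht x) (vals_setU1 o1X); exact.
    by rewrite /= size_cat size_map.
  + apply: cst => // x _; rewrite lE; apply: key => //; last by constructor 3; exists k.
    by rewrite iE inE eq_sym big // leq_addr.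
  apply: cst => // x _; rewrite lE; apply: key => //; last by constructor 4.
  by rewrite iE; apply/negP => /zl_lt/andP[/big]; rewrite eqxx.
(* The polynomial q is nonzero at t = 0, but the generators were extended only to t != 0; the factor
   t excludes 0. *)
have [x] : exists x, (q * 'X_ord0).@[x] != 0.
  apply: mpoly_nonroot => //; rewrite mulf_neq0 //; last first.
    by apply/eqP => /(congr1 (meval (fun=> 1)))/eqP; rewrite mevalXU meval0 oner_eq0.
  by apply: contraNneq q0 => ->; rewrite meval0.
rewrite mevalM mevalXU mulf_eq0 negb_or => /andP[qx0 xx0].
by exists (ht x); apply: qx.
Qed.

(** The exact sequence of multiplication by h_p: modulo the limit ideal, the contraction reduces
    every product to multiples of h_p, and the link relations multiplied by h_p dispose of these.
    The vertex p itself may be added to the link in the exterior case, because h_p * h_p = 0. *)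
Lemma lefschetz_step h : (c < E0)%N ->
  spn (lef_lists a.+1 c (upd a c s)) (E0 - c) h ->
  spn (fun i => [\/ exists2 v, (v < p + alt)%N & i = [:: v],
      exists2 X, gen m US a c.+1 s X & i = vals (X : {set 'I_n}),
      exists2 k, (k < killed c)%N & i = [:: (n + (n.-1 - k))%N]
    | i = zl]) (E0 - c.+1) h ->
  spn limit_lists (E0 - c) h.
Proof.
move=> cE spC spL l sl; have := spC l sl.
apply: lspan_trans => _ [i [r [li se ->]]].
have triv j t : limit_lists j -> (size j + size t)%N = (E0 - c)%N ->
    lspan (prgen pr limit_lists h (E0 - c)) (pr (map h j ++ t)).
  by move=> lj sj; apply: lspan_gen; exists j, t.
case: li => [[v vp iE]|[X gX iE]|[k kk iE]|iE]; last 1 first.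
- by apply: triv => //; constructor 4; right.
- rewrite addSn ltnS leq_eqVlt in vp; case/predU1P: vp => [vp|vp]; last first.
    by apply: triv => //; constructor 1; exists v.
  rewrite iE /= pr_cons; have sr : size r = (E0 - c.+1)%N.
    by rewrite iE /= in se; lia.
  apply: lspan_map (spL r sr) => _ [j [t [lj sj ->]]]; rewrite -pr_cons vp.
  have st : size (h p :: map h j ++ t) = (E0 - c)%N by rewrite /= size_cat size_map sj; lia.
  have pj : perm_eq (h p :: map h j ++ t) (map h j ++ h p :: t).
    by rewrite -cat1s perm_catCA.
  case: lj => [[w wp jE]|[X gX jE]|[k kk jE]|jE].
  + have [wp'|] := ltnP w p.
      by apply: (prgen_perm pr_swap _ pj st); constructor 1; exists w.
    move=> pw; have [halt wE] : alt /\ w = p by move: wp; case: (alt) => /=; lia.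
    rewrite jE wE /= (pr_alt halt [::] t); exact: lspan_nil.
  + have := triv (p :: j) t; rewrite /= addSn sj subnSK //; apply=> //.
    by constructor 3; exists X; rewrite ?jE.
  + by apply: (prgen_perm pr_swap _ pj st); constructor 4; left; exists k.
  by apply: (prgen_perm pr_swap _ pj st); constructor 4; right.
- by apply: triv => //; constructor 2; exists X.
by apply: triv => //; constructor 4; left; exists k.
Qed.

End Step.

Lemma lef_lists_lt a c s i : (a <= m)%N -> (2 * c <= d)%N -> lef_lists a c s i -> all (ltn^~ (n + n)%N) i.
Proof.
move=> am dc; case=> [[v vp ->]|[X _ ->]|[k _ ->]|->] /=.
- by rewrite andbT nE; lia.
- by apply/allP => k /valsP[v _ ->]; rewrite /= ltn_addr.
- by rewrite andbT ltn_add2l nE; lia.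
by apply/allP => k /zl_lt/andP[].
Qed.

Theorem lefschetz a c s : (a <= m)%N -> mono s -> (s a <= c)%N ->
  (alt -> c <= k0)%N -> exists h, spn (lef_lists a c s) (E0 - c) h.
Proof.
have [N] := ubnP (m - a + (d.+1 - c))%N; elim: N a c s => // N IHN a c s.
rewrite ltnS => NE am ms sc ck.
have [dc|dc] := ltnP d (2 * c)%N.
  exists coord; apply: spanning_nil; constructor 2; exists set0; first exact: (gen_set0 US nE).
  by rewrite vals0.
have [/andP[ha /eqP ck0]|hack] := boolP (alt && (c == k0)).
  by exists coord; apply: lefschetz_cover.
have {}ck : alt -> (c < k0)%N by move=> ha; rewrite ltn_neqAle ck // andbT; move: hack; rewrite ha.
have [aE|anm] := eqVneq a m.
  rewrite aE in sc *; have [ha|ha] := boolP alt; last exact: lefschetz_base_sym.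
  by apply: lefschetz_base_alt => //; apply: ck.
have {anm}am : (a < m)%N by rewrite ltn_neqAle anm.
have mu := mono_upd ms sc.
(* For E0 <= c the exponent 2 E0 - d is 0, as 2 c <= d, and the empty product generates
   everything. *)
have [cE|Ec] := ltnP c E0; last first.
  exists coord; apply: spanning_nil; constructor 4; apply/esym/size0nil.
  by rewrite size_zl /z; lia.
have [hC spC] : exists h, spn (lef_lists a.+1 c (upd a c s)) (E0 - c) h.
  by apply: IHN => //; [lia | by rewrite /upd ltnn | by move=> /ck/ltnW].
have [hL spL] : exists h, spn (lef_lists a c.+1 s) (E0 - c.+1) h.
  by apply: IHN => //; [lia | exact: ltnW | exact: leqW].
pose p := (a + 2 * c)%N.
pose LL (i : seq nat) := [\/ exists2 v, (v < p + alt)%N & i = [:: v],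
      exists2 X, gen m US a c.+1 s X & i = vals (X : {set 'I_n}),
      exists2 k, (k < killed c)%N & i = [:: (n + (n.-1 - k))%N]
    | i = zl].
(* The link counts h_p and h_(p+1) among the passed vertices. The forms y1 and y2, divided out
   before the pair step but not after it, are free to be set to h_(p+1) and, in the polynomial ring,
   h_p. *)
have [hL' spL'] : exists h, spn LL (E0 - c.+1) h.
  have [dc2|dc2] := ltnP d (2 * c.+1)%N.
    exists coord; apply: spanning_nil; constructor 2; exists set0.
      by apply: (gen_set0 US nE) => //; apply: leqW.
    by rewrite vals0.
  have kc : (0 < killed c)%N.
    by rewrite /killed; move: ck; case: (alt) => [/(_ isT)|_]; lia.
  pose y1 := (n + (n.-1 - (killed c).-1))%N; pose y2 := (n + (n.-1 - (killed c).-2))%N.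
  have kn : (killed c <= n.-1)%N.
    have := k0E; rewrite /killed nE; case: (alt) => [/(_ isT)|_]; lia.
  have ksub : (killed c.+1 <= (killed c).-1)%N /\ (~~ alt -> killed c.+1 <= (killed c).-2 /\ 1 < killed c)%N.
    by rewrite /killed; case: (alt); split=> //; lia.
  have zly : y1 \notin zl /\ (~~ alt -> y2 \notin zl).
    have := k0E; rewrite /y1 /y2 /zl /killed; move: ck; case: (alt) => ck k0e.
      split=> //; apply/negP => /mapP[l]; rewrite mem_iota => lz /eqP; rewrite eqn_add2l => /eqP.
      by have := ck isT; have := k0e isT; move: lz; rewrite /z nE; lia.
    split=> [|_]; apply/negP => /nseqP[/eqP]; rewrite eqn_add2l nE => /eqP; lia.
  pose h k := if k == y1 then hL p.+1 else if ~~ alt && (k == y2) then hL p else hL k.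
  have hlt k : (k < n)%N -> h k = hL k.
    move=> kn'; have ky y : (k == n + y)%N = false by rewrite ltn_eqF // ltn_addr.
    by rewrite /h /y1 /y2 !ky andbF.
  exists h => l sl; have := spL l sl; apply: lspan_trans => _ [i [r [li se ->]]].
  have triv j : LL j -> size j = size i -> map h j = map hL i ->
      lspan (prgen pr LL h (E0 - c.+1)) (pr (map hL i ++ r)).
    by move=> lj sj hji; apply: lspan_gen; exists j, r; rewrite hji -se sj.
  case: li => [[v vp iE]|[X gX iE]|[k kk iE]|iE].
  + have vn : (v < n)%N by rewrite nE; lia.
    have [vp0|] := ltnP v p.
      apply: (triv [:: v]); rewrite ?iE //=; last by rewrite hlt.
      by constructor 1; exists v => //; apply: ltn_addr.
    rewrite leq_eqVlt => /predU1P[vE|pv].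
      have [ha|ha] := boolP alt.
        apply: (triv [:: v]); rewrite ?iE //=; last by rewrite hlt.
        by constructor 1; exists v; rewrite // ha -vE addn1.
      apply: (triv [:: y2]); rewrite ?iE //=.
        by constructor 3; exists (killed c).-2 => //; have [_ /(_ ha)] := ksub; lia.
      rewrite /h ha eqxx vE ifN // /y1 /y2 eqn_add2l.
      by have [_ /(_ ha)] := ksub; lia.
    apply: (triv [:: y1]); rewrite ?iE //=.
      by constructor 3; exists (killed c).-1 => //; lia.
    by rewrite /h eqxx; congr [:: hL _]; rewrite /p in pv *; lia.
  + apply: (triv i) => //; first by constructor 2; exists X.
    by rewrite iE; apply/eq_in_map => k /valsP[v _ ->]; rewrite hlt.
  + apply: (triv i) => //; first by constructor 3; exists k => //; lia.
    rewrite iE /= /h !ifN //.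
      rewrite negb_and negbK /y2 eqn_add2l; case ha : (alt) => //=.
      by have [_ /(_ (negbT ha))] := ksub; lia.
    by rewrite /y1 eqn_add2l; lia.
  apply: (triv i) => //; first by constructor 4.
  rewrite iE; apply/eq_in_map => k kz; rewrite /h !ifN //.
    rewrite negb_and negbK; case ha: (alt) => //=; apply: contraNneq (zly.2 (negbT ha)) => <- //.
  by apply: contraNneq zly.1 => <-.
have bC i : lef_lists a.+1 c (upd a c s) i -> all (ltn^~ (n + n)%N) i by apply: lef_lists_lt.
have bL i : LL i -> all (ltn^~ (n + n)%N) i.
  case=> [[v vp ->]|[X _ ->]|[k _ ->]|->] /=.
  - by rewrite andbT; move: vp; rewrite nE /p; case: (alt) => /=; lia.
  - by apply/allP => k /valsP[v _ ->]; rewrite /= ltn_addr.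
  - by rewrite andbT ltn_add2l nE; lia.
  by apply/allP => k /zl_lt/andP[].
have [h [sC sL]] := spanning_common prP Kinf bC bL spC spL'.
by apply: (lefschetz_deform am ms sc dc (h := h)); apply: lefschetz_step.
Qed.

End Lefschetz.

Local Close Scope ring_scope.

(** * Partial sums of monomials *)

Section PartialSums.
Variable n : nat.
Implicit Types (u v : 'X_{1..n}).

Definition psum u k := \sum_(i < n | i < k) u i.

Lemma psum0 u : psum u 0 = 0.
Proof. by rewrite /psum big1. Qed.

Lemma psumS u (i : 'I_n) : psum u i.+1 = psum u i + u i.
Proof.
rewrite /psum (bigD1 i) //= addnC; congr (_ + _); apply: eq_bigl => j.
by rewrite ltnS [in RHS]ltn_neqAle andbC.
Qed.

Lemma psum_ge u k : n <= k -> psum u k = mdeg u.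
Proof.
move=> nk; rewrite mdegE /psum; apply: eq_bigl => i.
by rewrite (leq_trans (ltn_ord i)).
Qed.

Lemma psum_mono u : mono (psum u).
Proof.
move=> k; case: (ltnP k n) => kn; last by rewrite !psum_ge // ltnW.
by rewrite (psumS u (Ordinal kn)) leq_addr.
Qed.

Lemma psum_le_mdeg u k : psum u k <= mdeg u.
Proof.
case: (leqP n k) => [/psum_ge-> //|kn]; rewrite -(psum_ge u (leqnn n)).
by apply: mono_le (ltnW kn); apply: psum_mono.
Qed.

Lemma psumD u v k : psum (u + v)%MM k = psum u k + psum v k.
Proof. by rewrite -big_split; apply: eq_bigr => i _; rewrite mnmDE. Qed.

Lemma psumU (i : 'I_n) k : psum U_(i)%MM k = (i < k).
Proof.
rewrite /psum big_mkcond (bigD1 i) //= mnm1E eqxx big1 => [|j /negPf ji].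
  by case: ifP.
by rewrite mnm1E eq_sym ji; case: ifP.
Qed.

Lemma psum_inj u v : (forall i, i <= n -> psum u i = psum v i) -> u = v.
Proof.
move=> uv; apply/mnmP => i.
by have := uv i.+1 (ltn_ord i); rewrite !psumS uv ?(ltnW (ltn_ord i)) // => /addnI.
Qed.

Definition mnm_of (S : nat -> nat) : 'X_{1..n} := [multinom S i.+1 - S i | i < n].

Lemma psum_mnm_of S i : mono S -> S 0 = 0 -> i <= n -> psum (mnm_of S) i = S i.
Proof.
move=> mS S0; elim: i => [|i IHi] iN; first by rewrite psum0 S0.
by rewrite (psumS _ (Ordinal iN)) IHi 1?ltnW // mnmE subnKC.
Qed.

Lemma mdeg_mnm_of S : mono S -> S 0 = 0 -> mdeg (mnm_of S) = S n.
Proof. by move=> mS S0; rewrite -(psum_ge _ (leqnn n)) psum_mnm_of. Qed.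

Lemma nth_sorted_lt s i j : sorted leq s -> j < size s ->
  (nth 0 s j < i) = (j < count (gtn i) s).
Proof.
elim: s j => // x s IHs j /= ps; case: (ltnP x i) => xi.
  by case: j => [|j] //=; rewrite ltnS => /(IHs _ (path_sorted ps)) ->.
have all_i : all (leq i) s.
  by apply: sub_all (order_path_min leq_trans ps) => y; apply: leq_trans.
have -> : count (gtn i) s = 0.
  by apply/eqP; rewrite -leqn0 leqNgt -has_count; apply/hasPn => y /(allP all_i); rewrite /= leqNgt.
case: j => [|j] /=; first by move=> _; rewrite ltnNge xi.
by rewrite ltnS => js; rewrite ltnNge (allP all_i) ?mem_nth.
Qed.

Lemma sorted_mindices u : sorted leq (mindices u).
Proof.
rewrite sorted_pairwise; last exact: leq_trans.
have : pairwise (fun i j : 'I_n => i <= j) (enum 'I_n).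
  rewrite -(pairwise_map val leq) val_enum_ord -sorted_pairwise ?iota_sorted //; exact: leq_trans.
rewrite /mindices; elim: (enum _) => //= i l IHl /andP[il /IHl pl].
rewrite pairwise_cat pl andbT; apply/andP; split.
  apply/allrelP => x y /nseqP[-> _] /flattenP[_ /mapP[j jl ->]] /nseqP[-> _].
  exact: (allP il).
elim: (u i) => //= k ->; rewrite andbT; apply/allP => x /nseqP[-> _]; exact: leqnn.
Qed.

Lemma count_mindices u i : count (gtn i) (mindices u) = psum u i.
Proof.
rewrite /mindices count_flatten -map_comp sumnE big_map big_enum /= /psum [RHS]big_mkcond /=.
by apply: eq_bigr => j _; rewrite /= count_nseq /=; case: ifP; rewrite ?mul1n.
Qed.

Lemma size_mindices u : size (mindices u) = mdeg u.
Proof.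
rewrite /mindices size_flatten /shape -map_comp sumnE big_map big_enum /= mdegE.
by apply: eq_bigr => j _; rewrite /= size_nseq.
Qed.

Lemma nth_mindices_lt u i j : j < mdeg u -> (nth 0 (mindices u) j < i) = (j < psum u i).
Proof.
by move=> ju; rewrite nth_sorted_lt ?sorted_mindices ?size_mindices // count_mindices.
Qed.

Lemma nth_mindices u i j : psum u i <= j -> j < psum u i.+1 -> nth 0 (mindices u) j = i.
Proof.
move=> ij ji; have ju := leq_trans ji (psum_le_mdeg u _).
apply/eqP; rewrite eqn_leq -ltnS nth_mindices_lt // ji leqNgt nth_mindices_lt //.
by rewrite -leqNgt.
Qed.

End PartialSums.

(** At the first index i where the exponents differ, that of u is larger. Moving one factor x_i to
    x_(i+1), or deleting it if i is the last index, lowers by one the partial sum at i + 1 and no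
    other up to m, so u descends to v inside U. *)
Lemma psum_down_closed m (U : {pred 'X_{1..m}}) (u v : 'X_{1..m}) :
  shifted_order_ideal U -> u \in U -> (forall i, psum v i <= psum u i) -> v \in U.
Proof.
move=> [_ _ Udiv Ushift].
have [N] := ubnP (\sum_(i < m.+1) (psum u i - psum v i)).
elim: N u => // N IHN u; rewrite ltnS => uN uU vu.
have [<- //|uv] := eqVneq u v.
have [i0 i0P] : exists i : 'I_m, v i != u i.
  apply/existsP; apply: contraNT uv => /existsPn uv.
  by apply/eqP/mnmP => i; apply/esym/eqP/negPn/uv.
have [i iuv imin] := @arg_minnP _ i0 (fun i => v i != u i) (fun i : 'I_m => val i) i0P.
have eqi : psum u i = psum v i.
  apply: eq_bigr => j ji; apply/esym/eqP/negPn/negP => /imin.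
  by rewrite leqNgt ji.
have vi : v i < u i.
  by rewrite ltn_neqAle iuv /=; have := vu i.+1; rewrite !psumS eqi leq_add2l.
have ui : u = ((u - U_(i)) + U_(i))%MM.
  apply/mnmP => j; rewrite mnmDE mnmBE mnm1E subnK //.
  by case: eqP => [<-|//]; apply: leq_ltn_trans vi.
have psumB k : psum u k = psum (u - U_(i))%MM k + (i < k) by rewrite {1}ui psumD psumU.
have vu' k (b : bool) : b = (i.+1 < k) -> psum v k <= psum (u - U_(i))%MM k + b.
  move=> ->; case: (ltngtP k i.+1) => ki.
  - by have := vu k; rewrite psumB; have /negPf -> : ~~ (i < k) by rewrite -leqNgt -ltnS.
  - by have := vu k; rewrite psumB (ltnW ki).
  rewrite ki addn0; have := psumB i.+1; rewrite leqnn psumS eqi.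
  have := psumS v i; lia.
have dec (w : 'X_{1..m}) : (forall k, k <= m -> psum w k = psum (u - U_(i))%MM k + (i.+1 < k)) ->
    \sum_(k < m.+1) (psum w k - psum v k) < N.
  move=> wE; apply: leq_trans uN.
  have im : i.+1 < m.+1 by rewrite ltnS.
  rewrite (bigD1 (Ordinal im)) //= [X in _ < X](bigD1 (Ordinal im)) //=.
  rewrite -addSn leq_add //.
    rewrite wE // ltnn addn0 psumB leqnn addn1 subSn //.
    by have := @vu' i.+1 false; rewrite ltnn addn0; apply.
  apply: leq_sum => k _; rewrite wE -1?ltnS // psumB; apply: leq_sub2r; rewrite leq_add2l.
  by case: (ltnP i.+1 k) => // /ltnW ->.
case: (ltnP i.+1 m) => im.
  pose j := Ordinal im; have wE k : psum (u - U_(i) + U_(j))%MM k = psum (u - U_(i))%MM k + (i.+1 < k).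
    by rewrite psumD psumU.
  apply: (IHN (u - U_(i) + U_(j))%MM).
  - exact: dec.
  - by apply: (Ushift _ i j) => //; rewrite -ui.
  by move=> k; rewrite wE; apply: vu'.
apply: (IHN (u - U_(i))%MM).
- apply: dec => k km; rewrite (_ : (i.+1 < k) = false) ?addn0 //.
  by apply/negbTE; rewrite -leqNgt (leq_trans km).
- by apply: Udiv uU _; apply/mnm_lepP => j; rewrite mnmBE leq_subr.
move=> k; case: (leqP k m) => km.
  by rewrite -[psum (u - _)%MM k]addn0; apply: (@vu' k false); apply/esym/negbTE; rewrite -leqNgt (leq_trans km).
rewrite psum_ge ?(ltnW km) // -(psum_ge _ (leqnn m)) (psum_ge (u - _)%MM) ?(ltnW km) //.
rewrite -(psum_ge (u - _)%MM (leqnn m)) -[psum (u - _)%MM m]addn0.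
by apply: (@vu' m false); apply/esym/negbTE; rewrite -leqNgt.
Qed.

Lemma block_split m S v : mono S -> S 0 = 0 ->
  [\/ exists2 i, i < m & v = i + 2 * S i.+1,
      exists i t, [/\ i < m, S i <= t, t < S i.+1 & v = i + 2 * t \/ v = (i + 2 * t).+1]
    | m + 2 * S m <= v].
Proof.
move=> mS S0; elim: m => [|m IHm]; first by constructor 3; rewrite S0.
case: (leqP (m.+1 + 2 * S m.+1) v) => vm; first by constructor 3.
case: IHm => [[i im ->]|[i [t [im it ti vE]]]|mv].
- by constructor 1; exists i; rewrite // ltnW.
- by constructor 2; exists i, t; split; rewrite // ltnW.
have [vE|vE] := eqVneq v (m + 2 * S m.+1); first by constructor 1; exists m.
constructor 2; exists m, (v - m)./2; split=> //; lia.
Qed.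

(* The complement of the gaps {i + 2 S(i+1) : i < m}; for S the partial sums of
   u this is the facet F_d(u). *)
Definition ungap n m (S : nat -> nat) : {set 'I_n} :=
  [set v : 'I_n | `[< forall i, i < m -> v != i + 2 * S i.+1 :> nat >]].

Lemma ungapP n m S (v : 'I_n) :
  reflect (forall i, i < m -> v != i + 2 * S i.+1 :> nat) (v \in ungap n m S).
Proof. by rewrite inE; apply: asboolP. Qed.

Lemma notin_ungapP n m S (v : 'I_n) :
  reflect (exists2 i, i < m & v = i + 2 * S i.+1 :> nat) (v \notin ungap n m S).
Proof.
apply: (iffP idP) => [|[i im vE]]; last by apply/negP => /ungapP/(_ i im); rewrite vE eqxx.
move=> /ungapP h; apply: contrapT => nh; apply: h => i im; apply/eqP => vE.
by apply: nh; exists i.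
Qed.

Lemma lower_ungap n m S S' : mono S -> mono S' -> S 0 = 0 ->
  (forall i, i < m -> i + 2 * S' i.+1 < n) ->
  lower n m 2 S \subset ungap n m S' -> forall i, i <= m -> S i <= S' i.
Proof.
move=> mS mS' S0 gn sub; elim=> [|i IHi] im; first by rewrite S0.
rewrite leqNgt; apply/negP => lt; have := gn i im => vn.
suff : Ordinal vn \in lower n m 2 S.
  by move=> /(subsetP sub)/ungapP/(_ i im)/eqP; apply.
apply/lowerP; exists i, (S' i.+1); split=> //.
by apply: leq_trans (IHi (ltnW im)) (mS' i).
Qed.

(** The gap of index j lies in a block b(j) of [reach S]. As b is strictly increasing from m gaps to
    m blocks, it is the identity. *)
Lemma ungap_reach n m S S' : mono S -> mono S' ->
  (forall i, i < m -> i + 2 * S' i.+1 < n) ->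
  ~: ungap n m S' \subset reach n m S ->
  forall i, i < m -> S i <= S' i.+1 <= S i.+1.
Proof.
move=> mS mS' gn sub.
pose rep j b t := [/\ b < m, S b <= t, t <= S b.+1 & j + 2 * S' j.+1 = b + 2 * t].
have repE j : j < m -> exists b t, rep j b t.
  move=> jm; have vn := gn j jm.
  have : Ordinal vn \in ~: ungap n m S'.
    by rewrite in_setC; apply/notin_ungapP; exists j.
  by move=> /(subsetP sub)/reachP[b [t [h1 h2 h3 h4]]]; exists b, t.
have step j b t b' t' : rep j b t -> rep j.+1 b' t' -> b < b'.
  move=> [bm bt tb e] [bm' bt' tb' e']; rewrite ltnNge; apply/negP.
  rewrite leq_eqVlt => /predU1P[bb|bb]; have := mS' j.+1; first by rewrite bb in e'; lia.
  by have := mono_le mS bb; lia.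
have up j b t : j < m -> rep j b t -> j <= b.
  elim: j b t => // j IHj b t jm r; have [b' [t' r']] := repE j (ltnW jm).
  exact: leq_ltn_trans (IHj _ _ (ltnW jm) r') (step _ _ _ _ _ r' r).
have down k j b t : k + j.+1 = m -> rep j b t -> b <= j.
  elim: k j b t => [|k IHk] j b t jm r; first by case: r; rewrite -jm add0n ltnS.
  have jm1 : j.+1 < m by lia.
  have [b' [t' r']] := repE _ jm1; rewrite -ltnS.
  apply: leq_trans (step _ _ _ _ _ r r') _; apply: (IHk _ _ t') => //; lia.
move=> j jm; have [b [t r]] := repE j jm.
have bj : b = j by apply/eqP; rewrite eqn_leq (up _ _ _ jm r) (down (m - j.+1) _ _ t) // subnK.
by case: r => _; rewrite bj => h1 h2 h3; lia.
Qed.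

Lemma card_ungap n m S : mono S -> (forall i, i < m -> i + 2 * S i.+1 < n) ->
  #|ungap n m S| + m = n.
Proof.
move=> mS gn; have gn' (i : 'I_m) : i + 2 * S i.+1 < n by apply: gn.
have gi : injective (fun i : 'I_m => Ordinal (gn' i)).
  move=> i j /(congr1 val)/= ij; apply: val_inj => /=.
  case: (ltngtP i j) => // h; last by have := mono_le mS (leqW h : j.+1 <= i.+1); lia.
  by have := mono_le mS (leqW h : i.+1 <= j.+1); lia.
rewrite -[RHS]card_ord -(cardC (mem (ungap n m S))); congr (_ + _).
rewrite -[LHS]card_ord -(card_imset predT gi); apply: eq_card => v; rewrite [RHS]inE.
apply/imsetP/notin_ungapP => [[i _ ->]|[i im vE]]; first by exists i.
by exists (Ordinal im) => //; apply: val_inj.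
Qed.

Definition below n (F : {set 'I_n}) (x : nat) := #|[set v in F | v < x]|.

(** Exactly i gaps lie below a point of block i of [reach S]. Since v - i = 2 t, this is the source
    of the parity arguments, both for squeezed balls and for cyclic polytopes. *)
Lemma below_reach n m S (v : 'I_n) i t : mono S ->
  (forall j, j < m -> j + 2 * S j.+1 < n) ->
  i < m -> S i <= t -> t <= S i.+1 -> v = i + 2 * t :> nat ->
  below (ungap n m S) v + i = v.
Proof.
move=> mS gn im it ti vE.
have gn' (j : 'I_i) : j + 2 * S j.+1 < n by apply: gn; apply: ltn_trans im.
have gi : injective (fun j : 'I_i => Ordinal (gn' j)).
  move=> j k /(congr1 val)/= jk; apply: val_inj => /=.
  have := @mono_le _ j.+1 k.+1 mS; have := @mono_le _ k.+1 j.+1 mS.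
  by rewrite !ltnS; case: (ltngtP j k) => // h; [move=> _ /(_ isT) | move=> /(_ isT)]; lia.
rewrite -[RHS](card_ltn_ord (ltnW (ltn_ord v))) -(cardsID (ungap n m S)) /below.
congr (_ + _); first by apply: eq_card => w; rewrite !inE andbC.
rewrite -[LHS]card_ord -(card_imset predT gi); apply: eq_card => w; rewrite in_setD.
apply/imsetP/andP => [[j _ ->]|[/notin_ungapP[j jm wE]]].
  split; first by apply/notin_ungapP; exists j => //; apply: ltn_trans im.
  rewrite inE /= vE; have := mono_le mS (ltn_ord j).
  by have := ltn_ord j; lia.
rewrite inE vE wE => ji; have {}ji : j < i.
  rewrite ltnNge; apply/negP => h; have := @mono_le _ i.+1 j.+1 mS h; lia.
by exists (Ordinal ji) => //; apply: val_inj.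
Qed.

(** * Squeezed spheres *)

Lemma in_set_ (T : finType) (A : {set T}) (P : pred T) w : (w \in [set v in A | P v]) = (w \in A) && P w.
Proof. by rewrite inE. Qed.

Section SqueezedSphere.
Variables (n m d : nat) (U : {pred 'X_{1..m}}).
Hypothesis nE : n = m + d.+1.
Hypothesis Uideal : shifted_order_ideal U.
Hypothesis Udeg : forall u, u \in U -> (mdeg u).*2 <= d.+1.

Local Notation facet u := (ungap n m (psum u)).
Local Notation ball := (squeezed_ball n d U).
Local Notation sphere := (ball_boundary d ball).

Definition psum_below (S : nat -> nat) :=
  exists2 u, u \in U & forall i, i <= m -> S i <= psum u i.
Local Notation US := psum_below.

Lemma psum_below_le S S' : (forall i, i <= m -> S' i <= S i) -> US S -> US S'.
Proof.
by move=> SS [u uU Su]; exists u => // i im; apply: leq_trans (SS i im) (Su i im).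
Qed.

Lemma psum_below_deg S : US S -> 2 * S m <= d.+1.
Proof.
case=> u uU Su; apply: leq_trans (Udeg uU).
by rewrite -mul2n leq_mul2l (leq_trans (Su m (leqnn m))) // psum_le_mdeg.
Qed.

Lemma psum_below_mem S : mono S -> S 0 = 0 -> US S -> mnm_of m S \in U.
Proof.
move=> mS S0 [u uU Su]; apply: (psum_down_closed Uideal uU) => i.
case: (leqP i m) => im; first by rewrite psum_mnm_of // Su.
rewrite !psum_ge ?(ltnW im) // mdeg_mnm_of // (leq_trans (Su m (leqnn m))) //.
exact: psum_le_mdeg.
Qed.

Lemma gap_lt (u : 'X_{1..m}) i : (mdeg u).*2 <= d.+1 -> i < m -> i + 2 * psum u i.+1 < n.
Proof. by move=> ud im; have := psum_le_mdeg u i.+1; rewrite -mul2n in ud; lia. Qed.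

Lemma squeezed_facetE (u : 'X_{1..m}) : (mdeg u).*2 <= d.+1 -> squeezed_facet n d u = facet u.
Proof.
move=> ud; apply/setP => v; rewrite [LHS]inE.
have k2 : m + (mdeg u).*2 <= n by rewrite nE leq_add2l.
apply/orP/ungapP => [[/existsP[j /orP vE]|vm] i im|h].
- apply/eqP => vi; have := nth_mindices_lt i.+1 (ltn_ord j).
  have {}vE : (i + 2 * psum u i.+1 = nth 0 (mindices u) j + 2 * j \/
      i + 2 * psum u i.+1 = (nth 0 (mindices u) j + 2 * j).+1).
    by rewrite -vi mul2n; case: vE => /eqP; [left|right].
  by case: vE => vE; case: ltnP => h1 /esym h2; lia.
- by apply/eqP => vi; have := psum_le_mdeg u i.+1; rewrite -mul2n in vm; lia.
case: (block_split m v (psum_mono u) (psum0 u)) => [[i im /eqP vi]|[i [t [im it ti vE]]]|vm].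
- by have := h i im; rewrite vi.
- left; have tu : t < mdeg u := leq_trans ti (psum_le_mdeg u _).
  apply/existsP; exists (Ordinal tu); rewrite /= (nth_mindices it ti) -mul2n.
  by case: vE => ->; rewrite eqxx ?orbT.
by right; rewrite psum_ge // in vm; rewrite -mul2n; lia.
Qed.

Lemma card_facet u : u \in U -> #|facet u| = d.+1.
Proof.
move=> /Udeg ud; apply/eqP; rewrite -(eqn_add2r m) card_ungap; first by rewrite addnC -nE.
  exact: psum_mono.
by move=> i im; apply: gap_lt.
Qed.

Lemma card_facetD1 u x : u \in U -> x \in facet u -> #|facet u :\ x| = d.
Proof. by move=> uU xu; have := cardsD1 x (facet u); rewrite xu card_facet // add1n => -[<-]. Qed.

Lemma facet_inj u v : u \in U -> v \in U -> facet u \subset facet v -> u = v.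
Proof.
move=> uU vU uv; have guv : facet u = facet v.
  by apply/eqP; rewrite eqEcard uv (card_facet uU) (card_facet vU) leqnn.
apply: psum_inj; elim=> [|i IHi] im; first by rewrite !psum0.
suff le u' v' : u' \in U -> v' \in U -> facet u' = facet v' -> psum u' i = psum v' i ->
    psum u' i.+1 <= psum v' i.+1.
  by apply/eqP; rewrite eqn_leq !le // ?IHi // ltnW.
move=> u'U v'U uv' e.
have gn := gap_lt (Udeg v'U) im.
have : Ordinal gn \notin facet u' by rewrite uv'; apply/notin_ungapP; exists i.
case/notin_ungapP => j jm /= jE; have := psum_mono v' i.
case: (ltngtP j i) => ij.
- by have := mono_le (psum_mono u') ij; have := psum_mono u' j; lia.
- by have := mono_le (psum_mono u') (leqW ij); have := mono_le (psum_mono u') ij; lia.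
by rewrite ij in jE; lia.
Qed.

Lemma ballP (X : {set 'I_n}) : reflect (exists2 u, u \in U & X \subset facet u) (X \in ball).
Proof.
rewrite inE; apply: (iffP (asboolP _)) => [[F [u uU ->] XF]|[u uU XF]].
  by exists u; rewrite // -squeezed_facetE // Udeg.
by exists (facet u) => //; exists u; rewrite ?squeezed_facetE ?Udeg.
Qed.

Lemma facets_ballP (X : {set 'I_n}) : reflect (exists2 u, u \in U & X = facet u) (X \in facets ball).
Proof.
rewrite inE; apply: (iffP maxsetP) => [[/ballP[u uU Xu] Xmax]|[u uU ->]].
  by exists u => //; rewrite (Xmax (facet u)) //; apply/ballP; exists u.
split=> [|Y /ballP[v vU Yv] uY]; first by apply/ballP; exists u.
by have uv := facet_inj uU vU (subset_trans uY Yv); apply/eqP; rewrite eqEsubset uY uv Yv.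
Qed.

Lemma sphereP (X : {set 'I_n}) : reflect (exists u x, [/\ u \in U, x \in facet u, X \subset facet u :\ x &
    forall v, v \in U -> facet u :\ x \subset facet v -> v = u]) (X \in sphere).
Proof.
rewrite inE; apply: (iffP (asboolP _)) => [[F [/ballP[u uU Fu] Fd /eqP/cards1P[G GE]] XF]|].
  have [x xu FE] : exists2 x, x \in facet u & F = facet u :\ x.
    have : 0 < #|facet u :\: F| by rewrite cardsD (setIidPr Fu) card_facet // Fd subSnn.
    case/card_gt0P => x; rewrite inE => /andP[xF xu]; exists x => //.
    apply/eqP; rewrite eqEcard subsetD1 Fu xF /= Fd.
    by rewrite card_facetD1.
  exists u, x; split; rewrite -?FE // => v vU Fv.
  have inG w : w \in U -> F \subset facet w -> facet w = G.
    move=> wU Fw; apply/set1P; rewrite -GE inE Fw andbT; apply/facets_ballP; by exists w.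
  by apply: facet_inj; rewrite // (inG u) // (inG v).
case=> u [x [uU xu Xu uniq]]; exists (facet u :\ x) => //; split.
- by apply/ballP; exists u => //; apply: subD1set.
- exact: card_facetD1.
apply/eqP/cards1P; exists (facet u); apply/setP => G; rewrite [LHS]inE in_set1.
apply/andP/eqP => [[/facets_ballP[v vU ->] /uniq-> //]|->].
by split; [apply/facets_ballP; exists u | apply: subD1set].
Qed.

Lemma sphere_sub (X Y : {set 'I_n}) : X \in sphere -> Y \subset X -> Y \in sphere.
Proof.
move=> /sphereP[u [x [uU xu Xu uniq]]] YX; apply/sphereP; exists u, x.
by split=> //; apply: subset_trans Xu.
Qed.

Lemma sphere_card (X : {set 'I_n}) : X \in sphere -> #|X| <= d.
Proof.
by move=> /sphereP[u [x [uU xu /subset_leq_card Xu _]]]; rewrite card_facetD1 in Xu.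
Qed.

Lemma lower_nonface S : mono S -> S 0 = 0 -> ~ US S -> lower n m 2 S \notin sphere.
Proof.
move=> mS S0 nUS; apply/negP => /sphereP[u [x [uU _ Xu _]]]; apply: nUS; exists u => //.
apply: (lower_ungap (n := n) mS (psum_mono u) S0); last exact: subset_trans Xu (subD1set _ _).
by move=> i im; apply: gap_lt => //; apply: Udeg.
Qed.

(* If the complement of reach S lies in F_d(u) minus x, then x = b + 2 t with S b <= t <= S (b+1), and
   replacing the partial sum of index b+1 by t gives a second facet through
   F_d(u) minus x. *)
Lemma reach_nonface S : mono S -> S 0 = 0 -> US S -> ~: reach n m S \notin sphere.
Proof.
move=> mS S0 uS; apply/negP => /sphereP[u [x [uU xu Xu uniq]]].
have Xu' : ~: facet u \subset reach n m S.
  by rewrite -setCS setCK (subset_trans Xu) // subD1set.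
have gn i : i < m -> i + 2 * psum u i.+1 < n by apply: gap_lt; apply: Udeg.
have us := ungap_reach mS (psum_mono u) gn Xu'.
have : x \in reach n m S.
  by rewrite -[reach _ _ _]setCK in_setC; apply/negP => /(subsetP Xu); rewrite !inE eqxx.
case/reachP => b [t [bm bt tb xE]].
pose S' j := if j == b.+1 then t else if j <= m then psum u j else S m.
have um j : j <= m -> psum u j <= S m.
  move=> jm; apply: leq_trans (mono_le (psum_mono u) jm) _.
  have m0 : 0 < m by apply: leq_ltn_trans bm.
  by have := us m.-1; rewrite prednK // => /(_ (leqnn _))/andP[].
have mS' : mono S'.
  move=> j; rewrite /S' eqSS; have [->|jb1] := eqVneq j b.+1.
    rewrite gtn_eqF //; case: (ltnP b.+1 m) => b1m; first by have := us _ b1m; lia.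
    exact: leq_trans tb (mono_le mS bm).
  have [->|jb] := eqVneq j b.
    rewrite (ltnW bm); apply: leq_trans bt; case: (b) bm => [|b'] b'm; first by rewrite psum0.
    by have /andP[] := us b' (ltnW b'm).
  case: (ltnP j m) => jm; first by rewrite (ltnW jm) psum_mono.
  by case: (leqP j m) => // /um.
have S'0 : S' 0 = 0 by rewrite /S' /= psum0.
have S'S i : i <= m -> S' i <= S i.
  rewrite /S'; case: eqP => [-> _ //|_ im]; rewrite im.
  by case: i im => [|i] im; [rewrite psum0 | have := us i im; lia].
have vU := psum_below_mem mS' S'0 (psum_below_le S'S uS).
have vE i : i <= m -> psum (mnm_of m S') i = S' i by apply: psum_mnm_of.
have sub : facet u :\ x \subset facet (mnm_of m S').
  apply/subsetP => w; rewrite in_setD1 => /andP[wx /ungapP wu]; apply/ungapP => i im.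
  rewrite vE // /S' eqSS; have [ib|ib] := eqVneq i b.
    by rewrite ib -xE.
  by rewrite im; apply: wu.
have /(congr1 (fun w => psum w b.+1)) := uniq _ vU sub.
rewrite vE // /S' eqxx => tE; have /ungapP/(_ b bm) := xu.
by rewrite -tE xE eqxx.
Qed.

Lemma below_gap u (v : 'I_n) i : u \in U -> i < m -> v = i + 2 * psum u i.+1 :> nat ->
  below (facet u) v + i = v.
Proof.
move=> uU im vE; apply: (below_reach (t := psum u i.+1) (psum_mono u)) => //.
- by move=> k km; apply: gap_lt => //; apply: Udeg.
- exact: psum_mono.
Qed.

(** A form of Gale's evenness condition; it drives the count of the boundary facets. *)
Lemma even_below u v : u \in U -> v \notin facet u -> ~~ odd (below (facet u) v).
Proof.
move=> uU /notin_ungapP[i im vE]; have /eqP := below_gap uU im vE.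
by rewrite {2}vE addnC eqn_add2l => /eqP ->; rewrite mul2n odd_double.
Qed.

Lemma below_lt (F : {set 'I_n}) (x y : 'I_n) : x \in F -> x < y -> below F x < below F y.
Proof.
move=> xF xy; apply: proper_card; apply/properP; split.
  by apply/subsetP => w; rewrite !inE => /andP[-> /ltn_trans-> //].
by exists x; rewrite !inE ?xF ?xy ?ltnn.
Qed.

Local Notation T := 'X_{1..m < d.+2}.

Definition flags : {set T * 'I_n} := [set p : T * 'I_n | (bmnm p.1 \in U) && (p.2 \in facet p.1)].

(* The flags (u, x) such that F_d(u) minus x may be completed to another facet by
   a vertex above x. *)
Definition low_flags : {set T * 'I_n} :=
  [set p in flags | ~~ odd (below (facet p.1) p.2) &&
     [exists y : 'I_n, (y \notin facet p.1) && (p.2 < y)]].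

Lemma card_flags : #|flags| = \sum_(u : T | bmnm u \in U) d.+1.
Proof.
rewrite -sum1_card (eq_bigl (fun p : T * 'I_n => (bmnm p.1 \in U) && (p.2 \in facet p.1))).
  rewrite -(pair_big_dep (fun u : T => bmnm u \in U) (fun u x => x \in facet u) (fun _ _ => 1)) /=.
  by apply: eq_bigr => u uU; rewrite sum1_card card_facet.
by move=> p; rewrite inE.
Qed.

(** The vertex x of a low flag has an even number of facet elements below it and lies below some
    gap, so this number is one of 0, 2, ..., 2 deg u - 2, and it determines x. *)
Lemma card_low_flags : #|low_flags| <= \sum_(u : T | bmnm u \in U) mdeg u.
Proof.
pose Lu (u : T) := [set x in facet u | ~~ odd (below (facet u) x) &&
     [exists y : 'I_n, (y \notin facet u) && (x < y)]].
rewrite -sum1_card (eq_bigl (fun p : T * 'I_n => (bmnm p.1 \in U) && (p.2 \in Lu p.1))).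
  rewrite -(pair_big_dep (fun u : T => bmnm u \in U) (fun u x => x \in Lu u) (fun _ _ => 1)) /=.
  apply: leq_sum => u uU; rewrite sum1_card cardE.
  pose f (x : 'I_n) := (below (facet u) x)./2.
  rewrite -(size_map f) -[X in _ <= X](size_iota 0) uniq_leq_size //.
    rewrite map_inj_in_uniq ?enum_uniq // => x y; rewrite !mem_enum inE [y \in _]inE.
    move=> /and3P[xF ex _] /and3P[yF ey _] fxy.
    have exy : below (facet u) x = below (facet u) y.
      by rewrite -[LHS]odd_double_half -[RHS]odd_double_half (negPf ex) (negPf ey); congr (_ + _.*2).
    apply: val_inj => /=; case: (ltngtP x y) => // h.
      by have := below_lt xF h; rewrite exy ltnn.
    by have := below_lt yF h; rewrite exy ltnn.
  move=> _ /mapP[x + ->]; rewrite mem_enum inE => /and3P[xF ex /existsP[y /andP[yF xy]]].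
  rewrite mem_iota /= add0n /f; have /notin_ungapP[i im yE] := yF.
  have := below_lt xF xy; have := below_gap uU im yE; have := psum_le_mdeg u i.+1.
  by have := odd_double_half (below (facet u) x); rewrite -mul2n (negPf ex); lia.
by move=> p; rewrite !inE -!andbA.
Qed.

(** A flag (u, x) is free if F_d(u) minus x lies in no other facet. Otherwise a vertex y completes
    it to another facet: for y > x the flag is low by parity, for y < x the flag of the other facet
    at y is low. The latter correspondence is injective, so the flags that are not free are at most
    twice as many as the low ones. *)
Lemma sphere_facets :
  \sum_(u : T | bmnm u \in U) (d.+1 - 2 * mdeg u) <= #|[set X in sphere | #|X| == d]|.
Proof.
pose free := [set p in flags | [forall v : T, (bmnm v \in U) && (facet p.1 :\ p.2 \subset facet v) ==> (v == p.1)]].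
pose rel (q p : T * 'I_n) := [&& facet p.1 == p.2 |: (facet q.1 :\ q.2), q.2 < p.2 & p.2 \notin facet q.1].
pose high := [set p in flags | [exists q, (q \in low_flags) && rel q p]].
have high_le : #|high| <= #|low_flags|.
  pose f p := odflt p [pick q | (q \in low_flags) && rel q p].
  have fP p : p \in high -> (f p \in low_flags) && rel (f p) p.
    by rewrite inE => /andP[_ /existsP[q hq]]; rewrite /f; case: pickP => [//|/(_ q)]; rewrite hq.
  rewrite -(card_in_imset (f := f) (D := high)).
    by apply/subset_leq_card/subsetP => _ /imsetP[p /fP/andP[h _] ->].
  (* Here p1.2 is a gap of the facets of q.1 and of p2.1, and below it they differ by the single
     vertex q.2, against evenness. *)
  have lt_abs (q p1 p2 : T * 'I_n) : p1 \in high -> p2 \in high -> q \in low_flags ->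
      rel q p1 -> rel q p2 -> p1.2 < p2.2 -> False.
    move=> hp1 hp2 hq /and3P[/eqP f1 lt1 n1] /and3P[/eqP f2 lt2 n2] lt12.
    have q1U : bmnm q.1 \in U by move: hq; rewrite !inE -!andbA => /and3P[].
    have qF : q.2 \in facet q.1 by move: hq; rewrite 2!inE => /andP[/andP[]].
    have p2U : bmnm p2.1 \in U by move: hp2; rewrite 2!inE => /andP[/andP[]].
    have n1' : p1.2 \notin facet p2.1.
      by rewrite f2 in_setU1 negb_or in_setD1 (negPf n1) andbF -val_eqE /= ltn_eqF.
    have := even_below p2U n1'; have := even_below q1U n1.
    have -> : below (facet q.1) p1.2 = (below (facet p2.1) p1.2).+1.
      rewrite /below (cardsD1 q.2) inE qF lt1 add1n; congr _.+1; apply: eq_card => w.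
      rewrite f2 in_setD1 2!in_set_; rewrite in_setU1 in_setD1.
      have [->|_] := eqVneq w p2.2; first by rewrite /= ltnNge (ltnW lt12) !andbF.
      by rewrite andbA.
    by rewrite /= negbK => ->.
  move=> p1 p2 hp1 hp2 ff; have /andP[l1 r1] := fP _ hp1; have /andP[l2 r2] := fP _ hp2.
  rewrite -ff in l2 r2; case: (ltngtP p1.2 p2.2) => h.
  - by have := lt_abs _ _ _ hp1 hp2 l1 r1 r2 h.
  - by have := lt_abs _ _ _ hp2 hp1 l1 r2 r1 h.
  have e2 : p1.2 = p2.2 by apply: val_inj.
  have p1U : bmnm p1.1 \in U by move: hp1; rewrite 2!inE => /andP[/andP[]].
  have p2U : bmnm p2.1 \in U by move: hp2; rewrite 2!inE => /andP[/andP[]].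
  have e1 : bmnm p1.1 = bmnm p2.1.
    apply: facet_inj => //; case/and3P: r1 => /eqP -> _ _; case/and3P: r2 => /eqP -> _ _.
    by rewrite e2.
  by rewrite [p1]surjective_pairing [p2]surjective_pairing e2; congr pair; apply: val_inj.
have cover : flags \subset free :|: (low_flags :|: high).
  apply/subsetP => p pf; rewrite 2!in_setU; apply/orP.
  have [|nfree] := boolP (p \in free); [by left | right; apply/orP].
  have pU : bmnm p.1 \in U by move: pf; rewrite inE => /andP[].
  have pF : p.2 \in facet p.1 by move: pf; rewrite inE => /andP[].
  move: nfree; rewrite inE pf /= => /forallPn[v]; rewrite negb_imply => /andP[/andP[vU sub] vp].
  have [y yv yp] : exists2 y, y \in facet v & y \notin facet p.1.
    apply/subsetPn; apply: contraNN vp => vp; apply/eqP/val_inj; exact: facet_inj vp.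
  have vE : facet v = y |: (facet p.1 :\ p.2).
    apply/esym/eqP; rewrite eqEcard subUset sub1set yv sub /= card_facet // cardsU1.
    by rewrite in_setD1 (negPf yp) andbF add1n card_facetD1.
  have yp2 : y != p.2 by apply: contraNneq yp => ->.
  have p2v : p.2 \notin facet v by rewrite vE in_setU1 in_setD1 eqxx orbF eq_sym.
  have ev : below (facet v) p.2 = below (facet p.1) p.2 + (y < p.2).
    have [yl|yl] := ltnP y p.2; last first.
      rewrite addn0; apply: eq_card => w; rewrite 2!in_set_ vE in_setU1 in_setD1.
      have [->|_] := eqVneq w y; first by rewrite ltnNge yl !andbF.
      by have [->|_] := eqVneq w p.2; rewrite ?ltnn ?andbF.
    rewrite addn1 /below (cardsD1 y) inE yv yl add1n; congr _.+1; apply: eq_card => w.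
    rewrite in_setD1 2!in_set_ vE in_setU1 in_setD1.
    have [->|_] := eqVneq w y; first by rewrite (negPf yp).
    by have [->|_] := eqVneq w p.2; rewrite ?ltnn ?andbF.
  have := even_below vU p2v; rewrite ev.
  have [yl _|yl] := ltnP y p.2; last first.
    rewrite addn0 => od; left; rewrite inE pf od /=; apply/existsP; exists y.
    by rewrite yp ltn_neqAle yl andbT -val_eqE eq_sym in yp2 *.
  right; rewrite inE pf /=; apply/existsP; exists (v, y); apply/andP; split.
    rewrite in_set_ in_set /= vU yv /=; apply/andP; split; last by apply/existsP; exists p.2; rewrite p2v.
    have -> : below (facet v) y = below (facet p.1) y.
      apply: eq_card => w; rewrite 2!in_set_ vE in_setU1 in_setD1.
      have [->|_] := eqVneq w y; first by rewrite ltnn !andbF.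
      by have [->|_] := eqVneq w p.2; rewrite ?[_ < y]ltnNge ?(ltnW yl) ?andbF.
    exact: even_below pU yp.
  rewrite /rel /= yl p2v andbT vE setU1K ?setD1K ?eqxx //.
  by rewrite in_setD1 (negPf yp) andbF.
have free_le : #|free| <= #|[set X in sphere | #|X| == d]|.
  rewrite -(card_in_imset (f := fun p : T * 'I_n => facet p.1 :\ p.2) (D := free)).
    apply/subset_leq_card/subsetP => _ /imsetP[p + ->]; rewrite inE => /andP[].
    rewrite inE => /andP[pU pF] /forallP fr; rewrite inE; apply/andP; split; last first.
      by rewrite card_facetD1.
    apply/sphereP; exists (bmnm p.1), p.2; split=> // v vU sub.
    have vd : mdeg v < d.+2 by have := Udeg vU; lia.
    by have /implyP := fr (BMultinom vd); rewrite /= vU sub => /(_ isT)/eqP <-.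
  move=> p1 p2; rewrite inE => /andP[+ /forallP fr]; rewrite inE => /andP[p1U p1F].
  rewrite inE => /andP[+ _]; rewrite inE => /andP[p2U p2F] e.
  have e1 : p2.1 = p1.1.
    by have /implyP := fr p2.1; rewrite p2U e subD1set => /(_ isT)/eqP.
  rewrite [p1]surjective_pairing [p2]surjective_pairing e1; congr pair.
  apply/eqP/negPn/negP => ne; have : p2.2 \in facet p1.1 :\ p1.2.
    by rewrite in_setD1 eq_sym ne -e1.
  by rewrite e in_setD1 eqxx.
have h1 := subset_leq_card cover; have h2 := leq_card_setU free (low_flags :|: high).
have h3 := leq_card_setU low_flags high; have h4 := card_low_flags; have h5 := card_flags.
have h6 : \sum_(u : T | bmnm u \in U) (d.+1 - 2 * mdeg u) + 2 * \sum_(u : T | bmnm u \in U) mdeg u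
     = \sum_(u : T | bmnm u \in U) d.+1.
  rewrite big_distrr -big_split; apply: eq_bigr => u /Udeg; rewrite -mul2n /= => ud.
  by rewrite subnK.
have arith x1 x2 f l h fl s A B C : fl <= x1 -> x1 <= f + x2 -> x2 <= l + h -> l <= B ->
  fl = C -> A + 2 * B = C -> h <= l -> f <= s -> A <= s by lia.
exact: arith h1 h2 h3 h4 h5 h6 high_le free_le.
Qed.

End SqueezedSphere.

(** * Cyclic polytopes *)

Local Open Scope ring_scope.

Section DividedDifference.
Variables (R : realFieldType) (k : nat) (x : 'I_k.+1 -> R).
Hypothesis xmono : forall i j : 'I_k.+1, (i < j)%N -> x i < x j.

Let w i := \prod_(j | j != i) (x i - x j).

Lemma nodes_neq i j : i != j -> x i != x j.
Proof.
rewrite -val_eqE neq_ltn => /orP[] /xmono h; first by rewrite lt_eqF.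
by rewrite gt_eqF.
Qed.

Lemma weight_neq0 i : w i != 0.
Proof.
by apply/prodf_neq0 => j ji; rewrite subr_eq0 nodes_neq // eq_sym.
Qed.

Lemma weight_sign (i : 'I_k.+1) : 0 < (-1) ^+ (k - i) * w i.
Proof.
rewrite /w (bigID (fun j : 'I_k.+1 => (i < j)%N)) /= mulrA.
have card_gt : #|[pred j : 'I_k.+1 | (j != i) && (i < j)%N]| = (k - i)%N.
  rewrite -(card_ltn_ord (leq_trans (leq_subr i k) (leqnSn k))).
  rewrite -[LHS](card_imset _ (@rev_ord_inj _)); apply: eq_card => j; rewrite !inE.
  apply/imsetP/idP => [[l + ->]|jk]; rewrite ?inE /=.
    by move=> /andP[_ il]; have := ltn_ord l; lia.
  exists (rev_ord j); last by rewrite rev_ordK.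
  rewrite inE -val_eqE /=; have := ltn_ord i; lia.
rewrite -[in X in X * _]card_gt -prodr_const -big_split /= mulr_gt0 //.
  by apply: prodr_gt0 => j /andP[_ ij]; rewrite mulN1r opprB subr_gt0 xmono.
apply: prodr_gt0 => j /andP[ji]; rewrite -leqNgt leq_eqVlt val_eqE (negPf ji) /=.
by move=> h; rewrite subr_gt0 xmono.
Qed.

(** The sum is the coefficient of degree k of the Lagrange interpolation of q at the k + 1 nodes. *)
Lemma divided_difference (q : {poly R}) : (size q <= k)%N -> \sum_i q.[x i] / w i = 0.
Proof.
move=> qk; pose L i : {poly R} := \prod_(j | j != i) ('X - (x j)%:P).
have LE i j : (L i).[x j] = if i == j then w i else 0.
  rewrite horner_prod; case: eqVneq => [->|ij].
    by apply: eq_bigr => l _; rewrite !hornerE.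
  by rewrite (bigD1 j) 1?eq_sym //= !hornerE subrr mul0r.
have sL i : size (L i) = k.+1.
  rewrite /L -big_filter size_prod_XsubC.
  have [e _ _ [_ ->]] := big_enumP (fun j : 'I_k.+1 => j != i).
  by rewrite cardC1 card_ord.
have Lk i : (L i)`_k = 1.
  by have /monicP := monic_prod_XsubC (index_enum _) (fun j => j != i) x; rewrite /lead_coef sL.
pose p : {poly R} := \sum_i (q.[x i] / w i) *: L i.
have pq : p - q = 0.
  have sp : (size (p - q)%R <= k.+1)%N.
    rewrite (leq_trans (size_polyD _ _)) // geq_max size_polyN (leq_trans qk) // andbT.
    apply: (leq_trans (size_sum _ _ _)); apply/bigmax_leqP => i _.
    by rewrite (leq_trans (size_scale_leq _ _)) ?sL.
  apply/eqP/negPn/negP => p0.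
  suff : (k.+1 < size (p - q)%R)%N by rewrite ltnNge sp.
  apply: leq_trans (max_poly_roots p0 (rs := codom x) _ _); rewrite ?size_codom ?card_ord //.
  - apply/allP => _ /codomP[j ->]; rewrite /root !hornerE horner_sum (bigD1 j) //=.
    rewrite hornerZ LE eqxx divfK ?weight_neq0 // big1 ?addr0 ?subrr // => i ij.
    by rewrite hornerZ LE (negPf ij) mulr0.
  - rewrite map_inj_uniq ?enum_uniq // => i j xij; apply/eqP/negPn/negP => /nodes_neq.
    by rewrite xij eqxx.
have := congr1 (fun r : {poly R} => r`_k) pq; rewrite coefB coef0 coef_sum (nth_default 0 qk) subr0.
by under eq_bigr => i _ do rewrite coefZ Lk mulr1.
Qed.

(* All the nonzero terms of the divided difference of q have the same sign. *)
Lemma alternating_zero (q : {poly R}) (b : bool) : (size q <= k)%N ->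
  (forall i, 0 <= q.[x i]) -> (forall i : 'I_k.+1, odd i = b -> q.[x i] = 0) -> q = 0.
Proof.
move=> qk q0 qb; have := divided_difference qk.
have term i : q.[x i] / w i = (-1) ^+ (k + ~~ b) * (q.[x i] / ((-1) ^+ (k - i) * w i)).
  have [/qb->|ib] := eqVneq (odd i) b; first by rewrite !mul0r mulr0.
  have -> : (-1) ^+ (k - i) = (-1) ^+ (k + ~~ b) :> R.
    rewrite -signr_odd -[RHS]signr_odd oddB -1?ltnS // oddD; congr (_ ^+ nat_of_bool (_ (+) _)).
    by move: ib; case: (odd i); case: b {qb}.
  by rewrite mulrCA invfM [(-1) ^+ _ * (_ * _)]mulrA divff ?mul1r // signr_eq0.
under eq_bigr => i _ do rewrite term.
rewrite -mulr_sumr => /eqP; rewrite mulf_eq0 signr_eq0 /= => /eqP s0.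
have qx i : q.[x i] = 0.
  have /eqP := s0; rewrite psumr_eq0 => [/allP/(_ i)|j _]; last by rewrite divr_ge0 // ltW ?weight_sign.
  rewrite mem_index_enum => /(_ isT)/=; rewrite mulf_eq0 invr_eq0 => /orP[/eqP //|].
  by rewrite gt_eqF ?weight_sign.
apply/eqP/negPn/negP => qn0; have : (k.+1 < size q)%N.
  apply: leq_trans (max_poly_roots qn0 (rs := codom x) _ _); rewrite ?size_codom ?card_ord //.
  - by apply/allP => _ /codomP[j ->]; apply/eqP.
  - rewrite map_inj_uniq ?enum_uniq // => i j xij; apply/eqP/negPn/negP => /nodes_neq.
    by rewrite xij eqxx.
by rewrite ltnNge (leq_trans qk).
Qed.

End DividedDifference.

Section CyclicPolytope.
Variables (R : realFieldType) (n d : nat) (t : 'I_n -> R).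
Hypothesis tmono : forall i j : 'I_n, (i < j)%N -> t i < t j.

(** Along the moment curve the inequality defining F is a polynomial of degree at most d,
    nonnegative at all the points and zero on F. If F contains every second one of d + 2 increasing
    points, the polynomial is zero by [alternating_zero], and F contains all vertices. *)
Lemma cyclic_alternating (F : {set 'I_n}) (e : 'I_d.+2 -> 'I_n) b :
  (forall i j : 'I_d.+2, (i < j)%N -> (e i < e j)%N) -> (forall i : 'I_d.+2, odd i = b -> e i \in F) ->
  F \notin cyclic_complex d t.
Proof.
move=> emono eF; apply/negP; rewrite inE => /andP[/eqP FT /asboolP[a [c ac]]].
pose q : {poly R} := c%:P - \sum_(j < d) a j 0 *: 'X^(j.+1).
have qE i : q.[t i] = c - (moment_curve d (t i) *m a) 0 0.
  rewrite /q hornerD hornerN hornerC horner_sum mxE; congr (_ - _).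
  by apply: eq_bigr => j _; rewrite !hornerE mxE mulrC.
have sq : (size q <= d.+1)%N.
  rewrite (leq_trans (size_polyD _ _)) // geq_max size_polyN.
  rewrite (leq_trans (size_polyC_leq1 _)) //=.
  apply: (leq_trans (size_sum _ _ _)); apply/bigmax_leqP => j _.
  by apply: leq_trans (size_scale_leq _ _) _; rewrite size_polyXn; apply: (ltn_ord j).
have q0 : q = 0.
  apply: (@alternating_zero _ d.+1 (t \o e) _ q b) => //=.
  - by move=> i j ij; apply/tmono/emono.
  - move=> i; rewrite qE; have := ac (e i); case: ifP => _ => [->|/ltW]; rewrite ?subrr //.
    by rewrite subr_ge0.
  by move=> i /eF ei; rewrite qE; have := ac (e i); rewrite ei => ->; rewrite subrr.
apply: FT; apply/setP => i; rewrite inE; have := ac i; case: ifP => // _.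
by rewrite -subr_gt0 -qE q0 horner0 ltxx.
Qed.

Variable m : nat.
Hypothesis nE : n = (m + d.+1)%N.

(** The alternating points are the first d + 2 among the lower elements and their successors, of
    which there are 2 S(m); those of even position are the lower elements. *)
Lemma cyclic_lower_nonface (S : nat -> nat) (F : {set 'I_n}) : mono S -> S 0%N = 0%N ->
  (d.+1 < 2 * S m)%N -> lower n m 2 S \subset F -> F \notin cyclic_complex d t.
Proof.
move=> mS S0 dS SF; pose u := mnm_of m S; pose idx k := nth 0%N (mindices u) k.
have pu i : (i <= m)%N -> psum u i = S i by apply: psum_mnm_of.
have mu : mdeg u = S m by apply: mdeg_mnm_of.
have idxP k : (k < S m)%N -> [/\ (idx k < m)%N, (S (idx k) <= k)%N & (k < S (idx k).+1)%N].
  move=> kS; have h i := nth_mindices_lt i (u := u) (j := k); rewrite mu in h.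
  have im : (idx k < m)%N by rewrite h // pu.
  split=> //; first by rewrite -pu ?(ltnW im) // leqNgt -h // ltnn.
  by rewrite -pu // -h // ltnSn.
have idx_mono k : (k.+1 < S m)%N -> (idx k <= idx k.+1)%N.
  move=> kS; have [im _ _] := idxP _ (ltnW kS); have [im' s1 s2] := idxP _ kS.
  rewrite leqNgt; apply/negP => lt; have := mono_le mS lt.
  by have [_ s3 _] := idxP _ (ltnW kS); lia.
have half (i : 'I_d.+2) : (i./2 < S m)%N.
  by have := ltn_ord i; have := odd_double_half i; rewrite -mul2n; lia.
pose ev (i : 'I_d.+2) := (idx i./2 + 2 * i./2 + odd i)%N.
have evn i : (ev i < n)%N.
  have [im _ _] := idxP _ (half i); have := odd_double_half i; rewrite -mul2n.
  by have := ltn_ord i; rewrite /ev nE; lia.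
pose e i := Ordinal (evn i).
apply: (@cyclic_alternating F e false).
  have idx_le a b : (a <= b)%N -> (b < S m)%N -> (idx a <= idx b)%N.
    move=> ab bS; elim: b ab bS => [|b IHb]; first by rewrite leqn0 => /eqP ->.
    rewrite leq_eqVlt => /predU1P[-> //|ab] bS.
    exact: leq_trans (IHb ab (ltnW bS)) (idx_mono _ bS).
  move=> i j ij; rewrite /= /ev; have := idx_le i./2 j./2 (half_leq (ltnW ij)) (half j).
  by have := odd_double_half i; have := odd_double_half j; rewrite -!mul2n; lia.
move=> i oi; apply: (subsetP SF); apply/lowerP.
have [im s1 s2] := idxP _ (half i).
by exists (idx i./2), i./2; split; rewrite //= /ev oi addn0.
Qed.

(** The d + 2 points are those of [ungap n m S] together with the last gap. By [below_reach], a
    point in [reach S] has even position among them, so the points of odd position lie in F. *)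
Lemma cyclic_reach_nonface (S : nat -> nat) (F : {set 'I_n}) : mono S -> S 0%N = 0%N ->
  (2 * S m <= d.+1)%N -> ~: reach n m S \subset F -> F \notin cyclic_complex d t.
Proof.
move=> mS S0 dS SF; case: (posnP m) => m0.
  apply/negP; rewrite inE => /andP[/negP FT _]; apply: FT; rewrite -subTset.
  apply: subset_trans SF; apply/subsetP => v _; rewrite in_setC; apply/reachP => -[i [k []]].
  by rewrite m0.
have gn j : (j < m)%N -> (j + 2 * S j.+1 < n)%N.
  by move=> jm; have := mono_le mS jm; rewrite nE; lia.
have gm : (m.-1 + 2 * S m < n)%N by rewrite -{2}(prednK m0); apply: gn; rewrite prednK.
pose g := Ordinal gm; pose Q := g |: ungap n m S.
have gQ : g \notin ungap n m S by apply/notin_ungapP; exists m.-1; rewrite ?prednK.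
have cQ : #|Q| = d.+2.
  rewrite cardsU1 gQ add1n; congr _.+1; apply/eqP.
  by rewrite -(eqn_add2r m) card_ungap // addnC nE.
pose ev (i : 'I_d.+2) := nth 0%N (vals Q) i.
have sQ : size (vals Q) = d.+2 by rewrite size_vals.
have evQ i : ev i \in vals Q by rewrite mem_nth ?sQ.
have evn i : (ev i < n)%N by have /valsP[v _ ->] := evQ i.
pose e i := Ordinal (evn i).
have eQ i : e i \in Q by rewrite -(mem_vals Q (e i)); apply: evQ.
have emono (i j : 'I_d.+2) : (i < j)%N -> (e i < e j)%N.
  move=> ij; apply: (sorted_ltn_nth ltn_trans 0%N (sorted_vals Q)) => //; by rewrite inE sQ.
have belowe (i : 'I_d.+2) : below Q (e i) = i.
  have cb k : count (gtn k) (vals Q) = below Q k.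
    rewrite /vals count_map -size_filter /below cardE; apply/perm_size/uniq_perm.
    - by rewrite filter_uniq ?enum_uniq.
    - exact: enum_uniq.
    by move=> v; rewrite mem_filter !mem_enum in_set_ andbC.
  have sl := sub_sorted (@ltnW) (sorted_vals Q).
  have h j : (j < d.+2)%N -> (nth 0 (vals Q) j < e i)%N = (j < below Q (e i))%N.
    by move=> jd; rewrite -cb nth_sorted_lt ?sQ.
  apply/eqP; rewrite eqn_leq; apply/andP; split.
    by rewrite leqNgt -h // ltnn.
  case: (posnP i) => [-> //|i0]; rewrite -(prednK i0) -h; last by rewrite ltnW // prednK.
  pose i' := Ordinal (leq_ltn_trans (leq_pred i) (ltn_ord i)).
  by apply: (emono i' i); rewrite /= prednK.
apply: (@cyclic_alternating F e true) => // i oi; apply: (subsetP SF).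
rewrite in_setC; apply/negP => /reachP[j [l [jm jl lj eE]]].
have lej : (e i <= m.-1 + 2 * S m)%N by rewrite eE; have := mono_le mS jm; lia.
have : below Q (e i) = below (ungap n m S) (e i).
  rewrite /below; apply: eq_card => v; rewrite !in_set_ in_setU1.
  by have [->|//] := eqVneq v g; rewrite [(g < e i)%N]ltnNge lej !andbF.
have := below_reach mS gn jm jl lj eE; rewrite belowe => + h2; rewrite -h2 eE addnC.
by move=> /addnI il; move: oi; rewrite il oddM.
Qed.

End CyclicPolytope.

Local Close Scope ring_scope.

(** * Shifted complexes *)

Section Below.
Variable n : nat.
Implicit Types (F A B : {set 'I_n}).

Lemma below0 F : below F 0 = 0.
Proof. by apply/eqP; rewrite cards_eq0; apply/eqP/setP => v; rewrite !inE andbF. Qed.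

Lemma belowS F (v : 'I_n) : below F v.+1 = below F v + (v \in F).
Proof.
rewrite /below (cardsD1 v) in_set_ ltnSn andbT addnC; congr (_ + _).
apply: eq_card => w; rewrite in_setD1 !in_set_ ltnS [in RHS]ltn_neqAle.
by rewrite -val_eqE andbCA.
Qed.

Lemma below_full F x : n <= x -> below F x = #|F|.
Proof.
move=> nx; apply: eq_card => v; rewrite in_set_.
by rewrite (leq_trans (ltn_ord v) nx) andbT.
Qed.

Lemma below_le_card F x : below F x <= #|F|.
Proof. by apply/subset_leq_card/subsetP => v; rewrite in_set_ => /andP[]. Qed.

Lemma below_le F x : below F x <= x.
Proof.
elim: x => [|x IHx]; first by rewrite below0.
case: (ltnP x n) => xn; first by rewrite (belowS F (Ordinal xn)) -addn1 leq_add // leq_b1.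
by rewrite (below_full F (leqW xn)) -(below_full F xn) leqW.
Qed.

Lemma below_add F x y : x <= y -> below F y + x <= below F x + y.
Proof.
elim: y => [|y IHy]; first by rewrite leqn0 => /eqP ->.
rewrite leq_eqVlt => /predU1P[-> //|xy].
have {}IHy := IHy xy; case: (ltnP y n) => yn.
  by rewrite (belowS F (Ordinal yn)); case: (_ \in F) => /=; lia.
by rewrite (below_full F (leqW yn)) -(below_full F yn); lia.
Qed.

Lemma below_setC F x : x <= n -> below F x + below (~: F) x = x.
Proof.
move=> xn; rewrite -[RHS](card_ltn_ord xn) -(cardsID F); congr (_ + _).
  by apply: eq_card => v; rewrite !inE andbC.
by apply: eq_card => v; rewrite !inE.
Qed.

Lemma below_inj A B : (forall x, below A x = below B x) -> A = B.
Proof.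
by move=> AB; apply/setP => v; have := belowS A v; rewrite !AB belowS => /addnI; do 2!case: (_ \in _).
Qed.

(* If x_F = Phi(u), then cnt F i is the partial sum psum u i. *)
Definition cnt F i := #|[set v in F | v - below F v < i]|.

Lemma cnt0 F : cnt F 0 = 0.
Proof. by apply/eqP; rewrite cards_eq0; apply/eqP/setP => v; rewrite !inE andbF. Qed.

Lemma cnt_mono F : mono (cnt F).
Proof.
move=> x; apply/subset_leq_card/subsetP => v; rewrite !in_set_ => /andP[-> vx].
by rewrite ltnS ltnW.
Qed.

Lemma cnt_le_card F i : cnt F i <= #|F|.
Proof. by apply/subset_leq_card/subsetP => v; rewrite in_set_ => /andP[]. Qed.

Lemma cnt_ge F i : n - #|F| < i -> cnt F i = #|F|.
Proof.
move=> ni; apply: eq_card => v; rewrite in_set_ andbC; case vF: (v \in F); last by rewrite andbF.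
rewrite andbT; apply: leq_ltn_trans ni; have := below_setC F (ltnW (ltn_ord v)).
by have := below_le_card (~: F) v; have := cardsC F; rewrite card_ord; lia.
Qed.

Lemma cnt_full F i : n <= i -> cnt F i = #|F|.
Proof.
case: (posnP #|F|) => [F0 _|F0 ni]; last by apply: cnt_ge; have Fn : #|F| <= n by [rewrite -[X in _ <= X]card_ord max_card]; lia.
by apply/eqP; rewrite eqn_leq cnt_le_card F0.
Qed.

Lemma below_le_cnt F x i : x - below F x < i -> below F x <= cnt F i.
Proof.
move=> xi; apply/subset_leq_card/subsetP => v; rewrite !in_set_ => /andP[-> vx] /=.
by apply: leq_ltn_trans xi; have := below_add F (ltnW vx); have := below_le F v; lia.
Qed.

Lemma cnt_le_below F x i : i <= x - below F x -> cnt F i <= below F x.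
Proof.
move=> xi; apply/subset_leq_card/subsetP => v; rewrite !in_set_ => /andP[-> vx] /=.
rewrite ltnNge; apply/negP => xv; have := below_add F xv; have := below_le F v; lia.
Qed.

(** Since v - below F v is the number of gaps before v, [below] and [cnt] describe the same lattice
    path, one by positions and the other by gaps; hence they define the same dominance order. *)
Lemma cnt_below A B : (forall i, cnt B i <= cnt A i) -> forall x, below B x <= below A x.
Proof.
move=> BA x; rewrite leqNgt; apply/negP => lt.
have h1 := cnt_le_below (leqnn (x - below A x)).
have h2 : x - below B x < x - below A x by have := below_le B x; lia.
by have := below_le_cnt h2; have := BA (x - below A x); lia.
Qed.

Lemma below_cnt A B : (forall x, below B x <= below A x) -> forall i, cnt B i <= cnt A i.
Proof.
move=> BA i; case: (boolP [exists x : 'I_n.+1, i <= x - below A x]) => [ex|nex]; last first.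
  apply: leq_trans (cnt_le_card B i) _; have := BA n; rewrite below_full // => h.
  apply: leq_trans h _; apply: below_le_cnt; rewrite ltnNge; apply: contraNN nex => h.
  by apply/existsP; exists ord_max.
have [x0 x0P] := existsP ex.
have [x xP xmin] := @arg_minnP _ x0 (fun x : 'I_n.+1 => i <= x - below A x) (fun x : 'I_n.+1 => val x) x0P.
case: (posnP i) => [->|i0]; first by rewrite cnt0.
have hB : cnt B i <= below B x by apply: cnt_le_below; have := BA x; lia.
apply: leq_trans hB _; apply: leq_trans (BA x) _.
have x1 : 0 < x by have := below_le A x; lia.
have xn : x.-1 < n.+1 by have := ltn_ord x; lia.
have nmin : x.-1 - below A x.-1 < i.
  by rewrite ltnNge; apply/negP => h; have := xmin (Ordinal xn) h; rewrite /=; lia.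
have xn' : x.-1 < n by have := ltn_ord x; lia.
have := below_le_cnt nmin; have := belowS A (Ordinal xn'); rewrite /= prednK // => e h.
by rewrite e; case: (_ \in A) e => e; rewrite ?addn0 //; move: xP; rewrite e; lia.
Qed.

Lemma cnt_sub A B : A \subset B -> forall i, cnt A i <= cnt B i.
Proof.
move=> AB; apply: below_cnt => x; apply/subset_leq_card/subsetP => v; rewrite !in_set_.
by case/andP=> /(subsetP AB) ->.
Qed.

Lemma cnt_inj A B : (forall i, cnt A i = cnt B i) -> A = B.
Proof.
move=> AB; apply: below_inj => x; apply/eqP; rewrite eqn_leq.
by rewrite !cnt_below // => i; rewrite AB.
Qed.

(** A is moved to B inside C. The first vertex x in which they differ lies in A; it is replaced by
    the next vertex missing from A, or deleted if there is none. Dominance persists because from x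
    to that vertex A is full, while B lacks x. *)
Lemma shifted_dominance (C : {set {set 'I_n}}) A B : simplicial_complex C -> shifted C ->
  A \in C -> (forall i, cnt B i <= cnt A i) -> B \in C.
Proof.
move=> [_ Csub] Cshift + /cnt_below.
have [N] := ubnP (\sum_(v in A) (n - v)); elim: N A => // N IHN A; rewrite ltnS => AN AC BA.
have [<- //|AB] := eqVneq A B.
have [x0 x0P] : exists x : 'I_n, (x \in A) != (x \in B).
  apply/existsP; apply: contraNT AB => /existsPn AB.
  by apply/eqP/setP => i; apply/eqP/negPn/AB.
have [x xP xmin] := @arg_minnP _ x0 (fun x => (x \in A) != (x \in B)) (fun x : 'I_n => val x) x0P.
have eqb y : y <= x -> below A y = below B y.
  move=> yx; apply: eq_card => w; rewrite !in_set_; case: ltnP => wy; rewrite ?andbF // !andbT.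
  by apply/eqP/negPn/negP => /xmin; rewrite leqNgt (leq_trans wy).
have xA : x \in A.
  apply: contraNT xP => xA; have := BA x.+1; rewrite !belowS eqb // leq_add2l (negPf xA).
  by case: (x \in B).
have xB : x \notin B by move: xP; rewrite xA; case: (x \in B).
have sum_lt (A' : {set 'I_n}) : \sum_(v in A') (n - v) < \sum_(v in A) (n - v) ->
    \sum_(v in A') (n - v) < N by move=> h; apply: leq_trans h AN.
have sumA : \sum_(v in A) (n - v) = (n - x) + \sum_(v in A :\ x) (n - v) by rewrite (big_setD1 x).
have belowD y : below A y = below (A :\ x) y + (x < y).
  rewrite addnC /below (cardsD1 x) in_set_ xA; congr (_ + _); apply: eq_card => w.
  by rewrite in_setD1 !in_set_ in_setD1 andbA.
have Bx y : x < y -> below B y <= below A x + (y - x.+1).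
  move=> xy; rewrite eqb //; have := below_add B xy; rewrite belowS (negPf xB) addn0; lia.
have [[x' x'P]|nx'] := pselect (exists x' : 'I_n, (x < x') && (x' \notin A)); last first.
  apply: (IHN (A :\ x)).
  - by apply: sum_lt; rewrite sumA -addn1 addnC leq_add2r subn_gt0.
  - by apply: Csub AC _; apply: subD1set.
  suff le y : y <= n -> below B y <= below (A :\ x) y.
    move=> y; case: (leqP y n) => [/le //|/ltnW yn].
    by rewrite !(below_full _ yn) -!(below_full _ (leqnn n)) le.
  move=> yn; have := BA y; rewrite belowD; case: (leqP y x) => yx; first by rewrite addn0.
  move=> _; have := Bx y yx; have := belowD y; rewrite yx.
  have := below_setC A yn; have := below_setC A (ltnW (ltn_ord x)).
  suff -> : below (~: A) y = below (~: A) x by lia.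
  apply: eq_card => w; rewrite !in_set_; case wA : (w \in ~: A) => //=.
  case: (ltngtP w x) => h; first by rewrite (ltn_trans h).
    by case: nx'; exists w; rewrite h -in_setC wA.
  by move: wA; rewrite (val_inj h) in_setC xA.
have [z /andP[xz zA] zmin] := @arg_minnP _ x' (fun w => (x < w) && (w \notin A)) (fun w : 'I_n => val w) x'P.
have zAx : z \notin A :\ x by rewrite in_setD1 (negPf zA) andbF.
have belowU y : below (z |: A :\ x) y = below (A :\ x) y + (z < y).
  rewrite addnC /below (cardsD1 z) in_set_ setU11; congr (_ + _); apply: eq_card => w.
  rewrite in_setD1 !in_set_ in_setU1; have [->|//] := eqVneq w z.
  by rewrite (negPf zAx).
apply: (IHN (z |: A :\ x)).
- by apply: sum_lt; rewrite sumA big_setU1 //= ltn_add2r; have := ltn_ord z; lia.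
- exact: Cshift.
move=> y; rewrite belowU; have := BA y; rewrite belowD; case: (leqP y x) => yx.
  by rewrite addn0; lia.
case: (ltnP z y) => zy; first by [].
move=> _; have := Bx y yx; have := belowD y; rewrite yx.
have yn : y <= n by apply: leq_trans zy (ltnW (ltn_ord z)).
have := below_setC A yn; have := below_setC A (ltnW (ltn_ord x)).
suff -> : below (~: A) y = below (~: A) x by lia.
apply: eq_card => w; rewrite !in_set_; case wA : (w \in ~: A) => //=.
case: (ltngtP w x) => h; first by rewrite (ltn_trans h).
  apply/negbTE; rewrite -leqNgt; apply: leq_trans zy _; apply: zmin.
  by rewrite h -in_setC wA.
by move: wA; rewrite (val_inj h) in_setC xA.
Qed.

Lemma below_lower m S x i t : mono S -> S 0 = 0 -> (forall j, j < m -> j + S j.+1 <= n) ->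
  i < m -> S i <= t -> t <= S i.+1 -> x = i + t -> below (lower n m 1 S) x = t.
Proof.
move=> mS S0 fit; elim: x i t => [|x IHx] i t im it ti e.
  by rewrite below0; lia.
have xn : x < n by have := fit i im; lia.
have mem (v : 'I_n) j r : v = x :> nat -> j < m -> S j <= r -> r < S j.+1 -> x = j + r -> v \in lower n m 1 S.
  by move=> vx *; apply/lowerP; exists j, r; split; rewrite // vx mul1n.
rewrite (belowS _ (Ordinal xn)) /=.
have [lt|ge] := ltnP (S i) t.
  rewrite (IHx i t.-1) //; try lia.
  by rewrite (mem (Ordinal xn) i t.-1) //; lia.
have ts : t = S i by lia.
have i0 : 0 < i by case: i {it ti im ge} e ts => // e ts; rewrite ts S0 in e.
rewrite (IHx i.-1 t) //; try lia.
- rewrite (_ : _ \in _ = false) ?addn0 //; apply/negP => /lowerP[j [r [jm jr rj]]] /=.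
  rewrite mul1n => e'; case: (ltngtP j i) => ji.
  + by have := mono_le mS ji; lia.
  + by have := mono_le mS (ltnW ji); lia.
  + by rewrite ji in e' jr; lia.
- by have := mS i.-1; rewrite prednK //; lia.
by rewrite prednK // -ts.
Qed.

Lemma cnt_lower m S i : mono S -> S 0 = 0 -> (forall j, j < m -> j + S j.+1 <= n) ->
  cnt (lower n m 1 S) i = S (minn i m).
Proof.
move=> mS S0 fit; set F := lower n m 1 S.
have gap v j t : j < m -> S j <= t -> t < S j.+1 -> v = j + t -> v - below F v = j.
  by move=> jm jt tj e; rewrite (below_lower mS S0 fit jm jt (ltnW tj) e); lia.
have key k : k <= m -> cnt F k = S k.
  case: k => [|k] km; first by rewrite cnt0 S0.
  rewrite -(below_lower mS S0 fit km (mS k) (leqnn _) (erefl _)).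
  apply: eq_card => v; rewrite !in_set_; case vF: (v \in F) => //=.
  have /lowerP[j [t [jm jt tj]]] := vF; rewrite mul1n => e.
  rewrite (gap _ _ _ jm jt tj e) e; apply/idP/idP => h.
    by have := @mono_le _ j.+1 k.+1 mS h; lia.
  by rewrite ltnNge; apply/negP => h'; have := mono_le mS h'; lia.
case: (leqP i m) => im; first by rewrite key.
rewrite -key //; apply: eq_card => v; rewrite !in_set_.
case vF: (v \in F) => //=; have /lowerP[j [t [jm jt tj]]] := vF; rewrite mul1n => e.
by rewrite (gap _ _ _ jm jt tj e) jm (ltn_trans jm).
Qed.

End Below.

(** * The h-vector of a pure shifted complex *)

Section TopElements.
Variable n : nat.
Implicit Types (A B X : {set 'I_n}).

Definition top_elts k X := [set v in X | #|[set w in X | v < w]| < k].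

Lemma card_top_elts k X : k <= #|X| -> #|top_elts k X| = k.
Proof.
move=> kX; pose r (v : 'I_n) := #|[set w in X | v < w]|.
have r_lt v : v \in X -> r v < #|X|.
  move=> vX; apply: proper_card; apply/properP; split.
    by apply/subsetP => w; rewrite in_set_ => /andP[].
  by exists v; rewrite // in_set_ ltnn andbF.
have r_dec (v w : 'I_n) : w \in X -> v < w -> r w < r v.
  move=> wX vw; apply: proper_card; apply/properP; split.
    by apply/subsetP => u; rewrite !in_set_ => /andP[-> /(ltn_trans vw)].
  by exists w; rewrite in_set_ ?wX ?vw // ltnn andbF.
have r_inj : {in X &, injective r}.
  move=> v w vX wX e; apply: val_inj => /=; case: (ltngtP v w) => // h.
    by have := r_dec _ _ wX h; rewrite e ltnn.
  by have := r_dec _ _ vX h; rewrite e ltnn.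
pose s := [seq r v | v <- enum X].
have us : uniq s.
  by rewrite map_inj_in_uniq ?enum_uniq // => v w; rewrite !mem_enum; apply: r_inj.
have [_ sE] : (size s = size (iota 0 #|X|)) * (s =i iota 0 #|X|).
  apply: uniq_min_size => //; last by rewrite size_iota size_map -cardE.
  by move=> _ /mapP[v + ->]; rewrite mem_enum mem_iota => /r_lt.
have -> : #|top_elts k X| = count (gtn k) s.
  rewrite /s count_map -size_filter cardE; apply/perm_size/uniq_perm.
  - exact: enum_uniq.
  - by rewrite filter_uniq ?enum_uniq.
  by move=> v; rewrite [RHS]mem_filter !mem_enum in_set_ andbC.
have -> : count (gtn k) s = count (gtn k) (iota 0 #|X|).
  by apply/permP/uniq_perm => //; apply: iota_uniq.
have h1 : count (gtn k) (iota 0 k) = k.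
  rewrite -[RHS](size_iota 0) -[RHS]count_predT; apply: eq_in_count => v.
  by rewrite mem_iota /= => ->.
have h2 : count (gtn k) (iota k (#|X| - k)) = 0.
  apply/eqP; rewrite -leqn0 leqNgt -has_count; apply/hasPn => v.
  by rewrite mem_iota /= -leqNgt => /andP[].
by rewrite -{1}(subnKC kX) iotaD count_cat add0n h1 h2 addn0.
Qed.

Lemma top_elts_up k X v w : v \in top_elts k X -> w \in X -> v < w -> w \in top_elts k X.
Proof.
rewrite !in_set_ => /andP[vX vk] wX vw; rewrite wX /=; apply: leq_ltn_trans vk.
by apply/subset_leq_card/subsetP => u; rewrite !in_set_ => /andP[-> /(ltn_trans vw)].
Qed.

Lemma below_top_elts k X B x : k <= #|X| -> B \subset X -> #|B| = k ->
  below (top_elts k X) x <= below B x.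
Proof.
move=> kX BX Bk; case: (boolP [exists v, (v \in top_elts k X) && (v < x)]) => [/existsP[v /andP[vT vx]]|nex].
  rewrite -(leq_add2r #|[set w in B | x <= w]|).
  have split_card (Y : {set 'I_n}) : below Y x + #|[set w in Y | x <= w]| = #|Y|.
    rewrite -(cardsID [set w : 'I_n | w < x] Y); congr (_ + _); apply: eq_card => w; rewrite !inE //.
    by rewrite -leqNgt andbC.
  have -> : below B x + #|[set w in B | x <= w]| = below (top_elts k X) x + #|[set w in top_elts k X | x <= w]|.
    by rewrite !split_card card_top_elts.
  rewrite leq_add2l.
  apply/subset_leq_card/subsetP => w; rewrite !in_set_ => /andP[wB xw]; rewrite xw andbT.
  have := top_elts_up vT (subsetP BX w wB) (leq_trans vx xw).
  by rewrite in_set_.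
suff -> : below (top_elts k X) x = 0 by [].
apply/eqP; rewrite cards_eq0; apply/eqP/setP => w; rewrite in_set_ in_set0.
by move: nex => /existsPn/(_ w)/negPf.
Qed.

End TopElements.

Section PureShifted.
Variables (n m d : nat) (C : {set {set 'I_n}}).
Hypothesis nE : n = m + d.+1.
Hypotheses (Ccplx : simplicial_complex C) (Cshift : shifted C) (Cpure : pure C) (Cdim : dim1 C = d).

Lemma set0_face : set0 \in C.
Proof.
have n0 : 0 < n by rewrite nE addnS.
by have := Ccplx.2 _ set0 (Ccplx.1 (Ordinal n0)) (sub0set _).
Qed.

Lemma face_card F : F \in C -> #|F| <= d.
Proof. by move=> FC; rewrite -Cdim; apply: leq_bigmax_cond. Qed.

Lemma face_sub_facet F : F \in C -> exists G, [/\ G \in C, F \subset G & #|G| = d].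
Proof.
move=> FC; have C0 : 0 < #|C| by apply/card_gt0P; exists F.
have [F1 F1C F1d] := eq_bigmax_cond (fun F : {set 'I_n} => #|F|) C0.
have dF1 : #|F1| = d by rewrite -F1d.
have [G Gmax FG] := maxset_exists (P := fun X => X \in C) FC.
have GC := maxsetp Gmax.
exists G; split=> //; rewrite -dF1; apply: Cpure; rewrite inE //.
apply/maxsetP; split=> // B BC FB; apply/eqP; rewrite eq_sym eqEcard FB /= dF1.
exact: face_card.
Qed.

Definition last_gap_facets i := [set F in C | (#|F| == d) && (cnt F m.+1 == i)].

(** A set of size d has m + 1 gaps, so [run F] is its final run after the last gap. The complex is
    the disjoint union of the intervals from F minus its run to F, over the facets F, and [top]
    sends a face to the facet of its interval. *)
Let run (F : {set 'I_n}) := [set v in F | m < v - below F v].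
Let top (G : {set 'I_n}) := G :|: top_elts (d - #|G|) (~: G).

Lemma card_run (F : {set 'I_n}) : #|F| = d -> #|run F| + cnt F m.+1 = d.
Proof.
move=> Fd; rewrite -[RHS]Fd -(cardsID [set v : 'I_n | v - below F v < m.+1] F) addnC.
congr (_ + _); apply: eq_card => v; rewrite !inE // -leqNgt andbC //.
Qed.

Lemma runP (F : {set 'I_n}) v : #|F| = d -> v \in F -> reflect (forall w : 'I_n, v < w -> w \in F) (v \in run F).
Proof.
move=> Fd vF; rewrite in_set_ vF /=.
have cC : #|~: F| = m.+1 by have := cardsC F; rewrite card_ord Fd; lia.
have bC := below_setC F (ltnW (ltn_ord v)).
have -> : v - below F v = below (~: F) v by lia.
apply: (iffP idP) => [mv w vw|h].
  apply/negPn/negP => wF; have : below (~: F) v < #|~: F|; last by rewrite cC ltnS leqNgt mv.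
  apply: proper_card; apply/properP; split; first by apply/subsetP => u; rewrite in_set_ => /andP[].
  by exists w; rewrite ?in_set_ ?in_setC // [w < v]ltnNge (ltnW vw) andbF.
rewrite -ltnS -cC ltnS; apply/subset_leq_card/subsetP => w; rewrite in_set_ => wF; rewrite wF /=.
case: (ltngtP w v) => // hw; first by move: wF; rewrite in_setC h.
by move: wF; rewrite (val_inj hw) in_setC vF.
Qed.

Lemma compl_size (G : {set 'I_n}) : G \in C -> d - #|G| <= #|~: G|.
Proof. move=> GC; have := cardsC G; rewrite card_ord; move: #|G| #|~: G| => x y; lia. Qed.

Lemma card_top G : G \in C -> #|top G| = d.
Proof.
move=> GC; rewrite cardsU (_ : _ :&: _ = set0).
  by rewrite cards0 subn0 card_top_elts ?compl_size // subnKC // face_card.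
by apply/setP => v; rewrite !inE; case: (v \in G).
Qed.

(** Some facet contains G; trading its vertices outside G for the largest ones available stays in a
    shifted complex. *)
Lemma top_face G : G \in C -> top G \in C.
Proof.
move=> GC; have [F [FC GF Fd]] := face_sub_facet GC.
apply: (shifted_dominance Ccplx Cshift FC); apply: below_cnt => x.
have split_below (Y : {set 'I_n}) : G \subset Y -> below Y x = below G x + below (Y :\: G) x.
  move=> GY; rewrite /below -(cardsID G); congr (_ + _); apply: eq_card => w; rewrite !inE //.
    by case wG: (w \in G); rewrite ?andbF // (subsetP GY _ wG) andbT.
  by rewrite andbA andbAC.
rewrite (split_below F) // (split_below (top G)) ?subsetUl // leq_add2l.
have -> : top G :\: G = top_elts (d - #|G|) (~: G).
  by apply/setP => v; rewrite !inE; case: (v \in G); rewrite ?andbF.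
apply: below_top_elts; first exact: compl_size.
  by apply/subsetP => v; rewrite !inE => /andP[].
by rewrite cardsD (setIidPr GF) Fd.
Qed.

Lemma top_run G : G \in C -> top G :\: G \subset run (top G).
Proof.
move=> GC; apply/subsetP => v; rewrite in_setD => /andP[vG vT].
apply/runP => //; first exact: card_top.
move=> w vw; rewrite in_setU; apply/orP; case: (boolP (w \in G)) => wG; [by left | right].
apply: (top_elts_up (v := v)) => //; last by rewrite in_setC.
by move: vT; rewrite in_setU (negPf vG).
Qed.

Lemma top_setD (F B : {set 'I_n}) : F \in C -> #|F| = d -> B \subset run F -> top (F :\: B) = F.
Proof.
move=> FC Fd BF; have BF' : B \subset F by apply: subset_trans BF _; apply/subsetP => v; rewrite in_set_ => /andP[].
have GC : F :\: B \in C by apply: Ccplx.2 FC _; apply: subsetDl.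
have cG : d - #|F :\: B| = #|B|.
  by rewrite cardsD (setIidPr BF') Fd subKn // -Fd subset_leq_card.
apply/esym/eqP; rewrite eqEcard card_top // Fd leqnn andbT; apply/subsetP => v vF.
rewrite in_setU in_setD vF andbT; case: (boolP (v \in B)) => //= vB.
rewrite in_set_ cG in_setC in_setD vB /=.
have vr : forall w : 'I_n, v < w -> w \in F by apply/runP => //; apply: (subsetP BF).
rewrite (cardsD1 v B) vB add1n ltnS; apply/subset_leq_card/subsetP => w.
rewrite in_set_ in_setC in_setD => /andP[wB vw]; rewrite inE /=.
by move: wB; rewrite in_setD (vr _ vw) andbT negbK -val_eqE /= gtn_eqF.
Qed.

Local Open Scope ring_scope.

Lemma sum_subsets (R : comNzRingType) (A : {set 'I_n}) (x y : R) :
  \sum_(B : {set 'I_n} | B \subset A) x ^+ (#|A| - #|B|) * y ^+ #|B| = (x + y) ^+ #|A|.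
Proof.
rewrite exprDn (partition_big (fun B : {set 'I_n} => inord #|B| : 'I_#|A|.+1) predT) //=.
apply: eq_bigr => k _.
have cB (B : {set 'I_n}) : B \subset A -> (inord #|B| == k) = (#|B| == k :> nat).
  by move=> /subset_leq_card h; rewrite -val_eqE /= inordK // ltnS.
rewrite (eq_bigr (fun=> x ^+ (#|A| - k) * y ^+ k)); last first.
  by move=> B /andP[BA]; rewrite cB // => /eqP ->.
rewrite -cards_draws sumr_const; congr (_ *+ _); apply: eq_card => B; rewrite !inE.
by apply/andP/andP => -[BA]; rewrite cB.
Qed.

(** The left side is the h-polynomial in terms of faces. Over the interval of F it sums to 'X ^ cnt
    F (m + 1) times the power |run F| of 'X + (1 - 'X) = 1. *)
Lemma face_poly :
  \sum_(G in C) 'X ^+ #|G| * (1 - 'X) ^+ (d - #|G|) =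
  \sum_(F in C | #|F| == d) 'X ^+ cnt F m.+1 :> {poly int}.
Proof.
rewrite (partition_big top (fun F => (F \in C) && (#|F| == d))) /=; last first.
  by move=> G GC; rewrite top_face // card_top /=.
apply: eq_bigr => F /andP[FC /eqP Fd].
rewrite (reindex_onto (fun B => F :\: B) (fun G => F :\: G)) /=; last first.
  by move=> G /andP[GC /eqP <-]; rewrite setDDr setDv set0U (setIidPr _) // subsetUl.
rewrite (eq_bigl (fun B : {set 'I_n} => B \subset run F)); last first.
  move=> B; apply/idP/idP => [/andP[/andP[GC /eqP tG] /eqP BE]|BF].
    by have := top_run GC; rewrite tG BE.
  have BF' : B \subset F by apply: subset_trans BF _; apply/subsetP => v; rewrite in_set_ => /andP[].
  rewrite top_setD // eqxx andbT setDDr setDv set0U (setIidPr BF') eqxx andbT.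
  by apply: Ccplx.2 FC _; apply: subsetDl.
have rF : run F \subset F by apply/subsetP => v; rewrite in_set_ => /andP[].
have cr := card_run Fd.
transitivity ('X ^+ cnt F m.+1 * \sum_(B : {set 'I_n} | B \subset run F)
    'X ^+ (#|run F| - #|B|) * (1 - 'X : {poly int}) ^+ #|B|).
  rewrite mulr_sumr; apply: eq_bigr => B BF; rewrite mulrA -exprD.
  have cB := subset_leq_card BF; have -> : #|F :\: B| = (d - #|B|)%N.
    by rewrite cardsD (setIidPr (subset_trans BF rF)) Fd.
  by congr ('X ^+ _ * _ ^+ _); lia.
by rewrite sum_subsets subrKC expr1n mulr1.
Qed.

Lemma coef_1subX (R : comNzRingType) i k :
  ((1 - 'X : {poly R}) ^+ k)`_i = (-1) ^+ i *+ 'C(k, i).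
Proof.
elim: k i => [|k IHk] i; first by rewrite expr0 coef1 bin0n; case: i => //=; rewrite ?expr0 ?mulr0n.
rewrite exprS mulrBl mul1r coefB coefXM IHk; case: i => [|i] /=.
  by rewrite !bin0 subr0.
by rewrite IHk binS mulrnDr exprS mulN1r !mulNrn.
Qed.

Lemma hnum_last_gap i : (i <= d)%N -> hnum C i = #|last_gap_facets i|%:Z.
Proof.
move=> id; have := congr1 (fun p : {poly int} => p`_i) face_poly.
rewrite !coef_sum => e.
have -> : #|last_gap_facets i|%:Z = \sum_(F in C | #|F| == d) ('X ^+ cnt F m.+1 : {poly int})`_i.
  under eq_bigr => F _ do rewrite coefXn.
  rewrite -natr_sum -big_mkcondr sum1_card natz /last_gap_facets; congr (Posz _).
  by apply: eq_card => F; rewrite !inE -[RHS]/((F \in C) && (#|F| == d) && (i == cnt F m.+1)) -andbA [i == _]eq_sym.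
rewrite -e /hnum Cdim (partition_big (fun G : {set 'I_n} => inord #|G| : 'I_d.+1) predT) //=.
have -> : \sum_(j < i.+1) (-1) ^+ (i - j) * ('C(d - j, d - i))%:Z * (fnum C j)%:Z =
    \sum_(j < d.+1 | (j < i.+1)%N) (-1) ^+ (i - j) * ('C(d - j, d - i))%:Z * (fnum C j)%:Z :> int.
  by rewrite (big_ord_widen d.+1 (fun j : nat => (-1) ^+ (i - j) * ('C(d - j, d - i))%:Z * (fnum C j)%:Z)).
rewrite big_mkcond; apply: eq_bigr => j _.
rewrite (eq_bigr (fun=> if (j < i.+1)%N then (-1) ^+ (i - j) * ('C(d - j, d - i))%:Z else 0)); last first.
  move=> G /andP[GC /eqP Gj]; have Gd := face_card GC.
  have {}Gj : #|G| = j :> nat by rewrite -Gj inordK.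
  rewrite coefXnM Gj ltnS ltnNge; case: leqP => //= ji.
  rewrite coef_1subX -mulr_natr natz; congr (_ * Posz _).
  by rewrite -(bin_sub (n := d - j)); [congr 'C(_, _); lia | lia].
rewrite sumr_const; case: ifP => _; last by rewrite mul0rn.
rewrite -mulr_natr natz; congr (_ * Posz _); apply: eq_card => G; rewrite !inE.
rewrite -[RHS]/((G \in C) && (inord #|G| == j)); have [GC|//] := boolP (G \in C).
by rewrite -val_eqE /= inordK // ltnS face_card.
Qed.

End PureShifted.

Local Close Scope ring_scope.

(** * Pure shifted complexes with a symmetric h-vector *)

Section SymmetricHVector.
Variables (n m d : nat) (C : {set {set 'I_n}}).
Hypothesis nE : n = m + d.+1.
Hypothesis d0 : 0 < d.
Hypotheses (Ccplx : simplicial_complex C) (Cshift : shifted C) (Cpure : pure C) (Cdim : dim1 C = d).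
Hypothesis Csym : forall i, i <= d -> hnum C i = hnum C (d - i).
Hypothesis Cbound : forall F, F \in C -> cnt F m + cnt F m.+1 <= d.

Definition face_monomials : {pred 'X_{1..m}} :=
  [pred u : 'X_{1..m} | (2 * mdeg u <= d) && (lower n m 1 (psum u) \in C)].
Local Notation U := face_monomials.

Lemma face_monomialsP u : reflect (2 * mdeg u <= d /\ lower n m 1 (psum u) \in C) (u \in U).
Proof. exact: andP. Qed.

Lemma psum_fit (u : 'X_{1..m}) j : 2 * mdeg u <= d -> j < m -> j + psum u j.+1 <= n.
Proof. by move=> ud jm; have := @psum_le_mdeg m u j.+1; lia. Qed.

Lemma cnt_face (u : 'X_{1..m}) i : 2 * mdeg u <= d -> cnt (lower n m 1 (psum u)) i = psum u i.
Proof.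
move=> ud; rewrite cnt_lower //; last by move=> j; apply: psum_fit.
- by case: (leqP i m) => // im; rewrite !psum_ge // ltnW.
- exact: psum_mono.
exact: psum0.
Qed.

Lemma face_monomials_le (u v : 'X_{1..m}) : u \in U -> (forall i, psum v i <= psum u i) -> v \in U.
Proof.
move=> /face_monomialsP[ud uC] vu; have vd : 2 * mdeg v <= d.
  by apply: leq_trans ud; rewrite leq_mul2l -!(psum_ge _ (leqnn m)) vu.
apply/face_monomialsP; split=> //; apply: (shifted_dominance Ccplx Cshift uC) => i.
by rewrite !cnt_face.
Qed.

Lemma face_monomials_ideal : shifted_order_ideal U.
Proof.
split.
- apply/face_monomialsP; rewrite mdeg0; split=> //.
  suff -> : lower n m 1 (psum (0%MM : 'X_{1..m})) = set0 by apply: (set0_face nE).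
  apply/setP => v; rewrite in_set0; apply/negP => /lowerP[i [t [_ it ti _]]].
  by move: ti; rewrite /psum big1 ?ltn0 // => j _; rewrite mnm0E.
- move=> i; have im : i < n by have := ltn_ord i; lia.
  have lE : lower n m 1 (psum U_(i)%MM) = [set Ordinal im].
    apply/setP => v; rewrite in_set1; apply/lowerP/eqP => [[j [t [jm jt tj vE]]]|->].
      by apply: val_inj => /=; move: jt tj; rewrite !psumU vE; case: (ltngtP i j) => /=; lia.
    by exists i, 0; rewrite !psumU ltnn ltnSn; split=> //=; lia.
  have vC := Ccplx.1 (Ordinal im); apply/face_monomialsP; rewrite mdeg1 lE; split=> //.
  have := Cbound vC; have m0 : 0 < m by apply: leq_ltn_trans (ltn_ord i).
  have d1 : 1 <= d by [].
  have c1 k : 0 < k -> i < k -> cnt [set Ordinal im] k = 1.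
    move=> k0 ik; rewrite -(cards1 (Ordinal im)); apply: eq_card => v; rewrite in_set_ in_set1.
    by case: eqP => //= ->; apply: leq_ltn_trans ik; rewrite leq_subr.
  by rewrite !c1 // ?ltnS ?(ltnW (ltn_ord i)).
- move=> u v uU vu; apply: (face_monomials_le uU) => i; apply: leq_sum => j _.
  by move: vu => /mnm_lepP.
move=> u i j uU ij; apply: (face_monomials_le uU) => k; rewrite !psumD !psumU leq_add2l.
by case: (ltnP j k) => // jk; rewrite (ltn_trans ij jk).
Qed.

(* The facet of a shifted complex whose part before the gap of index m - 1 is
   Phi(u), and which has k elements before its last gap. *)
Definition facet_sums (u : 'X_{1..m}) k j := if j <= m then psum u j else if j == m.+1 then k else d.
Definition shifted_facet u k := lower n m.+2 1 (facet_sums u k).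

Lemma cnt_shifted_facet u k i : mdeg u <= k <= d ->
  cnt (shifted_facet u k) i = facet_sums u k (minn i m.+2).
Proof.
move=> /andP[uk kd]; apply: cnt_lower.
- move=> j; rewrite /facet_sums eqSS; case: (ltngtP j m) => jm /=.
  + by rewrite psum_mono.
  + by case: (_ == _).
  by rewrite jm psum_ge.
- by rewrite /facet_sums /= psum0.
move=> j jm; rewrite /facet_sums eqSS; case: (ltngtP j m) => h /=; try lia.
by have := @psum_le_mdeg m u j.+1; lia.
Qed.

Lemma facet_sums_lt u k j : j <= m -> facet_sums u k j = psum u j.
Proof. by rewrite /facet_sums => ->. Qed.

Lemma facet_sums_m1 u k : facet_sums u k m.+1 = k.
Proof. by rewrite /facet_sums ltnn eqxx. Qed.

Lemma facet_sums_m2 u k : facet_sums u k m.+2 = d.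
Proof. by rewrite /facet_sums !ifF //; [rewrite gtn_eqF | rewrite leqNgt ltnS leqnSn]. Qed.

Lemma card_shifted_facet u k : mdeg u <= k <= d -> #|shifted_facet u k| = d.
Proof.
move=> ukd; rewrite -(cnt_full (shifted_facet u k) (leqnn n)) cnt_shifted_facet //.
by rewrite (minn_idPr _) ?facet_sums_m2 // nE; lia.
Qed.

Lemma cnt_facet (F : {set 'I_n}) i : #|F| = d -> m.+1 < i -> cnt F i = d.
Proof. by move=> Fd im; rewrite cnt_ge // Fd nE; lia. Qed.

Definition cnt_mnm (F : {set 'I_n}) := mnm_of m (cnt F).

Lemma psum_cnt_mnm F i : i <= m -> psum (cnt_mnm F) i = cnt F i.
Proof. by move=> im; rewrite psum_mnm_of ?cnt0 //; apply: cnt_mono. Qed.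

Lemma mdeg_cnt_mnm F : mdeg (cnt_mnm F) = cnt F m.
Proof. by rewrite mdeg_mnm_of ?cnt0 //; apply: cnt_mono. Qed.

Lemma shifted_facetK (F : {set 'I_n}) k : #|F| = d -> cnt F m.+1 = k -> shifted_facet (cnt_mnm F) k = F.
Proof.
move=> Fd Fk; have ukd : mdeg (cnt_mnm F) <= k <= d.
  by rewrite mdeg_cnt_mnm -Fk cnt_mono -Fd cnt_le_card.
apply: cnt_inj => i; rewrite cnt_shifted_facet //.
case: (ltngtP i m.+1) => im.
- have -> : minn i m.+2 = i by lia.
  by rewrite facet_sums_lt ?psum_cnt_mnm.
- by rewrite (minn_idPr _) // facet_sums_m2 cnt_facet.
by rewrite im (minn_idPl _) // facet_sums_m1.
Qed.

Local Notation T := 'X_{1..m < d.+2}.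

Let facet_mnms k := [set u : T | (mdeg u <= k) && (shifted_facet u k \in C)].

Lemma card_facet_mnms k : k <= d -> #|facet_mnms k| = #|last_gap_facets m d C k|.
Proof.
move=> kd; have inj : {in facet_mnms k &, injective (fun u : T => shifted_facet u k)}.
  move=> u v; rewrite !inE => /andP[uk _] /andP[vk _] uv; apply: val_inj => /=.
  apply: psum_inj => i im; have := congr1 (fun F => cnt F i) uv.
  by rewrite !cnt_shifted_facet ?kd ?andbT // (minn_idPl _) ?facet_sums_lt // ltnW // ltnS ltnW.
rewrite -(card_in_imset inj); apply: eq_card => F.
apply/imsetP/idP => [[u + ->]|].
  rewrite inE => /andP[uk uC]; rewrite inE uC card_shifted_facet ?uk // eqxx /=.
  by rewrite cnt_shifted_facet ?uk // (minn_idPl _) ?facet_sums_m1.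
rewrite inE => /and3P[FC /eqP Fd /eqP Fk].
have ud : mdeg (cnt_mnm F) < d.+2.
  by rewrite mdeg_cnt_mnm !ltnS (leq_trans (cnt_le_card _ _)) // Fd leqnSn.
exists (BMultinom ud); last by rewrite /= shifted_facetK.
by rewrite inE /= shifted_facetK // FC mdeg_cnt_mnm -Fk cnt_mono.
Qed.

(** For k = d - i the bound on [cnt] forces deg u <= i, and lowering k to i stays in C by
    shiftedness. This inclusion is an equality, because h_(d-i) = h_i counts both sides. *)
Lemma facet_mnms_sym i : 2 * i <= d -> facet_mnms (d - i) = facet_mnms i.
Proof.
move=> i2; have id : i <= d by lia.
apply/eqP; rewrite eqEcard; apply/andP; split; last first.
  rewrite !card_facet_mnms ?leq_subr //.
  have := Csym id; rewrite !(hnum_last_gap nE) ?leq_subr // => -[->] //.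
apply/subsetP => u; rewrite !inE => /andP[ud uC].
have ud' : mdeg u <= d - i <= d by rewrite ud leq_subr.
have := Cbound uC; rewrite !cnt_shifted_facet // !(minn_idPl _) //; last by lia.
rewrite facet_sums_m1 facet_sums_lt // psum_ge // => h.
have ui : mdeg u <= i by lia.
rewrite ui; apply: (shifted_dominance Ccplx Cshift uC) => k.
rewrite !cnt_shifted_facet ?ui // /facet_sums; case: ifP => // _; case: ifP => // _.
by lia.
Qed.

(** For k = deg u the shifted facet is dominated by any facet containing Phi(u); the symmetry then
    gives k = d - deg u. *)
Lemma long_facet u : u \in U -> shifted_facet u (d - mdeg u) \in C.
Proof.
move=> uU; have /face_monomialsP[u2 uC] := uU.
have ud : mdeg u < d.+2 by lia.
have : BMultinom ud \in facet_mnms (mdeg u).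
  rewrite inE leqnn /=; have [F [FC uF Fd]] := face_sub_facet Cpure Cdim uC.
  apply: (shifted_dominance Ccplx Cshift FC) => i.
  have ukd : mdeg u <= mdeg u <= d by rewrite leqnn; lia.
  rewrite cnt_shifted_facet //; case: (ltngtP i m.+2) => im.
  - apply: leq_trans (cnt_sub uF i).
    rewrite cnt_face //; case: (ltngtP i m.+1) => im1; [|lia|].
      by rewrite facet_sums_lt.
    by rewrite im1 facet_sums_m1 psum_ge.
  - by rewrite facet_sums_m2 cnt_facet // ltnW.
  by rewrite im facet_sums_m2 cnt_facet.
by rewrite -facet_mnms_sym // inE => /andP[].
Qed.

(** A set with these two properties is dominated by the long facet of the monomial read off from its
    own [cnt]. *)
Theorem faceP F : reflect (psum_below U (cnt F) /\ cnt F m + cnt F m.+1 <= d) (F \in C).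
Proof.
have cm := @cnt_mono _ F; have c0 := @cnt0 _ F.
apply: (iffP idP) => [FC|[Fbelow Fd]].
  split; last exact: Cbound.
  have := Cbound FC => Fd; have ud : 2 * mdeg (cnt_mnm F) <= d.
    by rewrite mdeg_cnt_mnm; have := cm m; lia.
  exists (cnt_mnm F); last by move=> i im; rewrite psum_cnt_mnm.
  apply/face_monomialsP; split=> //; apply: (shifted_dominance Ccplx Cshift FC) => i.
  rewrite cnt_face //; case: (leqP i m) => im; first by rewrite psum_cnt_mnm.
  by rewrite psum_ge ?(ltnW im) // mdeg_cnt_mnm (mono_le cm (ltnW im)).
have uU : cnt_mnm F \in U by apply: psum_below_mem Fbelow; rewrite ?cnt0 //; apply: face_monomials_ideal.
have ukd : mdeg (cnt_mnm F) <= d - mdeg (cnt_mnm F) <= d.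
  by rewrite leq_subr andbT mdeg_cnt_mnm; have := cm m; lia.
have cF : #|F| <= d.
  rewrite leqNgt; apply/negP => dF; have : cnt F m.+1 = #|F| by apply: cnt_ge; lia.
  by lia.
apply: (shifted_dominance Ccplx Cshift (long_facet uU)) => i.
rewrite cnt_shifted_facet //; case: (ltngtP i m.+1) => im.
- have -> : minn i m.+2 = i by lia.
  by rewrite facet_sums_lt ?psum_cnt_mnm.
- by rewrite (minn_idPr _) // facet_sums_m2 (leq_trans (cnt_le_card _ _)).
by rewrite im (minn_idPl _) // facet_sums_m1 mdeg_cnt_mnm; lia.
Qed.

End SymmetricHVector.

(** * Triangular evaluation matrices *)

Section LowerSets.
Variable n : nat.

Lemma lower_ungap_refl m m' S : mono S -> lower n m' 2 S \subset ungap n m S.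
Proof.
move=> mS; apply/subsetP => v /lowerP[j [t [_ jt tj vE]]]; apply/ungapP => i _.
rewrite vE; apply/eqP => e; case: (ltngtP i j) => ij.
- by have := mono_le mS ij; lia.
- by have := mono_le mS ij; have := mS i; lia.
by rewrite ij in e; lia.
Qed.

Lemma card_lower m q S : 0 < q -> mono S -> S 0 = 0 ->
  (forall i t, i < m -> t < S i.+1 -> i + q * t < n) -> #|lower n m q S| = S m.
Proof.
move=> q0 mS S0 fit; pose u := mnm_of m S; pose idx t := nth 0 (mindices u) t.
have uE := psum_mnm_of mS S0; have ud : mdeg u = S m by apply: mdeg_mnm_of.
have idx_lt t : t < S m -> idx t < m.
  by move=> tm; rewrite /idx nth_mindices_lt ?ud // psum_ge ?ud.
have idx_ge t i : t < S m -> i <= m -> (i <= idx t) = (S i <= t).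
  by move=> tm im; rewrite leqNgt [RHS]leqNgt /idx nth_mindices_lt ?ud // uE.
have idxP t : t < S m -> S (idx t) <= t < S (idx t).+1.
  move=> tm; have im := idx_lt _ tm.
  by rewrite -idx_ge ?leqnn ?(ltnW im) //= ltnNge -idx_ge // ltnn.
have fit' (t : 'I_(S m)) : idx t + q * t < n.
  by apply: fit; [apply: idx_lt | have /andP[] := idxP _ (ltn_ord t)].
have idx_mono t t' : t < S m -> t' < S m -> t <= t' -> idx t <= idx t'.
  move=> tm tm' tt; rewrite idx_ge ?(ltnW (idx_lt _ tm)) //.
  by have /andP[h _] := idxP _ tm; apply: leq_trans tt.
have inj : injective (fun t : 'I_(S m) => Ordinal (fit' t)).
  move=> t t' /(congr1 val) /= e; apply: val_inj => /=.
  have h1 := idx_mono _ _ (ltn_ord t) (ltn_ord t').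
  have h2 := idx_mono _ _ (ltn_ord t') (ltn_ord t).
  case: (ltngtP t t') => // tt; exfalso.
    by have := h1 (ltnW tt); have := leq_mul (leqnn q) tt; rewrite mulnS; lia.
  by have := h2 (ltnW tt); have := leq_mul (leqnn q) tt; rewrite mulnS; lia.
rewrite -[RHS]card_ord -(card_imset predT inj); apply: eq_card => v.
apply/lowerP/imsetP => [[i [t [im it ti vE]]]|[t _ ->]].
  have tm : t < S m by apply: leq_trans ti _; apply: mono_le.
  exists (Ordinal tm) => //; apply: val_inj; rewrite /= vE; congr (_ + _).
  by rewrite /idx (nth_mindices (i := i)) // !uE // ltnW.
exists (idx t), t; have /andP[h1 h2] := idxP _ (ltn_ord t); split=> //.
exact: idx_lt.
Qed.

End LowerSets.

Local Open Scope ring_scope.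

Section LinearDependence.
Variable K : fieldType.

Lemma lin_dep (T M : finType) (B : {set M}) (W : T -> M -> K) : (#|B| < #|T|)%N ->
  exists x : T -> K, (exists s, x s != 0) /\ forall b, b \in B -> \sum_s x s * W s b = 0.
Proof.
move=> BT; pose A : 'M[K]_(#|T|, #|B|) := \matrix_(i, j) W (enum_val i) (enum_val j).
have : kermx A != 0.
  rewrite -mxrank_eq0 mxrank_ker subn_eq0 -ltnNge.
  exact: leq_ltn_trans (rank_leq_col A) BT.
case/rowV0Pn => y /sub_kermxP yA y0; exists (fun s => y 0 (enum_rank s)); split.
  apply: contrapT => h; case/eqP: y0; apply/rowP => j; rewrite mxE.
  apply/eqP/negPn/negP => yj; apply: h; exists (enum_val j).
  by rewrite enum_valK.
move=> b bB; have := congr1 (fun v : 'rV_ _ => v 0 (enum_rank_in bB b)) yA.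
rewrite !mxE => yAb; rewrite -[RHS]yAb (reindex (@enum_val T predT)) /=; last first.
  by exists enum_rank => s _; rewrite ?enum_valK ?enum_rankK.
apply: eq_bigr => s _; rewrite enum_valK !mxE enum_rankK_in //.
Qed.

Section SpanCount.
Variables (M T : finType) (lt : rel M) (B : {set M}) (ev : M -> T -> K).
Variables (z : T -> M -> K) (key : T -> nat).
Hypothesis lt_irr : irreflexive lt.
Hypothesis lt_trans : transitive lt.
Hypothesis evB : forall b, b \notin B ->
  exists c : M -> K, forall t, ev b t = \sum_(b' | lt b' b) c b' * ev b' t.
Hypothesis diag : forall s, \sum_b z s b * ev b s != 0.
Hypothesis tri : forall s t, s != t -> \sum_b z s b * ev b t != 0 -> (key s < key t)%N.

Lemma ev_span : exists c : M -> M -> K, forall b t, ev b t = \sum_(b' in B) c b b' * ev b' t.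
Proof.
suff h b : exists c : M -> K, forall t, ev b t = \sum_(b' in B) c b' * ev b' t.
  by have [c cE] := choice h; exists c.
have [N] := ubnP #|[set b' | lt b' b]|; elim: N b => // N IHN b; rewrite ltnS => bN.
have [bB|/evB[c cE]] := boolP (b \in B).
  exists (fun b' => (b' == b)%:R) => t; rewrite (bigD1 b) //= eqxx mul1r big1 ?addr0 //.
  by move=> b' /andP[_ /negPf ->]; rewrite mul0r.
have {}IHN b' : exists c' : M -> K, lt b' b -> forall t, ev b' t = \sum_(b'' in B) c' b'' * ev b'' t.
  have [bb|nbb] := boolP (lt b' b); last by exists (fun=> 0).
  have [|c' c'E] := IHN b'; last by exists c'.
  apply: leq_trans bN; apply: proper_card; apply/properP; split.
    by apply/subsetP => x; rewrite !in_set => /lt_trans; apply.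
  by exists b'; rewrite in_set ?bb // lt_irr.
have [C CE] := choice IHN; exists (fun b'' => \sum_(b' | lt b' b) c b' * C b' b'') => t.
rewrite cE; under eq_bigr => b' bb do rewrite (CE _ bb) mulr_sumr.
rewrite exchange_big /=; apply: eq_bigr => b'' _; rewrite mulr_suml.
by apply: eq_bigr => b' _; rewrite mulrA.
Qed.

(** The evaluations of B span, so |B| < |T| would give a nontrivial combination of the z s that
    vanishes at every point. At the point s of least key among the nonzero coefficients only the
    diagonal term survives. *)
Theorem span_count : (#|T| <= #|B|)%N.
Proof.
have [C CE] := ev_span; rewrite leqNgt; apply/negP => BT.
have [x [[s0 xs0] xB]] := lin_dep (fun s b => \sum_b' z s b' * C b' b) BT.
have x0 t : \sum_s x s * \sum_b z s b * ev b t = 0.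
  transitivity (\sum_(b in B) (\sum_s x s * \sum_b' z s b' * C b' b) * ev b t); last first.
    by rewrite big1 // => b /xB ->; rewrite mul0r.
  under [RHS]eq_bigr => b _ do rewrite mulr_suml.
  rewrite [RHS]exchange_big /=; apply: eq_bigr => s _.
  under [RHS]eq_bigr => b _ do rewrite -mulrA.
  rewrite -mulr_sumr; congr (_ * _).
  under [RHS]eq_bigr => b _ do rewrite mulr_suml.
  rewrite [RHS]exchange_big /=; apply: eq_bigr => b' _; rewrite CE mulr_sumr.
  by apply: eq_bigr => b _; rewrite mulrA.
have [s xs smin] := arg_minnP (P := fun s => x s != 0) key xs0.
have := x0 s; rewrite (bigD1 s) //= [X in _ + X]big1 ?addr0 => [/eqP|s' s's].
  by rewrite mulf_eq0 (negPf xs) (negPf (diag s)).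
have [xs'|/negbNE/eqP->] := boolP (x s' != 0); last by rewrite mul0r.
apply/eqP; rewrite mulf_eq0 (negPf xs') /=; apply/negPn/negP => /(tri s's).
by rewrite ltnNge smin.
Qed.

End SpanCount.
End LinearDependence.

(** * Matrices with nonvanishing minors in the first rows *)

Section Minors.
Variables (K : fieldType) (n : nat).
Implicit Types (A : 'M[K]_n) (P : {set 'I_n}) (x y : 'I_n -> K).

Lemma card_set_ord P : (#|P| <= n)%N.
Proof. by rewrite -[X in (_ <= X)%N]card_ord max_card. Qed.

(** Nonsingularity, for every P, of the submatrix on the first |P| rows and the columns in P, stated
    as injectivity so that it applies directly to points and forms. *)
Definition minors A := forall P x, (forall i : 'I_n, (#|P| <= i)%N -> x i = 0) ->
  (forall p, p \in P -> \sum_i x i * A i p = 0) -> forall i, x i = 0.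

Lemma minors_generic : exists2 p : {mpoly K[n * n]}, p != 0 &
  forall A, p.@[fun k => mxvec A 0 k] != 0 -> minors A.
Proof.
pose W P : 'M[{mpoly K[n * n]}]_#|P| :=
  \matrix_(i, l) 'X_(mxvec_index (widen_ord (card_set_ord P) i) (enum_val l)).
pose N A P : 'M[K]_#|P| := \matrix_(i, l) A (widen_ord (card_set_ord P) i) (enum_val l).
have WE A P : (\det (W P)).@[fun k => mxvec A 0 k] = \det (N A P).
  rewrite -det_map_mx; congr (\det _); apply/matrixP => i j.
  by rewrite !mxE -[RHS](mxvecE A); apply: mevalXU.
exists (\prod_P \det (W P)).
  apply/prodf_neq0 => P _; apply/eqP.
  (* Unit vectors in the columns of P make this minor the identity, so it is not the zero
     polynomial. *)
  pose A : 'M[K]_n := \matrix_(r, p) (val r == index p (enum P))%:R.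
  move=> /(congr1 (meval (fun k => mxvec A 0 k))).
  rewrite WE meval0 (_ : N A P = 1%:M) ?det1; first exact/eqP/oner_neq0.
  apply/matrixP => i l; rewrite !mxE /= (enum_val_nth (enum_val l)) index_uniq ?enum_uniq //.
  by rewrite -cardE.
move=> A; rewrite rmorph_prod => /prodf_neq0 nz P x x0 xP i.
case: (leqP #|P| i) => [/x0 //|iP].
have Nu : N A P \in unitmx by rewrite unitmxE unitfE -WE nz.
pose xr : 'rV[K]_#|P| := \row_j x (widen_ord (card_set_ord P) j).
have xN : xr *m N A P = 0.
  apply/rowP => l; rewrite !mxE -[RHS](xP (enum_val l)) ?enum_valP //.
  rewrite [RHS](bigID (fun i : 'I_n => i < #|P|)%N) /= [X in _ = _ + X]big1 ?addr0; last first.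
    by move=> j; rewrite -leqNgt => /x0 ->; rewrite mul0r.
  rewrite (big_ord_narrow (card_set_ord P)) /=.
  by apply: eq_bigr => j _; rewrite !mxE.
have : xr = 0 by rewrite -[xr](mulmxK Nu) xN mul0mx.
move=> /rowP/(_ (Ordinal iP)); rewrite !mxE => <-; congr x; exact: val_inj.
Qed.

Lemma minors_solve A P y : minors A -> exists x, (forall i : 'I_n, (#|P| <= i)%N -> x i = 0) /\
  forall p, p \in P -> \sum_i x i * A i p = y p.
Proof.
move=> mA; pose W (s : option 'I_#|P|) (p : 'I_n) :=
  if s is Some i then A (widen_ord (card_set_ord P) i) p else - y p.
have [|c [[s0 cs0] cP]] := @lin_dep K _ _ P W; first by rewrite card_option card_ord.
pose x (i : 'I_n) := if insub (val i) is Some j then c (Some (j : 'I_#|P|)) else 0.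
have xge (i : 'I_n) : (#|P| <= i)%N -> x i = 0 by move=> iP; rewrite /x insubF // ltnNge iP.
have xE (j : 'I_#|P|) : x (widen_ord (card_set_ord P) j) = c (Some j) by rewrite /x /= valK.
have xP p : p \in P -> \sum_i x i * A i p = c None * y p.
  move=> /cP; rewrite (bigD1 None) //= mulrN => /eqP; rewrite addrC addr_eq0 opprK => /eqP <-.
  rewrite (bigID (fun i : 'I_n => i < #|P|)%N) /= [X in _ + X]big1 ?addr0; last first.
    by move=> j; rewrite -leqNgt => /xge ->; rewrite mul0r.
  rewrite (big_ord_narrow (card_set_ord P)) /=.
  rewrite [RHS](reindex_omap Some id) /=; last by case.
  rewrite [RHS](eq_bigl predT) => [|j]; last by rewrite /= eqxx.
  by apply: eq_bigr => j _; rewrite xE.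
have c0 : c None != 0.
  apply/eqP => c0; have x0 := mA P x xge.
  have {}x0 : forall i, x i = 0 by apply: x0 => p /xP ->; rewrite c0 mul0r.
  case: s0 cs0 => [j|]; last by rewrite c0 eqxx.
  by rewrite -xE x0 eqxx.
exists (fun i => x i / c None); split=> [i /xge ->|p pP]; first by rewrite mul0r.
under eq_bigr => i _ do rewrite mulrAC.
by rewrite -mulr_suml xP // mulrAC mulfV // mul1r.
Qed.

End Minors.

Local Close Scope ring_scope.

(** * Symmetric algebraic shifting *)

Section RevlexOrder.
Variable n : nat.
Implicit Types (u v w : 'X_{1..n}).

Lemma revlex_split u v : u != v -> exists i : 'I_n, u i != v i /\ forall j : 'I_n, i < j -> u j = v j.
Proof.
move=> uv; have [i0 i0P] : exists i : 'I_n, u i != v i.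
  apply: contrapT => h; case/eqP: uv; apply/mnmP => i.
  by apply/eqP/negPn/negP => ui; apply: h; exists i.
have [i ui imax] := arg_maxnP (P := fun i => u i != v i) val i0P.
by exists i; split=> // j ij; apply/eqP; apply: contraLR ij => /imax; rewrite -leqNgt.
Qed.

Lemma revlexP u v : mdeg u = mdeg v -> reflect
  (exists i : 'I_n, v i < u i /\ forall j : 'I_n, i < j -> u j = v j) (revlex_lt u v).
Proof.
move=> uv; rewrite /revlex_lt uv ltnn eqxx /=; apply: (iffP existsP) => -[i].
  by case/andP=> vu /forall_inP h; exists i; split=> // j /h/eqP.
by case=> vu h; exists i; rewrite vu; apply/forall_inP => j /h/eqP.
Qed.

Lemma revlex_irr : irreflexive (@revlex_lt n).
Proof.
move=> u; apply/negP => /(revlexP (erefl (mdeg u)))[i].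
by rewrite ltnn => -[].
Qed.

Lemma revlex_deg u v : revlex_lt u v -> mdeg u <= mdeg v.
Proof. by rewrite /revlex_lt => /orP[/ltnW|/andP[/eqP-> _]]. Qed.

Lemma revlex_trans : transitive (@revlex_lt n).
Proof.
move=> v u w uv vw; have := revlex_deg uv; rewrite leq_eqVlt => /predU1P[e1|lt1]; last first.
  by rewrite /revlex_lt (leq_trans lt1 (revlex_deg vw)).
have := revlex_deg vw; rewrite leq_eqVlt => /predU1P[e2|lt2]; last first.
  by rewrite /revlex_lt e1 lt2.
have /(revlexP e1)[i [ui uj]] := uv; have /(revlexP e2)[k [vk vj]] := vw.
apply/(revlexP (etrans e1 e2)); case: (ltngtP i k) => ik.
- by exists k; rewrite uj //; split=> // j kj; rewrite uj ?vj // (ltn_trans ik).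
- by exists i; rewrite -vj //; split=> // j ij; rewrite uj ?vj // (ltn_trans ik).
exists i; split; last by move=> j ij; rewrite uj // vj // -ik.
by apply: leq_ltn_trans ui; rewrite (val_inj ik) ltnW.
Qed.

Lemma revlex_total u v : u != v -> mdeg u = mdeg v -> revlex_lt u v || revlex_lt v u.
Proof.
move=> uv e; have [i [ui uj]] := revlex_split uv; move: ui; rewrite neq_ltn => /orP[] h.
  by apply/orP; right; apply/(revlexP (esym e)); exists i; split=> // j /uj.
by apply/orP; left; apply/(revlexP e); exists i.
Qed.

Lemma psum_eq_above u v (i : 'I_n) : mdeg u = mdeg v -> (forall j : 'I_n, i < j -> u j = v j) ->
  psum u i.+1 = psum v i.+1.
Proof.
move=> e uv; have split w : mdeg w = psum w i.+1 + \sum_(j < n | i < j) w j.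
  rewrite mdegE (bigID (fun j : 'I_n => j < i.+1)) /=; congr (_ + _).
  by apply: eq_bigl => j; rewrite -leqNgt.
by move: e; rewrite !split (eq_bigr _ uv) => /addIn.
Qed.

End RevlexOrder.

Local Open Scope ring_scope.

Section IdealGen.
Variable R : pzRingType.
Implicit Types (S : R -> Prop).

Lemma ideal_gen0 S : ideal_gen S 0.
Proof. by exists [::]; rewrite ?big_nil. Qed.

Lemma ideal_genD S f g : ideal_gen S f -> ideal_gen S g -> ideal_gen S (f + g).
Proof.
move=> [s sS ->] [s' sS' ->]; exists (s ++ s'); rewrite ?big_cat //.
by move=> t; rewrite mem_cat => /orP[/sS|/sS'].
Qed.

Lemma ideal_genM S a f b : ideal_gen S f -> ideal_gen S (a * f * b).
Proof.
move=> [s sS ->]; exists [seq (a * t.1.1, t.1.2, t.2 * b) | t <- s].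
  by move=> _ /mapP[t /sS tS ->].
rewrite big_map mulr_sumr mulr_suml; apply: eq_bigr => t _ /=.
by rewrite !mulrA.
Qed.

Lemma ideal_gen_mem S f : S f -> ideal_gen S f.
Proof.
move=> Sf; exists [:: (1, f, 1)]; last by rewrite big_seq1 /= mul1r mulr1.
by move=> t; rewrite inE => /eqP ->.
Qed.

Lemma ideal_gen_sum S (I : Type) (r : seq I) (P : pred I) (F : I -> R) :
  (forall i, P i -> ideal_gen S (F i)) -> ideal_gen S (\sum_(i <- r | P i) F i).
Proof.
by move=> h; elim/big_ind: _ => //; [apply: ideal_gen0 | apply: ideal_genD].
Qed.

Lemma ideal_gen_ind S (P : R -> Prop) f : P 0 -> (forall x y, P x -> P y -> P (x + y)) ->
  (forall a x b, S x -> P (a * x * b)) -> ideal_gen S f -> P f.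
Proof.
move=> P0 PD PS [s sS ->]; rewrite big_seq; elim/big_ind: _ => // t /sS; exact: PS.
Qed.

Lemma ideal_gen_sub S T f : (forall x, S x -> ideal_gen T x) -> ideal_gen S f -> ideal_gen T f.
Proof.
move=> ST; apply: (ideal_gen_ind (P := ideal_gen T)); [exact: ideal_gen0 | by move=> *; apply: ideal_genD |].
by move=> a x b /ST; apply: ideal_genM.
Qed.

End IdealGen.

Section SymMap.
Variables (K : fieldType) (n : nat).
Implicit Types (A B : 'M[K]_n) (f g : {mpoly K[n]}) (a : 'I_n -> K).

Definition lin_form (v : 'rV[K]_n) : {mpoly K[n]} := \sum_i v 0 i *: 'X_i.

Lemma lin_formP (a : K) u v : lin_form (a *: u + v) = a *: lin_form u + lin_form v.
Proof.
rewrite /lin_form scaler_sumr -big_split; apply: eq_bigr => i _ /=.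
by rewrite !mxE scalerDl scalerA.
Qed.

Lemma lin_form_delta (i : 'I_n) : lin_form (delta_mx 0 i) = 'X_i.
Proof.
rewrite /lin_form (bigD1 i) //= mxE !eqxx scale1r big1 ?addr0 // => j /negPf ji.
by rewrite mxE ji andbF scale0r.
Qed.

Lemma sym_mapX A (j : 'I_n) : sym_map A 'X_j = \sum_i A i j *: 'X_i.
Proof. by rewrite /sym_map comp_mpolyXU -tnth_nth tnth_mktuple. Qed.

Lemma sym_mapM A f g : sym_map A (f * g) = sym_map A f * sym_map A g.
Proof. exact: rmorphM. Qed.

Lemma sym_map_lin A v : sym_map A (lin_form v) = lin_form (v *m A^T).
Proof.
rewrite /lin_form [LHS]raddf_sum.
transitivity (\sum_j v 0 j *: \sum_i A i j *: 'X_i : {mpoly K[n]}).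
  by apply: eq_bigr => j _; rewrite -sym_mapX; apply: comp_mpolyZ.
under eq_bigr => j _ do rewrite scaler_sumr.
rewrite exchange_big; apply: eq_bigr => i _ /=; rewrite mxE scaler_suml.
by apply: eq_bigr => j _; rewrite scalerA mxE.
Qed.

Lemma sym_map_comp A B f : sym_map A (sym_map B f) = sym_map (A *m B) f.
Proof.
rewrite {1}/sym_map [sym_map B f]comp_mpolyEX [RHS]comp_mpolyEX raddf_sum /=.
apply: eq_bigr => u _; rewrite linearZ /=; congr (_ *: _).
rewrite !comp_mpolyX rmorph_prod; apply: eq_bigr => j _ /=.
rewrite rmorphXn; congr (_ ^+ _); rewrite !tnth_mktuple.
rewrite -[LHS]/(sym_map A (\sum_i B i j *: 'X_i)).
have -> : \sum_i B i j *: 'X_i = lin_form (row j B^T) by apply: eq_bigr => i _; rewrite !mxE.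
rewrite sym_map_lin -row_mul -trmx_mul.
by apply: eq_bigr => i _; rewrite !mxE.
Qed.

Lemma sym_map1 f : sym_map 1%:M f = f.
Proof.
rewrite /sym_map -[RHS]comp_mpoly_id; congr (f \mPo _); apply: eq_from_tnth => j.
rewrite !tnth_mktuple (bigD1 j) //= mxE eqxx scale1r big1 ?addr0 // => i /negPf ij.
by rewrite mxE ij scale0r.
Qed.

Lemma meval_sym_map A f a : (sym_map A f).@[a] = f.@[fun j => \sum_i a i * A i j].
Proof.
rewrite comp_mpoly_meval; apply: meval_eq => j; rewrite tnth_mktuple raddf_sum /=.
by apply: eq_bigr => i _; rewrite mevalZ mevalXU mulrC.
Qed.

Lemma sr_ideal_meval (C : {set {set 'I_n}}) f a : (forall F G : {set 'I_n}, F \in C -> G \subset F -> G \in C) ->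
  [set j | a j != 0] \in C -> sr_ideal C f -> f.@[a] = 0.
Proof.
move=> Csub aC; apply: (ideal_gen_ind (P := fun f => f.@[a] = 0)); first exact: meval0.
  by move=> x y; rewrite mevalD => -> ->; rewrite addr0.
move=> p x q [F FC ->]; rewrite !mevalM mevalX.
suff [j jF aj] : exists2 j, j \in F & a j = 0.
  by rewrite (bigD1 j) //= mnmE jF aj expr1 mul0r mulr0 mul0r.
apply: contrapT => h; case/negP: FC; apply: Csub aC _; apply/subsetP => j jF.
by rewrite inE; apply/eqP => aj; apply: h; exists j.
Qed.

End SymMap.

(** * Leading monomials from the Lefschetz property *)

Section SymBlock.
Variables (K : fieldType) (n m d : nat) (US : (nat -> nat) -> Prop) (C : {set {set 'I_n}}).
Hypothesis Kinf : infinite_type K.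
Hypothesis nE : n = (m + d.+1)%N.
Hypothesis US_le : forall S S', (forall i, i <= m -> S' i <= S i)%N -> US S -> US S'.
Hypothesis US_deg : forall S, US S -> (2 * S m <= d.+1)%N.
Hypothesis lower_C : forall S, mono S -> S 0%N = 0%N -> ~ US S -> lower n m 2 S \notin C.
Hypothesis reach_C : forall S, mono S -> S 0%N = 0%N -> US S -> ~: reach n m S \notin C.

Let pr (s : seq 'rV[K]_n) : {mpoly K[n]} := \prod_(v <- s) lin_form v.

Let prP s1 s2 a u v : pr (s1 ++ (a *: u + v) :: s2) = a *: pr (s1 ++ u :: s2) + pr (s1 ++ v :: s2).
Proof.
rewrite /pr !big_cat !big_cons lin_formP /= -!mul_mpolyC; ring.
Qed.

Let pr_swap s1 s2 u v : pr (s1 ++ u :: v :: s2) = 1 *: pr (s1 ++ v :: u :: s2).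
Proof. by rewrite scale1r /pr !big_cat !big_cons /= [lin_form u * _]mulrCA. Qed.

Let lm u : {linear {mpoly K[n]} -> {mpoly K[n]}} := lin_form u \*o idfun.

Let pr_cons u s : pr (u :: s) = lm u (pr s).
Proof. by rewrite /pr big_cons. Qed.

Let pr_alt : false -> forall s1 s2 u, pr (s1 ++ u :: u :: s2) = 0.
Proof. by []. Qed.

Let Phi (g : 'M[K]_n) : {linear {mpoly K[n]} -> {mpoly K[n]}} :=
  comp_mpoly [tuple \sum_(i < n) (g^T) i j *: 'X_i | j < n].

Let PhiE g s : pr (map (mulmxr g) s) = Phi g (pr s).
Proof.
rewrite /pr big_map [RHS]rmorph_prod; apply: eq_bigr => v _.
by rewrite -[RHS]/(sym_map g^T (lin_form v)) sym_map_lin trmxK.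
Qed.

Let pr_homog s : pr s \is (size s).-homog.
Proof.
rewrite /pr; elim: s => [|v s IHs]; first by rewrite big_nil dhomog1.
rewrite big_cons /= -[(size s).+1]add1n dhomogM //.
by apply: rpred_sum => i _; rewrite dhomogZ // dhomogX /= mdeg1.
Qed.

(** Modulo the image of the ideal, the Lefschetz property writes w as a combination of monomials
    divisible by some x_j with j > m or by x_m ^ (2 e - d). The hypotheses say that w is divisible
    by neither, and all these monomials are smaller in reverse lexicographic order. *)
Lemma sym_block e : (d <= 2 * e)%N -> exists2 p : {mpoly K[n * n]}, p != 0 &
  forall A : 'M[K]_n, A \in unitmx -> p.@[fun k => mxvec A 0 k] != 0 ->
  forall w : 'X_{1..n}, mdeg w = e -> psum w m.+1 = e -> (d < e + psum w m)%N ->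
  exists2 f, sr_ideal C f & sym_lead (sym_map A f) w.
Proof.
move=> de.
(* The initial state is a = c = 0: the generators are all the sets [lower S] and complements of
   [reach S] with S(0) = 0. *)
have ms : mono (fun=> 0%N) by [].
have [h sp] := lefschetz Kinf prP pr_swap pr_cons pr_alt nE US_le US_deg (k0 := 0) de (fun f => False_ind _ (notF f))
  (leq0n m) ms (leqnn 0) (fun _ => leqnn 0).
rewrite subn0 in sp.
have bnd i : lef_lists n false m d US e 0 0 0 (fun=> 0%N) i -> all (ltn^~ (n + n)%N) i.
  by apply: (lef_lists_lt pr_alt nE de (fun f => False_ind _ (notF f))).
have [p p0 pA] := spanning_generic prP Kinf PhiE bnd sp.
exists p => // A Au /pA {}sp w we wm wd.
pose bad (u : 'X_{1..n}) := mdeg u = e /\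
  ((exists2 j : 'I_n, (m < j)%N & (0 < u j)%N) \/ exists2 j : 'I_n, j = m :> nat & (2 * e - d <= u j)%N).
pose good x := exists f, sr_ideal C f /\ forall u, (x - sym_map A f)@_u != 0 -> bad u.
have good0 : good 0.
  exists 0; split=> [|u]; first exact: ideal_gen0.
  by rewrite /sym_map comp_mpoly0 subr0 mcoeff0 eqxx.
have goodL a x y : good x -> good y -> good (a *: x + y).
  move=> [f [fC fx]] [g [gC gy]]; exists (a%:MP * f * 1 + g); split.
    by apply: ideal_genD => //; apply: ideal_genM.
  move=> u; have -> : a *: x + y - sym_map A (a%:MP * f * 1 + g) =
      a *: (x - sym_map A f) + (y - sym_map A g).
    rewrite mulr1 mul_mpolyC /sym_map comp_mpolyD comp_mpolyZ scalerBr; ring.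
  rewrite mcoeffD mcoeffZ => nz; have [e1|/fx //] := eqVneq ((x - sym_map A f)@_u) 0.
  by apply: gy; move: nz; rewrite e1 mulr0 add0r.
have bad_mul (q : {mpoly K[n]}) (v : 'X_{1..n}) k : q \is k.-homog -> (mdeg v + k)%N = e ->
    (forall u, bad (v + u)%MM \/ mdeg (v + u)%MM <> e) -> good ('X_[v] * q).
  move=> qk ve vbad; exists 0; split=> [|u]; first exact: ideal_gen0.
  rewrite /sym_map comp_mpoly0 subr0 mulrC -mcoeff_msupp (perm_mem (msuppMX q v)).
  case/mapP => u' u'q ->; have /dhomogP/(_ _ u'q) /= u'k := qk; case: (vbad u') => //.
  by rewrite mdegD u'k.
have goodw : good 'X_[w].
  have : lspan (prgen pr (lef_lists n false m d US e 0 0 0 (fun=> 0%N)) (frame A) e)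
     'X_[w].
    pose s := flatten [seq nseq (w i) (delta_mx 0 i : 'rV[K]_n) | i <- enum 'I_n].
    have -> : 'X_[w] = pr s.
      rewrite mpolyXE_id /pr /s big_flatten big_map big_enum /=; apply: eq_bigr => i _.
      by rewrite big_nseq lin_form_delta iter_mulr_1.
    apply: sp; rewrite /s size_flatten /shape -map_comp sumnE big_map big_enum /= -we mdegE.
    by apply: eq_bigr => i _; rewrite /= size_nseq.
  elim=> [|a x y + _]; first exact: good0.
  move=> [i [r [Ii se ->]]]; apply: goodL; rewrite /pr big_cat /= big_map.
  have rk := pr_homog r; rewrite /pr in rk.
  case: Ii se => [[v] //|[X [S [mS S0 _ SX]] ->]|[k kd ->]|->] /= se.
  - set q := \prod_(v <- r) lin_form v.
    have XE : \prod_(k <- vals X) lin_form (frame A k) = sym_map A 'X_[mesym1 X].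
      rewrite /vals big_map big_enum mpolyXE_id [RHS]rmorph_prod /= [LHS]big_mkcond /=.
      apply: eq_bigr => j _; rewrite [RHS]rmorphXn mnmE.
      have -> : lin_form (frame A j) = sym_map A 'X_j.
        by rewrite frame_lt sym_mapX; apply: eq_bigr => l _; rewrite !mxE.
      by case: (j \in X).
    exists (1 * 'X_[mesym1 X] * sym_map (invmx A) q); split.
      apply/ideal_genM/ideal_gen_mem; exists X => //.
      have S00 := S0 _ (leqnn 0).
      have setE (Y : {set 'I_n}) : [set v in Y | 0 + 2 * 0 <= v]%N = Y.
        by apply/setP => v; rewrite in_set_ andbT.
      by case: SX => -[uS ->]; rewrite setE ?lower_C ?reach_C.
    by move=> u; rewrite mul1r sym_mapM sym_map_comp mulmxV // sym_map1 XE subrr mcoeff0 eqxx.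
  - rewrite big_seq1; have kn : (n.-1 - k < n)%N by rewrite nE; lia.
    rewrite -[(n.-1 - k)%N]/(val (Ordinal kn)) frame_ge lin_form_delta.
    apply: bad_mul rk _ _; rewrite ?mdeg1 // => u.
    have [ue|ue] := eqVneq (mdeg (U_(Ordinal kn) + u)%MM) e; [left | by right; apply/eqP].
    split=> //; left; exists (Ordinal kn); first by rewrite /= nE /killed in kd *; lia.
    by rewrite mnmDE mnm1E eqxx.
  have mn : (m < n)%N by rewrite nE; lia.
  rewrite big_nseq -[m]/(val (Ordinal mn)) frame_ge lin_form_delta iter_mulr_1 mpolyXn.
  rewrite size_nseq in se; apply: bad_mul rk _ _; first by rewrite mdegMn mdeg1 mul1n.
  move=> u; have [ue|ue] := eqVneq (mdeg (U_(Ordinal mn) *+ (2 * e - d) + u)%MM) e; [left | by right; apply/eqP].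
  split=> //; right; exists (Ordinal mn) => //.
  by rewrite mnmDE mulmnE mnm1E eqxx mul1n leq_addr.
have mn : (m < n)%N by rewrite nE; lia.
have w_above (j : 'I_n) : (m < j)%N -> w j = 0%N.
  move=> mj; apply/eqP; rewrite -leqn0 -(leq_add2l (psum w j)) -psumS addn0.
  apply: leq_trans (psum_le_mdeg w _) _; rewrite we -wm; apply: mono_le mj; exact: psum_mono.
have w_m (j : 'I_n) : j = m :> nat -> (w j < 2 * e - d)%N.
  by move=> jm; have := psumS w j; rewrite jm wm; move: wd; lia.
have wbad u : bad u -> revlex_lt u w.
  move=> [ue ub]; have uw : u != w.
    apply/eqP => uw; move: ub; rewrite uw => -[[j mj]|[j jm]]; first by rewrite w_above.
    by rewrite leqNgt w_m.
  have [j [uj above]] := revlex_split uw.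
  apply/revlexP; first by rewrite ue we.
  exists j; split=> //; case: (ltngtP m j) => mj.
  - by rewrite w_above // lt0n -(w_above _ mj).
  - case: ub => [[i mi]|[i im]].
      by rewrite (above i (ltn_trans mj mi)) w_above.
    by rewrite above ?im // leqNgt w_m.
  case: ub => [[i mi]|[i im ui]]; first by rewrite (above i) ?(w_above i mi) // -mj.
  have -> : j = i by apply: val_inj; rewrite /= im.
  by apply: leq_trans (w_m i im) ui.
have [f [fC fw]] := goodw; exists f => //.
have nbw : ~ bad w by move=> /wbad; rewrite revlex_irr.
have fE u : u != w -> (sym_map A f)@_u != 0 -> bad u.
  by move=> uw fu; apply: fw; rewrite mcoeffB mcoeffX [w == u]eq_sym (negPf uw) sub0r oppr_eq0.
split; last by move=> v; rewrite mcoeff_msupp => fv vw; apply: wbad (fE v vw fv).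
rewrite mcoeff_msupp; apply/eqP => fw0; apply/nbw/fw.
by rewrite mcoeffB mcoeffX eqxx fw0 subr0 oner_neq0.
Qed.

End SymBlock.

Local Close Scope ring_scope.

(** The expected generic initial ideal, as a condition on sequences so that it applies to monomials
    through [psum] and to sets of vertices through [cnt]. *)
Definition gin m d (US : (nat -> nat) -> Prop) (S : nat -> nat) : Prop :=
  ~ US S \/ d < S m + S m.+1.

(** * Counting the monomials outside the expected ideal *)

Section NonGinCount.
Variables (m d : nat) (U : {pred 'X_{1..m}}).
Hypothesis Uideal : shifted_order_ideal U.

(** Such a monomial consists of its part u in the first m variables, which lies in U, and an
    exponent of the last variable, at most d - 2 deg u. *)
Lemma nongin_card L :
  #|[set b : 'X_{1..m.+1 < L} | `[< ~ gin m d (psum_below U) (psum b) >]]| <=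
  \sum_(u : 'X_{1..m < d.+2} | bmnm u \in U) (d.+1 - 2 * mdeg u).
Proof.
set A := [set b | _].
have AP (b : 'X_{1..m.+1 < L}) : b \in A ->
    psum_below U (psum b) /\ psum b m + psum b m.+1 <= d.
  by rewrite inE => /asboolP h; split; [apply: contrapT => h'; apply: h; left | rewrite leqNgt; apply/negP => h'; apply: h; right].
have ud (b : 'X_{1..m.+1 < L}) : b \in A -> mdeg (mnm_of m (psum b)) < d.+2.
  move=> /AP[_ bd]; rewrite mdeg_mnm_of ?psum0 //; last exact: psum_mono.
  by have := psum_mono b m; lia.
have u0 : mdeg (0%MM : 'X_{1..m}) < d.+2 by rewrite mdeg0.
pose tr (b : 'X_{1..m.+1 < L}) : 'X_{1..m < d.+2} := insubd (BMultinom u0) (mnm_of m (psum b)).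
have trE b : b \in A -> bmnm (tr b) = mnm_of m (psum b).
  by move=> /ud bd; rewrite /tr insubdK.
rewrite -sum1_card (partition_big tr (fun u => bmnm u \in U)) /=; last first.
  move=> b bA; rewrite trE //; have [bU _] := AP b bA.
  by apply: psum_below_mem; rewrite ?psum0 //; apply: psum_mono.
apply: leq_sum => u uU; rewrite sum1_card.
pose c (b : 'X_{1..m.+1 < L}) : 'I_d.+1 := inord (b ord_max).
have cE b : b \in A -> c b = b ord_max :> nat.
  move=> /AP[_ bd]; rewrite /c inordK //; have := psumS b ord_max.
  by rewrite /=; lia.
have inj : {in [pred b | (b \in A) && (tr b == u)] &, injective c}.
  move=> b b' /andP[bA /eqP bu] /andP[bA' /eqP bu'] e; apply/val_inj/psum_inj => i.
  have e1 j : j <= m -> psum b j = psum b' j.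
    move=> jm; have := trE _ bA; rewrite bu -bu' trE // => /(congr1 (fun u => psum u j)).
    by rewrite !psum_mnm_of ?psum0 //; apply: psum_mono.
  rewrite leq_eqVlt => /predU1P[->|/e1 //].
  have h (x : 'X_{1..m.+1}) : psum x m.+1 = psum x m + x ord_max by exact: (psumS x ord_max).
  move/eqP: e; rewrite -val_eqE /= !cE // => /eqP e.
  by rewrite !h e1 // e.
rewrite -(card_in_imset inj) -(@card_ltn_ord d.+1 (d.+1 - 2 * mdeg u)) ?leq_subr //.
apply/subset_leq_card/subsetP => _ /imsetP[b /andP[bA /eqP bu] ->].
rewrite inE cE //; have [_ bd] := AP b bA; have := psumS b ord_max.
rewrite -bu trE // mdeg_mnm_of ?psum0 //; last exact: psum_mono.
by rewrite /=; lia.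
Qed.

End NonGinCount.

Local Open Scope ring_scope.

(** The relation is solved for its leading term. Distinct indices may have the same image under
    [tr], so the coefficients are grouped by image. *)
Lemma rel_of_sum (K : fieldType) (M T : finType) (lt : rel M) (ev : M -> T -> K)
    (I : eqType) (s : seq I) (C : pred I) (G : I -> K) (tr : I -> M) b :
  uniq s -> b \in s -> C b -> G b != 0 ->
  (forall u, u \in s -> C u -> u != b -> lt (tr u) (tr b)) ->
  (forall t, \sum_(u <- s | C u) G u * ev (tr u) t = 0) ->
  exists c : M -> K, forall t, ev (tr b) t = \sum_(b' | lt b' (tr b)) c b' * ev b' t.
Proof.
move=> us bs Cb Gb lt_tr s0.
exists (fun x => - (G b)^-1 * \sum_(u <- s | C u && (u != b) && (tr u == x)) G u) => t.
transitivity (- (G b)^-1 * \sum_(u <- s | C u && (u != b)) G u * ev (tr u) t).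
  set X := \sum_(u <- s | C u && (u != b)) _.
  have e : G b * ev (tr b) t + X = 0.
    rewrite -[RHS](s0 t) [RHS]big_mkcond [RHS](bigD1_seq b) //= Cb; congr (_ + _).
    rewrite /X big_mkcond [RHS]big_mkcond; apply: eq_bigr => u _.
    by case: (C u); case: (u != b).
  by have /eqP := e; rewrite addrC addr_eq0 => /eqP ->; rewrite mulrNN mulKf.
rewrite (eq_bigr (fun b' => - (G b)^-1 * (\sum_(u <- s | C u && (u != b) && (tr u == b')) G u * ev b' t))); last first.
  by move=> b' _; rewrite -mulrA mulr_suml.
rewrite -mulr_sumr; congr (_ * _).
rewrite big_seq_cond [LHS](partition_big tr (fun b' => lt b' (tr b))) /=; last first.
  by move=> u /and3P[us' Cu ub]; apply: lt_tr.
apply: eq_bigr => b' _; rewrite [RHS]big_seq_cond.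
by apply: eq_big => [u|u /andP[_ /eqP -> //]]; rewrite !andbA.
Qed.

(** * Vanishing on linear subspaces and the leading monomial *)

Section Restriction.
Variables (K : fieldType) (n : nat).
Hypothesis Kinf : infinite_type K.
Implicit Types (A : 'M[K]_n) (g : {mpoly K[n]}) (b u : 'X_{1..n}) (i : 'I_n).

Lemma digits_lt D (k : nat) (c : nat -> nat) : (forall j, c j < D)%N ->
  (\sum_(j < k) c j * D ^ j < D ^ k)%N.
Proof.
move=> cD; elim: k => [|k IHk]; first by rewrite big_ord0.
rewrite big_ord_recr /= expnS; have := leq_mul (cD k) (leqnn (D ^ k)).
by rewrite mulSn; apply: leq_trans; rewrite -addSn leq_add2r.
Qed.

(** The weights D ^ j turn the comparison of the exponents above i into one of integers. Only the
    exponents of b have to be below D, those of u may be larger. *)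
Lemma revlex_digits D i u b : (forall j, b j < D)%N -> mdeg u = mdeg b -> revlex_lt u b ->
  ~~ [forall j : 'I_n, (i < j)%N ==> (u j == b j)] ->
  (\sum_(j < n | i < j) b j * D ^ j < \sum_(j < n | i < j) u j * D ^ j)%N.
Proof.
move=> bD e /(revlexP e)[k [bk above]] /forallPn[j]; rewrite negb_imply => /andP[ij uj].
have ik : (i < k)%N.
  rewrite ltnNge; apply/negP => ki; case/eqP: uj; apply: above.
  exact: leq_ltn_trans ij.
rewrite (bigID (fun j : 'I_n => k < j)%N) [X in (_ < X)%N](bigID (fun j : 'I_n => k < j)%N) /=.
rewrite [X in (_ < X + _)%N](eq_bigr (fun j : 'I_n => b j * D ^ j)%N); last first.
  by move=> l /andP[_ /above ->].
rewrite ltn_add2l [X in (_ < X)%N](bigD1 k) /=; last by rewrite ik ltnn.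
rewrite (bigD1 k) /=; last by rewrite ik ltnn.
apply: (@leq_trans ((b k).+1 * D ^ k)); last first.
  by apply: leq_trans (leq_addr _ _); rewrite leq_mul2r bk orbT.
rewrite mulSn addnC ltn_add2r.
pose c l := if insub l is Some j then b (j : 'I_n) else 0%N.
have D0 : (0 < D)%N by apply: leq_ltn_trans (bD i).
have cD l : (c l < D)%N by rewrite /c; case: insubP.
apply: leq_ltn_trans (digits_lt k cD).
rewrite (big_ord_widen n (fun l => c l * D ^ l)%N (ltnW (ltn_ord k))).
rewrite [X in (X <= _)%N]big_mkcond [X in (_ <= X)%N]big_mkcond; apply: leq_sum => l _.
case: ifP => // /andP[/andP[_ h1] h2]; rewrite ifT; first by rewrite /c valK.
by rewrite ltn_neqAle h2 leqNgt.
Qed.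

(* The vectors h j, j >= i, are a basis of the solutions x of the equations
   (x A)_p = 0, p in P, and the other forms do not vanish at h i. *)
Definition flat A i (P : {set 'I_n}) (h : 'I_n -> 'I_n -> K) : Prop :=
  [/\ forall j j' : 'I_n, (i <= j)%N -> (i <= j')%N -> h j j' = (j' == j)%:R,
      forall j p : 'I_n, (i <= j)%N -> p \in P -> \sum_l h j l * A l p = 0 &
      forall p, p \notin P -> \sum_l h i l * A l p != 0].

(** Each h j is the unit vector at j corrected in the first i coordinates. If a form at p outside P
    vanished at h i, then h i would contradict the minor of P with p added. *)
Lemma flat_exists A i (P : {set 'I_n}) : minors A -> #|P| = i -> exists h, flat A i P h.
Proof.
move=> mA Pi; have sol (j : 'I_n) := minors_solve P (fun p => - A j p) mA.
have [x xE] := choice sol.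
pose h (j l : 'I_n) := x j l + (l == j)%:R.
have hA j p : \sum_l h j l * A l p = \sum_l x j l * A l p + A j p.
  under eq_bigr => l _ do rewrite mulrDl.
  rewrite big_split /= [X in _ + X](bigD1 j) //= eqxx mul1r [X in _ + (_ + X)]big1 ?addr0 //.
  by move=> l /negPf ->; rewrite mul0r.
exists h; split.
- by move=> j j' ij ij'; rewrite /h (xE j).1 ?add0r // Pi.
- by move=> j p ij pP; rewrite hA (xE j).2 // addNr.
move=> p pP; apply/eqP => hp.
have : h i i = 0.
  apply: (mA (p |: P)) => [l|r].
    rewrite cardsU1 pP Pi add1n => il; rewrite /h (xE i).1 ?Pi ?(ltnW il) // add0r.
    by rewrite -val_eqE /= gtn_eqF.
  by rewrite in_setU1 => /predU1P[-> //|rP]; rewrite hA (xE i).2 // addNr.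
by rewrite /h (xE i).1 ?Pi // eqxx add0r => /eqP; rewrite oner_eq0.
Qed.

(* Substitute y_j = s ^ (D ^ j) for j > i and y_i = 1, and let s tend to 0: the
   terms of lowest order in s are those that agree with b above i. *)
Lemma revlex_restrict g i h b : (forall j j' : 'I_n, (i <= j)%N -> (i <= j')%N -> h j j' = (j' == j)%:R) ->
  (forall y : 'I_n -> K, g.@[fun l => \sum_(j < n | (i <= j)%N) y j * h j l] = 0) ->
  sym_lead g b ->
  \sum_(u <- msupp g | (mdeg u == mdeg b) && [forall j : 'I_n, (i < j)%N ==> (u j == b j)])
     g@_u * \prod_(l < n | (l < i)%N) h i l ^+ u l = 0.
Proof.
move=> hE g0 [bg blead]; pose pt (y : 'I_n -> K) l := \sum_(j < n | (i <= j)%N) y j * h j l.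
have top_part y : \sum_(u <- msupp g | mdeg u == mdeg b) g@_u * \prod_l pt y l ^+ u l = 0.
  pose r : {poly K} := \sum_(u <- msupp g) (g@_u * \prod_l pt y l ^+ u l) *: 'X^(mdeg u).
  have : r = 0.
    apply: (poly_eq0_infinite Kinf) => s _.
    rewrite -[RHS](g0 (fun j => s * y j)) mevalE horner_sum; apply: eq_bigr => u _.
    rewrite hornerZ hornerXn -mulrA; congr (_ * _); rewrite mdegE -prodrXr -big_split /=.
    apply: eq_bigr => l _; rewrite -exprMn mulrC; congr (_ ^+ _).
    by rewrite /pt mulr_sumr; apply: eq_bigr => j _; rewrite mulrA.
  move=> /(congr1 (fun r : {poly K} => r`_(mdeg b))); rewrite coef0 coef_sum => r0.
  rewrite -[RHS]r0 big_mkcond; apply: eq_bigr => u _.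
  by rewrite coefZ coefXn eq_sym; case: ifP; rewrite ?mulr1 ?mulr0.
pose D := (mdeg b).+1; pose wt (j : 'I_n) := if (i < j)%N then (D ^ j)%N else 0%N.
pose om u := (\sum_(j < n | i < j) u j * D ^ j)%N.
pose al (l : 'I_n) : {poly K} := \sum_(j < n | (i <= j)%N) h j l *: 'X^(wt j).
pose cond u := [forall j : 'I_n, (i < j)%N ==> (u j == b j)].
pose r : {poly K} := \sum_(u <- msupp g | mdeg u == mdeg b)
   (g@_u *: \prod_(l < n | (l < i)%N) al l ^+ u l) * 'X^(om u - om b).
have bD j : (b j < D)%N by rewrite ltnS mdegE (bigD1 j) //= leq_addr.
have om_ge u : u \in msupp g -> mdeg u == mdeg b -> (om b <= om u)%N /\ (om u - om b == 0)%N = cond u.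
  move=> ug /eqP ub; have [cu|ncu] := boolP (cond u).
    have -> : om u = om b; last by rewrite subnn leqnn.
    by apply: eq_bigr => j ij; move/forall_inP: cu => /(_ _ ij)/eqP ->.
  have uneb : u != b by apply: contraNneq ncu => ->; apply/forall_inP => j _.
  have := revlex_digits bD ub (blead _ ug uneb) ncu; rewrite -/(om b) -/(om u) => h1.
  by split; [apply: ltnW | rewrite subn_eq0 leqNgt h1].
have r0 : r = 0.
  apply: (poly_eq0_infinite Kinf) => s s0.
  pose y j := s ^+ wt j.
  have := top_part y => e; apply/eqP; have : s ^+ om b * r.[s] == 0; last first.
    by rewrite mulf_eq0 expf_eq0 (negPf s0) andbF.
  rewrite -e horner_sum mulr_sumr; apply/eqP.
  rewrite big_seq_cond [RHS]big_seq_cond; apply: eq_bigr => u /andP[ug ub].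
  have [obu _] := om_ge _ ug ub.
  rewrite hornerM hornerZ hornerXn mulrC -!mulrA -exprD subnK //; congr (_ * _).
  rewrite [RHS](bigID (fun l : 'I_n => l < i)%N) /= horner_prod; congr (_ * _).
    apply: eq_bigr => l _; rewrite horner_exp; congr (_ ^+ _).
    by rewrite horner_sum; apply: eq_bigr => j _; rewrite hornerZ hornerXn mulrC.
  have ptE (l : 'I_n) : (i <= l)%N -> pt y l = s ^+ wt l.
    move=> il; rewrite /pt (bigD1 l) //= hE // eqxx mulr1 big1 ?addr0 // => j /andP[ij jl].
    by rewrite hE // eq_sym (negPf jl) mulr0.
  rewrite /om -prodrXr big_mkcond [RHS]big_mkcond; apply: eq_bigr => l _.
  rewrite -leqNgt; case: ltngtP => // il.
    by rewrite ptE ?(ltnW il) // /wt il mulnC exprM.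
  by rewrite ptE ?il // /wt il ltnn expr0 expr1n.
have := congr1 (fun r : {poly K} => r.[0]) r0; rewrite horner0 horner_sum => e0; rewrite -[RHS]e0.
rewrite big_mkcondr big_seq_cond [RHS]big_seq_cond; apply: eq_bigr => u /andP[ug ub].
have [_ obu] := om_ge _ ug ub.
rewrite hornerM hornerZ hornerXn expr0n obu -/(cond u); case: (cond u); rewrite ?mulr0 // mulr1.
congr (_ * _); rewrite horner_prod; apply: eq_bigr => l li; rewrite horner_exp; congr (_ ^+ _).
rewrite horner_sum (bigD1 i) //= hornerZ hornerXn {1}/wt ltnn expr0 mulr1 big1 ?addr0 //.
move=> j /andP[ij ji]; have {}ij : (i < j)%N by rewrite ltn_neqAle eq_sym val_eqE ji.
have D0 : (0 < D)%N by [].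
by rewrite hornerZ hornerXn /wt ij expr0n expn_eq0 gtn_eqF // mulr0.
Qed.

Definition trunc_mnm i u : 'X_{1..i} := [multinom u (widen_ord (ltnW (ltn_ord i)) j) | j < i].

Lemma psum_trunc i u k : (k <= i)%N -> psum (trunc_mnm i u) k = psum u k.
Proof.
elim: k => [|k IHk] ki; first by rewrite !psum0.
have kn : (k < n)%N by apply: leq_trans ki (ltnW (ltn_ord i)).
rewrite (psumS _ (Ordinal ki)) (psumS u (Ordinal kn)) IHk 1?ltnW // mnmE.
by congr (_ + u _)%N; apply: val_inj.
Qed.

Lemma mdeg_trunc i u : mdeg (trunc_mnm i u) = psum u i.
Proof. by rewrite -(psum_ge _ (leqnn i)) psum_trunc. Qed.

Lemma prod_trunc i u (x : 'I_n -> K) :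
  \prod_(l < n | (l < i)%N) x l ^+ u l =
  \prod_(j < i) x (widen_ord (ltnW (ltn_ord i)) j) ^+ trunc_mnm i u j.
Proof.
rewrite (big_ord_narrow (ltnW (ltn_ord i))) /=.
by apply: eq_bigr => j _; rewrite mnmE.
Qed.

Lemma revlex_trunc i u b : mdeg u = mdeg b -> (forall j : 'I_n, (i < j)%N -> u j = b j) ->
  revlex_lt u b -> revlex_lt (trunc_mnm i u) (trunc_mnm i b).
Proof.
move=> e above /(revlexP e)[k [bk kabove]].
have ki : (k <= i)%N by rewrite leqNgt; apply/negP => /above bk'; rewrite bk' ltnn in bk.
have e1 := psum_eq_above e above; move: e1; rewrite !psumS => e1.
case: (ltngtP k i) ki => // ik _.
  have ui : u i = b i by apply: kabove.
  rewrite ui in e1; move/addIn: e1 => e1.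
  apply/revlexP; first by rewrite !mdeg_trunc.
  exists (Ordinal ik); rewrite !mnmE; split.
    by rewrite (_ : widen_ord _ _ = k) //; apply: val_inj.
  by move=> j kj; rewrite !mnmE kabove.
rewrite /revlex_lt !mdeg_trunc; apply/orP; left.
by move: bk; rewrite (val_inj ik); move: e1; lia.
Qed.

(* The monomials in the first i variables are evaluated at the points h t i.  The
   products of the linear forms (x A)_p, p in S t, give a triangular matrix, so that
   these evaluations span; a leading monomial is in the span of smaller ones. *)
Theorem sym_count A i (T : finType) (P S : T -> {set 'I_n}) (key : T -> nat) L
    (h : T -> 'I_n -> 'I_n -> K) (B : {set 'X_{1..i < L}}) :
  (forall t, flat A i (P t) (h t)) ->
  (forall t, #|S t| < L)%N ->
  (forall t, [disjoint S t & P t]) ->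
  (forall s t, s != t -> [disjoint S s & P t] -> key s < key t)%N ->
  (forall b0 : 'X_{1..i < L}, b0 \notin B -> exists g b, [/\ bmnm b0 = trunc_mnm i b, sym_lead g b &
     forall t a, (forall p, p \in P t -> \sum_l a l * A l p = 0) -> g.@[a] = 0]) ->
  (#|T| <= #|B|)%N.
Proof.
move=> hf SL diag tri rel; pose wi (j : 'I_i) := widen_ord (ltnW (ltn_ord i)) j.
pose ev (b0 : 'X_{1..i < L}) t := \prod_(j < i) h t i (wi j) ^+ b0 j.
(* The form (x A)_p with x_i = 1 and x_l = 0 for l > i; these are the values of the last coordinates
   of the points h t i. *)
pose ell p : {mpoly K[i]} := \sum_(j < i) A (wi j) p *: 'X_j + (A i p)%:MP.
pose Q t : {mpoly K[i]} := \prod_(p in S t) ell p.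
have Qsize t : (msize (Q t) <= L)%N.
  apply: leq_trans (SL t); rewrite /Q -sum1_card.
  elim/big_rec2: _ => [|p s x pS IH]; first by rewrite msize1.
  have [->|x0] := eqVneq x 0; first by rewrite mulr0 msize0.
  have [->|l0] := eqVneq (ell p) 0; first by rewrite mul0r msize0.
  rewrite msizeM // add1n; have : (msize (ell p) <= 2)%N; last by move: IH; move: (msize x) (msize (ell p)) => a1 a2; lia.
  apply: leq_trans (msizeD_le _ _) _; rewrite geq_max; apply/andP; split; last first.
    by rewrite msizeC; case: (_ != 0).
  apply: leq_trans (msize_sum _ _ _) _; apply/bigmax_leqP => j _.
  by apply: leq_trans (msizeZ_le _ _) _; rewrite msizeX mdeg1.
have QE s t : (Q s).@[fun j => h t i (wi j)] = \sum_(b0 : 'X_{1..i < L}) (Q s)@_b0 * ev b0 t.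
  rewrite {1}(mpolywE (Qsize s)) raddf_sum /=; apply: eq_bigr => b0 _.
  by rewrite mevalZ mevalX.
have ellE p t : (ell p).@[fun j => h t i (wi j)] = \sum_l h t i l * A l p.
  have [hE _ _] := hf t.
  rewrite mevalD mevalC raddf_sum /= [RHS](bigID (fun l : 'I_n => l < i)%N) /=.
  rewrite (big_ord_narrow (ltnW (ltn_ord i))) /=; congr (_ + _).
    by apply: eq_bigr => j _; rewrite mevalZ mevalXU mulrC.
  rewrite (bigD1 i) ?ltnn //= hE // eqxx mul1r big1 ?addr0 // => l /andP[il li].
  have {}il : (i <= l)%N by rewrite leqNgt.
  by rewrite hE // (negPf li) mul0r.
have V s t : (\sum_(b0 : 'X_{1..i < L}) (Q s)@_b0 * ev b0 t != 0) = [disjoint S s & P t].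
  rewrite -QE rmorph_prod /=; have [_ h0 hn0] := hf t; apply/prodf_neq0/idP => [nz|dis p pS].
    rewrite disjoint_subset; apply/subsetP => p pS; rewrite inE; apply/negP => pP.
    by have := nz p pS; rewrite ellE h0 ?eqxx.
  by rewrite ellE; apply: hn0; rewrite (disjointFr dis pS).
apply: (@span_count K _ T (fun b b' : 'X_{1..i < L} => revlex_lt b b') B ev (fun s (b0 : 'X_{1..i < L}) => (Q s)@_b0) key).
- by move=> b; apply: revlex_irr.
- by move=> b b' b''; apply: revlex_trans.
- move=> b0 /rel[g [b [b0E glead gP]]].
  pose C u := (mdeg u == mdeg b) && [forall j : 'I_n, (i < j)%N ==> (u j == b j)].
  pose tr u : 'X_{1..i < L} := insubd b0 (trunc_mnm i u).
  have CP u : C u -> mdeg u = mdeg b /\ forall j : 'I_n, (i < j)%N -> u j = b j.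
    by move=> /andP[/eqP ? /forall_inP h1]; split=> // j /h1/eqP.
  have trb : tr b = b0 by apply: val_inj; rewrite /tr insubdK -?b0E //; apply: valP.
  have trE u : u \in msupp g -> C u -> bmnm (tr u) = trunc_mnm i u.
    move=> ug /CP[ub above]; have uL : (mdeg (trunc_mnm i u) < L)%N.
      have := valP b0; rewrite /= b0E; apply: leq_ltn_trans.
      have [-> //|une] := eqVneq u b.
      by apply: revlex_deg; apply: revlex_trunc => //; apply: glead.2.
    by rewrite /tr insubdK.
  have Cb : C b by rewrite /C eqxx; apply/forall_inP.
  have := @rel_of_sum K _ T (fun b b' : 'X_{1..i < L} => revlex_lt b b') ev _ (msupp g) C (fun u => g@_u) tr b.
  rewrite trb; apply.
  + exact: msupp_uniq.
  + by case: glead.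
  + by [].
  + by rewrite -mcoeff_msupp; case: glead.
  + move=> u ug Cu une; rewrite trE // b0E.
    by have [ub above] := CP u Cu; apply: revlex_trunc => //; apply: glead.2.
  move=> t; have [hE h0 _] := hf t.
  have e : \sum_(u <- msupp g | C u) g@_u * \prod_(l < n | (l < i)%N) h t i l ^+ u l = 0.
    apply: (revlex_restrict hE _ glead).
    move=> y; apply: (gP t) => p pP; under eq_bigr => l _ do rewrite mulr_suml.
    rewrite exchange_big big1 //= => j ij; under eq_bigr => l _ do rewrite -mulrA.
    by rewrite -mulr_sumr h0 ?mulr0.
  rewrite -[RHS]e.
  rewrite big_seq_cond [RHS]big_seq_cond; apply: eq_bigr => u /andP[ug Cu].
  by rewrite /ev trE // prod_trunc.
- by move=> s; rewrite V.
by move=> s t st; rewrite V; apply: tri.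
Qed.

End Restriction.

Local Close Scope ring_scope.

Lemma gin_le m d US S S' : (forall S S', (forall i, i <= m -> S' i <= S i) -> US S -> US S') ->
  (forall i, i <= m.+1 -> S i <= S' i) -> gin m d US S -> gin m d US S'.
Proof.
move=> US_le SS [nS|dS]; [left | right].
  by apply: contra_not nS; apply: US_le => i im; apply: SS; apply: leqW.
by apply: leq_trans dS _; apply: leq_add; apply: SS.
Qed.

Section RhatSets.
Variables (n i l : nat).
Hypothesis iln : i + 2 * l <= n.

(* The sets fill t have size l - 1, and [disjoint fill s & gaps t] makes s <= t for
   the order of partial sums. *)
Definition gaps (t : 'X_{1..i < l}) : {set 'I_n} := ~: ungap n i (psum t).
Definition fill_sums (t : 'X_{1..i < l}) k := if k <= i then psum t k else l.-1.
Definition fill (t : 'X_{1..i < l}) : {set 'I_n} := lower n i.+1 2 (fill_sums t).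
Definition gaps_key (t : 'X_{1..i < l}) := \sum_(j < i) psum t j.+1.

Lemma psum_bound (t : 'X_{1..i < l}) k : psum t k <= l.-1.
Proof. by apply: leq_trans (psum_le_mdeg t k) _; rewrite -ltnS (leq_trans (valP t)) // leqSpred. Qed.

Lemma degree_pos (t : 'X_{1..i < l}) : 0 < l.
Proof. by apply: leq_ltn_trans (valP t). Qed.

Lemma gaps_lt (t : 'X_{1..i < l}) k : k < i -> k + 2 * psum t k.+1 < n.
Proof. by move=> ki; have := psum_bound t k.+1; have := degree_pos t; lia. Qed.

Lemma card_gaps t : #|gaps t| = i.
Proof.
have := card_ungap (psum_mono t) (gaps_lt t); have := cardsC (ungap n i (psum t)).
by rewrite card_ord /gaps => e1 e2; move: e1 e2; move: #|_| #|_| => x y; lia.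
Qed.

Lemma fill_sums_mono t : mono (fill_sums t).
Proof.
move=> k; rewrite /fill_sums; case: (ltnP k i) => ki; first by rewrite (ltnW ki) psum_mono.
by case: ifP => // _; apply: psum_bound.
Qed.

Lemma card_fill t : #|fill t| = l.-1.
Proof.
rewrite card_lower //; first by rewrite /fill_sums ltnn.
- exact: fill_sums_mono.
- by rewrite /fill_sums psum0.
move=> k s ki; rewrite /fill_sums; have := psum_bound t k.+1; have := degree_pos t.
by case: ifP => _; lia.
Qed.

Lemma fill_gaps t : [disjoint fill t & gaps t].
Proof.
rewrite disjoint_subset; apply/subsetP => v vF; rewrite inE /= inE negbK.
have /subsetP/(_ v vF)/ungapP h := @lower_ungap_refl n i i.+1 _ (fill_sums_mono t).
by apply/ungapP => k ki; have := h k ki; rewrite /fill_sums ki.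
Qed.

Lemma fill_gaps_lt s t : s != t -> [disjoint fill s & gaps t] -> gaps_key s < gaps_key t.
Proof.
move=> st dis; have le k : k <= i -> psum s k <= psum t k.
  move=> ki; have h : lower n i 2 (fill_sums s) \subset ungap n i (psum t).
    apply/subsetP => v /lowerP[j [r [ji jr rj vE]]]; apply/negPn/negP => vt.
    have vs : v \in fill s by apply/lowerP; exists j, r; split=> //; apply: ltnW.
    by have := disjointFr dis vs; rewrite inE vt.
  have := lower_ungap (fill_sums_mono s) (psum_mono t) _ (gaps_lt t) h ki.
  by rewrite /fill_sums ki; apply; rewrite psum0.
have [j sj] : exists j : 'I_i, psum s j.+1 < psum t j.+1.
  apply: contrapT => nex; case/eqP: st; apply/val_inj/psum_inj => -[|k] ki; first by rewrite !psum0.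
  apply/eqP; rewrite eqn_leq le //= leqNgt; apply/negP => h; apply: nex.
  by exists (Ordinal ki).
rewrite /gaps_key (bigD1 j) // [X in _ < X](bigD1 j) //= -addSn leq_add //.
by apply: leq_sum => k _; apply: le.
Qed.

End RhatSets.

Local Open Scope ring_scope.

Section SymLead.
Variables (K : fieldType) (n : nat).
Implicit Types (A : 'M[K]_n) (f g : {mpoly K[n]}) (b u v : 'X_{1..n}).

Lemma revlex_add v u b : revlex_lt u b -> revlex_lt (u + v)%MM (b + v)%MM.
Proof.
move=> ub; have := revlex_deg ub; rewrite leq_eqVlt => /predU1P[e|lt]; last first.
  by rewrite /revlex_lt !mdegD ltn_add2r lt.
have /(revlexP e)[i [bi above]] := ub.
apply/revlexP; first by rewrite !mdegD e.
by exists i; rewrite !mnmDE ltn_add2r; split=> // j /above e1; rewrite !mnmDE e1.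
Qed.

Lemma sym_lead_mulX g b v : sym_lead g b -> sym_lead (g * 'X_[v]) (b + v)%MM.
Proof.
move=> [bg lead]; split; first by rewrite (perm_mem (msuppMX g v)) addmC map_f.
move=> u; rewrite (perm_mem (msuppMX g v)) => /mapP[u' ug ->] ne.
by rewrite addmC; apply/revlex_add/lead => //; apply: contraNneq ne => ->; rewrite addmC.
Qed.

Lemma sym_lead_exists g : g != 0 -> exists b, sym_lead g b.
Proof.
move=> g0; suff h (s : seq 'X_{1..n}) : s != [::] ->
    exists2 b, b \in s & forall v, v \in s -> v != b -> revlex_lt v b.
  by have [|b bg lead] := h (msupp g); [rewrite msupp_eq0 | exists b].
elim: s => // u s IHs _; have [->|/IHs[b bs bmax]] := eqVneq s [::].
  by exists u; rewrite ?mem_head // => v; rewrite inE => /eqP ->; rewrite eqxx.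
have [ub|nub] := boolP (revlex_lt u b).
  exists b; first by rewrite inE bs orbT.
  by move=> v; rewrite inE => /predU1P[-> //|]; apply: bmax.
have [->|ne] := eqVneq u b.
  by exists b; rewrite ?mem_head // => v; rewrite inE => /predU1P[->|]; [rewrite eqxx | apply: bmax].
have bu : revlex_lt b u.
  case: (ltngtP (mdeg u) (mdeg b)) => e.
  - by case/negP: nub; rewrite /revlex_lt e.
  - by rewrite /revlex_lt e.
  by have := revlex_total ne e; rewrite (negPf nub).
exists u; first exact: mem_head.
move=> v; rewrite inE => /predU1P[->|vs _]; first by rewrite eqxx.
have [-> //|vb] := eqVneq v b.
exact: revlex_trans (bmax v vs vb) bu.
Qed.

Lemma sym_map_homog A u : sym_map A 'X_[u] \is (mdeg u).-homog.
Proof.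
rewrite /sym_map comp_mpolyX mdegE; elim/big_rec2: _ => [|i k x _ xk]; first exact: dhomog1.
apply: dhomogM => //; rewrite -[X in X.-homog]mul1n; apply: dhomogMn; rewrite tnth_mktuple.
by apply: rpred_sum => j _; rewrite dhomogZ // dhomogX /= mdeg1.
Qed.

Lemma sym_mapK A f : A \in unitmx -> sym_map (invmx A) (sym_map A f) = f.
Proof. by move=> Au; rewrite sym_map_comp mulVmx // sym_map1. Qed.

Lemma sym_mapVK A f : A \in unitmx -> sym_map A (sym_map (invmx A) f) = f.
Proof. by move=> Au; rewrite sym_map_comp mulmxV // sym_map1. Qed.

Hypothesis Kinf : infinite_type K.

(** If psum b i < l, the truncation of b is one of the monomials of degree below l in i variables,
    and its evaluations depend on those of smaller ones. But there are as many such monomials as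
    points, and their evaluations are independent. *)
Lemma lead_psum A g b (i : 'I_n) l : minors A -> (i + 2 * l <= n)%N -> sym_lead g b ->
  (forall (t : 'X_{1..i < l}) a, (forall p, p \in gaps n t -> \sum_j a j * A j p = 0) -> g.@[a] = 0) ->
  (l <= psum b i)%N.
Proof.
move=> mA iln glead g0; rewrite leqNgt; apply/negP => bl.
have [h hf] : exists h : 'X_{1..i < l} -> 'I_n -> 'I_n -> K, forall t, flat A i (gaps n t) (h t).
  have fl (t : 'X_{1..i < l}) := flat_exists mA (card_gaps iln t).
  by have [h hE] := choice fl; exists h.
have bL : (mdeg (trunc_mnm i b) < l)%N by rewrite mdeg_trunc.
pose tb : 'X_{1..i < l} := BMultinom bL.
have := @sym_count K n Kinf A i _ (gaps n (l := l)) (fill n (l := l)) (@gaps_key i l) l h (setT :\ tb) hf.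
have cT : #|{: 'X_{1..i < l}}| = #|setT :\ tb|.+1 by rewrite -cardsT (cardsD1 tb) in_setT.
rewrite cT ltnn => hc; apply: notF; apply: hc.
- by move=> t; rewrite card_fill // prednK ?(degree_pos t).
- by move=> t; apply: fill_gaps.
- by move=> s t; apply: fill_gaps_lt.
move=> b0; rewrite in_setD1 in_setT andbT negbK => /eqP ->.
by exists g, b; split=> // t a /g0.
Qed.

End SymLead.

Local Close Scope ring_scope.

Local Open Scope ring_scope.

Lemma mdeg_mesym1 n (F : {set 'I_n}) : mdeg (mesym1 F) = #|F|.
Proof.
by rewrite mdegE -sum1_card [RHS]big_mkcond; apply: eq_bigr => j _; rewrite mnmE; case: (j \in _).
Qed.

Section ExtendMnm.
Variables (n : nat).

Definition extend_mnm (i : 'I_n) (b : 'X_{1..i}) : 'X_{1..n} :=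
  mnm_of n (fun k => psum b (minn k i)).

Lemma psum_extend (i : 'I_n) (b : 'X_{1..i}) k : (k <= n)%N -> psum (extend_mnm b) k = psum b (minn k i).
Proof.
move=> kn; rewrite psum_mnm_of ?min0n ?psum0 // => j.
by apply: mono_le; [apply: psum_mono | lia].
Qed.

Lemma trunc_extend (i : 'I_n) (b : 'X_{1..i}) : trunc_mnm i (extend_mnm b) = b.
Proof.
apply: psum_inj => k ki; rewrite psum_trunc // psum_extend ?(minn_idPl ki) //.
exact: leq_trans ki (ltnW (ltn_ord i)).
Qed.

End ExtendMnm.

(** * The generic initial ideal of the sphere *)

Section SymGin.
Variables (K : fieldType) (n m d : nat) (U : {pred 'X_{1..m}}) (C : {set {set 'I_n}}).
Hypothesis Kinf : infinite_type K.
Hypothesis nE : n = (m + d.+1)%N.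
Hypothesis d0 : (0 < d)%N.
Hypothesis Uideal : shifted_order_ideal U.
Hypothesis Udeg : forall u, u \in U -> ((mdeg u).*2 <= d.+1)%N.
Hypothesis C_sub : forall F G : {set 'I_n}, F \in C -> G \subset F -> G \in C.
Hypothesis lower_C : forall S, mono S -> S 0%N = 0%N -> ~ psum_below U S -> lower n m 2 S \notin C.
Hypothesis reach_C : forall S, mono S -> S 0%N = 0%N -> psum_below U S -> ~: reach n m S \notin C.
Implicit Types (A : 'M[K]_n) (f g : {mpoly K[n]}) (b u v w : 'X_{1..n}).

Local Notation US := (psum_below U).
Local Notation gin := (gin m d US).

(* With R(u) = lower 2 (psum u), by lead_psum every combination of the images of the
   monomials x_(R(u)), for u in
   B = {u : psum w <= psum u}, has its leading monomial in B; some nontrivial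
   combination has vanishing coefficients on B except at w. *)
Lemma sym_lead_below A w : minors A -> A \in unitmx -> ~ US (psum w) ->
  psum w m = mdeg w -> (2 * mdeg w <= d)%N ->
  exists2 f, sr_ideal C f & sym_lead (sym_map A f) w.
Proof.
move=> mA Au nUw wm wd; set k := mdeg w.
pose Bw := [set b : 'X_{1..n < k.+1} | (mdeg b == k) && [forall i : 'I_m.+1, psum w i <= psum b i]%N].
have BwP (b : 'X_{1..n < k.+1}) : b \in Bw -> mdeg b = k /\ forall i, (i <= m)%N -> (psum w i <= psum b i)%N.
  by rewrite inE => /andP[/eqP bk /forallP bi]; split=> // i im; apply: (bi (Ordinal (im : i < m.+1)%N)).
have wk : (mdeg w < k.+1)%N by [].
pose wb : 'X_{1..n < k.+1} := BMultinom wk.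
have wB : wb \in Bw by rewrite inE eqxx; apply/forallP.
have mn : (m <= n)%N by lia.
pose T := {b : 'X_{1..n < k.+1} | b \in Bw}.
pose R b := lower n m 2 (psum b).
have TP (t : T) : mdeg (val (val t)) = k /\ forall i, (i <= m)%N -> (psum w i <= psum (val t) i)%N.
  exact: (BwP _ (valP t)).
have Tm (t : T) : psum (val t) m = k.
  have := psum_le_mdeg (val t) m; have := (TP t).2 m (leqnn m); rewrite (TP t).1 wm => h1 h2.
  by apply/eqP; rewrite eqn_leq h2 h1.
pose W (t : T) (b : 'X_{1..n < k.+1}) := (sym_map A 'X_[mesym1 (R (val t))])@_b.
have [|x [[t0 xt0] xB]] := @lin_dep K _ _ (Bw :\ wb) W.
  have cT : #|{: T}| = #|Bw| by rewrite card_sig; apply: eq_card => b; rewrite inE.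
  by rewrite cT (cardsD1 wb Bw) wB.
have gap_n (t : T) i : (i < m)%N -> (i + 2 * psum (val t) i.+1 < n)%N.
  by move=> im; have := psum_le_mdeg (val t) i.+1; rewrite (TP t).1; move: wd; rewrite -/k; lia.
have R_inj (s t : T) : R (val s) = R (val t) -> s = t.
  move=> Rst; apply/val_inj/val_inj/psum_inj => i iN.
  have sub (s' t' : T) : R (val s') = R (val t') -> forall i, (i <= m)%N -> (psum (val s') i <= psum (val t') i)%N.
    move=> e; apply: (lower_ungap (psum_mono _) (psum_mono _) (psum0 _) (gap_n t')).
    by rewrite -/(R (val s')) e; apply: lower_ungap_refl; apply: psum_mono.
  have [im|mi] := leqP i m; first by apply/eqP; rewrite eqn_leq !sub.
  have top (t' : T) : psum (val t') i = k.
    have := psum_le_mdeg (val t') i; have := mono_le (psum_mono (val t')) (ltnW mi).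
    by rewrite (TP t').1 (Tm t') => h1 h2; apply/eqP; rewrite eqn_leq h2 h1.
  by rewrite !top.
have cardR (t : T) : mdeg (mesym1 (R (val t))) = k.
  rewrite mdeg_mesym1 card_lower ?psum0 ?Tm //; first exact: psum_mono.
  by move=> i j im ji; have := gap_n t i im; lia.
pose f : {mpoly K[n]} := \sum_(t : T) x t *: 'X_[mesym1 (R (val t))].
have fC : sr_ideal C f.
  apply: ideal_gen_sum => t _; rewrite -mul_mpolyC -[_ * _]mulr1; apply/ideal_genM/ideal_gen_mem.
  exists (R (val t)) => //; apply: lower_C; rewrite ?psum0 //; first exact: psum_mono.
  by apply: contra_not nUw; apply: psum_below_le => i im; apply: (TP t).2.
have f0 : f != 0.
  apply/eqP => /(congr1 (fun f : {mpoly K[n]} => f@_(mesym1 (R (val t0))))); rewrite mcoeff0 raddf_sum /=.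
  rewrite (bigD1 t0) //= mcoeffZ mcoeffX eqxx mulr1 big1 ?addr0; first exact/eqP.
  move=> t tt0; rewrite mcoeffZ mcoeffX; case: eqP => [e|]; last by rewrite mulr0.
  case/eqP: tt0; apply: R_inj; apply/setP => j.
  by move/mnmP: e => /(_ j); rewrite !mnmE; do 2!case: (j \in _).
have [b blead] : exists b, sym_lead (sym_map A f) b.
  by apply: sym_lead_exists; apply: contraNneq f0 => e; rewrite -(sym_mapK f Au) e /sym_map comp_mpoly0.
have fhom : sym_map A f \is k.-homog.
  rewrite /sym_map raddf_sum; apply: rpred_sum => t _ /=; rewrite comp_mpolyZ; apply: dhomogZ.
  by have := sym_map_homog A (mesym1 (R (val t))); rewrite cardR.
have bk : mdeg b = k by have [bs _] := blead; have /dhomogP/(_ _ bs) := fhom.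
have bB i : (i <= m)%N -> (psum w i <= psum b i)%N.
  move=> im; have iN : (i < n)%N by lia.
  apply: (lead_psum Kinf (i := Ordinal iN) (l := psum w i) mA _ blead).
    by rewrite /=; have := psum_le_mdeg w i; lia.
  move=> t a ta; rewrite meval_sym_map raddf_sum big1 //= => s _; rewrite mevalZ mevalX.
  suff [p pR pt] : exists2 p, p \in R (val s) & p \in gaps n t.
    by rewrite (bigD1 p) //= ta // mnmE pR expr1 mul0r mulr0.
  have ti : (psum t i < psum w i)%N.
    by apply: leq_ltn_trans (psum_le_mdeg t i) (valP t).
  apply: contrapT => dis; have sub : lower n i 2 (psum (val s)) \subset ungap n i (psum t).
    apply/subsetP => v /lowerP[j [r [ji jr rj vE]]]; apply/negPn/negP => vt; apply: dis.
    exists v; last by rewrite inE.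
    by apply/lowerP; exists j, r; split=> //; apply: leq_trans im.
  have gt : forall j, (j < i)%N -> (j + 2 * psum t j.+1 < n)%N.
    by move=> j ji; have := psum_le_mdeg t j.+1; have := valP t; have := psum_le_mdeg w i; rewrite /=; lia.
  have := lower_ungap (psum_mono _) (psum_mono _) (psum0 _) gt sub (leqnn i).
  by rewrite leqNgt (leq_trans ti) // (TP s).2.
have [bw|bw] := eqVneq b w; first by exists f; rewrite // -bw.
have bL : (mdeg b < k.+1)%N by rewrite bk.
have : BMultinom bL \in Bw :\ wb.
  by rewrite in_setD1 -val_eqE /= bw inE /= bk eqxx; apply/forallP => i; apply: bB; rewrite -ltnS ltn_ord.
move=> /xB /= e; have [+ _] := blead; rewrite mcoeff_msupp => /eqP[]; rewrite -[RHS]e.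
have phiE : sym_map A f = \sum_t x t *: sym_map A 'X_[mesym1 (R (val t))].
  by rewrite {1}/sym_map raddf_sum; apply: eq_bigr => t _ /=; rewrite comp_mpolyZ.
by rewrite phiE raddf_sum; apply: eq_bigr => t _ /=; rewrite mcoeffZ.
Qed.

Let US_le S S' : (forall i, i <= m -> S' i <= S i)%N -> US S -> US S'.
Proof. exact: psum_below_le. Qed.

Lemma sym_lead_of_gin : exists2 p : {mpoly K[n * n]}, p != 0 &
  forall A, A \in unitmx -> p.@[fun k => mxvec A 0 k] != 0 -> minors A /\
  forall w, gin (psum w) -> exists2 f, sr_ideal C f & sym_lead (sym_map A f) w.
Proof.
have [pm pm0 pmA] := minors_generic K n.
(* Finitely many degrees, up to d + 1, are enough for one polynomial to serve every w, because the
   divisors chosen below for the Lefschetz case have degree at most d + 1. *)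
have blk (e : 'I_d.+2) : exists p : {mpoly K[n * n]}, p != 0 /\ ((d <= 2 * e)%N ->
  forall A : 'M[K]_n, A \in unitmx -> p.@[fun k => mxvec A 0 k] != 0 ->
  forall w : 'X_{1..n}, mdeg w = e -> psum w m.+1 = e -> (d < e + psum w m)%N ->
  exists2 f, sr_ideal C f & sym_lead (sym_map A f) w).
  have [de|_] := leqP d (2 * e)%N; last by exists 1; split=> //; apply: oner_neq0.
  have [p p0 pA] := sym_block Kinf nE US_le (psum_below_deg Udeg) lower_C reach_C de.
  by exists p.
have [pe peP] := choice blk.
exists (pm * \prod_e pe e).
  by rewrite mulf_neq0 //; apply/prodf_neq0 => e _; apply: (peP e).1.
move=> A Au; rewrite mevalM mulf_eq0 negb_or rmorph_prod => /andP[/pmA mA /prodf_neq0 peA].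
split=> // w wG.
suff [w' ww' [f fC flead]] : exists2 w' : 'X_{1..n}, (w' <= w)%MM & exists2 f, sr_ideal C f & sym_lead (sym_map A f) w'.
  exists (1 * f * sym_map (invmx A) 'X_[(w - w')]); first exact: ideal_genM.
  rewrite mul1r sym_mapM sym_mapVK // -{2}(submK ww') addmC.
  exact: sym_lead_mulX.
have pw := psum_mono w; have mn : (m.+1 < n)%N by lia.
(* Keeping the first c variables and cutting the partial sums at j gives a divisor of w. *)
have div c j : (c <= n)%N -> (mnm_of n (fun i => minn (psum w (minn i c)) j) <= w)%MM /\
    forall i, (i <= n)%N -> psum (mnm_of n (fun i => minn (psum w (minn i c)) j)) i = minn (psum w (minn i c)) j.
  move=> cn; set S := fun _ => _.
  have mS : mono S.
    move=> i; rewrite /S; have h : (minn i c <= minn i.+1 c)%N by lia.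
    by have := mono_le pw h; lia.
  have S0 : S 0%N = 0%N by rewrite /S min0n psum0 min0n.
  split; last by move=> i iN; rewrite psum_mnm_of.
  apply/mnm_lepP => i; rewrite mnmE /S; case: (ltnP i c) => ic.
    by rewrite (minn_idPl ic) psumS; lia.
  by rewrite (minn_idPr (leqW ic)) subnn.
have [ltd|ged] := ltnP d (psum w m + psum w m.+1).
  have [h1 h2] := div m.+1 d.+1 (ltnW mn); set w' := mnm_of _ _ in h1 h2.
  exists w' => //; have w'm : psum w' m = minn (psum w m) d.+1.
    by rewrite h2 ?(ltnW (ltnW mn)) // (minn_idPl (leqnSn m)).
  have w'm1 : psum w' m.+1 = minn (psum w m.+1) d.+1 by rewrite h2 ?(ltnW mn) // minnn.
  have ed : (minn (psum w m.+1) d.+1 < d.+2)%N by rewrite ltnS geq_minr.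
  have w'e : mdeg w' = minn (psum w m.+1) d.+1.
    by rewrite -(psum_ge w' (leqnn n)) h2 // (minn_idPr (ltnW mn)).
  have pm1 := pw m.
  by apply: ((peP (Ordinal ed)).2 _ A Au (peA _ isT)) => //=; rewrite ?w'm; lia.
case: wG => [nU|]; last by rewrite ltnNge ged.
have mn' := ltnW (ltnW mn).
have [h1 h2] := div m (psum w m) mn'; set w' := mnm_of _ _ in h1 h2.
have w'i i : (i <= m)%N -> psum w' i = psum w i.
  move=> im; rewrite h2 ?(leq_trans im) // (minn_idPl im) (minn_idPl _) //; exact: mono_le im.
have w'k : mdeg w' = psum w m by rewrite -(psum_ge w' (leqnn n)) h2 // (minn_idPr mn') minnn.
exists w' => //; apply: sym_lead_below => //.
- by apply: contra_not nU; apply: US_le => i im; rewrite w'i.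
- by rewrite w'i.
by rewrite w'k; have := pw m; lia.
Qed.

Hypothesis facets_C : (\sum_(u : 'X_{1..m < d.+2} | bmnm u \in U) (d.+1 - 2 * mdeg u) <=
  #|[set F in C | #|F| == d]|)%N.

(* The evaluations at the facets of the sphere show that there are at least as many
   monomials of degree <= d in the first m + 1 variables that are not leading as
   there are facets, and hence at least as many as monomials outside gin. *)
Lemma sym_gin_of_lead A : minors A ->
  (forall w, gin (psum w) -> exists2 f, sr_ideal C f & sym_lead (sym_map A f) w) ->
  forall f b, sr_ideal C f -> sym_lead (sym_map A f) b -> gin (psum b).
Proof.
move=> mA leads f b fC blead; apply: contrapT => ngb.
have mn : (m.+1 < n)%N by lia.
pose i := Ordinal mn; pose T := {F : {set 'I_n} | F \in [set F in C | #|F| == d]}.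
have TP (t : T) : val t \in C /\ #|val t| = d by have := valP t; rewrite inE => /andP[-> /eqP].
have cT (t : T) : #|~: val t| = i.
  by have := cardsC (val t); rewrite card_ord (TP t).2 /=; move: #|_| => x; rewrite nE; lia.
have [h hf] : exists h : T -> 'I_n -> 'I_n -> K, forall t, flat A i (~: val t) (h t).
  have fl (t : T) := flat_exists mA (cT t).
  by have [h hE] := choice fl; exists h.
(* Large enough for the products of d linear forms that separate the facets, and for the truncation
   of b. *)
pose L := maxn d.+1 (mdeg (trunc_mnm i b)).+1.
have bL : (mdeg (trunc_mnm i b) < L)%N by rewrite leq_max leqnn orbT.
pose N := [set b0 : 'X_{1..m.+1 < L} | `[< ~ gin (psum b0) >]].
pose tb : 'X_{1..m.+1 < L} := BMultinom bL.
have gin_eq S S' : (forall k, (k <= m.+1)%N -> S k = S' k) -> gin S -> gin S'.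
  by move=> e; apply: (gin_le US_le) => k km; rewrite e.
have tbN : tb \in N.
  by rewrite inE; apply/asboolP; apply: contra_not ngb; apply: gin_eq => k km; apply: (psum_trunc (i := i)).
have := @sym_count K n Kinf A i T (fun t => ~: val t) (fun t => val t) (fun=> 0%N) L h (N :\ tb) hf.
have -> : #|{: T}| = #|[set F in C | #|F| == d]| by rewrite card_sig; apply: eq_card => F; rewrite inE.
have lt : (#|N :\ tb| < #|[set F in C | #|F| == d]|)%N.
  apply: leq_trans facets_C; apply: leq_trans (nongin_card d Uideal L).
  by rewrite -/N (cardsD1 tb N) tbN.
rewrite [(#|[set F in C | _]| <= _)%N]leqNgt lt => hc; apply: notF; apply: hc.
- by move=> t; rewrite (TP t).2 leq_max leqnn.
- by move=> t; rewrite -setI_eq0 setICr.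
- move=> s t st; rewrite -subsets_disjoint => sub; case/eqP: st; apply: val_inj.
  by apply/eqP; rewrite eqEcard sub (TP s).2 (TP t).2 leqnn.
have vanish g : sr_ideal C g -> forall (t : T) a, (forall p, p \in ~: val t -> \sum_l a l * A l p = 0) ->
    (sym_map A g).@[a] = 0.
  move=> gC t a ta; rewrite meval_sym_map; apply: sr_ideal_meval gC => //.
  apply: (C_sub (TP t).1); apply/subsetP => p; rewrite inE; apply: contraNT => pt.
  by rewrite ta // inE.
move=> b0 b0N; have [->|ne] := eqVneq b0 tb.
  by exists (sym_map A f), b; split=> //; apply: vanish.
have gb0 : gin (psum b0).
  by move: b0N; rewrite in_setD1 ne inE /= => /asboolP; apply: contra_notP.
have [|g gC glead] := leads (extend_mnm (i := i) b0).
  by apply: gin_eq gb0 => k km; rewrite psum_extend ?(minn_idPl km) // (leq_trans km) // ltnW.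
exists (sym_map A g), (extend_mnm (i := i) b0); split=> //; first by rewrite trunc_extend.
exact: vanish.
Qed.

End SymGin.

Local Close Scope ring_scope.

(** * The operator Phi in terms of gap counts *)

Section PhiIndices.
Variable n : nat.
Implicit Types (F : {set 'I_n}) (u v w : 'X_{1..n}).

Lemma count_vals F x : count (gtn x) (vals F) = below F x.
Proof.
rewrite /vals count_map -size_filter /below cardE; apply/perm_size/uniq_perm.
- by rewrite filter_uniq ?enum_uniq.
- exact: enum_uniq.
by move=> v; rewrite mem_filter [RHS]mem_enum in_set_ mem_enum andbC.
Qed.

Lemma below_nth F k : k < #|F| -> below F (nth 0 (vals F) k) = k.
Proof.
move=> kF; have sF := sorted_vals F; have sF' := sub_sorted (fun x y => @ltnW x y) sF.
have h j : j < #|F| -> (j < below F (nth 0 (vals F) k)) = (j < k).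
  move=> jF; rewrite -count_vals -nth_sorted_lt ?size_vals //.
  case: (ltngtP j k) => jk.
  - by apply: (sorted_ltn_nth ltn_trans) => //; rewrite inE size_vals.
  - by apply/negbTE; rewrite -leqNgt ltnW //; apply: (sorted_ltn_nth ltn_trans) => //; rewrite inE size_vals.
  by rewrite jk ltnn.
apply/eqP; rewrite eqn_leq [X in _ && X]leqNgt; apply/andP; split.
  by rewrite leqNgt; apply/negP => lt; have := h k kF; rewrite lt ltnn.
apply/negP => lt; have := h _ (ltn_trans lt kF); by rewrite ltnn lt.
Qed.

Lemma nth_vals_ge F k : k < #|F| -> k <= nth 0 (vals F) k.
Proof. by move=> kF; rewrite -{1}(below_nth kF) below_le. Qed.

(** The index list of the monomial that Phi sends to x_F. *)
Definition gap_indices F := mkseq (fun k => nth 0 (vals F) k - k) #|F|.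

Lemma count_gap_indices F i : count (gtn i) (gap_indices F) = cnt F i.
Proof.
pose s := [seq (x : 'I_n) - below F x | x <- enum F].
have -> : gap_indices F = s.
  apply: (@eq_from_nth _ 0); first by rewrite size_mkseq size_map cardE.
  move=> k; rewrite size_mkseq => kF; have n0 : 0 < n.
    by apply: leq_trans (card_set_ord F); apply: leq_ltn_trans kF.
  have kE : k < size (enum F) by rewrite -cardE.
  rewrite nth_mkseq // [RHS](nth_map (Ordinal n0)) //.
  have -> : (nth (Ordinal n0) (enum F) k : nat) = nth 0 (vals F) k by rewrite /vals (nth_map (Ordinal n0)).
  by rewrite below_nth.
rewrite /s count_map -size_filter /cnt cardE; apply/perm_size/uniq_perm.
- by rewrite filter_uniq ?enum_uniq.
- exact: enum_uniq.
by move=> v; rewrite mem_filter [RHS]mem_enum in_set_ mem_enum andbC.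
Qed.

Lemma sorted_gap_indices F : sorted leq (gap_indices F).
Proof.
apply/(sortedP 0) => k; rewrite size_mkseq => kF; have kF' := ltnW kF.
rewrite !nth_mkseq //; have lt : nth 0 (vals F) k < nth 0 (vals F) k.+1.
  by apply: (sorted_ltn_nth ltn_trans) (sorted_vals F) _ _ _ _ _; rewrite ?inE ?size_vals.
by lia.
Qed.

Lemma Phi_is_cnt u F : Phi_is u F -> forall i, cnt F i = psum u i.
Proof.
rewrite /Phi_is -/(vals F) => e i; have sF : #|F| = mdeg u by rewrite -size_vals e size_mkseq.
rewrite -count_gap_indices -count_mindices; congr (count _ _).
apply: (@eq_from_nth _ 0); first by rewrite size_mkseq size_mindices.
move=> k; rewrite size_mkseq sF => ku; rewrite nth_mkseq ?sF // e nth_mkseq //.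
by rewrite addnK.
Qed.

Lemma Phi_is_mnm_of F : Phi_is (mnm_of n (cnt F)) F.
Proof.
have mc := @cnt_mono n F; have c0 := cnt0 F; set w := mnm_of n _.
have wd : mdeg w = #|F| by rewrite mdeg_mnm_of // cnt_full.
rewrite /Phi_is -/(vals F) /Phi_indices wd; apply: (@eq_from_nth _ 0).
  by rewrite size_vals size_mkseq.
move=> k; rewrite size_vals => kF; rewrite nth_mkseq //.
have eqk i : i <= n -> (nth 0 (vals F) k - k < i) = (nth 0 (mindices w) k < i).
  move=> iN; rewrite nth_mindices_lt ?wd // psum_mnm_of // -count_gap_indices.
  by rewrite -nth_sorted_lt ?sorted_gap_indices ?size_mkseq // nth_mkseq.
have := nth_vals_ge kF; have : nth 0 (vals F) k < n.
  have : nth 0 (vals F) k \in vals F by rewrite mem_nth ?size_vals.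
  by case/valsP => v _ ->.
move=> xn kx; have := eqk (nth 0 (vals F) k - k).+1; have := eqk (nth 0 (mindices w) k).+1.
have wn : nth 0 (mindices w) k < n by rewrite -eqk //; lia.
by rewrite !ltnSn => h1 h2; have := h1 wn; have := h2 _; lia.
Qed.

Lemma Phi_exists u : (forall k, k < mdeg u -> nth 0 (mindices u) k + k < n) -> exists F, Phi_is u F.
Proof.
move=> fit; pose F := [set v : 'I_n | val v \in Phi_indices u].
exists F; rewrite /Phi_is -/(vals F); have lt_trans := ltn_trans.
have srt : sorted ltn (Phi_indices u).
  apply/(sortedP 0) => k; rewrite size_mkseq => ku; have ku' := ltnW ku.
  rewrite !nth_mkseq // /ltn /= addnS ltnS leq_add2r.
  have := sorted_mindices u; move/(sortedP 0); apply; by rewrite size_mindices.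
apply: (irr_sorted_eq ltn_trans ltnn (sorted_vals F) srt) => x.
apply/valsP/idP => [[v]|xu]; first by rewrite inE => vu ->.
have xn : x < n by case/mapP: xu => k; rewrite mem_iota => /fit kn ->.
by exists (Ordinal xn); rewrite ?inE.
Qed.

(** The largest vertex influences no gap count of the others, so only the values [cnt F i] = |F|
    drop, and by one. This carries minimality of nonfaces over to minimality of generators. *)
Lemma cnt_setD_max F (x : 'I_n) i : x \in F -> (forall y, y \in F -> y <= x) ->
  minn (cnt F i) #|F|.-1 <= cnt (F :\ x) i.
Proof.
move=> xF xmax; have bE (y : 'I_n) : y \in F :\ x -> below (F :\ x) y = below F y.
  rewrite in_setD1 => /andP[yx yF]; apply: eq_card => z; rewrite !in_set_ in_setD1.
  case: (ltnP z y) => zy; rewrite ?andbF // !andbT.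
  by rewrite -val_eqE /= ltn_eqF // (leq_trans zy) ?xmax.
have [xi|xi] := ltnP (x - below F x) i.
  have allF : F :\ x \subset [set v in F :\ x | v - below (F :\ x) v < i].
    apply/subsetP => y yF; rewrite in_set_ yF bE //=; apply: leq_ltn_trans xi.
    have := yF; rewrite in_setD1 => /andP[_ /xmax yx].
    by have := below_add F yx; have := below_le F y; lia.
  apply: leq_trans (geq_minr _ _) _; apply: leq_trans (subset_leq_card allF).
  by rewrite (cardsD1 x F) xF.
apply: leq_trans (geq_minl _ _) _; apply/subset_leq_card/subsetP => y; rewrite !in_set_ => /andP[yF yi].
have yx : y \in F :\ x.
  by rewrite in_setD1 yF andbT; apply: contraTneq yi => ->; rewrite -leqNgt.
by rewrite yx bE.
Qed.

End PhiIndices.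

Local Open Scope ring_scope.

Section MonomialIdeals.
Variables (K : fieldType) (n : nat).
Implicit Types (u v w : 'X_{1..n}) (C D : {set {set 'I_n}}).

Lemma mesym1_sub (F G : {set 'I_n}) : F \subset G -> mesym1 G = (mesym1 F + mesym1 (G :\: F))%MM.
Proof.
move=> FG; apply/mnmP => i; rewrite mnmDE !mnmE in_setD; have := subsetP FG i.
by case: (i \in F) => [->|] //=; case: (i \in G).
Qed.

Lemma sr_ideal_mesym1 C (F : {set 'I_n}) : (forall F G : {set 'I_n}, F \in C -> G \subset F -> G \in C) ->
  sr_ideal C ('X_[mesym1 F] : {mpoly K[n]}) -> F \notin C.
Proof.
move=> Csub CF; apply/negP => FC; pose a (j : 'I_n) : K := (j \in F)%:R.
have := sr_ideal_meval (a := a) Csub _ CF; rewrite mevalX => h.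
have : (1 : K) = 0.
  rewrite -[RHS]h; last first.
    by rewrite (_ : [set j | _] = F) //; apply/setP => j; rewrite inE /a; case: (j \in F); rewrite ?oner_eq0 ?eqxx.
  by rewrite big1 // => j _; rewrite mnmE /a; case: (j \in F); rewrite ?expr1 ?expr0.
by move/eqP; rewrite oner_eq0.
Qed.

Lemma ideal_gen_monomial (g : 'X_{1..n} -> Prop) u :
  (forall u v, g u -> (u <= v)%MM -> g v) ->
  ideal_gen (fun f : {mpoly K[n]} => exists2 w, g w & f = 'X_[w]) 'X_[u] <-> g u.
Proof.
move=> gup; split=> [|gu]; last by apply: ideal_gen_mem; exists u.
move=> h; suff : forall v, v \in msupp ('X_[u] : {mpoly K[n]}) -> g v by apply; rewrite msuppX mem_head.
move: h; apply: (ideal_gen_ind (P := fun f : {mpoly K[n]} => forall v, v \in msupp f -> g v)).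
- by move=> v; rewrite msupp0.
- by move=> x y gx gy v /msuppD_le; rewrite mem_cat => /orP[/gx|/gy].
move=> a _ b [w gw ->] v; rewrite mulrAC (perm_mem (msuppMX _ _)) => /mapP[v' _ ->].
by apply: gup gw _; apply/mnm_lepP => i; rewrite mnmDE ?leq_addr ?leq_addl.
Qed.

Lemma min_generator_exists (G : {mpoly K[n]} -> Prop) w : G 'X_[w] ->
  exists2 u, min_generator G u & (u <= w)%MM.
Proof.
have [N] := ubnP (mdeg w); elim: N w => // N IHN w; rewrite ltnS => wN Gw.
have [mw|nmw] := pselect (min_generator G w); first by exists w; rewrite ?lepm_refl.
have [v [vw Gv ne]] : exists v, [/\ (v <= w)%MM, G 'X_[v] & v <> w].
  apply: contrapT => h; apply: nmw; split=> // v vw Gv; apply: contrapT => ne; apply: h.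
  by exists v.
have [|u mu uv] := IHN v _ Gv; last by exists u => //; apply: lepm_trans vw.
apply: leq_trans wN; rewrite -[X in (_ < mdeg X)%N](submK vw) mdegD -[X in (X < _)%N]add0n ltn_add2r lt0n mdeg_eq0.
by apply/eqP => e; apply: ne; rewrite -(submK vw) e add0m.
Qed.

Lemma minors_unit (A : 'M[K]_n) : minors A -> A \in unitmx.
Proof.
move=> mA; rewrite -row_free_unit -kermx_eq0; apply/eqP/row_matrixP => i; rewrite row0.
have /sub_kermxP yA : (row i (kermx A) <= kermx A)%MS by apply: row_sub.
apply/rowP => j; rewrite [RHS]mxE; apply: (mA setT (fun j => row i (kermx A) 0 j)) => [l|p _].
  by rewrite cardsT card_ord leqNgt ltn_ord.
by have := congr1 (fun v : 'rV_n => v 0 p) yA; rewrite !mxE.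
Qed.

End MonomialIdeals.

(** * Symmetric shifting of the sphere and of the cyclic polytope *)

Section SymShifting.
Variables (K : fieldType) (n m d : nat).
Hypothesis Kinf : infinite_type K.
Hypothesis nE : n = (m + d.+1)%N.

Section Sphere.
Variables (U : {pred 'X_{1..m}}) (C D : {set {set 'I_n}}).
Hypothesis d0 : (0 < d)%N.
Hypothesis Uideal : shifted_order_ideal U.
Hypothesis Udeg : forall u, u \in U -> ((mdeg u).*2 <= d.+1)%N.
Hypothesis C_sub : forall F G : {set 'I_n}, F \in C -> G \subset F -> G \in C.
Hypothesis lower_C : forall S, mono S -> S 0%N = 0%N -> ~ psum_below U S -> lower n m 2 S \notin C.
Hypothesis reach_C : forall S, mono S -> S 0%N = 0%N -> psum_below U S -> ~: reach n m S \notin C.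
Hypothesis facets_C : (\sum_(u : 'X_{1..m < d.+2} | bmnm u \in U) (d.+1 - 2 * mdeg u) <=
  #|[set F in C | #|F| == d]|)%N.
Hypothesis Dcplx : simplicial_complex D.
Hypothesis DE : forall F, F \notin D <-> gin m d (psum_below U) (cnt F).

Local Notation gin := (gin m d (psum_below U)).
Let G := ideal_gen (fun f : {mpoly K[n]} => exists2 w : 'X_{1..n}, gin (psum w) & f = 'X_[w]).

Let gin_up S S' : (forall i, S i <= S' i)%N -> gin S -> gin S'.
Proof. by move=> le; apply: (gin_le (@psum_below_le m U)) => i _. Qed.

Let GE (w : 'X_{1..n}) : G 'X_[w] <-> gin (psum w).
Proof.
apply: (ideal_gen_monomial K (g := fun w => gin (psum w))) => u v gu uv; apply: gin_up gu => i.
by apply: leq_sum => j _; move: uv => /mnm_lepP.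
Qed.

Theorem sym_shifting_sphere : sym_shifting K C D.
Proof.
split=> //; exists G.
  have [p p0 pA] := sym_lead_of_gin Kinf nE d0 Udeg lower_C reach_C.
  exists p => // A Au /(pA A Au)[mA leads] f; split; apply: ideal_gen_sub => {}f.
    move=> [_ [u [[g gC ->] glead ->]]]; apply: ideal_gen_mem; exists u => //.
    exact: (sym_gin_of_lead Kinf nE d0 Uideal C_sub facets_C mA leads gC glead).
  move=> [w /leads[g gC glead] ->]; apply: ideal_gen_mem; exists (sym_map A g), w.
  by split=> //; exists g.
move=> f; split; apply: ideal_gen_sub => {}f; last first.
  move=> [u [F [[Gu _] uF ->]]]; apply: ideal_gen_mem; exists F => //; apply/DE.
  by move/GE: Gu; apply: gin_up => i; rewrite (Phi_is_cnt uF).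
(* A minimal nonface F0 in F is Phi of the monomial with partial sums [cnt F0]. This monomial is a
   minimal generator: a proper divisor in [gin] would make F0 without its largest vertex a
   nonface. *)
move=> [F FD ->]; have [F0] := minset_exists (P := fun X : {set 'I_n} => X \notin D) FD.
move=> /minsetP[F0D F0min] F0F.
rewrite (mesym1_sub F0F) addmC mpolyXD -[_ * _]mulr1.
apply/ideal_genM/ideal_gen_mem; exists (mnm_of n (cnt F0)), F0.
have wE i : (i <= n)%N -> psum (mnm_of n (cnt F0)) i = cnt F0 i.
  by move=> iN; rewrite psum_mnm_of ?cnt0 //; apply: cnt_mono.
have wge i : (n <= i)%N -> cnt F0 i = cnt F0 n by move=> iN; rewrite !cnt_full.
have wE' i : psum (mnm_of n (cnt F0)) i = cnt F0 i.
  by have [/wE //|/ltnW iN] := leqP i n; rewrite psum_ge // -(psum_ge _ (leqnn n)) wE // wge.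
split=> //; last exact: Phi_is_mnm_of.
split; first by apply/GE; move/DE: F0D; apply: gin_up => i; rewrite wE'.
move=> v vw Gv; apply: contrapT => ne.
have vlt : (mdeg v < #|F0|)%N.
  rewrite -(@cnt_full n F0 n) // -wE // psum_ge // -[X in (_ < mdeg X)%N](submK vw) mdegD.
  rewrite -[X in (X < _)%N]add0n ltn_add2r lt0n mdeg_eq0.
  by apply/eqP => e; apply: ne; rewrite -(submK vw) e add0m.
have [x0 x0F] : exists x, x \in F0 by apply/card_gt0P; apply: leq_ltn_trans vlt.
have [x xF xmax] := arg_maxnP (P := fun x => x \in F0) val x0F.
have : F0 :\ x \notin D.
  apply/DE; move/GE: Gv; apply: gin_up => i; apply: leq_trans (cnt_setD_max i xF xmax).
  rewrite leq_min -wE'; apply/andP; split.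
    by apply: leq_sum => j _; move: vw => /mnm_lepP.
  by apply: leq_trans (psum_le_mdeg v i) _; rewrite -ltnS (leq_trans vlt) // leqSpred.
move=> /F0min -/(_ (subD1set _ _)) e; have : x \in F0 :\ x by rewrite e.
by rewrite in_setD1 eqxx.
Qed.

End Sphere.

(** From a violating F the Lefschetz property of the cyclic polytope produces a monomial w of its
    generic initial ideal with partial sums at most [cnt F]. A minimal generator dividing w has its
    Phi outside D, yet dominated by F, hence in C. *)
Lemma cyclic_bound (R : realFieldType) (t : 'I_n -> R) (C D : {set {set 'I_n}}) :
  (forall i j : 'I_n, (i < j)%N -> t i < t j) ->
  sym_shifting K (cyclic_complex d t) D -> C \subset D -> simplicial_complex C -> shifted C ->
  forall F, F \in C -> (cnt F m + cnt F m.+1 <= d)%N.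
Proof.
move=> tmono [Dcplx [G [pG pG0 GA] GD]] CD Ccplx Cshift F FC; rewrite leqNgt; apply/negP => dF.
have mn : (m < n)%N by lia.
pose US (S : nat -> nat) := (2 * S m <= d.+1)%N.
have US_le S S' : (forall i, i <= m -> S' i <= S i)%N -> US S -> US S'.
  by move=> /(_ m (leqnn m)); rewrite /US; lia.
have lowC S : mono S -> S 0%N = 0%N -> ~ US S -> lower n m 2 S \notin cyclic_complex d t.
  by move=> mS S0 /negP; rewrite -ltnNge => dS; apply: (cyclic_lower_nonface tmono nE mS S0 dS).
have reaC S : mono S -> S 0%N = 0%N -> US S -> ~: reach n m S \notin cyclic_complex d t.
  by move=> mS S0 dS; apply: (cyclic_reach_nonface tmono nE mS S0 dS).
have mc := @cnt_mono n F; have c0 := cnt0 F.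
pose e := minn (cnt F m.+1) d.+1; have de : (d <= 2 * e)%N by rewrite /e; have := mc m; lia.
have [p p0 pA] := sym_block Kinf nE US_le (fun S h => h) lowC reaC de.
have [pm pm0 pmA] := minors_generic K n.
have [x] : exists x, (pm * p * pG).@[x] != 0 by apply: mpoly_nonroot; rewrite ?mulf_neq0.
pose A : 'M[K]_n := vec_mx (\row_l x l).
have xA : x =1 fun k => mxvec A 0 k by move=> k; rewrite vec_mxK mxE.
rewrite !mevalM !mulf_eq0 !negb_or !(meval_eq _ xA) => /andP[/andP[/pmA/minors_unit Au px] pGx].
(* With m + 1 variables and degree at most d + 1, Phi of any divisor of w has indices at most m + d
   < n, so it is a set of vertices. *)
pose S i := minn (cnt F (minn i m.+1)) d.+1.
have mS : mono S.
  move=> i; rewrite /S; have h : (minn i m.+1 <= minn i.+1 m.+1)%N by lia.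
  by have := mono_le mc h; lia.
have S0 : S 0%N = 0%N by rewrite /S min0n c0 min0n.
have wE i : (i <= n)%N -> psum (mnm_of n S) i = S i by move=> iN; rewrite psum_mnm_of.
set w := mnm_of n S in wE.
have we : mdeg w = e by rewrite mdeg_mnm_of // /S (minn_idPr mn).
have wm1 : psum w m.+1 = e by rewrite wE // /S minnn.
have wm : (d < e + psum w m)%N.
  by rewrite wE ?(ltnW mn) // /S (minn_idPl (leqnSn m)) /e; have := mc m; lia.
have [f fC flead] := pA A Au px w we wm1 wm.
have Gw : G 'X_[w].
  by apply/(GA A Au pGx); apply: ideal_gen_mem; exists (sym_map A f), w; split=> //; exists f.
have [v vmin vw] := min_generator_exists Gw.
have psvw i : (psum v i <= psum w i)%N by apply: leq_sum => j _; move: vw => /mnm_lepP.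
have split_deg (u : 'X_{1..n}) : mdeg u = (psum u m.+1 + \sum_(j < n | m < j) u j)%N.
  rewrite mdegE (bigID (fun j : 'I_n => j < m.+1)%N) /=; congr (_ + _)%N.
  by apply: eq_bigl => j; rewrite -leqNgt.
have vdeg : mdeg v = psum v m.+1.
  rewrite split_deg; apply/eqP; rewrite -[X in _ == X]addn0 eqn_add2l -leqn0.
  apply: (@leq_trans (\sum_(j < n | (m < j)%N) w j)); first by apply: leq_sum => j _; move: vw => /mnm_lepP.
  by rewrite leqn0 -(eqn_add2l (psum w m.+1)) -split_deg we wm1 addn0.
have [|Fv vF] := @Phi_exists n v.
  move=> k kv; have : (nth 0 (mindices v) k < m.+1)%N by rewrite nth_mindices_lt // -vdeg.
  have : (k < d.+1)%N by apply: leq_trans kv _; rewrite vdeg; apply: leq_trans (psvw _) _; rewrite wm1 geq_minr.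
  by move: (nth _ _ _) => x1; lia.
have cF := Phi_is_cnt vF.
have FvD : Fv \notin D.
  apply: (sr_ideal_mesym1 (K := K) Dcplx.2); apply/GD/ideal_gen_mem; exists v, Fv.
  by split.
case/negP: FvD; apply: (subsetP CD); apply: (shifted_dominance Ccplx Cshift FC) => i.
rewrite cF; have [iN|ni] := leqP i n.
  apply: leq_trans (psvw i) _; rewrite wE // /S; apply: leq_trans (geq_minl _ _) _.
  by apply: mono_le mc _; rewrite geq_minl.
rewrite psum_ge ?(ltnW ni) // vdeg; apply: leq_trans (psvw _) _; rewrite wm1.
apply: leq_trans (geq_minl _ _) _; apply: mono_le mc _; lia.
Qed.

End SymShifting.

Local Close Scope ring_scope.

(** * Exterior algebraic shifting *)

Lemma enum_min n (F : {set 'I_n}) (x : 'I_n) : x \in F -> (forall y, y \in F -> x <= y) ->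
  enum F = x :: enum (F :\ x).
Proof.
move=> xF xmin; apply: (inj_map val_inj); rewrite /= -/(vals F) -/(vals (F :\ x)).
apply: (irr_sorted_eq ltn_trans ltnn (sorted_vals F)).
  rewrite /= path_min_sorted ?sorted_vals //; apply/allP => _ /valsP[y + ->].
  by rewrite in_setD1 /= ltn_neqAle eq_sym -val_eqE => /andP[-> /xmin ->].
move=> k; rewrite inE; apply/valsP/orP => [[y yF ->]|[/eqP ->|/valsP[y yF ->]]].
- by rewrite mem_vals in_setD1 yF andbT -val_eqE; case: eqP => _; [left | right].
- by exists x.
by exists y => //; move: yF; rewrite in_setD1 => /andP[].
Qed.

Local Open Scope ring_scope.

Section ExteriorBasics.
Variables (K : fieldType) (n : nat).
Local Notation E := (exterior K n).
Local Notation eb := (@ext_basis K n).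
Implicit Types (x y : E) (F G : {set 'I_n}).

Lemma ext_mulE x y F : (x * y : E) F = \sum_A \sum_B (A :|: B == F)%:R * (wedge_sign K A B * (x A * y B)).
Proof. by rewrite ffunE. Qed.

Lemma ext_scaleE a x F : (a *: x) F = a * x F.
Proof. exact: ffunE. Qed.

Lemma ext_addE x y F : (x + y) F = x F + y F.
Proof. exact: ffunE. Qed.

Lemma ext_oppE x F : (- x) F = - x F.
Proof. exact: ffunE. Qed.

Lemma ext_scaleAl a x y : a *: (x * y : E) = (a *: x) * y.
Proof.
apply/ffunP => F; rewrite ext_scaleE !ext_mulE [LHS]mulr_sumr; apply: eq_bigr => A _.
by rewrite mulr_sumr; apply: eq_bigr => B _; rewrite ext_scaleE; ring.
Qed.

Lemma ext_scaleAr a x y : a *: (x * y : E) = x * (a *: y).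
Proof.
apply/ffunP => F; rewrite ext_scaleE !ext_mulE [LHS]mulr_sumr; apply: eq_bigr => A _.
by rewrite mulr_sumr; apply: eq_bigr => B _; rewrite ext_scaleE; ring.
Qed.

Lemma ext_basis_sum x : x = \sum_F x F *: eb F.
Proof.
apply/ffunP => G; rewrite sum_ffunE (bigD1 G) //= big1 ?addr0 => [|F FG].
  by rewrite ext_scaleE ffunE eqxx mulr1.
by rewrite ext_scaleE ffunE eq_sym (negPf FG) mulr0.
Qed.

Lemma ext_basisM F G : eb F * eb G = wedge_sign K F G *: eb (F :|: G).
Proof.
apply/ffunP => X; rewrite ext_mulE (bigD1 F) //= [X in _ + X]big1 ?addr0 => [|A AF]; last first.
  by rewrite big1 // => B _; rewrite !ffunE (negPf AF) mul0r !mulr0.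
rewrite (bigD1 G) //= big1 ?addr0 => [|B BG]; last by rewrite !ffunE (negPf BG) !mulr0.
by rewrite ext_scaleE !ffunE !eqxx !mulr1 mulrC eq_sym.
Qed.

Lemma ext_linear_eq (f g : {linear E -> E}) : (forall F, f (eb F) = g (eb F)) -> f =1 g.
Proof.
move=> fg x; rewrite (ext_basis_sum x) !linear_sum; apply: eq_bigr => F _.
by rewrite !linearZ /= fg.
Qed.

Definition ext_lmul x y : E := x * y.

Lemma ext_lmul_linear x : linear (ext_lmul x).
Proof. by move=> a y z; rewrite /ext_lmul mulrDr ext_scaleAr. Qed.

HB.instance Definition _ x := GRing.isLinear.Build K E E _ (ext_lmul x) (@ext_lmul_linear x).

Definition ext_rmul x y : E := y * x.

Lemma ext_rmul_linear x : linear (ext_rmul x).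
Proof. by move=> a y z; rewrite /ext_rmul mulrDl ext_scaleAl. Qed.

HB.instance Definition _ x := GRing.isLinear.Build K E E _ (ext_rmul x) (@ext_rmul_linear x).

Lemma ext_map_linear (A : 'M[K]_n) : linear (ext_map A).
Proof.
move=> a x y; rewrite /ext_map scaler_sumr -big_split; apply: eq_bigr => F _ /=.
by rewrite scalerA -scalerDl ext_addE ext_scaleE.
Qed.

HB.instance Definition _ (A : 'M[K]_n) := GRing.isLinear.Build K E E _ (ext_map A) (@ext_map_linear A).

Definition ext_vec (v : 'rV[K]_n) : E := \sum_i v 0 i *: eb [set i].

Lemma ext_vecP a u v : ext_vec (a *: u + v) = a *: ext_vec u + ext_vec v.
Proof.
rewrite /ext_vec scaler_sumr -big_split; apply: eq_bigr => i _ /=.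
by rewrite !mxE scalerDl scalerA.
Qed.

Lemma ext_vec_delta (i : 'I_n) : ext_vec (delta_mx 0 i) = eb [set i].
Proof.
rewrite /ext_vec (bigD1 i) //= mxE !eqxx scale1r big1 ?addr0 // => j /negPf ji.
by rewrite mxE ji andbF scale0r.
Qed.

Lemma wedge_sign1 (i : 'I_n) F : (forall j, j \in F -> i < j)%N -> wedge_sign K [set i] F = 1.
Proof.
move=> iF; have iNF : i \notin F by apply/negP => /iF; rewrite ltnn.
rewrite /wedge_sign disjoints1 iNF /inversions big1 ?expr0 // => j; rewrite in_set1 => /eqP ->.
by apply: big1 => k /iF ik; rewrite ltnNge (ltnW ik).
Qed.

Lemma ext_basis1_sq (i : 'I_n) : eb [set i] * eb [set i] = 0.
Proof. by rewrite ext_basisM /wedge_sign disjoints1 set11 scale0r. Qed.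

Lemma ext_basis1_anti (i j : 'I_n) : eb [set i] * eb [set j] = - (eb [set j] * eb [set i]).
Proof.
wlog ij : i j / (i < j)%N => [h|].
  case: (ltngtP i j) => ij; first exact: h.
    by rewrite (h j i ij) opprK.
  by rewrite (val_inj ij) ext_basis1_sq oppr0.
rewrite !ext_basisM wedge_sign1 => [|k]; last by rewrite in_set1 => /eqP ->.
rewrite setUC /wedge_sign disjoints1 in_set1 -val_eqE /= gtn_eqF //= /inversions !big_set1 ij.
by rewrite expr1 scale1r scaleN1r opprK.
Qed.

Lemma ext_vec_anti u v : ext_vec u * ext_vec v = - (ext_vec v * ext_vec u).
Proof.
rewrite /ext_vec !mulr_suml -sumrN.
transitivity (\sum_i \sum_j (u 0 i * v 0 j) *: (eb [set i] * eb [set j])).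
  apply: eq_bigr => i _; rewrite mulr_sumr; apply: eq_bigr => j _.
  by rewrite -ext_scaleAl -ext_scaleAr scalerA.
rewrite exchange_big; apply: eq_bigr => j _ /=; rewrite mulr_sumr -sumrN; apply: eq_bigr => i _.
by rewrite -ext_scaleAl -ext_scaleAr scalerA ext_basis1_anti scalerN mulrC.
Qed.

Lemma ext_vec_sq u : ext_vec u * ext_vec u = 0.
Proof.
rewrite {1}/ext_vec mulr_suml.
have -> : \sum_i (u 0 i *: eb [set i]) * ext_vec u =
    \sum_(i <- index_enum 'I_n) \sum_(j <- index_enum 'I_n) (u 0 i * u 0 j) *: (eb [set i] * eb [set j]).
  apply: eq_bigr => i _; rewrite /ext_vec mulr_sumr; apply: eq_bigr => j _.
  by rewrite -ext_scaleAl -ext_scaleAr scalerA.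
elim: (index_enum _) => [|k s IHs]; first by rewrite big_nil.
rewrite big_cons; under [X in _ + X]eq_bigr => i _ do rewrite big_cons.
rewrite big_split /= IHs addr0 big_cons ext_basis1_sq scaler0 add0r -big_split big1 //= => i _.
by rewrite [eb [set i] * _]ext_basis1_anti scalerN mulrC subrr.
Qed.

Lemma prod_enum F (f : 'I_n -> E) : \prod_(j in F) f j = \prod_(j <- enum F) f j.
Proof. by rewrite -big_filter; congr (\prod_(j <- _) _); rewrite /index_enum unlock. Qed.

Definition ext_prod (s : seq 'rV[K]_n) : E := \prod_(v <- s) ext_vec v.

Lemma ext_prod_cat s t : ext_prod (s ++ t) = ext_prod s * ext_prod t.
Proof. exact: big_cat. Qed.

Lemma ext_prod_cons v s : ext_prod (v :: s) = ext_vec v * ext_prod s.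
Proof. exact: big_cons. Qed.

Lemma ext_map_basis (A : 'M[K]_n) F : ext_map A (eb F) = ext_prod [seq row j A^T | j <- enum F].
Proof.
rewrite /ext_map (bigD1 F) //= ffunE eqxx scale1r [X in _ + X]big1 ?addr0 => [|G GF]; last first.
  by rewrite ffunE (negPf GF) scale0r.
rewrite /ext_prod big_map prod_enum; apply: eq_bigr => j _.
by apply: eq_bigr => i _; rewrite !mxE.
Qed.

Lemma set_min F : F != set0 -> exists2 i, i \in F & forall j : 'I_n, j \in F -> (i <= j)%N.
Proof.
by case/set0Pn => i0 i0F; have [i iF imin] := arg_minnP (P := fun i => i \in F) val i0F; exists i.
Qed.

Lemma ext_map_min (A : 'M[K]_n) (i : 'I_n) F : (forall j, j \in F -> i < j)%N ->
  eb (i |: F) = eb [set i] * eb F /\ ext_map A (eb (i |: F)) = ext_vec (row i A^T) * ext_map A (eb F).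
Proof.
move=> iF; split; first by rewrite ext_basisM wedge_sign1 // scale1r.
have iNF : i \notin F by apply/negP => /iF; rewrite ltnn.
have eE : enum (i |: F) = i :: enum F.
  rewrite (@enum_min _ (i |: F) i) ?setU11 ?setU1K // => j.
  by rewrite in_setU1 => /predU1P[-> //|/iF/ltnW].
by rewrite !ext_map_basis eE /= ext_prod_cons.
Qed.

(** [ext_map] is defined on the basis through increasing products, so reordering has to be checked:
    e_i is moved past the least element g of G by anticommutation, in the source and in the image
    alike. *)
Lemma ext_map_mul1 (A : 'M[K]_n) (i : 'I_n) y :
  ext_map A (eb [set i] * y) = ext_vec (row i A^T) * ext_map A y.
Proof.
suff h G : ext_map A (eb [set i] * eb G) = ext_vec (row i A^T) * ext_map A (eb G).
  rewrite (ext_basis_sum y) mulr_sumr !linear_sum /= mulr_sumr; apply: eq_bigr => G _.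
  by rewrite -ext_scaleAr !linearZ /= h ext_scaleAr.
have [N] := ubnP #|G|; elim: N G => // N IHN G; rewrite ltnS => GN.
have [->|/set_min[g gG gmin]] := eqVneq G set0.
  by have [|e1 e2] := @ext_map_min A i set0 _; [move=> j; rewrite in_set0 | rewrite -e1 e2].
have gG' j : j \in G :\ g -> (g < j)%N.
  by rewrite in_setD1 ltn_neqAle eq_sym -val_eqE => /andP[-> /gmin ->].
have [e1 e2] := @ext_map_min A g (G :\ g) gG'; rewrite setD1K // in e1 e2.
case: (ltngtP i g) => ig.
- by have [|e3 e4] := @ext_map_min A i G _; [move=> j /gmin; apply: leq_trans | rewrite -e3].
- have IH : ext_map A (eb [set i] * eb (G :\ g)) = ext_vec (row i A^T) * ext_map A (eb (G :\ g)).
    by apply: IHN; apply: leq_trans GN; rewrite [X in (_ < X)%N](cardsD1 g) gG.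
  rewrite e2 e1 !mulrA ext_basis1_anti ext_vec_anti !mulNr linearN -!mulrA -IH; congr (- _).
  rewrite ext_basisM -ext_scaleAr !linearZ /= -ext_scaleAr; congr (_ *: _).
  have [|e3 e4] := @ext_map_min A g (i |: (G :\ g)) _; last by rewrite -e3 e4.
  by move=> j; rewrite in_setU1 => /predU1P[->|/gG'].
have -> : i = g by apply: val_inj.
by rewrite e2 e1 !mulrA ext_basis1_sq ext_vec_sq !mul0r linear0.
Qed.

Lemma ext_mapM (A : 'M[K]_n) x y : ext_map A (x * y) = ext_map A x * ext_map A y.
Proof.
suff h F : ext_map A (eb F * y) = ext_map A (eb F) * ext_map A y.
  rewrite (ext_basis_sum x) mulr_suml !linear_sum /= mulr_suml; apply: eq_bigr => F _.
  by rewrite -ext_scaleAl !linearZ /= h ext_scaleAl.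
have [N] := ubnP #|F|; elim: N F => // N IHN F; rewrite ltnS => FN.
have [->|/set_min[f fF fmin]] := eqVneq F set0.
  by rewrite ext_map_basis enum_set0 /ext_prod big_nil -[eb set0]/(1 : E) !mul1r.
have fF' j : j \in F :\ f -> (f < j)%N.
  by rewrite in_setD1 ltn_neqAle eq_sym -val_eqE => /andP[-> /fmin ->].
have [e1 e2] := @ext_map_min A f (F :\ f) fF'; rewrite setD1K // in e1 e2.
rewrite e2 e1 -mulrA ext_map_mul1 IHN ?mulrA //.
by apply: leq_trans FN; rewrite [X in (_ < X)%N](cardsD1 f) fF.
Qed.

Lemma ext_map_vec (A : 'M[K]_n) v : ext_map A (ext_vec v) = ext_vec (v *m A^T).
Proof.
have e1 (j : 'I_n) : ext_map A (eb [set j]) = ext_vec (row j A^T).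
  by rewrite ext_map_basis enum_set1 /ext_prod /= big_seq1.
rewrite {1}/ext_vec linear_sum /=.
under eq_bigr => j _ do rewrite linearZ /= e1 /ext_vec scaler_sumr.
rewrite exchange_big; apply: eq_bigr => i _ /=; rewrite mxE scaler_suml.
by apply: eq_bigr => j _; rewrite scalerA !mxE.
Qed.

Lemma ext_map_prod (A : 'M[K]_n) s : ext_map A (ext_prod s) = ext_prod [seq v *m A^T | v <- s].
Proof.
elim: s => [|v s IHs]; last by rewrite !ext_prod_cons ext_mapM ext_map_vec IHs.
by rewrite /ext_prod /= !big_nil -[1 in LHS]/(eb set0) ext_map_basis enum_set0 /ext_prod big_nil.
Qed.

Lemma ext_map1 x : ext_map 1%:M x = x.
Proof.
rewrite [in LHS](ext_basis_sum x) linear_sum /= [RHS]ext_basis_sum; apply: eq_bigr => F _.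
rewrite linearZ /=; congr (_ *: _); have [N] := ubnP #|F|; elim: N F => // N IHN F; rewrite ltnS => FN.
have [->|/set_min[f fF fmin]] := eqVneq F set0.
  by rewrite ext_map_basis enum_set0 /ext_prod big_nil.
have fF' j : j \in F :\ f -> (f < j)%N.
  by rewrite in_setD1 ltn_neqAle eq_sym -val_eqE => /andP[-> /fmin ->].
have [e1 e2] := @ext_map_min 1%:M f (F :\ f) fF'; rewrite setD1K // in e1 e2.
rewrite e2 e1 IHN; first by rewrite trmx1 row1 ext_vec_delta.
by apply: leq_trans FN; rewrite [X in (_ < X)%N](cardsD1 f) fF.
Qed.

Lemma ext_basis_prod F : eb F = ext_prod [seq delta_mx 0 j | j <- enum F].
Proof.
rewrite -[LHS]ext_map1 ext_map_basis; congr ext_prod; apply: eq_map => j.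
by rewrite trmx1 row1.
Qed.

Lemma ext_map_comp (A B : 'M[K]_n) x : ext_map A (ext_map B x) = ext_map (A *m B) x.
Proof.
suff h F : ext_map A (ext_map B (eb F)) = ext_map (A *m B) (eb F).
  exact: (@ext_linear_eq (ext_map A \o ext_map B) (ext_map (A *m B))).
rewrite [RHS]ext_map_basis ext_map_basis ext_map_prod -map_comp; congr ext_prod.
by apply: eq_map => j /=; rewrite -row_mul -trmx_mul.
Qed.

Lemma ext_mapK (A : 'M[K]_n) x : A \in unitmx -> ext_map (invmx A) (ext_map A x) = x.
Proof. by move=> Au; rewrite ext_map_comp mulVmx // ext_map1. Qed.

Lemma ext_mapVK (A : 'M[K]_n) x : A \in unitmx -> ext_map A (ext_map (invmx A) x) = x.
Proof. by move=> Au; rewrite ext_map_comp mulmxV // ext_map1. Qed.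

Definition ext_homog k x := forall F, x F != 0 -> #|F| = k.

Lemma ext_mul_supp x y F : (x * y : E) F != 0 -> exists A B, [/\ x A != 0, y B != 0, [disjoint A & B] & F = A :|: B].
Proof.
rewrite ext_mulE => h; apply: contrapT => nex; case/eqP: h.
apply: big1 => A _; apply: big1 => B _; case: eqP => [e|]; last by rewrite mul0r.
have [xA|xA] := eqVneq (x A) 0; first by rewrite xA mul0r !mulr0.
have [yB|yB] := eqVneq (y B) 0; first by rewrite yB !mulr0.
have [dAB|dAB] := boolP [disjoint A & B]; first by case: nex; exists A, B.
by rewrite /wedge_sign (negPf dAB) mul0r mulr0.
Qed.

Lemma ext_basis_supp F G : eb F G != 0 -> G = F.
Proof. by rewrite ffunE; case: (G =P F) => // _; rewrite /= mulr0n eqxx. Qed.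

Lemma ext_homogM k l x y : ext_homog k x -> ext_homog l y -> ext_homog (k + l) (x * y).
Proof.
move=> xk yl F /ext_mul_supp[A [B [xA yB dAB ->]]].
by rewrite cardsU -(xk A xA) -(yl B yB) (eqP (_ : A :&: B == set0)) ?setI_eq0 // cards0 subn0.
Qed.

Lemma ext_vec_homog v : ext_homog 1 (ext_vec v).
Proof.
move=> F; rewrite /ext_vec sum_ffunE => h; apply: contrapT => F1; case/eqP: h.
apply: big1 => i _; rewrite ext_scaleE ffunE; case: eqP => [e|]; last by rewrite mulr0.
by case: F1; rewrite e cards1.
Qed.

Lemma ext_prod_homog s : ext_homog (size s) (ext_prod s).
Proof.
elim: s => [|v s IHs]; last first.
  by rewrite ext_prod_cons => F /(ext_homogM (@ext_vec_homog v) IHs); rewrite add1n.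
by rewrite /ext_prod big_nil => F /(@ext_basis_supp set0 F) ->; rewrite cards0.
Qed.

Lemma ext_map_homog (A : 'M[K]_n) k x : ext_homog k x -> ext_homog k (ext_map A x).
Proof.
move=> xk F; rewrite (ext_basis_sum x) linear_sum /= sum_ffunE => h; apply: contrapT => Fk.
case/eqP: h; apply: big1 => G _; rewrite linearZ /= ext_scaleE.
have [xG|xG] := eqVneq (x G) 0; first by rewrite xG mul0r.
have [gF|gF] := eqVneq (ext_map A (eb G) F) 0; first by rewrite gF mulr0.
case: Fk; rewrite -(xk G xG); move: gF; rewrite ext_map_basis => /ext_prod_homog.
by rewrite size_map -cardE.
Qed.

(* The factors of e_H * phi(e_S) are the images of the variables under an invertible
   map X. *)
Lemma ext_top (A : 'M[K]_n) (S : {set 'I_n}) : minors A ->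
  (eb [set v : 'I_n | (#|S| <= v)%N] * ext_map A (eb S)) setT != 0.
Proof.
move=> mA; set H := [set v : 'I_n | _].
pose w := [seq delta_mx 0 j : 'rV[K]_n | j <- enum H] ++ [seq row j A^T | j <- enum S].
have wE : ext_prod w = eb H * ext_map A (eb S) by rewrite ext_prod_cat -ext_basis_prod -ext_map_basis.
have Hc : (#|H| + #|S|)%N = n.
  have := cardsC [set v : 'I_n | v < #|S|]%N; rewrite card_ltn_ord ?card_set_ord // card_ord => e; rewrite -[RHS]e.
  by rewrite addnC; congr (_ + _)%N; apply: eq_card => v; rewrite !inE -leqNgt.
have sw : size w = n by rewrite size_cat !size_map -!cardE.
pose X : 'M[K]_n := \matrix_(i, j) (nth 0 w j) 0 i.
have XE : ext_map X (eb setT) = ext_prod w.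
  rewrite ext_map_basis /ext_prod big_map -prod_enum [RHS](big_nth 0) sw big_mkord.
  rewrite (eq_bigl predT) => [|j]; last by rewrite in_setT.
  by apply: eq_bigr => j _; congr ext_vec; apply/rowP => i; rewrite !mxE.
have Xu : X \in unitmx.
  rewrite -row_free_unit -kermx_eq0; apply/eqP/row_matrixP => r; rewrite row0.
  have /sub_kermxP : (row r (kermx X) <= kermx X)%MS by apply: row_sub.
  move: (row r _) => y yX.
  have yw v : v \in w -> \sum_i y 0 i * v 0 i = 0.
    move=> /(nthP 0)[j]; rewrite sw => jn <-.
    have := congr1 (fun z : 'rV_n => z 0 (Ordinal jn)) yX; rewrite !mxE => yj; rewrite -[RHS]yj.
    by apply: eq_bigr => i _; rewrite mxE.
  apply/rowP => j; rewrite [RHS]mxE; apply: (mA S (fun j => y 0 j)) => [h Sh|p pS].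
    have /yw : delta_mx 0 h \in w.
      by rewrite mem_cat; apply/orP; left; apply/mapP; exists h; rewrite ?mem_enum ?inE.
    rewrite (bigD1 h) //= mxE !eqxx mulr1 big1 ?addr0 // => i /negPf ih.
    by rewrite mxE ih andbF mulr0.
  have /yw e : row p A^T \in w.
    by rewrite mem_cat; apply/orP; right; apply/mapP; exists p; rewrite ?mem_enum.
  by rewrite -[RHS]e; apply: eq_bigr => i _; rewrite !mxE.
apply/eqP => top0; have : eb setT = 0.
  rewrite -(ext_mapK (eb setT) Xu) XE wE; set x := _ * _ in top0 *.
  suff -> : x = 0 by rewrite linear0.
  apply/ffunP => F; rewrite [RHS]ffunE; apply/eqP/negPn/negP => xF.
  have : #|F| = n.
    by rewrite -[RHS]sw; apply: (@ext_prod_homog w); rewrite wE.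
  move=> Fn; case/eqP: xF; rewrite (_ : F = setT) //; apply/eqP.
  by rewrite eqEcard subsetT cardsT card_ord Fn leqnn.
move=> /ffunP/(_ setT); rewrite !ffunE eqxx => /eqP; exact/negP/oner_neq0.
Qed.

Lemma ext_map_mul_disjoint (A : 'M[K]_n) F G : [disjoint F & G] ->
  exists2 c : K, c != 0 & ext_map A (eb F) * ext_map A (eb G) = c *: ext_map A (eb (F :|: G)).
Proof.
move=> dFG; exists (wedge_sign K F G); last by rewrite -ext_mapM ext_basisM linearZ.
by rewrite /wedge_sign dFG signr_eq0.
Qed.

Lemma ext_map_mul_meet (A : 'M[K]_n) F G : ~~ [disjoint F & G] ->
  ext_map A (eb F) * ext_map A (eb G) = 0.
Proof. by move=> dFG; rewrite -ext_mapM ext_basisM /wedge_sign (negPf dFG) scale0r linear0. Qed.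

Lemma ext_idealP (C : {set {set 'I_n}}) x : (forall F G : {set 'I_n}, F \in C -> G \subset F -> G \in C) ->
  ext_face_ideal C x <-> forall F, F \in C -> x F = 0.
Proof.
move=> Csub; split=> [|x0].
  apply: (ideal_gen_ind (P := fun x : E => forall F, F \in C -> x F = 0)) => [F _|y z y0 z0 F FC|a b y [F FC ->] G GC].
  - by rewrite ffunE.
  - by rewrite ext_addE y0 // z0 // addr0.
  apply/eqP/negPn/negP => /ext_mul_supp[A [B [/ext_mul_supp[A1 [B1 [_ /ext_basis_supp -> _ AE]]] _ _ GE]]].
  case/negP: FC; apply: Csub GC _; rewrite GE AE; apply: subset_trans (subsetUl _ _); exact: subsetUr.
rewrite (ext_basis_sum x); apply: ideal_gen_sum => F _.
have [/x0 -> |FC] := boolP (F \in C); first by rewrite scale0r; apply: ideal_gen0.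
rewrite -[_ *: _]mulr1 -[eb F]mul1r ext_scaleAl.
by apply/ideal_genM/ideal_gen_mem; exists F.
Qed.

End ExteriorBasics.

Local Close Scope ring_scope.

Local Open Scope ring_scope.

(** * Leading exterior monomials from the Lefschetz property *)

Section ExtBlock.
Variables (K : fieldType) (n m d : nat) (US : (nat -> nat) -> Prop) (C : {set {set 'I_n}}).
Hypothesis Kinf : infinite_type K.
Hypothesis nE : n = (m + d.+1)%N.
Hypothesis US_le : forall S S', (forall i, i <= m -> S' i <= S i)%N -> US S -> US S'.
Hypothesis US_deg : forall S, US S -> (2 * S m <= d.+1)%N.
Hypothesis lower_C : forall S, mono S -> S 0%N = 0%N -> ~ US S -> lower n m 2 S \notin C.
Hypothesis reach_C : forall S, mono S -> S 0%N = 0%N -> US S -> ~: reach n m S \notin C.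
Local Notation E := (exterior K n).
Local Notation eb := (@ext_basis K n).
Local Notation pr := (@ext_prod K n).

Let prP s1 s2 a u v : pr (s1 ++ (a *: u + v) :: s2) = a *: pr (s1 ++ u :: s2) + pr (s1 ++ v :: s2).
Proof.
by rewrite !ext_prod_cat !ext_prod_cons ext_vecP mulrDl mulrDr -ext_scaleAl -ext_scaleAr.
Qed.

Let pr_swap s1 s2 u v : pr (s1 ++ u :: v :: s2) = -1 *: pr (s1 ++ v :: u :: s2).
Proof.
rewrite !ext_prod_cat !ext_prod_cons scaleN1r -mulrN; congr (_ * _).
by rewrite !mulrA ext_vec_anti mulNr.
Qed.

Let lm u : {linear E -> E} := ext_lmul (ext_vec u).

Let pr_cons u s : pr (u :: s) = lm u (pr s).
Proof. exact: ext_prod_cons. Qed.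

Let pr_alt : true -> forall s1 s2 u, pr (s1 ++ u :: u :: s2) = 0.
Proof. by move=> _ s1 s2 u; rewrite ext_prod_cat !ext_prod_cons [ext_vec u * _]mulrA ext_vec_sq mul0r mulr0. Qed.

Let Phi (g : 'M[K]_n) : {linear E -> E} := ext_map g^T.

Let PhiE g s : pr (map (mulmxr g) s) = Phi g (pr s).
Proof. by rewrite [RHS]ext_map_prod; congr pr; apply: eq_map => v; rewrite trmxK. Qed.

(** The coordinates divided out are those from m + e on, and the Lefschetz product is that of the
    coordinates from m + d - e to m + e - 1. P avoids the former and misses one of the latter; sets
    of size e that meet the former or contain the latter are smaller in the order. *)
Lemma ext_block e : (d <= 2 * e)%N -> (e <= d)%N -> exists2 p : {mpoly K[n * n]}, p != 0 &
  forall A : 'M[K]_n, A \in unitmx -> p.@[fun k => mxvec A 0 k] != 0 ->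
  forall P : {set 'I_n}, #|P| = e -> (forall j : 'I_n, j \in P -> (j < m + e)%N) ->
  (exists j : 'I_n, [/\ m + d - e <= j, j < m + e & j \notin P]%N) ->
  exists2 f, ext_face_ideal C f & ext_lead (ext_map A f) P.
Proof.
move=> de ed; pose k0 := (d.+1 - e)%N; have k0E : true -> (k0 + e)%N = d.+1 by rewrite /k0; lia.
have ms : mono (fun=> 0%N) by [].
have [h sp] := lefschetz Kinf prP pr_swap pr_cons pr_alt nE US_le US_deg de k0E (leq0n m) ms (leqnn 0) (fun _ => leq0n k0).
rewrite subn0 in sp.
have bnd i : lef_lists n true m d US e k0 0 0 (fun=> 0%N) i -> all (ltn^~ (n + n)%N) i.
  by apply: (lef_lists_lt pr_alt nE de k0E).
have [p p0 pA] := spanning_generic prP Kinf PhiE bnd sp.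
exists p => // A Au /pA {}sp P Pe Plt [j0 [j0ge j0lt j0P]].
pose bad (F : {set 'I_n}) := #|F| = e /\ ((exists2 j : 'I_n, j \in F & (m + e <= j)%N) \/
  forall j : 'I_n, (m + d - e <= j < m + e)%N -> j \in F).
pose good (x : E) := exists f, ext_face_ideal C f /\ forall F, (x - ext_map A f) F != 0 -> bad F.
have good0 : good 0.
  exists 0; split=> [|F]; first exact: ideal_gen0.
  by rewrite linear0 subr0 ffunE eqxx.
have goodL a x y : good x -> good y -> good (a *: x + y).
  move=> [f [fC fx]] [g [gC gy]].
  have e1 : (a *: eb set0) * f * 1 = a *: f.
    by rewrite mulr1 -ext_scaleAl; congr (_ *: _); apply: mul1r.
  exists ((a *: eb set0) * f * 1 + g); split.
    by apply: ideal_genD => //; apply: ideal_genM.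
  move=> F; have -> : a *: x + y - ext_map A ((a *: eb set0) * f * 1 + g) =
      a *: (x - ext_map A f) + (y - ext_map A g).
    by rewrite e1 linearD /= linearZ /= scalerBr opprD addrACA.
  rewrite ext_addE ext_scaleE => nz; have [e2|/fx //] := eqVneq ((x - ext_map A f) F) 0.
  by apply: gy; move: nz; rewrite e2 mulr0 add0r.
have bad_good (x : E) : (forall F, x F != 0 -> bad F) -> good x.
  move=> xb; exists 0; split=> [|F]; first exact: ideal_gen0.
  by rewrite linear0 subr0 => /xb.
have deltas (s : seq 'I_n) (y : E) F : (pr [seq delta_mx 0 j | j <- s] * y) F != 0 -> forall j, j \in s -> j \in F.
  elim: s F => // i s IHs F; rewrite /= ext_prod_cons -mulrA => /ext_mul_supp[X [B [+ yB _ ->]]] j.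
  rewrite ext_vec_delta => /ext_basis_supp ->; rewrite inE in_setU in_set1 => /predU1P[->|js].
    by rewrite eqxx.
  by rewrite (IHs B yB) ?orbT.
have goodP : good (eb P).
  have : lspan (prgen pr (lef_lists n true m d US e k0 0 0 (fun=> 0%N)) (frame A) e) (eb P).
    by rewrite ext_basis_prod; apply: sp; rewrite size_map -cardE.
  elim=> [|a x y + _]; first exact: good0.
  move=> [i [r [Ii se ->]]]; apply: goodL.
  have hom F : pr (map (frame A) i ++ r) F != 0 -> #|F| = e.
    by move=> /ext_prod_homog; rewrite size_cat size_map se.
  case: Ii hom se => [[v] //|[X [S [mS S0 _ SX]] ->]|[k kd ->]|->] /= hom se.
  - have XE : pr (map (frame A) (vals X)) = ext_map A (eb X).
      rewrite ext_map_basis /vals -map_comp; congr pr; apply: eq_map => j /=.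
      exact: frame_lt.
    exists (1 * eb X * ext_map (invmx A) (pr r)); split.
      apply/ideal_genM/ideal_gen_mem; exists X => //.
      have S00 := S0 _ (leqnn 0).
      have setE (Y : {set 'I_n}) : [set v in Y | 0 + 2 * 0 <= v]%N = Y.
        by apply/setP => v; rewrite in_set_ andbT.
      by case: SX => -[uS ->]; rewrite setE ?lower_C ?reach_C.
    move=> F; rewrite mul1r ext_mapM ext_mapVK // -XE ext_prod_cat subrr ffunE eqxx //.
  - apply: bad_good => F Fnz; split; first exact: hom.
    left; have kn : (n.-1 - k < n)%N by lia.
    exists (Ordinal kn); last by move: kd; rewrite /= /killed /k0; lia.
    move: Fnz; rewrite -cat1s ext_prod_cat.
    rewrite -[(n.-1 - k)%N]/(val (Ordinal kn)) frame_ge -[[:: _]]/[seq delta_mx 0 j | j <- [:: Ordinal kn]].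
    by move/deltas; apply; rewrite mem_head.
  apply: bad_good => F Fnz; split; first exact: hom.
  right=> j /andP[jge jlt]; pose s := [seq (insubd j (n.-1 - (k0 + l))%N : 'I_n) | l <- iota 0 (2 * e - d)].
  move: Fnz; rewrite ext_prod_cat.
  have -> : map (frame A) [seq (n + (n.-1 - (k0 + l)))%N | l <- iota 0 (2 * e - d)] = [seq delta_mx 0 j | j <- s].
    rewrite /s -!map_comp; apply: eq_map => l /=.
    have ln : (n.-1 - (k0 + l) < n)%N by lia.
    by rewrite -[(n.-1 - (k0 + l))%N]/(val (Ordinal ln)) frame_ge valKd.
  move/deltas; apply; apply/mapP; exists (n.-1 - k0 - j)%N.
    by rewrite mem_iota /k0; lia.
  apply: val_inj; rewrite /= insubdK /k0; first by lia.
  by rewrite unfold_in /=; lia.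
have badP F : bad F -> revlex_lt (mesym1 F) (mesym1 P).
  move=> [Fe Fb]; have mF : mdeg (mesym1 F) = mdeg (mesym1 P) by rewrite !mdeg_mesym1 Fe Pe.
  have ne : mesym1 F != mesym1 P.
    apply/eqP => /mnmP e1; have e2 j : (j \in F) = (j \in P).
      by have := e1 j; rewrite !mnmE; do 2!case: (j \in _).
    case: Fb => [[j]|/(_ j0)]; first by rewrite e2 => /Plt; rewrite ltnNge => /negP.
    by rewrite j0ge j0lt e2 (negPf j0P) => /(_ isT).
  have [j [jne above]] := revlex_split ne.
  apply/(revlexP mF); exists j; split=> //.
  have ab (i : 'I_n) : (j < i)%N -> (i \in F) = (i \in P).
    by move=> /above; rewrite !mnmE; do 2!case: (i \in _).
  suff jF : j \in F by move: jne; rewrite !mnmE jF; case: (j \in P).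
  apply: contraT => jF; have jP : j \in P by move: jne; rewrite !mnmE (negPf jF); case: (j \in P).
  case: Fb => [[i iF im]|Fb].
    have ji : (j < i)%N by apply: leq_trans im; apply: Plt.
    by have := iF; rewrite ab // => /Plt; rewrite ltnNge im.
  have [jj0|j0j] := ltnP j j0.
    by have := Fb j0; rewrite j0ge j0lt ab // (negPf j0P) => /(_ isT).
  by case/negP: jF; apply: Fb; rewrite (leq_trans j0ge) ?Plt.
have [f [fC fP]] := goodP; exists f => //.
have fE F : F != P -> ext_map A f F != 0 -> bad F.
  move=> FP Fnz; apply: fP; by rewrite ext_addE ext_oppE ffunE (negPf FP) add0r oppr_eq0.
split; last by move=> F Fnz FP; apply/badP/fE.
apply/eqP => fP0; have /badP : bad P.
  by apply: fP; rewrite ext_addE ext_oppE fP0 ffunE eqxx oppr0 addr0 oner_neq0.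
by rewrite revlex_irr.
Qed.

End ExtBlock.

Local Close Scope ring_scope.

Section Prefix.
Variable n : nat.
Implicit Types (F G X : {set 'I_n}).

Lemma below_full_block F x y : y <= n -> (forall v : 'I_n, x <= v -> v < y -> v \in F) -> x <= y ->
  below F y = below F x + (y - x).
Proof.
move=> yn full xy; have := below_setC F yn; have := below_setC F (leq_trans xy yn).
have -> : below (~: F) y = below (~: F) x; last by lia.
apply: eq_card => v; rewrite !in_set_ in_setC; case: (boolP (v \in F)) => //= vF.
case: (ltnP v x) => vx; first by rewrite (leq_trans vx).
by apply/negbTE; apply: contra vF; apply: full.
Qed.

(** The counterpart for sets of truncating a monomial to its first i variables. *)
Definition gap_prefix F i := [set v in F | v - below F v < i].

Lemma gap_prefix_sub F i : gap_prefix F i \subset F.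
Proof. by apply/subsetP => v; rewrite in_set_ => /andP[]. Qed.

Lemma below_gap_prefix F i (v : 'I_n) : v \in gap_prefix F i -> below (gap_prefix F i) v = below F v.
Proof.
rewrite in_set_ => /andP[vF vi]; apply: eq_card => w; rewrite !in_set_.
case: (ltnP w v) => wv; rewrite ?andbF // !andbT; case wF: (w \in F) => //=.
by apply: leq_ltn_trans vi; have := below_add F (ltnW wv); have := below_le F w; lia.
Qed.

Lemma cnt_gap_prefix F i j : j <= i -> cnt (gap_prefix F i) j = cnt F j.
Proof.
move=> ji; apply: eq_card => v; rewrite !in_set_; case vP: (v \in gap_prefix F i).
  by have := vP; rewrite in_set_ => /andP[-> ->]; rewrite below_gap_prefix.
move: vP; rewrite in_set_; case: (v \in F) => //= vi; rewrite vi /=.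
by apply/esym/negbTE; rewrite -leqNgt; move/negbT: vi; rewrite -leqNgt; apply: leq_trans.
Qed.

Lemma gap_prefix_below F i (v : 'I_n) : v \in gap_prefix F i -> below F v < cnt F i.
Proof.
rewrite in_set_ => /andP[vF vi]; have := belowS F v; rewrite vF addn1 => e.
by rewrite -e; apply: below_le_cnt; rewrite e subSS.
Qed.

End Prefix.

Local Open Scope ring_scope.

(** * Annihilation by exterior products and the leading monomial *)

Section ExtGin.
Variables (K : fieldType) (n : nat).
Local Notation E := (exterior K n).
Local Notation eb := (@ext_basis K n).
Implicit Types (A : 'M[K]_n) (g : E) (F G X : {set 'I_n}).

Lemma mesym1_inj F G : mesym1 F = mesym1 G -> F = G.
Proof. by move=> /mnmP e; apply/setP => j; have := e j; rewrite !mnmE; do 2!case: (j \in _). Qed.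

Lemma mesym1U F G : [disjoint F & G] -> mesym1 (F :|: G) = (mesym1 G + mesym1 F)%MM.
Proof.
move=> dFG; rewrite (mesym1_sub (subsetUr F G)) setDUl setDv setU0; congr (_ + mesym1 _)%MM.
by apply/setDidPl.
Qed.

Lemma ext_lead_exists g : g != 0 -> exists F, ext_lead g F.
Proof.
move=> g0; have [F0 gF0] : exists F, g F != 0.
  apply: contrapT => h; case/eqP: g0; apply/ffunP => F; rewrite [RHS]ffunE.
  by apply/eqP/negPn/negP => gF; apply: h; exists F.
pose f : {mpoly K[n]} := \sum_F g F *: 'X_[mesym1 F].
have fE F : f@_(mesym1 F) = g F.
  rewrite raddf_sum /= (bigD1 F) //= mcoeffZ mcoeffX eqxx mulr1 big1 ?addr0 // => G GF.
  by rewrite mcoeffZ mcoeffX; case: eqP => [/mesym1_inj e|]; [rewrite e eqxx in GF | rewrite mulr0].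
have [|b [bf lead]] := @sym_lead_exists _ _ f.
  by apply: contraNneq gF0 => f0; rewrite -fE f0 mcoeff0.
have [F bE] : exists F, b = mesym1 F.
  apply: contrapT => nb; move: bf; rewrite mcoeff_msupp raddf_sum /= big1 ?eqxx // => F _.
  by rewrite mcoeffZ mcoeffX; case: eqP => [e|]; [case: nb; exists F | rewrite mulr0].
exists F; split; first by rewrite -fE -bE -mcoeff_msupp.
move=> G gG GF; rewrite -bE; apply: lead; first by rewrite mcoeff_msupp fE.
by rewrite bE; apply: contraNneq GF => /mesym1_inj ->.
Qed.

Lemma ext_mulbE T g x : (eb T * g * x) setT =
  \sum_(G <- index_enum {set 'I_n} | (g G != 0) && [disjoint T & G]) g G * wedge_sign K T G * (eb (T :|: G) * x) setT.
Proof.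
rewrite {1}(ext_basis_sum g) mulr_sumr mulr_suml sum_ffunE [RHS]big_mkcond; apply: eq_bigr => G _.
rewrite -ext_scaleAr ext_basisM scalerA -ext_scaleAl ext_scaleE.
have [->|_] := eqVneq (g G) 0; first by rewrite !mul0r.
by rewrite /wedge_sign; case: ifP => //= _; rewrite mulr0 mul0r.
Qed.

(* Multiplying g by a suitable e_T turns its terms into multiples of e_X with X
   containing all vertices >= i + l - 1, on which the functionals
   x |-> top coefficient of x * phi(e_gamma) are triangular. *)
Lemma ext_lead_cnt A g F i l : minors A -> (i + 2 * l <= n)%N -> ext_homog #|F| g -> ext_lead g F ->
  (forall t : 'X_{1..i < l}, g * ext_map A (eb (gaps n t)) = 0) -> (l <= cnt F i)%N.
Proof.
move=> mA iln gF [gF0 glead] g0; rewrite leqNgt; apply/negP => cl.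
pose q := (i + l.-1)%N; have qn : (q <= n)%N by rewrite /q; lia.
have bF : (below F q <= l.-1)%N.
  rewrite leqNgt; apply/negP => lb; have := below_le F q => bq.
  have : (below F q <= cnt F i)%N by apply: below_le_cnt; rewrite /q in lb bq *; lia.
  by lia.
pose H := [set v : 'I_n | (q <= v)%N]; pose Q := [set v : 'I_n | (v < q)%N].
have cH : (#|H| + q)%N = n.
  have := cardsC Q; rewrite /Q card_ltn_ord // card_ord => e; rewrite -[RHS]e addnC.
  by congr (_ + _)%N; apply: eq_card => v; rewrite !inE -leqNgt.
have cQF : (#|Q :\: F| + below F q)%N = q.
  have := cardsID F Q; rewrite /Q card_ltn_ord // => e; rewrite -[RHS]e addnC.
  by congr (_ + _)%N; apply: eq_card => v; rewrite !inE andbC.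
have kQ : (l.-1 - below F q <= #|Q :\: F|)%N by rewrite /q in cQF *; lia.
(* T completes F to a set that contains H and has |H| + l - 1 elements, the degree of the products
   of e_H with phi(e_(fill s)). *)
pose T := top_elts (l.-1 - below F q) (Q :\: F) :|: (H :\: F).
have TF : [disjoint T & F].
  rewrite -setI_eq0; apply/eqP/setP => v; rewrite !inE.
  by case: (v \in F); rewrite ?andbF.
pose M0 := [set X : {set 'I_n} | (H \subset X) && (#|X| == #|H| + l.-1)%N].
have cTF : #|T :|: F| = (#|H| + l.-1)%N.
  have -> : T :|: F = H :|: (top_elts (l.-1 - below F q) (Q :\: F) :|: (Q :&: F)).
    apply/setP => v; rewrite !inE -[(v < q)%N]negbK -leqNgt.
    by case: (v \in F); case: (q <= v)%N; rewrite ?orbT ?orbF ?andbF ?andbT.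
  rewrite cardsU (_ : H :&: _ = set0) ?cards0 ?subn0; last first.
    apply/setP => v; rewrite !inE -[(v < q)%N]negbK -leqNgt.
    by case: (q <= v)%N; rewrite ?andbF.
  rewrite cardsU (_ : _ :&: (Q :&: F) = set0) ?cards0 ?subn0; last first.
    by apply/setP => v; rewrite !inE; case: (v \in F); rewrite ?andbF.
  rewrite card_top_elts //; congr (_ + _)%N.
  have -> : #|Q :&: F| = below F q by apply: eq_card => v; rewrite !inE andbC.
  by lia.
have TFM : T :|: F \in M0.
  rewrite inE cTF eqxx andbT; apply/subsetP => v; rewrite !inE => ->.
  by case: (v \in F); rewrite ?orbT.
(* The highest difference of G and F lies in G. It is below q, because T contains every vertex from
   q on outside F and is disjoint from G. So G and F agree from q on. *)
have TM G : g G != 0 -> [disjoint T & G] -> T :|: G \in M0.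
  move=> gG TG; have cG := gF G gG; have [->|ne] := eqVneq G F; first exact: TFM.
  rewrite inE cardsU (eqP (_ : T :&: G == set0)) ?setI_eq0 // cards0 subn0 cG.
  rewrite -cTF cardsU (eqP (_ : T :&: F == set0)) ?setI_eq0 // cards0 subn0 eqxx andbT.
  have md : mdeg (mesym1 G) = mdeg (mesym1 F) by rewrite !mdeg_mesym1 cG.
  have /(revlexP md)[j [jGF above]] := glead G gG ne.
  have jq : (j < q)%N.
    rewrite ltnNge; apply/negP => qj; move: jGF; rewrite !mnmE.
    case jF: (j \in F); case jG: (j \in G) => //= _.
    by have := disjointFl TG jG; rewrite !inE qj jF orbT.
  apply/subsetP => v; rewrite inE => qv; have := above v (leq_trans jq qv); rewrite !mnmE in_setU => e.
  have -> : (v \in G) = (v \in F) by move: e; do 2!case: (v \in _).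
  by rewrite !inE qv; case: (v \in F); rewrite ?orbT.
pose ev X (t : 'X_{1..i < l}) := if X \in M0 then (eb X * ext_map A (eb (gaps n t))) setT else 0.
pose z (s : 'X_{1..i < l}) X : K := (eb H * ext_map A (eb (fill n s))) X.
have zM s X : z s X != 0 -> X \in M0.
  move=> /ext_mul_supp[X1 [X2 [/ext_basis_supp -> zX2 dis ->]]].
  rewrite inE subsetUl cardsU (eqP (_ : H :&: X2 == set0)) ?setI_eq0 // cards0 subn0 eqn_add2l /=.
  have h : ext_homog #|fill n s| (eb (fill n s)) by move=> X' /ext_basis_supp ->.
  by rewrite (ext_map_homog h zX2) (card_fill iln) eqxx.
have VE s t : \sum_X z s X * ev X t = (eb H * ext_map A (eb (fill n s)) * ext_map A (eb (gaps n t))) setT.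
  rewrite [eb H * ext_map A (eb (fill n s))]ext_basis_sum mulr_suml sum_ffunE; apply: eq_bigr => X _.
  rewrite -ext_scaleAl ext_scaleE -/(z s X) /ev; case: ifP => // XM.
  have [->|/zM] := eqVneq (z s X) 0; first by rewrite !mul0r.
  by rewrite XM.
pose B := M0 :\ (T :|: F).
(* A single relation is used, the one expressing T :|: F, so any order with this set on top will
   do. *)
pose lt X Y := (Y == T :|: F) && (X != T :|: F).
(* A set in M0 is determined by its counts [cnt X] up to i, which are at most l - 1, that is, by a
   monomial of degree below l in i variables. *)
have cB : (#|B| < #|{: 'X_{1..i < l}}|)%N.
  apply: (@leq_trans #|M0|); first by rewrite [X in (_ < X)%N](cardsD1 (T :|: F)) TFM.
  have inj_deg X : X \in M0 -> (mdeg (mnm_of i (cnt X)) < l)%N.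
    rewrite inE => /andP[HX /eqP cX]; rewrite mdeg_mnm_of ?cnt0 //; last exact: cnt_mono.
    have bX : below X q = l.-1.
      have := cardsID H X; rewrite (setIidPr HX) cX => /eqP; rewrite eqn_add2l => /eqP <-.
      by apply: eq_card => v; rewrite !inE -ltnNge andbC.
    have : (cnt X i <= l.-1)%N by rewrite -bX; apply: cnt_le_below; rewrite bX /q; lia.
    by lia.
  have l0 : (0 < l)%N by apply: leq_ltn_trans cl.
  have z0 : (mdeg (0%MM : 'X_{1..i}) < l)%N by rewrite mdeg0.
  pose tr X : 'X_{1..i < l} := insubd (BMultinom z0) (mnm_of i (cnt X)).
  have inj : {in M0 &, injective tr}.
    move=> X Y XM YM /(congr1 (fun t : 'X_{1..i < l} => bmnm t)).
    rewrite /tr !insubdK ?unfold_in ?inj_deg // => e; apply: cnt_inj => j.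
    have [ji|ij] := leqP j i.
      have := congr1 (fun u => psum u j) e.
      by rewrite !psum_mnm_of ?cnt0 //; apply: cnt_mono.
    move: XM YM; rewrite !inE => /andP[_ /eqP cX] /andP[_ /eqP cY].
    by rewrite !cnt_ge ?cX ?cY //; rewrite /q in cH; lia.
  by rewrite -(card_in_imset inj); apply: max_card.
have := @span_count K _ _ lt B ev z (@gaps_key i l).
rewrite [(#|{: 'X_{1..i < l}}| <= _)%N]leqNgt cB => hc; apply: notF; apply: hc.
- by move=> X; rewrite /lt; case: eqP.
- by move=> Y X Z /andP[/eqP -> ?] /andP[_]; rewrite eqxx.
- move=> X XB; have [XE|XE] := eqVneq X (T :|: F); last first.
    exists (fun=> 0) => t; rewrite big1 => [|Y _]; last by rewrite mul0r.
    by rewrite /ev; case: ifP => // XM; move: XB; rewrite in_setD1 XE XM.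
  rewrite XE; have := @rel_of_sum K _ _ lt ev _ (index_enum {set 'I_n}) (fun G => (g G != 0) && [disjoint T & G])
    (fun G => g G * wedge_sign K T G) (fun G => T :|: G) F.
  apply.
  + exact: index_enum_uniq.
  + exact: mem_index_enum.
  + by rewrite gF0.
  + by rewrite mulf_neq0 // /wedge_sign TF signr_eq0.
  + move=> G _ /andP[_ TG] GF; rewrite /lt eqxx; apply: contraNneq GF => e; apply/eqP.
    apply/setP => v; move/setP: e => /(_ v); rewrite [LHS]in_setU [RHS]in_setU.
    by case vT: (v \in T) => /= h; [rewrite (disjointFr TG vT) (disjointFr TF vT) | move: h; case: (v \in G); case: (v \in F)].
  move=> t; have := ext_mulbE T g (ext_map A (eb (gaps n t))).
  rewrite -mulrA g0 mulr0 ffunE => e; rewrite [RHS]e; apply: eq_bigr => G /andP[gG TG].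
  by rewrite /ev TM.
- move=> s; rewrite VE -mulrA; have [c c0 ->] := ext_map_mul_disjoint A (fill_gaps n s).
  rewrite -ext_scaleAr ext_scaleE mulf_neq0 //.
  have -> : H = [set v : 'I_n | (#|fill n s :|: gaps n s| <= v)%N]; last exact: ext_top.
  apply/setP => v; rewrite !inE cardsU (eqP (_ : fill n s :&: gaps n s == set0)) ?setI_eq0 ?(fill_gaps n) //.
  by rewrite cards0 subn0 (card_fill iln) (card_gaps iln) addnC.
move=> s t st; rewrite VE -mulrA; have [dis _|ndis] := boolP [disjoint fill n s & gaps n t].
  exact: (fill_gaps_lt iln).
by rewrite ext_map_mul_meet // mulr0 ffunE eqxx.
Qed.

End ExtGin.

Local Close Scope ring_scope.

Lemma setDUK (T : finType) (X Y : {set T}) : X \subset Y -> Y :\: X :|: X = Y.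
Proof. by move=> XY; rewrite -[RHS](setID Y X) (setIidPr XY) setUC. Qed.

Local Open Scope ring_scope.

(** * The exterior shifting of the sphere *)

Section ExtShifting.
Variables (K : fieldType) (n m d : nat) (U : {pred 'X_{1..m}}) (C D : {set {set 'I_n}}).
Hypothesis Kinf : infinite_type K.
Hypothesis nE : n = (m + d.+1)%N.
Hypothesis d0 : (0 < d)%N.
Hypothesis Uideal : shifted_order_ideal U.
Hypothesis Udeg : forall u, u \in U -> ((mdeg u).*2 <= d.+1)%N.
Hypothesis C_sub : forall F G : {set 'I_n}, F \in C -> G \subset F -> G \in C.
Hypothesis C_card : forall F : {set 'I_n}, F \in C -> (#|F| <= d)%N.
Hypothesis lower_C : forall S, mono S -> S 0%N = 0%N -> ~ psum_below U S -> lower n m 2 S \notin C.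
Hypothesis reach_C : forall S, mono S -> S 0%N = 0%N -> psum_below U S -> ~: reach n m S \notin C.
Hypothesis facets_C : (\sum_(u : 'X_{1..m < d.+2} | bmnm u \in U) (d.+1 - 2 * mdeg u) <=
  #|[set F in C | #|F| == d]|)%N.
Local Notation E := (exterior K n).
Local Notation eb := (@ext_basis K n).
Local Notation US := (psum_below U).
Local Notation gin := (gin m d US).
Implicit Types (A : 'M[K]_n) (f g : E) (F G P X : {set 'I_n}).

Let US_le S S' : (forall i, i <= m -> S' i <= S i)%N -> US S -> US S'.
Proof. exact: psum_below_le. Qed.

(** As for monomials, with [cnt P] for the partial sums and [ext_lead_cnt] for [lead_psum]: a
    combination of the phi(e_(R X)) is freed of all terms of [BP] except P, which must then lead. *)
Lemma ext_lead_below A P : minors A -> A \in unitmx -> ~ US (cnt P) ->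
  cnt P m = #|P| -> (2 * #|P| <= d)%N ->
  exists2 f, ext_face_ideal C f & ext_lead (ext_map A f) P.
Proof.
move=> mA Au nUP Pm Pd.
pose BP := [set X : {set 'I_n} | (#|X| == #|P|) && [forall i : 'I_m.+1, cnt P i <= cnt X i]%N].
have BPP X : X \in BP -> #|X| = #|P| /\ forall i, (i <= m)%N -> (cnt P i <= cnt X i)%N.
  by rewrite inE => /andP[/eqP Xk /forallP Xi]; split=> // i im; apply: (Xi (Ordinal (im : i < m.+1)%N)).
have PB : P \in BP by rewrite inE eqxx; apply/forallP.
pose T := {X : {set 'I_n} | X \in BP}; pose R X := lower n m 2 (cnt X).
have TP (t : T) : #|val t| = #|P| /\ forall i, (i <= m)%N -> (cnt P i <= cnt (val t) i)%N by apply: BPP (valP t).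
have Tm (t : T) i : (m <= i)%N -> cnt (val t) i = #|P|.
  move=> mi; have h1 := cnt_le_card (val t) i; have h2 := (TP t).2 m (leqnn m).
  rewrite (TP t).1 in h1; rewrite Pm in h2; have h3 := mono_le (@cnt_mono n (val t)) mi.
  by apply/eqP; rewrite eqn_leq h1 (leq_trans h2).
pose W (t : T) X := ext_map A (eb (R (val t))) X.
have [|x [[t0 xt0] xB]] := @lin_dep K _ _ (BP :\ P) W.
  have cT : #|{: T}| = #|BP| by rewrite card_sig; apply: eq_card => X; rewrite inE.
  by rewrite cT [X in (_ < X)%N](cardsD1 P BP) PB.
have gap_n (t : T) i : (i < m)%N -> (i + 2 * cnt (val t) i.+1 < n)%N.
  by move=> im; have := cnt_le_card (val t) i.+1; rewrite (TP t).1; move: Pd; lia.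
have R_inj (s t : T) : R (val s) = R (val t) -> s = t.
  move=> Rst; apply/val_inj/cnt_inj => i.
  have sub (s' t' : T) : R (val s') = R (val t') -> forall i, (i <= m)%N -> (cnt (val s') i <= cnt (val t') i)%N.
    move=> e; apply: (lower_ungap (@cnt_mono n _) (@cnt_mono n _) (cnt0 _) (gap_n t')).
    by rewrite -/(R (val s')) e; apply: lower_ungap_refl; apply: cnt_mono.
  have [im|mi] := leqP i m; first by apply/eqP; rewrite eqn_leq !sub.
  by rewrite !Tm ?(ltnW mi).
have cardR (t : T) : #|R (val t)| = #|P|.
  rewrite card_lower ?cnt0 ?Tm //; first exact: cnt_mono.
  by move=> i j im ji; have := gap_n t i im; lia.
pose f : E := \sum_(t : T) x t *: eb (R (val t)).
have fC : ext_face_ideal C f.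
  apply/(ext_idealP _ C_sub) => F FC; rewrite sum_ffunE big1 // => t _; rewrite ext_scaleE ffunE.
  case: eqP => [FR|]; last by rewrite mulr0.
  have := FC; rewrite FR (negPf (lower_C _ _ _)) ?cnt0 //; first exact: cnt_mono.
  by apply: contra_not nUP; apply: US_le => i im; apply: (TP t).2.
have f0 : f != 0.
  apply/eqP => /ffunP/(_ (R (val t0))); rewrite sum_ffunE [RHS]ffunE (bigD1 t0) //= ext_scaleE ffunE eqxx mulr1.
  rewrite big1 ?addr0; first exact/eqP.
  move=> t tt0; rewrite ext_scaleE ffunE; case: eqP => [/R_inj e|]; last by rewrite mulr0.
  by rewrite e eqxx in tt0.
have phiE : ext_map A f = \sum_t x t *: ext_map A (eb (R (val t))).
  have lin (h : {linear E -> E}) : h f = \sum_t x t *: h (eb (R (val t))).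
    by rewrite linear_sum; apply: eq_bigr => t _; rewrite linearZ.
  exact: (lin (ext_map A)).
have fhom : ext_homog #|P| (ext_map A f).
  apply: ext_map_homog => F; rewrite sum_ffunE => nz; apply: contrapT => FP; case/eqP: nz.
  rewrite big1 // => t _; rewrite ext_scaleE ffunE; case: eqP => [e|]; last by rewrite mulr0.
  by case: FP; rewrite e cardR.
have [b blead] : exists b, ext_lead (ext_map A f) b.
  by apply: ext_lead_exists; apply: contraNneq f0 => e; rewrite -(ext_mapK f Au) e linear0.
have bk : #|b| = #|P| by apply: fhom; case: blead.
have bB i : (i <= m)%N -> (cnt P i <= cnt b i)%N.
  move=> im; apply: (ext_lead_cnt (l := cnt P i) mA _ _ blead); last 1 first.
  - move=> t; rewrite phiE mulr_suml big1 // => s _; rewrite -ext_scaleAl ext_map_mul_meet ?scaler0 //.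
    have ti : (psum t i < cnt P i)%N by apply: leq_ltn_trans (psum_le_mdeg t i) (valP t).
    apply/negP => dis; have sub : lower n i 2 (cnt (val s)) \subset ungap n i (psum t).
      apply/subsetP => v /lowerP[j [r [ji jr rj vE]]]; apply/negPn/negP => vt.
      have vR : v \in R (val s) by apply/lowerP; exists j, r; split=> //; apply: leq_trans im.
      by have := disjointFr dis vR; rewrite inE vt.
    have gt : forall j, (j < i)%N -> (j + 2 * psum t j.+1 < n)%N.
      move=> j ji; have h1 : (psum t j.+1 < #|P|)%N.
        by apply: leq_trans (cnt_le_card P i); apply: leq_ltn_trans (psum_le_mdeg t j.+1) (valP t).
      by move: h1 Pd; move: #|P| (psum t j.+1) => k r; lia.
    have := lower_ungap (@cnt_mono n _) (psum_mono _) (cnt0 _) gt sub (leqnn i).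
    by rewrite leqNgt (leq_trans ti) // (TP s).2.
  - by have := cnt_le_card P i; lia.
  by rewrite bk.
have [bP|bP] := eqVneq b P; first by exists f; rewrite // -bP.
have : b \in BP :\ P.
  by rewrite in_setD1 bP inE bk eqxx; apply/forallP => i; apply: bB; rewrite -ltnS ltn_ord.
move=> /xB /= e; have [+ _] := blead; move=> /eqP[]; rewrite -[RHS]e phiE sum_ffunE.
by apply: eq_bigr => t _; rewrite ext_scaleE.
Qed.

Lemma ext_lead_of_gin : exists2 p : {mpoly K[n * n]}, p != 0 &
  forall A, A \in unitmx -> p.@[fun k => mxvec A 0 k] != 0 -> minors A /\
  forall F, gin (cnt F) -> exists2 P : {set 'I_n}, P \subset F & exists2 f, ext_face_ideal C f & ext_lead (ext_map A f) P.
Proof.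
have [pm pm0 pmA] := minors_generic K n.
have blk (e : 'I_d.+1) : exists p : {mpoly K[n * n]}, p != 0 /\ ((d <= 2 * e)%N ->
  forall A : 'M[K]_n, A \in unitmx -> p.@[fun k => mxvec A 0 k] != 0 ->
  forall P : {set 'I_n}, #|P| = e -> (forall j : 'I_n, j \in P -> (j < m + e)%N) ->
  (exists j : 'I_n, [/\ m + d - e <= j, j < m + e & j \notin P]%N) ->
  exists2 f, ext_face_ideal C f & ext_lead (ext_map A f) P).
  have [de|_] := leqP d (2 * e)%N; last by exists 1; split=> //; apply: oner_neq0.
  have ed : (e <= d)%N by rewrite -ltnS.
  have [p p0 pA] := ext_block Kinf nE US_le (psum_below_deg Udeg) lower_C reach_C de ed.
  by exists p.
have [pe peP] := choice blk.
exists (pm * \prod_e pe e).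
  by rewrite mulf_neq0 //; apply/prodf_neq0 => e _; apply: (peP e).1.
move=> A Au; rewrite mevalM mulf_eq0 negb_or rmorph_prod => /andP[/pmA mA /prodf_neq0 peA].
split=> // F Fgin; have cm := @cnt_mono n F.
have [ltd|ged] := ltnP d (cnt F m + cnt F m.+1); last first.
  case: Fgin => [nU|]; last by rewrite ltnNge ged.
  exists (gap_prefix F m); first exact: gap_prefix_sub.
  have Pm : cnt (gap_prefix F m) m = #|gap_prefix F m| by rewrite cnt_gap_prefix.
  apply: ext_lead_below => //.
    by apply: contra_not nU; apply: US_le => i im; rewrite cnt_gap_prefix.
  by rewrite -Pm cnt_gap_prefix //; have := cm m; lia.
(* If F has more than d elements, no Lefschetz argument is needed: C has no face of size d + 1, so
   its ideal contains everything in that degree. *)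
have [big|small] := ltnP d (cnt F m.+1).
  have [P [PF cP]] : exists P : {set 'I_n}, P \subset F /\ #|P| = d.+1.
    have dF : (d.+1 <= #|F|)%N by apply: leq_trans big (cnt_le_card _ _).
    exists (top_elts d.+1 F); rewrite card_top_elts //; split=> //.
    by apply/subsetP => v; rewrite in_set_ => /andP[].
  exists P => //; exists (ext_map (invmx A) (eb P)).
    apply/(ext_idealP _ C_sub) => X XC; apply/eqP/negPn/negP.
    have h : ext_homog d.+1 (eb P) by move=> Y /ext_basis_supp ->.
    by move=> /(ext_map_homog h) cX; have := C_card XC; rewrite cX ltnn.
  rewrite ext_mapVK //; split; first by rewrite ffunE eqxx oner_neq0.
  by move=> X /ext_basis_supp ->; rewrite eqxx.
have ed : (cnt F m.+1 < d.+1)%N by [].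
exists (gap_prefix F m.+1); first exact: gap_prefix_sub.
have de : (d <= 2 * cnt F m.+1)%N by have := cm m; lia.
apply: ((peP (Ordinal ed)).2 de A Au (peA _ isT)) => //=.
  move=> j jP; have := gap_prefix_below jP; move: jP; rewrite in_set_ => /andP[_].
  by have := below_le F j; lia.
(* If the prefix contained all of the interval from m + d - e to m + e - 1, at most d - e elements
   of F and hence at least m gaps would precede it, so cnt F m <= d - e, against [ltd]. *)
set e := cnt F m.+1 in small de ltd ed *; apply: contrapT => full.
have xy : (m + d - e <= m + e)%N by lia.
have yn : (m + e <= n)%N by lia.
have := @below_full_block n F (m + d - e) (m + e) yn _ xy.
have h1 (v : 'I_n) : (m + d - e <= v)%N -> (v < m + e)%N -> v \in F.
  move=> v1 v2; apply: contrapT => /negP vF; apply: full; exists v; split=> //.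
  by apply: contra vF; apply: (subsetP (gap_prefix_sub _ _)).
move=> /(_ h1) bE; have bye : (below F (m + e) <= e)%N.
  by rewrite leqNgt; apply/negP => lt; have := @below_le_cnt n F (m + e) m.+1; rewrite -/e; lia.
by have := @cnt_le_below n F (m + d - e) m; move: ltd; lia.
Qed.

Lemma nongin_sets_card :
  (#|[set X : {set 'I_n} | (#|X| == d) && `[< ~ gin (cnt X) >]]| <= #|[set F in C | #|F| == d]|)%N.
Proof.
apply: leq_trans facets_C; apply: leq_trans (nongin_card d Uideal d.+1).
set N := [set X | _]; have NP X : X \in N -> #|X| = d /\ ~ gin (cnt X).
  by rewrite inE => /andP[/eqP ? /asboolP].
have z0 : (mdeg (0%MM : 'X_{1..m.+1}) < d.+1)%N by rewrite mdeg0.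
pose u X := mnm_of m.+1 (cnt X).
have uE X i : (i <= m.+1)%N -> psum (u X) i = cnt X i.
  by move=> im; rewrite psum_mnm_of ?cnt0 //; apply: cnt_mono.
pose tr X : 'X_{1..m.+1 < d.+1} := insubd (BMultinom z0) (u X).
have trE X : X \in N -> bmnm (tr X) = u X.
  move=> /NP[Xd _]; rewrite /tr insubdK // unfold_in mdeg_mnm_of ?cnt0 //; last exact: cnt_mono.
  by rewrite ltnS -Xd cnt_le_card.
have inj : {in N &, injective tr}.
  move=> X Y XN YN /(congr1 (fun t : 'X_{1..m.+1 < d.+1} => bmnm t)); rewrite !trE // => e.
  apply: cnt_inj => j; have [ji|ij] := leqP j m.+1; first by rewrite -!uE // e.
  by rewrite !cnt_ge ?(NP X XN).1 ?(NP Y YN).1 //; lia.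
rewrite -(card_in_imset inj); apply/subset_leq_card/subsetP => _ /imsetP[X XN ->].
rewrite inE trE //; apply/asboolP; apply: contra_not (NP X XN).2.
by apply: (gin_le US_le) => i im; rewrite uE.
Qed.

Hypothesis Dcplx : simplicial_complex D.
Hypothesis DE : forall F, F \notin D <-> gin (cnt F).
Hypothesis D_facet : forall F, F \in D -> exists G, [/\ G \in D, F \subset G & #|G| = d].

(** The functionals are the top coefficients after multiplication by phi(e_N), N the complement of a
    facet. They kill the image of the ideal and are diagonal on the products phi(e_F), F a facet. As
    they see only degree d, a leading set in D is first enlarged to a face Y of size d, which
    inherits its relation. *)
Lemma ext_gin_of_lead A : minors A -> A \in unitmx ->
  (forall F, gin (cnt F) -> exists2 P : {set 'I_n}, P \subset F & exists2 f, ext_face_ideal C f & ext_lead (ext_map A f) P) ->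
  forall f F, ext_face_ideal C f -> ext_lead (ext_map A f) F -> F \notin D.
Proof.
move=> mA Au leads f F fC flead; apply/negP => /D_facet[Y [YD FY Yd]].
pose T := {X : {set 'I_n} | X \in [set X in C | #|X| == d]}.
have TP (t : T) : val t \in C /\ #|val t| = d by have := valP t; rewrite inE => /andP[-> /eqP].
pose ev X (t : T) := (eb X * ext_map A (eb (~: val t))) setT.
pose z (s : T) X : K := ext_map A (eb (val s)) X.
pose lt X X' := revlex_lt (mesym1 X) (mesym1 X').
pose N := [set X : {set 'I_n} | (#|X| == d) && `[< ~ gin (cnt X) >]].
have YN : Y \in N.
  by rewrite inE Yd eqxx; apply/asboolP => /DE; rewrite YD.
have VE s t : \sum_X z s X * ev X t = (ext_map A (eb (val s)) * ext_map A (eb (~: val t))) setT.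
  rewrite [ext_map A (eb (val s))]ext_basis_sum mulr_suml sum_ffunE; apply: eq_bigr => X _.
  by rewrite -ext_scaleAl ext_scaleE.
have kill g (t : T) : ext_face_ideal C g -> ext_map A g * ext_map A (eb (~: val t)) = 0.
  move=> /(ext_idealP _ C_sub) gC; rewrite -ext_mapM (ext_basis_sum g) mulr_suml big1 ?linear0 // => X _.
  rewrite -ext_scaleAl ext_basisM; have [dis|/negPf dis] := boolP [disjoint X & ~: val t]; last first.
    by rewrite /wedge_sign dis scale0r scaler0.
  rewrite gC ?scale0r //; apply: (C_sub (TP t).1); rewrite -[val t]setCK.
  by rewrite subsets_disjoint setCK.
have rel g P X : ext_face_ideal C g -> ext_lead (ext_map A g) P -> P \subset X ->
    exists c : {set 'I_n} -> K, forall t, ev X t = \sum_(X' | lt X' X) c X' * ev X' t.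
  move=> gC [gP glead] PX; set V := X :\: P.
  have VP : [disjoint V & P].
    by rewrite -setI_eq0 /V; apply/eqP/setP => v; rewrite !inE; case: (v \in P); rewrite ?andbF.
  have XE : V :|: P = X by apply: setDUK.
  rewrite -{1 2}XE; have := @rel_of_sum K _ _ lt ev _ (index_enum {set 'I_n})
    (fun G => (ext_map A g G != 0) && [disjoint V & G])
    (fun G => ext_map A g G * wedge_sign K V G) (fun G => V :|: G) P.
  rewrite XE; apply.
  - exact: index_enum_uniq.
  - exact: mem_index_enum.
  - by rewrite gP.
  - by rewrite mulf_neq0 // /wedge_sign VP signr_eq0.
  - move=> G _ /andP[gG VG] GP; rewrite /lt -XE !mesym1U //.
    by apply: revlex_add; apply: glead.
  move=> t; have := ext_mulbE V (ext_map A g) (ext_map A (eb (~: val t))).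
  by rewrite -mulrA kill // mulr0 ffunE => e; rewrite [RHS]e.
have lt_card : (#|N :\ Y| < #|{: T}|)%N.
  have -> : #|{: T}| = #|[set X in C | #|X| == d]| by rewrite card_sig; apply: eq_card => X; rewrite inE.
  by apply: leq_trans nongin_sets_card; rewrite -/N [X in (_ < X)%N](cardsD1 Y N) YN.
have := @span_count K _ _ lt (N :\ Y) ev z (fun=> 0%N).
rewrite [(#|{: T}| <= _)%N]leqNgt lt_card => hc; apply: notF; apply: hc.
- by move=> X; apply: revlex_irr.
- by move=> X X' X''; apply: revlex_trans.
- move=> X XN; have [XY|XY] := eqVneq X Y.
    by rewrite XY; apply: rel fC flead FY.
  have [Xd|Xd] := eqVneq #|X| d; last first.
    exists (fun=> 0) => t; rewrite big1 => [|X' _]; last by rewrite mul0r.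
    apply/eqP/negPn/negP => /ext_mul_supp[X1 [X2 [/ext_basis_supp -> x2 dis e]]].
    have h : ext_homog #|~: val t| (eb (~: val t)) by move=> X' /ext_basis_supp ->.
    have := ext_map_homog h x2; have := cardsC (val t); rewrite card_ord (TP t).2 => e1 e2.
    have := congr1 (fun B : {set 'I_n} => #|B|) e; rewrite cardsT card_ord cardsU.
    rewrite (eqP (_ : X :&: X2 == set0)) ?setI_eq0 // cards0 subn0 e2 => e3.
    by case/eqP: Xd; move: e1 e3; move: #|~: _| #|X| => a b; lia.
  have Xgin : gin (cnt X).
    by move: XN; rewrite in_setD1 XY inE Xd eqxx /= => /asboolP; apply: contra_notP.
  by have [P PX [g gC glead]] := leads X Xgin; apply: rel gC glead PX.
- move=> s; rewrite VE; have dis : [disjoint val s & ~: val s] by rewrite -setI_eq0 setICr.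
  have [c c0 ->] := ext_map_mul_disjoint A dis; rewrite setUCr ext_scaleE mulf_neq0 //.
  have := @ext_top K n A setT mA; have -> : [set v : 'I_n | (#|[set: 'I_n]| <= v)%N] = set0.
    by apply/setP => v; rewrite !inE cardsT card_ord leqNgt ltn_ord.
  by rewrite -[eb set0]/(1 : E) mul1r.
move=> s t st; rewrite VE; have [dis|ndis] := boolP [disjoint val s & ~: val t]; last first.
  by rewrite ext_map_mul_meet // ffunE eqxx.
move: dis; rewrite -subsets_disjoint => sub; case/eqP: st; apply: val_inj.
by apply/eqP; rewrite eqEcard sub (TP s).2 (TP t).2 leqnn.
Qed.

Theorem ext_shifting_sphere : ext_shifting K C D.
Proof.
split=> //; have [p p0 pA] := ext_lead_of_gin.
exists p => // A Au /(pA A Au)[mA leads] f; split; apply: ideal_gen_sub => {}f.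
  move=> [_ [F [[g gC ->] glead ->]]]; apply: ideal_gen_mem; exists F => //.
  exact: (ext_gin_of_lead mA Au leads gC glead).
move=> [F /DE/leads[P PF [g gC glead]] ->].
have dis : [disjoint F :\: P & P] by rewrite -setI_eq0; apply/eqP/setP => v; rewrite !inE; case: (v \in P); rewrite ?andbF.
have -> : eb F = ((wedge_sign K (F :\: P) P)^-1 *: eb (F :\: P)) * eb P * 1.
  rewrite mulr1 -ext_scaleAl ext_basisM scalerA mulVf ?scale1r; last by rewrite /wedge_sign dis signr_eq0.
  by rewrite setDUK.
apply/ideal_genM/ideal_gen_mem; exists (ext_map A g), P.
by split=> //; exists g.
Qed.

End ExtShifting.

Local Close Scope ring_scope.

(** * Fields of characteristic 0, and the squeezed sphere attached to Sigma *)

Lemma infinite_pchar0 (L : fieldType) : [pchar L]%R =i pred0 -> infinite_type L.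
Proof.
move=> /pcharf0P L0 s; apply: contrapT => h.
have inj : injective (fun i : nat => i%:R%R : L).
  move=> i j e; wlog ij : i j e / i <= j => [th|].
    by case: (leqP i j) => [|/ltnW] ij; [apply: th | apply/esym/th].
  have := L0 (j - i); rewrite natrB // e subrr eqxx => /esym/eqP ji.
  by apply/eqP; rewrite eqn_leq ij -subn_eq0 ji eqxx.
have sub : {subset [seq i%:R%R : L | i <- iota 0 (size s).+1] <= s}.
  by move=> x _; apply: contrapT => /negP xs; apply: h; exists x.
have := uniq_leq_size _ sub; rewrite size_map size_iota ltnn map_inj_uniq // iota_uniq.
by move=> /(_ isT).
Qed.

Theorem theorem1p4
  (K : fieldType) (L : fieldType) (R : realFieldType) (n d : nat)
  (t : 'I_n -> R) (Sigma : {set {set 'I_n}}) :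
  infinite_type K ->
  [pchar L]%R =i pred0 ->
  0 < d -> d < n ->
  (forall i j : 'I_n, i < j -> (t i < t j)%R) ->
  simplicial_complex Sigma ->
  dim1 Sigma = d ->
  pure Sigma ->
  shifted Sigma ->
  (forall i, i <= d -> hnum Sigma i = hnum Sigma (d - i)) ->
  (exists2 D, sym_shifting L (cyclic_complex d t) D & Sigma \subset D) ->
  (exists2 Gamma, squeezed_sphere d Gamma & ext_shifting K Gamma Sigma) /\
  (exists2 Gamma, squeezed_sphere d Gamma & sym_shifting L Gamma Sigma).
Proof.
move=> Kinf L0 d0 dn tmono Scplx Sdim Spure Sshift Ssym [D Dshift SD].
have Linf := infinite_pchar0 L0.
pose m := n - d.+1; have nE : n = m + d.+1 by rewrite subnK.
have bound := cyclic_bound Linf nE tmono Dshift SD Scplx Sshift.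
pose U := @face_monomials n m d Sigma.
have Uideal : shifted_order_ideal U := face_monomials_ideal nE d0 Scplx Sshift Sdim bound.
(* The symmetric h-vector is determined by degrees up to d / 2, within the bound (d + 1) / 2 for
   squeezed spheres. *)
have Udeg u : u \in U -> (mdeg u).*2 <= d.+1.
  by case/face_monomialsP => ud _; rewrite -mul2n; apply: leqW.
have SE F : F \notin Sigma <-> gin m d (psum_below U) (cnt F).
  have := faceP nE d0 Scplx Sshift Spure Sdim Ssym bound F; rewrite -/U => FP; split.
    move/FP => nF; have [uF|nuF] := pselect (psum_below U (cnt F)); last by left.
    by right; rewrite ltnNge; apply/negP => Fd; apply: nF.
  move=> g; apply/FP => -[uF Fd]; case: g => [//|]; by rewrite ltnNge Fd.
pose Gamma := ball_boundary d (squeezed_ball n d U).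
have sphere : squeezed_sphere d Gamma by exists U; split.
have Gsub (F G : {set 'I_n}) : F \in Gamma -> G \subset F -> G \in Gamma := @sphere_sub n m d U nE Udeg F G.
have Glow := lower_nonface nE Udeg.
have Greach := reach_nonface nE Uideal Udeg.
have Gcard := sphere_facets nE Udeg.
split; exists Gamma => //; last first.
  exact: (sym_shifting_sphere Linf nE d0 Uideal Udeg Gsub Glow Greach Gcard Scplx SE).
apply: (ext_shifting_sphere Kinf nE d0 Uideal Udeg Gsub _ Glow Greach Gcard Scplx SE).
  by move=> F; apply: (sphere_card nE Udeg).
by move=> F; apply: face_sub_facet.
Qed.
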